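(* Let $d\ge 2$, $p\in(1,\infty)$ and $s\in(0,1)$. Let $H\in\mathcal{H}$ be a polarizer and let $\Omega\subset\mathbb{R}^d$ be a bounded domain. Then $$\Lambda_{\mathcal{L}^s_p}(P_H(\Omega))\le \Lambda_{\mathcal{L}^s_p}(\Omega).$$ Further, if $\Omega$ is of class $\mathcal{C}^{1,\beta}$ for some $\beta\in(0,1)$, and $P_H(\Omega)\ne\Omega$ and $P_H(\Omega)\neq\sigma_H(\Omega)$, then $$\Lambda_{\mathcal{L}^s_p}(P_H(\Omega))< \Lambda_{\mathcal{L}^s_p}(\Omega).$$
   Context: A polarizer is an open affine half-space of $\mathbb{R}^d$, i.e. a set $H=\{x\in\mathbb{R}^d: x\cdot h<a\}$ with $h\in\mathbb{S}^{d-1}$, $a\in\mathbb{R}$; $\mathcal{H}$ is the set of all polarizers. $\sigma_H(x)=x-2(x\cdot h-a)h$ is the reflection with respect to $\partial H$, and $\sigma_H(A)=\{\sigma_H(x):x\in A\}$ for $A\subseteq\mathbb{R}^d$. The polarization of $\Omega\subseteq\mathbb{R}^d$ with respect to $H$ is $$P_H(\Omega)=[(\Omega\cup\sigma_H(\Omega))\cap H]\cup[\Omega\cap\sigma_H(\Omega)].$$ A domain is a nonempty connected open set. For an open set $\Omega\subset\mathbb{R}^d$, $$W^{1,p}_0(\Omega)=\{u\in L^p(\mathbb{R}^d): \|\nabla u\|_{L^p(\mathbb{R}^d)}<\infty,\ u=0\text{ in }\mathbb{R}^d\setminus\Omega\},$$ and $$[u]_{s,p}=\Big(\int_{\mathbb{R}^d}\int_{\mathbb{R}^d}\frac{|u(x)-u(y)|^p}{|x-y|^{d+sp}}\,dy\,dx\Big)^{1/p}.$$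 For a bounded open set $\Omega$, $\Lambda_{\mathcal{L}^s_p}(\Omega)$ is the least Dirichlet eigenvalue of the mixed operator $\mathcal{L}^s_p=-\Delta_p+(-\Delta_p)^s$, given by $$\Lambda_{\mathcal{L}^s_p}(\Omega)=\inf\{\|\nabla u\|_{L^p(\Omega)}^p+[u]_{s,p}^p: u\in W^{1,p}_0(\Omega)\setminus\{0\},\ \|u\|_{L^p(\Omega)}=1\}.$$ *)

(* Defs.v *)
From HB Require Import structures.
From mathcomp Require Import all_boot all_order all_algebra.
From mathcomp Require Import all_classical all_reals all_analysis.
Set Implicit Arguments.
Unset Strict Implicit.
Unset Printing Implicit Defensive.
Import Order.TTheory GRing.Theory Num.Def Num.Theory.
Import numFieldNormedType.Exports.
Local Open Scope classical_set_scope.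
Local Open Scope ring_scope.

(* 'rV[R]_n carries the sigma-algebra generated by the coordinates, as tuples do
   in the library; it is the Borel sigma-algebra. *)
Definition measure_rV_display : measure_display.
Proof. exact. Qed.

Section measurable_rV.
Variables (R : realType) (n : nat).

Definition rV_coord (i : 'I_n) (x : 'rV[R]_n) : R := x ord0 i.

Let rV_set0 : g_sigma_preimage rV_coord set0.
Proof. exact: sigma_algebra0. Qed.

Let rV_setC A : g_sigma_preimage rV_coord A -> g_sigma_preimage rV_coord (~` A).
Proof. exact: sigma_algebraC. Qed.

Let rV_bigcup (F : (set 'rV[R]_n)^nat) :
  (forall i, g_sigma_preimage rV_coord (F i)) ->
  g_sigma_preimage rV_coord (\bigcup_i (F i)).
Proof. exact: sigma_algebra_bigcup. Qed.

HB.instance Definition _ := @isMeasurable.Build measure_rV_display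
  'rV[R]_n (g_sigma_preimage rV_coord) rV_set0 rV_setC rV_bigcup.

End measurable_rV.

Lemma measurable_rV_coord (R : realType) n (i : 'I_n) :
  measurable_fun [set: 'rV[R]_n] (rV_coord i).
Proof.
move=> _ Y mY; rewrite setTI; apply: sub_sigma_algebra => /=.
rewrite -bigcup_seq/=; exists i => /=; first by rewrite mem_index_enum.
by exists Y => //; rewrite setTI.
Qed.

Lemma measurable_fun_rVP d (T : measurableType d) (R : realType) n
    (f : T -> 'rV[R]_n) :
  measurable_fun [set: T] f <->
  forall i, measurable_fun [set: T] (rV_coord i \o f).
Proof.
split=> [mf i|mf]; first exact: measurableT_comp (measurable_rV_coord i) mf.
suff: g_sigma_preimage (fun i => rV_coord i \o f) `<=` measurable.
  rewrite g_sigma_preimage_comp => prefS _ A mA.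
  by apply: prefS; exists A.
apply: smallest_sub; first exact: sigma_algebra_measurable.
rewrite -bigcup_seq; apply: bigcup_sub => i _ A [B mB <-]; exact: mf.
Qed.

Section lebesgue_rV.
Variable R : realType.

Definition cons_rV n (p : R * 'rV[R]_n) : 'rV[R]_n.+1 :=
  \row_i (if unlift ord0 i is Some j then p.2 ord0 j else p.1).

Definition uncons_rV n (x : 'rV[R]_n.+1) : R * 'rV[R]_n :=
  (x ord0 ord0, \row_j x ord0 (lift ord0 j)).

Lemma cons_rVK n : cancel (@cons_rV n) (@uncons_rV n).
Proof.
move=> [t y]; rewrite /uncons_rV !mxE unlift_none; congr pair.
by apply/rowP => j; rewrite !mxE liftK.
Qed.

Lemma measurable_cons_rV n : measurable_fun setT (@cons_rV n).
Proof.
apply/measurable_fun_rVP => i.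
have -> : rV_coord i \o @cons_rV n =
    (fun p => if unlift ord0 i is Some j then p.2 ord0 j else p.1).
  by apply/funext => p; rewrite /= /rV_coord mxE.
case: unliftP => [j _|_]; last exact: measurable_fst.
exact: measurableT_comp (measurable_rV_coord j) measurable_snd.
Qed.

Lemma measurable_uncons_rV n : measurable_fun setT (@uncons_rV n).
Proof.
apply/measurable_fun_pair => /=; first exact: (measurable_rV_coord ord0).
apply/measurable_fun_rVP => i.
have -> : rV_coord i \o (fun x : 'rV[R]_n.+1 => \row_j x ord0 (lift ord0 j)) =
    rV_coord (lift ord0 i).
  by apply/funext => x; rewrite /= /rV_coord mxE.
exact: measurable_rV_coord.
Qed.

Section step.
Variables (n : nat) (m : {sigma_finite_measure set 'rV[R]_n -> \bar R}).

Definition lebesgue_rV_step : set 'rV[R]_n.+1 -> \bar R :=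
  pushforward (@lebesgue_measure R \x m)%E (@cons_rV n).

Let step0 : lebesgue_rV_step set0 = 0%E.
Proof. by rewrite /lebesgue_rV_step /pushforward preimage_set0 measure0. Qed.

Let step_ge0 A : (0 <= lebesgue_rV_step A)%E.
Proof. exact: (measure_ge0 (@lebesgue_measure R \x m)%E). Qed.

Let step_sigma_additive : semi_sigma_additive lebesgue_rV_step.
Proof.
move=> F mF tF mUF; rewrite /lebesgue_rV_step /pushforward preimage_bigcup.
apply: measure_semi_sigma_additive.
- by move=> k; rewrite -[X in measurable X]setTI; exact: measurable_cons_rV.
- apply/trivIsetP => /= i j _ _ ij; rewrite -preimage_setI.
  by move/trivIsetP : tF => /(_ _ _ _ _ ij) ->//; rewrite preimage_set0.
- rewrite -preimage_bigcup -[X in measurable X]setTI.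
  exact: measurable_cons_rV.
Qed.

HB.instance Definition _ := isMeasure.Build _ _ _ lebesgue_rV_step
  step0 step_ge0 step_sigma_additive.

Let step_sigma_finite : sigma_finite setT lebesgue_rV_step.
Proof.
have /sigma_finiteP[F [FT ndF Foo]] := sigma_finiteT (@lebesgue_measure R).
have /sigma_finiteP[G [GT ndG Goo]] := sigma_finiteT m.
exists (fun k => @uncons_rV n @^-1` (F k `*` G k)).
  apply/esym/seteqP; split=> // x _.
  have [i _ Fi] : (\bigcup_i F i) (uncons_rV x).1 by rewrite -FT.
  have [j _ Gj] : (\bigcup_j G j) (uncons_rV x).2 by rewrite -GT.
  exists (maxn i j) => //; split.
    by move: Fi; exact/subsetPset/ndF/leq_maxl.
  by move: Gj; exact/subsetPset/ndG/leq_maxr.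
move=> k; have [? ?] := Foo k; have [? ?] := Goo k; split.
  by rewrite -[X in measurable X]setTI; apply: measurable_uncons_rV => //;
    exact: measurableX.
rewrite /lebesgue_rV_step /pushforward -comp_preimage.
rewrite (_ : _ \o _ = id); last by apply/funext => q /=; rewrite cons_rVK.
by rewrite preimage_id product_measure1E// lte_mul_pinfty// ge0_fin_numE.
Qed.

HB.instance Definition _ := Measure_isSigmaFinite.Build _ _ _ lebesgue_rV_step
  step_sigma_finite.

End step.

(* The n-fold product of the one-dimensional Lebesgue measure, transported to row
   vectors (cf. lebesgue_rV_box). *)
Fixpoint lebesgue_rV (n : nat) : {sigma_finite_measure set 'rV[R]_n -> \bar R} :=
  match n with
  | 0 => \d_(0 : 'rV[R]_0)
  | k.+1 => lebesgue_rV_step (lebesgue_rV k)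
  end.

Lemma lebesgue_rV_box n (A : 'I_n -> set R) :
  (forall i, measurable (A i)) ->
  lebesgue_rV n [set x | forall i, A i (x ord0 i)] =
  (\prod_(i < n) @lebesgue_measure R (A i))%E.
Proof.
elim: n A => [|n IH] A mA.
  by rewrite big_ord0 /= diracE mem_set //= => -[].
pose B := [set y : 'rV[R]_n | forall i, A (lift ord0 i) (y ord0 i)].
have mB : measurable B.
  have -> : B =
      \big[setI/setT]_(i < n) (rV_coord i @^-1` A (lift ord0 i)).
    rewrite -bigcap_seq; apply/seteqP.
    split=> x /= Hx i; first by move=> _; exact: Hx.
    by apply: Hx; rewrite /= mem_index_enum.
  apply: bigsetI_measurable => i _; rewrite -[X in measurable X]setTI.
  exact: measurable_rV_coord.
rewrite big_ord_recl -IH // -/B -product_measure1E //=; last exact: mA.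
rewrite /lebesgue_rV_step /pushforward; congr (_ _).
apply/seteqP; split=> -[t y] /=.
  move=> Hx; split=> [|i]; first by have := Hx ord0; rewrite mxE unlift_none.
  by have := Hx (lift ord0 i); rewrite mxE liftK.
by move=> [Ht Hy] i; rewrite mxE; case: unliftP => [j ->|->].
Qed.

End lebesgue_rV.

Section euclidean.
Variables (R : realType) (d : nat).
Implicit Types (x y : 'rV[R]_d) (A : set 'rV[R]_d).

Definition dotrV x y : R := \sum_(i < d) x ord0 i * y ord0 i.

(* The library norm on row vectors is the sup norm; topology and boundedness are
   the same for both norms. *)
Definition enorm x : R := Num.sqrt (dotrV x x).

Record polarizer := Polarizer {
  pol_normal : 'rV[R]_d;
  pol_offset : R;
  _ : enorm pol_normal = 1
}.

Definition half_space (H : polarizer) : set 'rV[R]_d :=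
  [set x | dotrV x (pol_normal H) < pol_offset H].

Definition reflection (H : polarizer) x : 'rV[R]_d :=
  x - (2 * (dotrV x (pol_normal H) - pol_offset H)) *: pol_normal H.

Definition polarization (H : polarizer) A : set 'rV[R]_d :=
  ((A `|` reflection H @` A) `&` half_space H) `|` (A `&` reflection H @` A).

Definition domain A := [/\ A !=set0, connected A & open A].

Definition partial (i : 'I_d) (f : 'rV[R]_d -> R) : 'rV[R]_d -> R :=
  fun x => 'D_(delta_mx ord0 i) f x.

Definition gradient (f : 'rV[R]_d -> R) x : 'rV[R]_d := \row_i partial i f x.

(* Every iterated partial derivative is differentiable everywhere, i.e. C^oo. *)
Definition smooth (f : 'rV[R]_d -> R) :=
  forall (s : seq 'I_d) x, differentiable (foldr partial f s) x.

Definition test_function (f : 'rV[R]_d -> R) :=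
  smooth f /\ compact (closure [set x | f x != 0]).

Definition C1holder (beta : R) (f : 'rV[R]_d -> R) :=
  (forall x, differentiable f x) /\
  exists C : R, forall x y,
    enorm (gradient f x - gradient f y) <= C * enorm (x - y) `^ beta.

(* Near each boundary point, A is the open epigraph, in some unit direction e,
   of a C^{1,beta} function on the hyperplane orthogonal to e.  The function is
   given on the whole space (a function on the hyperplane extends constantly
   along e), but only its values on the hyperplane are used. *)
Definition C1holder_set (beta : R) A :=
  forall x0, (closure A `\` A^°) x0 ->
  exists (r : R) (e : 'rV[R]_d) (f : 'rV[R]_d -> R),
    [/\ 0 < r, enorm e = 1, C1holder beta f &
      forall x, enorm (x - x0) < r ->
        (A x <-> f (x - dotrV x e *: e) < dotrV x e)].

End euclidean.

Section sobolev.
Variables (R : realType) (d : nat).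
Implicit Types (u : 'rV[R]_d -> R) (g : 'rV[R]_d -> 'rV[R]_d).
Implicit Types (p s : R) (Omega : set 'rV[R]_d).
Local Notation mu := (lebesgue_rV R d).
Local Open Scope ereal_scope.

Definition loc_integrable u :=
  measurable_fun setT u /\
  forall K, compact K -> \int[mu]_(x in K) `|u x|%:E < +oo.

Definition is_weak_gradient u g :=
  forall i : 'I_d, loc_integrable (fun x => g x ord0 i) /\
    forall phi, test_function phi ->
      \int[mu]_x (u x * partial i phi x)%:E =
      - \int[mu]_x (g x ord0 i * phi x)%:E.

(* The weak gradient is unique up to null sets; the default value 0 is used
   when there is none. *)
Definition weak_gradient u : 'rV[R]_d -> 'rV[R]_d :=
  xget (cst 0%R) (is_weak_gradient u).

(* Functions are representatives of L^p classes, so vanishing outside Omega is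
   meant almost everywhere, as is u <> 0 below. *)
Definition W1p0 p Omega : set ('rV[R]_d -> R) := [set u |
  [/\ u \in Lfun mu p%:E,
      exists g, is_weak_gradient u g,
      'N[mu]_p%:E[(fun x => (enorm (weak_gradient u x))%:E)] < +oo &
      {ae mu, forall x, ~ Omega x -> u x = 0%R}]].

Definition gagliardo s p u : \bar R :=
  (\int[mu]_x \int[mu]_y
     (`|u x - u y| `^ p / enorm (x - y) `^ (d%:R + s * p))%:E) `^ p^-1.

Definition dirichlet_energy s p Omega u : \bar R :=
  'N[mu]_p%:E[(fun x => (enorm (weak_gradient u x))%:E) \_ Omega] `^ p
  + gagliardo s p u `^ p.

Definition least_eigenvalue s p Omega : \bar R :=
  ereal_inf [set dirichlet_energy s p Omega u | u in
    [set u | [/\ W1p0 p Omega u, ~ ae_eq mu setT u (cst 0%R) &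
                 'N[mu]_p%:E[(EFin \o u) \_ Omega] = 1]]].

End sobolev.

(* Main.v *)
(* For the weak inequality, polarize |u|: the L^p norms of the function and of its
   gradient are unchanged, and a four-point rearrangement over x, y, sigma x,
   sigma y, based on the convexity of |t|^p and the monotonicity of the kernel,
   shows that the Gagliardo energy drops by a quarter of an explicit nonnegative
   gain.  That |u|, u o sigma and 1_H w for odd w are Sobolev functions follows
   by describing the weak gradient g as a derivative in L^1: the integral of
   |u(x + z) - u(x) - g(x) . z| is o(|z|).

   The strict inequality needs neither the regularity of eigenfunctions nor a
   strong maximum principle.  By compactness a minimizing sequence u_k for Omega
   converges almost everywhere to some u <> 0.  If the eigenvalues were equal,
   the gains of the u_k would tend to 0.  The two hypotheses on the polarized set
   and the C^{1,beta} boundary give boxes B1, B2 in Omega, on either side of the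
   hyperplane, whose reflections avoid Omega; the gain being positive where
   u(x) u(y) > 0 on B1 x B2, Fatou's lemma gives u = 0 on one of the boxes.
   Comparing u_k with max(u_k, t phi) for a bump phi in that box then forces
   u = 0: the max saves a nonlocal energy of order t at the cost of t^p E(phi),
   and p > 1. *)
Require Import Defs.
From HB Require Import structures.
From mathcomp Require Import all_boot all_order all_algebra.
From mathcomp Require Import all_classical all_reals all_analysis.
From mathcomp Require Import measurable_realfun ring lra zify.
Set Implicit Arguments.
Unset Strict Implicit.
Unset Printing Implicit Defensive.
Import Order.TTheory GRing.Theory Num.Def Num.Theory.
Import numFieldNormedType.Exports.
Local Open Scope classical_set_scope.
Local Open Scope ring_scope.

(** * Boxes, Lebesgue measure and translations *)

Section open_boxes.
Variables (R : realType) (n : nat).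
Implicit Types (a b x y : 'rV[R]_n) (U A : set 'rV[R]_n).

(** The limit [u] of a minimizing sequence is used only as an almost everywhere limit that is not
    null: gradients occur for the [u_k] alone, through the inequality between the eigenvalue and an
    energy, and what passes to the limit is the nonlocal gains, by Fatou's lemma. The L1 expansion
    of [u (x + z)] commutes with isometries, and difference quotients are pointwise expressions to
    which absolute values and cut-offs can be applied directly. The obstacle is the cut-off by the
    half-space in the normal direction, where the indicator jumps; it is overcome because
    [u - u \o sigma] is odd, so that it may be tested against even extensions, whose corner sits on
    the hyperplane where an odd function vanishes. Compactness rests on the Gagliardo seminorm: on
    small cells it controls the oscillation, since [s > 0]. Functions are handled as pairs [(u, g)]
    with an explicit gradient, because the gradient selected by [xget] is determined only up to null
    sets. *)

Definition obox a b : set 'rV[R]_n :=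
  [set x | forall i, a ord0 i < x ord0 i < b ord0 i].

Lemma nbhs_rVP x A : nbhs x A <->
  exists2 e : R, 0 < e &
    forall y, (forall i, `|y ord0 i - x ord0 i| < e) -> A y.
Proof.
split.
  move=> /nbhs_ballP[e /= e0 xA]; exists e => // y xy; apply: xA; split => //.
  by move=> i j; rewrite ord1 /ball /= distrC.
move=> [e e0 xA]; apply/nbhs_ballP; exists e => // y [_ xy]; apply: xA => i.
by have := xy ord0 i; rewrite /ball /= distrC.
Qed.

Lemma obox_near x a b : obox a b x ->
  exists2 e : R, 0 < e &
    forall y, (forall i, `|y ord0 i - x ord0 i| < e) -> obox a b y.
Proof.
move=> xab.
pose m i := minr (x ord0 i - a ord0 i) (b ord0 i - x ord0 i).
exists (\big[minr/1]_i m i).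
  elim/big_ind : _ => [//|u v u0 v0|i _]; first by rewrite lt_min u0.
  by rewrite /m lt_min !subr_gt0; exact: xab.
move=> y xy i.
have : `|y ord0 i - x ord0 i| < m i.
  by apply: lt_le_trans (xy i) _; exact: bigmin_le.
by rewrite /m lt_min !ltr_distl => /andP[] /andP[? ?] /andP[? ?]; apply/andP; lra.
Qed.

Lemma open_obox a b : open (obox a b).
Proof.
rewrite openE => x /obox_near[e e0 xA]; apply/nbhs_rVP; exists e => //.
Qed.

Lemma obox_setI a b a' b' : obox a b `&` obox a' b' =
  obox (\row_i maxr (a ord0 i) (a' ord0 i)) (\row_i minr (b ord0 i) (b' ord0 i)).
Proof.
apply/seteqP; split => x /=.
  by move=> [h k] i; rewrite !mxE gt_max lt_min; have := h i; have := k i;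
    move=> /andP[-> ->] /andP[-> ->].
by move=> h; split => i; have := h i; rewrite !mxE gt_max lt_min;
  move=> /andP[/andP[h1 h2] /andP[h3 h4]]; apply/andP.
Qed.

Lemma open_bigcup_obox U : open U -> exists D : (set 'rV[R]_n)^nat,
  (forall k, D k = set0 \/ exists a b, D k = obox a b) /\ U = \bigcup_k D k.
Proof.
move=> oU.
(* Boxes with rational corners, numbered through their codes; numbers that are not codes and boxes
   that leave [U] contribute the empty set. *)
pose B (q : {ffun 'I_n -> rat * rat}) :=
  obox (\row_i ratr (q i).1) (\row_i ratr (q i).2).
pose D k := if @unpickle {ffun 'I_n -> rat * rat} k is Some q then
  if `[< B q `<=` U >] then B q else set0 else set0.
exists D; split.
  move=> k; rewrite /D; case: unpickle => [q|]; last by left.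
  by case: ifPn => _; [right; do 2 eexists|left].
apply/seteqP; split => [x Ux|x [k _]]; last first.
  by rewrite /D; case: unpickle => // q; case: asboolP => // qU /qU.
have /nbhs_rVP[e e0 xU] : nbhs x U by move: oU; rewrite openE => /(_ _ Ux).
have r1 i : exists q : rat, ratr q \in `]x ord0 i - e, x ord0 i[.
  by apply: rat_in_itvoo; rewrite ltrBlDr ltrDl.
have r2 i : exists q : rat, ratr q \in `]x ord0 i, x ord0 i + e[.
  by apply: rat_in_itvoo; rewrite ltrDl.
pose q := [ffun i => (xchoose (r1 i), xchoose (r2 i))].
have h1 i := xchooseP (r1 i); have h2 i := xchooseP (r2 i).
have qU : B q `<=` U.
  move=> y yB; apply: xU => i; have := yB i; have := h1 i; have := h2 i.
  rewrite !mxE !ffunE /= !in_itv /= ltr_distl => /andP[? ?] /andP[? ?] /andP[? ?].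
  by apply/andP; split; lra.
exists (pickle q) => //; rewrite /D pickleK asboolT // => i.
by have := h1 i; have := h2 i; rewrite !mxE !ffunE /= !in_itv /= => /andP[-> _] /andP[_ ->].
Qed.

Definition oboxes : set (set 'rV[R]_n) :=
  [set A | A = set0 \/ exists a b, A = obox a b].

Lemma setI_closed_oboxes : setI_closed oboxes.
Proof.
move=> A B [->|[a [b ->]]]; first by left; rewrite set0I.
move=> [->|[a' [b' ->]]]; first by left; rewrite setI0.
by right; rewrite obox_setI; do 2 eexists.
Qed.

Lemma open_sigma_oboxes U : open U -> <<s oboxes >> U.
Proof.
move=> /open_bigcup_obox[D [hD ->]]; apply: sigma_algebra_bigcup => k.
by apply: sub_sigma_algebra; exact: hD.
Qed.

Lemma measurable_obox a b : measurable (obox a b).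
Proof.
have -> : obox a b =
    \big[setI/setT]_(i < n) (@rV_coord R n i @^-1` `]a ord0 i, b ord0 i[%classic).
  rewrite -bigcap_seq; apply/seteqP; split=> x /= Hx i.
    by move=> _; rewrite /= in_itv; exact: Hx.
  by have := Hx i; rewrite /= mem_index_enum in_itv; exact.
apply: bigsetI_measurable => i _; rewrite -[X in measurable X]setTI.
exact: measurable_rV_coord.
Qed.

Lemma continuous_rV_coord i : continuous (@rV_coord R n i).
Proof.
move=> x A /nbhs_ballP[e e0 xA]; apply/nbhs_rVP; exists e => // y xy.
by apply: xA; rewrite /ball /= distrC; exact: xy.
Qed.

(** Boxes form a generator stable under intersection, which opens the way to Dynkin induction and to
    uniqueness of measures. The coordinate preimage of an open interval is open, hence a countable
    union of rational boxes. *)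
Lemma measurable_rV_oboxes : measurable = <<s oboxes >> :> set (set 'rV[R]_n).
Proof.
apply/seteqP; split; last first.
  apply: smallest_sub; first exact: sigma_algebra_measurable.
  by move=> A [->|[a [b ->]]]; [exact: measurable0|exact: measurable_obox].
apply: smallest_sub; first exact: smallest_sigma_algebra.
rewrite -bigcup_seq; apply: bigcup_sub => i _ A [B mB <-].
rewrite setTI.
suff : measurable `<=` [set B | <<s oboxes >> (@rV_coord R n i @^-1` B)] by exact.
have -> : measurable = <<s @RGenOpens.G R >> :> set (set R).
  exact: RGenOpens.measurableE.
apply: smallest_sub.
  split => /=.
  - by rewrite preimage_set0; exact: sigma_algebra0.
  - move=> C hC; rewrite setTD preimage_setC; exact: sigma_algebraC.
  - move=> F hF; rewrite preimage_bigcup; exact: sigma_algebra_bigcup.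
move=> C [x [y ->]] /=; apply: open_sigma_oboxes; apply: open_comp.
  by move=> z _; exact: continuous_rV_coord.
exact: interval_open.
Qed.

Lemma open_measurable_rV U : open U -> measurable U.
Proof. by rewrite measurable_rV_oboxes; exact: open_sigma_oboxes. Qed.

Lemma continuous_measurable_rV (f : 'rV[R]_n -> R) :
  continuous f -> measurable_fun setT f.
Proof.
move=> cf; apply: (measurability (@RGenOpens.G R)).
  exact: RGenOpens.measurableE.
move=> _ [_ [x [y ->]] <-]; rewrite setTI; apply: open_measurable_rV.
by apply: open_comp => [z _|]; [exact: cf|exact: interval_open].
Qed.

Lemma measure_rV_unique (m1 m2 : {measure set 'rV[R]_n -> \bar R}) :
  (forall a b, m1 (obox a b) = m2 (obox a b)) ->
  (forall a b, (m1 (obox a b) < +oo)%E) ->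
  forall A, measurable A -> m1 A = m2 A.
Proof.
move=> m12 m1oo.
pose g k := obox (const_mx (- k%:R)) (const_mx k%:R).
apply: (@measure_unique _ _ _ oboxes g).
- exact: measurable_rV_oboxes.
- exact: setI_closed_oboxes.
- by move=> k; right; do 2 eexists.
- apply/seteqP; split => // x _.
  exists (truncn `|x|).+1 => // i; rewrite !mxE -ltr_norml.
  apply: le_lt_trans (truncnS_gt _).
  rewrite [leRHS]/normr /= mx_normrE; apply/bigmax_geP; right => /=.
  by exists (ord0, i).
- by move=> A [->|[a [b ->]]]; [rewrite !measure0|exact: m12].
- by move=> k; exact: m1oo.
Qed.

Lemma lebesgue_rV_obox a b : lebesgue_rV R n (obox a b) =
  (\prod_(i < n) @lebesgue_measure R `]a ord0 i, b ord0 i[%classic)%E.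
Proof.
rewrite -lebesgue_rV_box; last by move=> i; exact: measurable_itv.
by congr (_ _); apply/seteqP; split => x /= h i; have := h i; rewrite /= in_itv.
Qed.

Lemma lebesgue_rV_obox_lty a b : (lebesgue_rV R n (obox a b) < +oo)%E.
Proof.
rewrite lebesgue_rV_obox.
suff /andP[] : (0 <= \prod_(i < n) @lebesgue_measure R `]a ord0 i, b ord0 i[%classic
    < +oo)%E by [].
elim/big_ind : _ => //.
- by rewrite lee_fin ler01 ltry.
- move=> x y /andP[x0 xoo] /andP[y0 yoo]; rewrite mule_ge0//= lte_mul_pinfty//.
  by rewrite ge0_fin_numE.
- move=> i _; rewrite measure_ge0 /= lebesgue_measure_itv /=.
  by case: ifPn => _; rewrite -?EFinB ltry.
Qed.

Lemma lebesgue_rV_obox_gt0 a b : (forall i, a ord0 i < b ord0 i) ->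
  (0 < lebesgue_rV R n (obox a b))%E.
Proof.
move=> ab; rewrite lebesgue_rV_obox; elim/big_ind : _ => //.
- by move=> x y x0 y0; rewrite mule_gt0.
- by move=> i _; rewrite lebesgue_measure_itv /= lte_fin ab -EFinB lte_fin subr_gt0.
Qed.

Lemma measurable_addrV z : measurable_fun setT (fun x : 'rV[R]_n => x + z).
Proof.
apply/measurable_fun_rVP => i.
rewrite (_ : _ \o _ = fun x => rV_coord i x + z ord0 i); last first.
  by apply/funext => x /=; rewrite /rV_coord mxE.
by apply: measurable_funD => //; exact: measurable_rV_coord.
Qed.

Lemma lebesgue_rV_translation z A : measurable A ->
  lebesgue_rV R n [set x | A (x + z)] = lebesgue_rV R n A.
Proof.
move=> mA.
pose T := (fun x : 'rV[R]_n => x + z).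
have mT : measurable_fun setT T by exact: measurable_addrV.
change (pushforward (lebesgue_rV R n) T A = lebesgue_rV R n A).
have obE a b : pushforward (lebesgue_rV R n) T (obox a b) = lebesgue_rV R n (obox a b).
  rewrite /pushforward.
  have -> : T @^-1` obox a b = obox (a - z) (b - z).
    by apply/seteqP; split => x h i; have := h i; rewrite !mxE ltrBlDr ltrBrDr.
  rewrite !lebesgue_rV_obox; apply: eq_bigr => i _.
  rewrite !lebesgue_measure_itv /= !mxE !lte_fin ltrD2r.
  by case: ifPn => // _; rewrite -!EFinB; congr EFin; ring.
symmetry; apply: measure_rV_unique => //.
  by move=> a b /=; rewrite obE.
by move=> a b; exact: lebesgue_rV_obox_lty.
Qed.
End open_boxes.

Section measurable_rV_operations.
Context d (T : measurableType d) (R : realType) (n : nat).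
Implicit Types f g : T -> 'rV[R]_n.

Lemma measurable_rV_comp i f : measurable_fun setT f ->
  measurable_fun setT (fun x => f x ord0 i).
Proof. by move=> /measurable_fun_rVP/(_ i). Qed.

Lemma measurable_rVD f g : measurable_fun setT f -> measurable_fun setT g ->
  measurable_fun setT (fun x => f x + g x).
Proof.
move=> mf mg; apply/measurable_fun_rVP => i.
rewrite (_ : _ \o _ = fun x => f x ord0 i + g x ord0 i).
  by apply: measurable_funD; exact: measurable_rV_comp.
by apply/funext => x /=; rewrite /rV_coord mxE.
Qed.

Lemma measurable_rVZ (h : T -> R) f : measurable_fun setT h ->
  measurable_fun setT f -> measurable_fun setT (fun x => h x *: f x).
Proof.
move=> mh mf; apply/measurable_fun_rVP => i.
rewrite (_ : _ \o _ = fun x => h x * f x ord0 i).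
  by apply: measurable_funM => //; exact: measurable_rV_comp.
by apply/funext => x /=; rewrite /rV_coord mxE.
Qed.

Lemma measurable_rVN f : measurable_fun setT f ->
  measurable_fun setT (fun x => - f x).
Proof.
move=> mf; apply/measurable_fun_rVP => i.
rewrite (_ : _ \o _ = fun x => - f x ord0 i).
  by apply: measurableT_comp => //; exact: measurable_rV_comp.
by apply/funext => x /=; rewrite /rV_coord mxE.
Qed.

Lemma measurable_rVB f g : measurable_fun setT f -> measurable_fun setT g ->
  measurable_fun setT (fun x => f x - g x).
Proof. by move=> mf mg; apply: measurable_rVD => //; exact: measurable_rVN. Qed.

Lemma measurable_dotrV f g : measurable_fun setT f -> measurable_fun setT g ->
  measurable_fun setT (fun x => dotrV (f x) (g x)).
Proof.
move=> mf mg; apply: measurable_sum => i.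
by apply: measurable_funM => //; exact: measurable_rV_comp.
Qed.

Lemma measurable_enorm f : measurable_fun setT f ->
  measurable_fun setT (fun x => enorm (f x)).
Proof.
move=> mf; apply: (measurableT_comp (f := @Num.sqrt R)); last exact: measurable_dotrV.
by apply: continuous_measurable_fun; exact: sqrt_continuous.
Qed.

End measurable_rV_operations.

Lemma mule_fin_inj (R : realType) (x y z : \bar R) : x \is a fin_num -> (0 < x)%E ->
  (x * y = x * z)%E -> y = z.
Proof.
move=> xf x0 E; apply/le_anti/andP; split.
  by rewrite -(lee_pmul2l xf x0) E.
by rewrite -(lee_pmul2l xf x0) E.
Qed.

(** * Maps preserving Lebesgue measure *)

Section measure_preserving.
Variables (R : realType) (n : nat).
Local Notation mu := (lebesgue_rV R n).
Implicit Types (T S : 'rV[R]_n -> 'rV[R]_n) (A : set 'rV[R]_n).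

Definition measure_preserving T := measurable_fun setT T /\
  forall A, measurable A -> mu (T @^-1` A) = mu A.

Lemma measure_preserving_comp T S : measure_preserving T ->
  measure_preserving S -> measure_preserving (T \o S).
Proof.
move=> [mT hT] [mS hS]; split; first exact: measurableT_comp.
move=> A mA; rewrite comp_preimage hS ?hT//.
by rewrite -[X in measurable X]setTI; exact: mT.
Qed.

Lemma ge0_integral_preserving T (f : 'rV[R]_n -> \bar R) :
  measure_preserving T -> measurable_fun setT f -> (forall x, 0 <= f x)%E ->
  (\int[mu]_x f (T x) = \int[mu]_x f x)%E.
Proof.
move=> [mT hT] mf f0.
have := @ge0_integral_pushforward _ _ _ _ R T mT mu setT f measurableT mf (fun x _ => f0 x).
rewrite preimage_setT => <-; apply: eq_measure_integral => A mA _.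
exact: hT.
Qed.

Lemma integrable_preserving T (f : 'rV[R]_n -> R) :
  measure_preserving T -> mu.-integrable setT (EFin \o f) ->
  mu.-integrable setT (EFin \o (f \o T)).
Proof.
move=> pT /integrableP[mf foo]; apply/integrableP; split.
  by apply: (measurableT_comp mf); exact: (pT.1).
rewrite (ge0_integral_preserving (f := fun x => `|(EFin \o f) x|%E) pT)//.
by apply: measurableT_comp.
Qed.

Lemma integral_preserving T (f : 'rV[R]_n -> R) :
  measure_preserving T -> mu.-integrable setT (EFin \o f) ->
  (\int[mu]_x (f (T x))%:E = \int[mu]_x (f x)%:E)%E.
Proof.
move=> pT If; have [mT hT] := pT.
have := @integral_pushforward _ _ _ _ R T mT mu setT (EFin \o f).
rewrite preimage_setT => /(_ _ _ _) <-//.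
- by apply: eq_measure_integral => A mA _; exact: hT.
- by case/integrableP : If.
- exact: integrable_preserving.
Qed.

Lemma ae_preserving T (P : 'rV[R]_n -> Prop) : measure_preserving T ->
  {ae mu, forall x, P x} -> {ae mu, forall x, P (T x)}.
Proof.
move=> [mT hT] [A [mA A0 PA]]; exists (T @^-1` A); split.
- by rewrite -[X in measurable X]setTI; exact: mT.
- by rewrite hT.
- by move=> x /= Px; exact: PA.
Qed.

Lemma translation_preserving z : measure_preserving (fun x => x + z).
Proof.
split; first exact: measurable_addrV.
by move=> A mA; exact: lebesgue_rV_translation.
Qed.

(** A set invariant under linear isometries and symmetric about the origin; lying between two boxes
    it has finite positive measure, so its measure can be cancelled. *)
Let unitball : set 'rV[R]_n := [set x | dotrV x x < 1].

Let measurable_unitball : measurable unitball.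
Proof.
rewrite (_ : unitball = (fun x => dotrV x x) @^-1` `]-oo, 1[%classic).
  by rewrite -[X in measurable X]setTI; apply: measurable_dotrV => //;
    exact: measurable_id.
by apply/seteqP; split => x; rewrite /unitball /= in_itv.
Qed.

Let unitball_lty : (mu unitball < +oo)%E.
Proof.
apply: le_lt_trans (@lebesgue_rV_obox_lty R n (const_mx (-1)) (const_mx 1)).
apply: le_measure; rewrite ?inE //; first exact: measurable_obox.
move=> x x1 i; rewrite !mxE -ltr_norml -(@ltr_pXn2r _ 2)// ?nnegrE// expr1n.
apply: le_lt_trans x1; rewrite /dotrV (bigD1 i) //= real_normK ?num_real// expr2.
by rewrite lerDl sumr_ge0// => j _; rewrite -expr2 sqr_ge0.
Qed.

Let unitball_gt0 : (0 < mu unitball)%E.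
Proof.
(* In the box of half-side [e] each of the [n] squares is at most [e], so their sum is at most
   [n / (n + 1) < 1]; [n + 1] also covers [n = 0]. *)
pose e : R := n.+1%:R^-1.
have e0 : 0 < e by rewrite invr_gt0.
apply: lt_le_trans (@lebesgue_rV_obox_gt0 R n (const_mx (- e)) (const_mx e) _) _.
  by move=> i; rewrite !mxE gtrN.
apply: le_measure; rewrite ?inE //; first exact: measurable_obox.
move=> x xe; rewrite /unitball /= /dotrV.
have h i : x ord0 i * x ord0 i <= e.
  have := xe i; rewrite !mxE -ltr_norml => xi.
  rewrite -expr2 -real_normK ?num_real// expr2.
  apply: le_trans (ler_pM _ _ (ltW xi) (ltW xi)) _ => //.
  by rewrite ger_pMr// invf_le1// ler1n.
apply: le_lt_trans (ler_sum _ (fun i _ => h i)) _.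
rewrite sumr_const card_ord -[_ *+ _]mulr_natr.
by rewrite mulrC ltr_pdivrMr// mul1r ltr_nat.
Qed.

(* Uniqueness of Haar measure: both nu(A) mu(B) and mu(A) mu(B), for the image
   measure nu and the unit ball B, are the integral of 1_B(x) 1_A(x + T y). *)
Lemma isometry_preserving T : measurable_fun setT T ->
  {morph T : x y / x + y} -> involutive T -> (forall x, dotrV (T x) (T x) = dotrV x x) ->
  measure_preserving T.
Proof.
move=> mT TD TK Tn; split => // A mA.
have T0 : T 0 = 0 by apply: (addrI (T 0)); rewrite -TD !addr0.
have TN x : T (- x) = - T x.
  by apply: (addrI (T x)); rewrite -TD !subrr.
set B := unitball.
have mTA : measurable (T @^-1` A) by rewrite -[X in measurable X]setTI; exact: mT.
pose F (p : 'rV[R]_n * 'rV[R]_n) : \bar R := (\1_B p.1 * \1_A (p.1 + T p.2))%:E.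
have mF : measurable_fun setT F.
  apply/measurable_EFinP; apply: measurable_funM.
    by apply: measurableT_comp => //; exact: measurable_fst.
  apply: measurableT_comp => //; apply: measurable_rVD; first exact: measurable_fst.
  by apply: measurableT_comp => //; exact: measurable_snd.
have F0 p : (0 <= F p)%E by rewrite lee_fin mulr_ge0// indicE.
have L : (\int[mu]_x \int[mu]_y F (x, y) = mu B * mu (T @^-1` A))%E.
  transitivity (\int[mu]_x ((\1_B x)%:E * mu (T @^-1` A)))%E.
    apply: eq_integral => x _.
    under eq_integral do rewrite /F /= EFinM.
    rewrite ge0_integralZl//; last first.
      apply/measurable_EFinP; apply: measurableT_comp => //.
      by apply: measurable_rVD => //; exact: measurable_cst.
    congr (_ * _)%E.
    transitivity (\int[mu]_y (\1_(T @^-1` A) (y + T x))%:E)%E.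
      apply: eq_integral => y _; congr EFin.
      have -> : x + T y = T (y + T x) by rewrite TD TK addrC.
      by rewrite !indicE; congr (_%:R); congr nat_of_bool; apply/idP/idP; rewrite !in_setE.
    rewrite (ge0_integral_preserving (f := fun y => (\1_(T @^-1` A) y)%:E)
      (translation_preserving (T x)))//.
    - by rewrite integral_indic// setIT.
    - by apply/measurable_EFinP.
  rewrite ge0_integralZr//; first by rewrite integral_indic// setIT.
  by apply/measurable_EFinP.
have Rr : (\int[mu]_y \int[mu]_x F (x, y) = mu A * mu B)%E.
  transitivity (\int[mu]_y \int[mu]_x ((\1_A x * \1_B (x - T y))%:E))%E.
    apply: eq_integral => y _.
    rewrite -(ge0_integral_preserving (f := fun x => (\1_A x * \1_B (x - T y))%:E)
      (translation_preserving (T y))).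
    - by apply: eq_integral => x _; rewrite /F /= addrK mulrC.
    - apply/measurable_EFinP; apply: measurable_funM => //.
      apply: measurableT_comp => //.
      by apply: measurable_rVB => //; exact: measurable_cst.
    - by move=> x; rewrite lee_fin mulr_ge0// indicE.
  rewrite (fubini_tonelli (fun p : 'rV[R]_n * 'rV[R]_n =>
    (\1_A p.2 * \1_B (p.2 - T p.1))%:E))//=; last first.
    apply/measurable_EFinP; apply: measurable_funM.
      by apply: measurableT_comp => //; exact: measurable_snd.
    apply: measurableT_comp => //; apply: measurable_rVB; first exact: measurable_snd.
    by apply: measurableT_comp => //; exact: measurable_fst.
  transitivity (\int[mu]_x ((\1_A x)%:E * mu B))%E.
    apply: eq_integral => x _.
    under eq_integral do rewrite EFinM.
    rewrite ge0_integralZl//; last first.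
      apply/measurable_EFinP; apply: measurableT_comp => //.
      by apply: measurable_rVB => //; exact: measurable_cst.
    congr (_ * _)%E.
    transitivity (\int[mu]_y (\1_B (y + (- T x)))%:E)%E.
      apply: eq_integral => y _; congr EFin.
      rewrite !indicE; congr (_%:R); congr nat_of_bool; apply/idP/idP; rewrite !in_setE /B /unitball /=.
        by rewrite -(Tn (y - T x)) TD TN TK => h;
          rewrite -opprB -scaleN1r /dotrV (eq_bigr (fun i => (x - T y) ord0 i * (x - T y) ord0 i))// => i _; rewrite !mxE; ring.
      by rewrite -(Tn (y - T x)) TD TN TK => h;
          rewrite -opprB -scaleN1r /dotrV (eq_bigr (fun i => (T y - x) ord0 i * (T y - x) ord0 i))// => i _; rewrite !mxE; ring.
    rewrite (ge0_integral_preserving (f := fun y => (\1_B y)%:E)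
      (translation_preserving (- T x)))//.
    - by rewrite integral_indic// setIT.
    - by apply/measurable_EFinP.
  rewrite ge0_integralZr//; first by rewrite integral_indic// setIT.
  by apply/measurable_EFinP.
have := fubini_tonelli (m1 := mu) (m2 := mu) F mF F0; rewrite L Rr [RHS]muleC.
have Bf : mu B \is a fin_num by rewrite ge0_fin_numE.
exact: mule_fin_inj.
Qed.
End measure_preserving.

(** * Euclidean geometry and reflections *)

Section dot_product.
Variables (R : realType) (n : nat).
Implicit Types (x y z : 'rV[R]_n).

Lemma dotrVC x y : dotrV x y = dotrV y x.
Proof. by apply: eq_bigr => i _; rewrite mulrC. Qed.

Lemma dotrVDl x y z : dotrV (x + y) z = dotrV x z + dotrV y z.
Proof. by rewrite -big_split; apply: eq_bigr => i _; rewrite mxE mulrDl. Qed.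

Lemma dotrVZl (c : R) x y : dotrV (c *: x) y = c * dotrV x y.
Proof. by rewrite /dotrV mulr_sumr; apply: eq_bigr => i _; rewrite mxE mulrA. Qed.

Lemma dotrVNl x y : dotrV (- x) y = - dotrV x y.
Proof. by rewrite -scaleN1r dotrVZl mulN1r. Qed.

Lemma dotrVBl x y z : dotrV (x - y) z = dotrV x z - dotrV y z.
Proof. by rewrite dotrVDl dotrVNl. Qed.

Lemma dotrVDr x y z : dotrV z (x + y) = dotrV z x + dotrV z y.
Proof. by rewrite dotrVC dotrVDl !(dotrVC z). Qed.

Lemma dotrVZr (c : R) x y : dotrV x (c *: y) = c * dotrV x y.
Proof. by rewrite dotrVC dotrVZl dotrVC. Qed.

Lemma dotrVBr x y z : dotrV z (x - y) = dotrV z x - dotrV z y.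
Proof. by rewrite dotrVC dotrVBl !(dotrVC z). Qed.

Lemma dotrV0l x : dotrV 0 x = 0.
Proof. by rewrite /dotrV big1// => i _; rewrite mxE mul0r. Qed.

Lemma dotrV_ge0 x : 0 <= dotrV x x.
Proof. by apply: sumr_ge0 => i _; rewrite -expr2 sqr_ge0. Qed.

Lemma enorm_ge0 x : 0 <= enorm x.
Proof. exact: sqrtr_ge0. Qed.

Lemma enorm0 : enorm (0 : 'rV[R]_n) = 0.
Proof. by rewrite /enorm dotrV0l sqrtr0. Qed.

Lemma enorm_sqr x : enorm x ^+ 2 = dotrV x x.
Proof. by rewrite sqr_sqrtr// dotrV_ge0. Qed.

Lemma enormZ (c : R) x : enorm (c *: x) = `|c| * enorm x.
Proof. by rewrite /enorm dotrVZl dotrVZr mulrA -expr2 sqrtrM ?sqr_ge0// sqrtr_sqr. Qed.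

Lemma enormN x : enorm (- x) = enorm x.
Proof. by rewrite -scaleN1r enormZ normrN1 mul1r. Qed.

Lemma coord_le_norm x i : `|x ord0 i| <= `|x|.
Proof.
rewrite [leRHS]/normr /= mx_normrE; apply/bigmax_geP; right => /=.
by exists (ord0, i).
Qed.

Lemma normr_rV_lt x (e : R) : 0 < e -> (forall i, `|x ord0 i| < e) -> `|x| < e.
Proof.
move=> e0 h; rewrite [ltLHS]/normr /= mx_normrE; apply/bigmax_ltP; split => //.
by move=> [j i] _ /=; rewrite ord1.
Qed.

Lemma normr_rV_le x (e : R) : 0 <= e -> (forall i, `|x ord0 i| <= e) -> `|x| <= e.
Proof.
move=> e0 h; rewrite [leLHS]/normr /= mx_normrE; apply/bigmax_leP; split => //.
by move=> [j i] _ /=; rewrite ord1.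
Qed.

Lemma coord_le_enorm x i : `|x ord0 i| <= enorm x.
Proof.
rewrite -sqrtr_sqr ler_sqrt ?dotrV_ge0// /dotrV (bigD1 i)//= expr2 lerDl.
by apply: sumr_ge0 => j _; rewrite -expr2 sqr_ge0.
Qed.

Lemma norm_le_enorm x : `|x| <= enorm x.
Proof. by apply: normr_rV_le => [|i]; [exact: enorm_ge0|exact: coord_le_enorm]. Qed.

Lemma enorm_le_norm x : enorm x <= n%:R * `|x|.
Proof.
rewrite -[leRHS]ger0_norm ?mulr_ge0// -sqrtr_sqr ler_sqrt ?sqr_ge0//.
apply: (@le_trans _ _ (\sum_(i < n) `|x| ^+ 2)).
  apply: ler_sum => i _; rewrite -expr2 -real_normK ?num_real//.
  by rewrite lerXn2r ?nnegrE// coord_le_norm.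
rewrite sumr_const card_ord -[leLHS]mulr_natl exprMn ler_wpM2r ?sqr_ge0//.
by rewrite -natrX ler_nat; case: (n) => // k; rewrite leq_pmulr.
Qed.

Lemma enorm_eq0 x : enorm x = 0 -> x = 0.
Proof.
move=> x0; apply/eqP; rewrite -normr_le0; apply: le_trans (norm_le_enorm x) _.
by rewrite x0.
Qed.

Lemma dotrV_delta x i : dotrV x (delta_mx ord0 i) = x ord0 i.
Proof.
rewrite /dotrV (bigD1 i)//= big1 ?addr0; first by rewrite mxE !eqxx mulr1.
by move=> j ji; rewrite mxE eqxx (negPf ji) mulr0.
Qed.

End dot_product.

Section reflections.
Variables (R : realType) (n : nat) (H : polarizer R n).
Local Notation h := (pol_normal H).
Local Notation a := (pol_offset H).
Local Notation sigma := (reflection H).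
Implicit Types (x y z : 'rV[R]_n).

(** The linear part of [reflection H]: it acts on displacements and gradients, while the affine map
    acts on points. *)
Definition lin_reflection x := x - (2 * dotrV x h) *: h.
Local Notation S := lin_reflection.

Lemma dotrV_normal : dotrV h h = 1.
Proof. by case: H => k b k1; rewrite -enorm_sqr k1 expr1n. Qed.

Lemma lin_reflectionD x y : S (x + y) = S x + S y.
Proof.
by rewrite /S dotrVDl mulrDr scalerDl opprD addrACA.
Qed.

Lemma lin_reflectionZ (c : R) x : S (c *: x) = c *: S x.
Proof. by rewrite /S dotrVZl scalerBr scalerA mulrCA. Qed.

Lemma lin_reflectionN x : S (- x) = - S x.
Proof. by rewrite -scaleN1r lin_reflectionZ scaleN1r. Qed.

Lemma dotrV_lin_reflectionh x : dotrV (S x) h = - dotrV x h.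
Proof. by rewrite /S dotrVBl dotrVZl dotrV_normal; ring. Qed.

Lemma lin_reflectionK : involutive S.
Proof.
move=> x; rewrite {1}/S dotrV_lin_reflectionh mulrN scaleNr opprK /S.
by rewrite subrK.
Qed.

Lemma dotrV_lin_reflection x y : dotrV (S x) (S y) = dotrV x y.
Proof.
rewrite [X in dotrV _ X]/S dotrVBr dotrVZr dotrV_lin_reflectionh /S dotrVBl dotrVZl.
by rewrite (dotrVC h y); ring.
Qed.

Lemma dotrV_lin_reflectionC x y : dotrV (S x) y = dotrV x (S y).
Proof. by rewrite -{1}(lin_reflectionK y) dotrV_lin_reflection. Qed.

Lemma enorm_lin_reflection x : enorm (S x) = enorm x.
Proof. by rewrite /enorm dotrV_lin_reflection. Qed.

Lemma reflectionE x : sigma x = S x + (2 * a) *: h.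
Proof. by rewrite /sigma /S mulrBr scalerBl opprB -addrA [- _ + _]addrC. Qed.

Lemma reflectionD x z : sigma (x + z) = sigma x + S z.
Proof. by rewrite !reflectionE lin_reflectionD addrAC. Qed.

Lemma dotrV_reflection x : dotrV (sigma x) h = 2 * a - dotrV x h.
Proof.
by rewrite reflectionE dotrVDl dotrVZl dotrV_normal dotrV_lin_reflectionh; ring.
Qed.

Lemma reflectionK : involutive sigma.
Proof.
move=> x; rewrite {1}/sigma dotrV_reflection /sigma; apply/rowP => i.
by rewrite !mxE; ring.
Qed.

Lemma reflectionB x y : sigma x - sigma y = S (x - y).
Proof. by rewrite !reflectionE opprD addrACA subrr addr0 -lin_reflectionN -lin_reflectionD. Qed.

Lemma enorm_reflection x y : enorm (sigma x - sigma y) = enorm (x - y).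
Proof. by rewrite reflectionB enorm_lin_reflection. Qed.

Lemma enorm_reflectionC x y : enorm (sigma x - y) = enorm (x - sigma y).
Proof. by rewrite -[in LHS](reflectionK y) enorm_reflection. Qed.

Lemma measurable_lin_reflection : measurable_fun setT S.
Proof.
apply: measurable_rVB; first exact: measurable_id.
apply: measurable_rVZ; last exact: measurable_cst.
apply: measurable_funM => //; apply: measurable_dotrV; first exact: measurable_id.
exact: measurable_cst.
Qed.

Lemma reflection_preserving : measure_preserving sigma.
Proof.
rewrite (_ : sigma = (fun x => x + (2 * a) *: h) \o S); last first.
  by apply/funext => x; rewrite reflectionE.
apply: measure_preserving_comp; first exact: translation_preserving.
apply: isometry_preserving.
- exact: measurable_lin_reflection.
- exact: lin_reflectionD.
- exact: lin_reflectionK.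
- by move=> x; exact: dotrV_lin_reflection.
Qed.

Lemma measurable_half_space : measurable (half_space H).
Proof.
rewrite (_ : half_space H = (fun x => dotrV x h) @^-1` `]-oo, a[%classic).
  rewrite -[X in measurable X]setTI; exact: measurable_dotrV.
by apply/seteqP; split => x; rewrite /half_space /= in_itv.
Qed.

End reflections.

(** * Continuity of translations in L1 *)

Section nonnegative_integrals.
Context d (T : measurableType d) (R : realType) (m : {measure set T -> \bar R}).
Implicit Types f g : T -> R.

Lemma cvge0P (f : nat -> \bar R) : (forall n, 0 <= f n)%E ->
  (f @ \oo --> 0%E) <->
  (forall e : R, 0 < e -> exists N, forall n, (N <= n)%N -> (f n <= e%:E)%E).
Proof.
move=> f0; split.
  move=> /fine_cvgP[ff /cvgrPdist_le fc] e e0.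
  have [N _ hN] := filterI ff (fc _ e0).
  exists N => n Nn; have [h1 h2] := hN n Nn.
  rewrite -(fineK h1) lee_fin; apply: le_trans h2.
  by rewrite sub0r normrN /= ler_norm.
move=> H; apply/fine_cvgP; split.
  have [N hN] := H _ ltr01; exists N => // n Nn.
  by rewrite ge0_fin_numE//; apply: le_lt_trans (hN n Nn) _; exact: ltry.
apply/cvgrPdist_le => e e0; have [N hN] := H _ e0; exists N => // n Nn.
rewrite sub0r normrN /= ger0_norm ?fine_ge0//.
have h : f n \is a fin_num.
  by rewrite ge0_fin_numE//; apply: le_lt_trans (hN n Nn) _; exact: ltry.
by rewrite -lee_fin (fineK h) hN.
Qed.

Lemma ge0_le_integralT (f g : T -> R) : measurable_fun setT f -> measurable_fun setT g ->
  (forall x, 0 <= f x <= g x) -> (\int[m]_x (f x)%:E <= \int[m]_x (g x)%:E)%E.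
Proof.
move=> mf mg fg; apply: ge0_le_integral => //.
- by move=> x _; rewrite lee_fin; case/andP: (fg x).
- exact/measurable_EFinP.
- exact/measurable_EFinP.
- by move=> x _; rewrite lee_fin; case/andP: (fg x).
Qed.

Lemma integral_normrD f g : measurable_fun setT f -> measurable_fun setT g ->
  (\int[m]_x `|f x + g x|%:E <= \int[m]_x `|f x|%:E + \int[m]_x `|g x|%:E)%E.
Proof.
move=> mf mg.
have mnf : measurable_fun setT (fun x => `|f x|) by exact: measurableT_comp.
have mng : measurable_fun setT (fun x => `|g x|) by exact: measurableT_comp.
rewrite -ge0_integralD//; last 2 first.
- exact/measurable_EFinP.
- exact/measurable_EFinP.
apply: ge0_le_integral => //.
- by apply/measurable_EFinP; apply: measurableT_comp => //; exact: measurable_funD.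
- by apply: emeasurable_funD; exact/measurable_EFinP.
- by move=> x _; rewrite -EFinD lee_fin ler_normD.
Qed.

Lemma integral_normrZ (c : R) f : measurable_fun setT f ->
  (\int[m]_x `|c * f x|%:E = `|c|%:E * \int[m]_x `|f x|%:E)%E.
Proof.
move=> mf; rewrite -ge0_integralZl//.
- by apply: eq_integral => x _; rewrite normrM EFinM.
by apply/measurable_EFinP; exact: measurableT_comp.
Qed.

(** The series of the [a n] has integral at most 1, so it is finite almost everywhere; each term is
    bounded by a tail, and the tails tend to 0. *)
Lemma summable_integral_ae_cvg0 (a : nat -> T -> R) :
  (forall n, measurable_fun setT (a n)) -> (forall n x, 0 <= a n x) ->
  (forall n, \int[m]_x (a n x)%:E <= (1 / (2 ^ n.+1)%:R)%:E)%E ->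
  {ae m, forall x, a ^~ x @ \oo --> 0}.
Proof.
move=> ma a0 ai.
pose S x := (\sum_(0 <= n <oo) (a n x)%:E)%E.
have mS : measurable_fun setT S.
  apply: ge0_emeasurable_sum => [k x _ _|k _]; first by rewrite lee_fin.
  exact/measurable_EFinP.
have S0 x : (0 <= S x)%E by apply: nneseries_ge0 => n _ _; rewrite lee_fin.
have IS : m.-integrable setT S.
  apply/integrableP; split => //.
  under eq_integral do rewrite gee0_abs//.
  rewrite integral_nneseries//; last 2 first.
  - by move=> n; exact/measurable_EFinP.
  - by move=> n x _; rewrite lee_fin.
  apply: (@le_lt_trans _ _ (\sum_(0 <= n <oo) (1 / (2 ^ n.+1)%:R)%:E)%E).
    apply: lee_nneseries => [n _ _|n _]; last exact: ai.
    by apply: integral_ge0 => x _; rewrite lee_fin.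
  by apply: le_lt_trans (epsilon_trick0 xpredT ler01) _; rewrite ltry.
have := integrable_ae measurableT IS; apply: filterS => x /(_ I) Sf.
have : (S x < +oo)%E by rewrite -ge0_fin_numE.
move=> /nneseries_tail_cvg tc.
have a0x k : (0 <= (a k x)%:E)%E by rewrite lee_fin.
have tail0 N : (0 <= \sum_(N <= k <oo) (a k x)%:E)%E by apply: nneseries_ge0.
have {}tc := (cvge0P tail0).1 (tc (fun k _ => a0x k)).
apply/cvgrPdist_le => e e0; have [N hN] := tc _ e0; exists N => // k Nk.
rewrite sub0r normrN ger0_norm// -lee_fin; apply: le_trans (hN k Nk).
rewrite (nneseries_split k 1)// addn1 big_nat1.
by rewrite leeDl// nneseries_ge0.
Qed.

End nonnegative_integrals.

Section translation_continuity.
Variables (R : realType) (n : nat).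
Local Notation mu := (lebesgue_rV R n).
Implicit Types (f g : 'rV[R]_n -> R) (A : set 'rV[R]_n).

Definition translation_continuous f := forall e : R, 0 < e ->
  exists2 r : R, 0 < r & forall z : 'rV[R]_n, `|z| < r ->
    (\int[mu]_x `|f (x + z) - f x|%:E <= e%:E)%E.

Lemma measurable_translate f z : measurable_fun setT f ->
  measurable_fun setT (fun x : 'rV[R]_n => f (x + z)).
Proof. by move=> mf; apply: measurableT_comp => //; exact: measurable_addrV. Qed.

Lemma integral_translate_norm f z : measurable_fun setT f ->
  (\int[mu]_x `|f (x + z)|%:E = \int[mu]_x `|f x|%:E)%E.
Proof.
move=> mf.
rewrite (ge0_integral_preserving (f := fun x => `|f x|%:E) (translation_preserving z))//.
by apply/measurable_EFinP; exact: measurableT_comp.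
Qed.

(** Translations preserve the L1 norm, so the approximation error is counted twice and the modulus
    of [g] once: three times [e / 3]. *)
Lemma translation_continuous_approx f : measurable_fun setT f ->
  (forall e : R, 0 < e -> exists g, [/\ measurable_fun setT g,
    translation_continuous g & (\int[mu]_x `|f x - g x|%:E <= e%:E)%E]) ->
  translation_continuous f.
Proof.
move=> mf H e e0; have e3 : 0 < e / 3 by lra.
have [g [mg tg fg]] := H _ e3; have [r r0 gr] := tg _ e3.
exists r => // z zr.
have mfg : measurable_fun setT (fun x => f x - g x) by exact: measurable_funB.
have mgz := measurable_translate z mg.
have mfgz := measurable_translate z mfg.
rewrite (eq_integral (fun x : 'rV[R]_n => `|(f (x + z) - g (x + z)) +
   ((g (x + z) - g x) + - (f x - g x))|%:E)%E); last first.
  by move=> x _; congr (`|_|%:E); ring.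
apply: le_trans (integral_normrD _ _ _) _ => //.
  apply: measurable_funD; first exact: measurable_funB.
  exact: measurableT_comp.
have -> : e = e / 3 + (e / 3 + e / 3) by lra.
rewrite !EFinD; apply: leeD.
  by rewrite (integral_translate_norm z mfg).
apply: le_trans (integral_normrD _ _ _) _ => //.
- exact: measurable_funB.
- exact: measurableT_comp.
apply: leeD; first exact: gr.
by under eq_integral do rewrite normrN.
Qed.

Lemma translation_continuousD f g : measurable_fun setT f -> measurable_fun setT g ->
  translation_continuous f -> translation_continuous g ->
  translation_continuous (fun x => f x + g x).
Proof.
move=> mf mg tf tg e e0; have e2 : 0 < e / 2 by lra.
have [r r0 fr] := tf _ e2; have [s s0 gs] := tg _ e2.
exists (minr r s); first by rewrite lt_min r0.
move=> z; rewrite lt_min => /andP[zr zs].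
rewrite (eq_integral (fun x : 'rV[R]_n => `|(f (x + z) - f x) + (g (x + z) - g x)|%:E)%E); last first.
  by move=> x _; congr (`|_|%:E); ring.
apply: le_trans (integral_normrD _ _ _) _ => //.
- by apply: measurable_funB => //; exact: measurable_translate.
- by apply: measurable_funB => //; exact: measurable_translate.
have -> : e = e / 2 + e / 2 by lra.
by rewrite EFinD; apply: leeD; [exact: fr|exact: gs].
Qed.

Lemma translation_continuousZ (c : R) f : measurable_fun setT f ->
  translation_continuous f -> translation_continuous (fun x => c * f x).
Proof.
move=> mf tf e e0.
have c1 : 0 < `|c| + 1 by rewrite ltr_wpDl.
have [r r0 fr] := tf _ (divr_gt0 e0 c1); exists r => // z zr.
under eq_integral do rewrite -mulrBr.
rewrite integral_normrZ; last by apply: measurable_funB => //; exact: measurable_translate.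
apply: le_trans (lee_wpmul2l _ (fr _ zr)) _; first by rewrite lee_fin.
rewrite -EFinM lee_fin mulrCA ger_pMr// ler_pdivrMr// mul1r.
by rewrite lerDl.
Qed.

Lemma translation_continuous_sum (I : Type) (s : seq I) (F : I -> 'rV[R]_n -> R) :
  (forall i, measurable_fun setT (F i)) -> (forall i, translation_continuous (F i)) ->
  translation_continuous (fun x => \sum_(i <- s) F i x).
Proof.
move=> mF tF; elim: s => [|i s IH].
  move=> e e0; exists 1 => // z _; rewrite integral0_eq ?lee_fin ?ltW//.
  by move=> x _; rewrite !big_nil subrr normr0.
rewrite (_ : (fun x => _) = fun x => F i x + \sum_(j <- s) F j x); last first.
  by apply/funext => x; rewrite big_cons.
apply: translation_continuousD => //; exact: measurable_sum.
Qed.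

Lemma integral_indic_sub A B : measurable A -> measurable B -> B `<=` A ->
  (mu A < +oo)%E ->
  (\int[mu]_x `|\1_A x - \1_B x|%:E = mu A - mu B)%E.
Proof.
move=> mA mB BA Aoo.
transitivity (\int[mu]_x (\1_(A `\` B) x)%:E)%E.
  apply: eq_integral => x _; congr EFin; rewrite !indicE.
  have [xB|xB] := boolP (x \in B).
    have xA : x \in A by rewrite inE; apply: BA; rewrite inE in xB.
    rewrite xA subrr normr0 (_ : (x \in A `\` B) = false)//.
    by apply/negbTE; rewrite notin_setE => -[_]; apply; rewrite inE in xB.
  have -> : (x \in A `\` B) = (x \in A).
    apply/idP/idP; rewrite !inE; first by case.
    by move=> xA; split => //; rewrite notin_setE in xB.
  by rewrite subr0 ger0_norm.
rewrite integral_indic ?setIT//; last exact: measurableD.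
by rewrite measureD// (setIidr BA).
Qed.

(* Scheffe: (1_U(x) - 1_U(x + z))^+ tends to 0 pointwise as U is open, and
   1_U - 1_U(. + z) has integral zero. *)
Lemma translation_continuous_open (U : set 'rV[R]_n) : open U -> (mu U < +oo)%E ->
  translation_continuous \1_U.
Proof.
move=> oU Uoo; have mU := open_measurable_rV oU.
apply: contrapT => /existsNP[e /not_implyP[e0 He]].
have {}He k : exists z : 'rV[R]_n, `|z| < k.+1%:R^-1 /\
    (e%:E < \int[mu]_x `|\1_U (x + z) - \1_U x|%:E)%E.
  apply: contrapT => H; apply: He; exists k.+1%:R^-1; first by rewrite invr_gt0.
  move=> z zk; rewrite leNgt; apply/negP => ez; apply: H; exists z; split => //.
have [z zP] := choice He.
pose E k := U `&` (fun x => x + z k) @^-1` U.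
have mE k : measurable (E k).
  apply: measurableI => //; rewrite -[X in measurable X]setTI.
  exact: (measurable_addrV (z k)).
pose F k := (\int[mu]_x `|(\1_U x - \1_(E k) x : R)|%:E)%E.
have F0 k : (0 <= F k)%E by apply: integral_ge0 => x _; rewrite lee_fin.
have L1 : F k @[k --> \oo] --> 0%E.
  have [] // := @dominated_convergence _ _ _ mu setT measurableT
     (fun k x => (\1_(E k) x)%:E) (fun x => (\1_U x)%:E) (fun x => (\1_U x)%:E).
  - by move=> k; apply/measurable_EFinP.
  - by apply/measurable_EFinP.
  - apply: aeW => x _ /=; apply: cvg_near_cst.
    have [xU|xU] := pselect (U x); last first.
      apply: nearW => k; rewrite !indicE (memNset xU) memNset//.
      by move=> [].
    have /nbhs_rVP[r r0 xr] : nbhs x U by move: oU; rewrite openE => /(_ _ xU).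
    exists (truncn r^-1) => // k /= rk; rewrite !indicE !mem_set//; split => //=.
    apply: xr => i; rewrite mxE addrAC subrr add0r.
    apply: le_lt_trans (coord_le_norm _ _) _; apply: lt_le_trans (zP k).1 _.
    rewrite -[leRHS]invrK lef_pV2 ?posrE ?invr_gt0//.
    apply: le_trans (ltW (truncnS_gt _)) _.
    by rewrite ler_nat ltnS.
  - apply/integrableP; split; first exact/measurable_EFinP.
    under eq_integral do rewrite gee0_abs ?lee_fin ?indicE//.
    by rewrite integral_indic// setIT.
  - apply: aeW => x k _; rewrite lee_fin !indicE normr_nat ler_nat.
    have [/set_mem[xU _]|] := boolP (x \in E k) => //.
    by rewrite mem_set.
  move=> _ h _; apply: cvg_trans h; apply: near_eq_cvg; apply: nearW => k.
  by apply: eq_integral => x _; rewrite -EFinB /= distrC.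
have e2 : 0 < e / 2 by lra.
have [N /(_ N (leqnn N)) hN] := (cvge0P F0).1 L1 _ e2.
have [_] := zP N; apply/negP; rewrite -leNgt.
set V := (fun x => x + z N) @^-1` U.
have mV : measurable V.
  by rewrite -[X in measurable X]setTI; exact: (measurable_addrV (z N)).
have muV : mu V = mu U by exact: lebesgue_rV_translation.
rewrite (eq_integral (fun x : 'rV[R]_n =>
    `|(\1_V x - \1_(E N) x : R) + - (\1_U x - \1_(E N) x)|%:E)%E); last first.
  move=> x _; congr (`|_|%:E).
  have -> : \1_U (x + z N) = \1_V x :> R.
    by rewrite !indicE; congr (_%:R); congr nat_of_bool; apply/idP/idP; rewrite !in_setE.
  ring.
apply: le_trans (integral_normrD _ _ _) _.
- exact: measurable_funB.
- by apply: measurableT_comp => //; exact: measurable_funB.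
under [X in (_ + X)%E]eq_integral do rewrite normrN.
have -> : e = e / 2 + e / 2 by lra.
rewrite EFinD; apply: leeD; last exact: hN.
rewrite integral_indic_sub//; last 2 first.
- by move=> x [].
- by rewrite muV.
by rewrite muV -integral_indic_sub//; move=> x [].
Qed.

(** Continuity of the measure from below makes the sets [F k] approximate [E] in L1. *)
Lemma translation_continuous_cvg_indic (E : set 'rV[R]_n) (F : (set 'rV[R]_n)^nat) :
  (forall k, measurable (F k)) -> {homo F : k l / (k <= l)%N >-> (k <= l)%O} ->
  E = \bigcup_k F k -> (mu E < +oo)%E ->
  (forall k, translation_continuous (\1_(F k) : _ -> R)) ->
  translation_continuous \1_E.
Proof.
move=> mF ndF EF Eoo tF.
have mE : measurable E by rewrite EF; exact: bigcupT_measurable.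
apply: translation_continuous_approx => // e e0.
have FE k : F k `<=` E by rewrite EF; exact: bigcup_sup.
have := @nondecreasing_cvg_mu _ _ _ mu F mF _ ndF; rewrite -EF => /(_ mE) c.
have Ef : mu E \is a fin_num by rewrite ge0_fin_numE.
have {}c : (mu \o F) x @[x --> \oo] --> (fine (mu E))%:E by rewrite fineK.
move/fine_cvgP : c => [ff /cvgrPdist_le /(_ _ e0)] fc.
have [N _ /(_ N (leqnn N)) [h1 h2]] := filterI ff fc.
exists \1_(F N); split => //.
have h1' : mu (F N) \is a fin_num by exact: h1.
rewrite integral_indic_sub// -(fineK Ef) -(fineK h1') -EFinB lee_fin.
exact: le_trans (ler_norm _) h2.
Qed.

(** Dynkin induction over the boxes, carried out inside a fixed cube [Q k] so that complements keep
    finite measure; the cubes are then exhausted. *)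
Lemma translation_continuous_indic A : measurable A -> (mu A < +oo)%E ->
  translation_continuous \1_A.
Proof.
move=> mA Aoo.
pose Q k : set 'rV[R]_n := obox (const_mx (- k%:R)) (const_mx k%:R).
have mQ k : measurable (Q k) by exact: measurable_obox.
have Qoo k : (mu (Q k) < +oo)%E by exact: lebesgue_rV_obox_lty.
have AQoo B k : measurable B -> (mu (B `&` Q k) < +oo)%E.
  move=> mB; apply: le_lt_trans (Qoo k); apply: le_measure; rewrite ?inE//.
  exact: measurableI.
have ndQ : {homo Q : k l / (k <= l)%N >-> (k <= l)%O}.
  move=> k l kl; apply/subsetPset => x xQ i; have := xQ i; rewrite !mxE => /andP[h1 h2].
  apply/andP; split.
    by apply: le_lt_trans h1; rewrite lerN2 ler_nat.
  by apply: lt_le_trans h2 _; rewrite ler_nat.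
have H k B : measurable B -> translation_continuous \1_(B `&` Q k).
  move=> mB.
  pose P := [set B : set 'rV[R]_n | translation_continuous \1_(B `&` Q k)].
  suff : P B by [].
  have : <<s @oboxes R n >> B by rewrite -measurable_rV_oboxes.
  apply: (@dynkin_induction _ 'rV[R]_n) => //.
  - exact: measurable_rV_oboxes.
  - exact: setI_closed_oboxes.
  - by rewrite /P /= setTI; apply: translation_continuous_open => //; exact: open_obox.
  - move=> C [->|[a [b ->]]]; rewrite /P /=.
      rewrite set0I; apply: translation_continuous_open; first exact: open0.
      by rewrite measure0.
    apply: translation_continuous_open.
      by apply: openI; exact: open_obox.
    by apply: AQoo; exact: measurable_obox.
  - move=> C mC tC; rewrite /P /=.
    have -> : \1_(~` C `&` Q k) =
        (fun x : 'rV[R]_n => \1_(Q k) x + (-1) * \1_(C `&` Q k) x : R).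
      apply/funext => x; rewrite !indicE !in_setI in_setC.
      by case: (x \in C); case: (x \in Q k) => /=; ring.
    apply: translation_continuousD => //.
    + by apply: measurable_funM => //; apply: measurable_indic; exact: measurableI.
    + by apply: translation_continuous_open => //; exact: open_obox.
    + by apply: translation_continuousZ => //; apply: measurable_indic; exact: measurableI.
  - move=> F mF tF PF; rewrite /P /=.
    apply: (@translation_continuous_cvg_indic _
        (fun m => (\big[setU/set0]_(i < m) F i) `&` Q k)).
    + by move=> m; apply: measurableI => //; exact: bigsetU_measurable.
    + move=> m m' mm'; apply/subsetPset; apply: setSI.
      exact: subset_bigsetU.
    + apply/seteqP; split => [x [[m _ Fm] Qx]|x [m _ []]].
        by exists m.+1 => //; split => //; rewrite -bigcup_mkord; exists m => /=.
      by rewrite -bigcup_mkord => -[i _ Fi] Qx; split => //; exists i.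
    + by apply: AQoo; exact: bigcupT_measurable.
    + move=> m; elim: m => [|m IH].
        rewrite big_ord0 set0I; apply: translation_continuous_open; first exact: open0.
        by rewrite measure0.
      rewrite big_ord_recr /=; set G := \big[setU/set0]_(i < m) F i in IH *.
      have mG : measurable G by exact: bigsetU_measurable.
      have GF : G `&` F m = set0.
        rewrite -subset0 => x [+ Fx]; rewrite /G -bigcup_mkord => -[i /= im Fi].
        move/trivIsetP : tF => /(_ i m I I).
        move=> /(_ (negbT (ltn_eqF im))) E0.
        by have : (F i `&` F m) x by []; rewrite E0.
      have -> : \1_((G `|` F m) `&` Q k) =
          (fun x : 'rV[R]_n => \1_(G `&` Q k) x + \1_(F m `&` Q k) x : R).
        apply/funext => x; rewrite !indicE !in_setI in_setU.
        have : ~~ ((x \in G) && (x \in F m)) by rewrite -in_setI GF in_set0.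
        by case: (x \in G); case: (x \in F m); case: (x \in Q k) => //=; rewrite ?addr0 ?add0r.
      apply: translation_continuousD => //; last exact: PF.
        by apply: measurable_indic; exact: measurableI.
      by apply: measurable_indic; exact: measurableI.
apply: (@translation_continuous_cvg_indic _ (fun k => A `&` Q k)) => //.
- by move=> k; exact: measurableI.
- by move=> k l kl; apply/subsetPset; apply: setIS; apply/subsetPset; exact: ndQ.
- rewrite -setI_bigcupr; apply/seteqP; split => [x Ax|x []//].
  split => //; exists (truncn `|x|).+1 => // i; rewrite !mxE -ltr_norml.
  by apply: le_lt_trans (truncnS_gt _); exact: coord_le_norm.
- by move=> k; exact: H.
Qed.

Import HBSimple.

Theorem integrable_translation_continuous f : mu.-integrable setT (EFin \o f) ->
  translation_continuous f.
Proof.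
move=> If.
have mf : measurable_fun setT f by case/integrableP : If => /measurable_EFinP.
apply: translation_continuous_approx => // e e0.
have [g [Ig _ /cvge0P]] := approximation_sfun_integrable measurableT If.
move=> /(_ (fun k => integral_ge0 _ (fun x _ => abse_ge0 _))) /(_ _ e0)[N /(_ N (leqnn N)) gN].
have mgN : measurable_fun setT (fun x : 'rV[R]_n => g N x) by exact: measurable_funPT.
exists (fun x : 'rV[R]_n => g N x); split => //.
have -> : (fun x : 'rV[R]_n => g N x) = (fun x : 'rV[R]_n => \sum_(y <- finmap.enum_fset (fset_set (range (g N))))
    (y * \1_(g N @^-1` [set y]) x)).
  apply/funext => x; rewrite {1}fimfunE fsbig_finite//.
apply: translation_continuous_sum => y.
  by apply: measurable_funM => //.
(* The level set of the value 0 may have infinite measure, but its term in the sum vanishes. *)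
have [->|y0] := eqVneq y 0.
  move=> e' e'0; exists 1 => // z _; rewrite integral0_eq ?lee_fin ?ltW//.
  by move=> x _; rewrite !mul0r subrr normr0.
apply: translation_continuousZ => //; apply: translation_continuous_indic => //.
have [_ gi] := integrableP _ _ _ (Ig N).
have ny : 0 < `|y| by rewrite normr_gt0.
rewrite -(@lte_pmul2l R `|y|%:E)// mulry gtr0_sg// mul1e.
apply: le_lt_trans gi.
rewrite -[X in mu X]setIT -integral_indic// -ge0_integralZl//; last exact/measurable_EFinP.
apply: ge0_le_integral => //.
- by apply/measurable_EFinP; exact: measurable_funM.
- by apply: measurableT_comp => //; exact/measurable_EFinP.
- move=> x _; rewrite -EFinM lee_fin indicE.
  have [/set_mem/= ->|_] := boolP (x \in _); first by rewrite mulr1.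
  by rewrite mulr0.
Qed.

End translation_continuity.

(** * Smooth bump functions *)

Section iterated_derivability.
Variable R : realType.
Implicit Types (f g : R -> R) (k m : nat).

(** The derivative is existential at each order, so that stability under sums, products and affine
    substitutions is proved by induction on [k] without a formula for higher derivatives. *)
Fixpoint derivablen k f : Prop :=
  if k is k'.+1 then
    exists2 f' : R -> R, (forall x : R, is_derive x 1 f (f' x)) & derivablen k' f'
  else True.

Definition smooth1 f := forall k, derivablen k f.

Lemma derivablenS k f : derivablen k.+1 f -> derivablen k f.
Proof.
elim: k f => [//|k IH] f [f' ff' kf']; exists f' => //; exact: IH.
Qed.

Lemma derivablen_cst k (c : R) : derivablen k (cst c).
Proof.
elim: k c => [//|k IH] c; exists (cst 0); last exact: IH.
by move=> x; exact: is_derive_cst.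
Qed.

Lemma derivablenD k f g : derivablen k f -> derivablen k g ->
  derivablen k (fun x => f x + g x).
Proof.
elim: k f g => [//|k IH] f g [f' ff' kf'] [g' gg' kg'].
exists (fun x => f' x + g' x); last exact: IH.
by move=> x; exact: (is_deriveD (ff' x) (gg' x)).
Qed.

Lemma derivablenM k f g : derivablen k f -> derivablen k g ->
  derivablen k (fun x => f x * g x).
Proof.
elim: k f g => [//|k IH] f g kf kg.
have [f' ff' kf'] := kf; have [g' gg' kg'] := kg.
exists (fun x => f x * g' x + g x * f' x).
  by move=> x; exact: (is_deriveM (ff' x) (gg' x)).
by apply: derivablenD; apply: IH => //; exact: derivablenS.
Qed.

Lemma derivablenZ k (c : R) f : derivablen k f -> derivablen k (fun x => c * f x).
Proof. by move=> kf; apply: derivablenM => //; exact: derivablen_cst. Qed.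

Lemma is_derive_affine (c b x : R) : is_derive x 1 (fun y => c * y + b) c.
Proof.
have h1 : is_derive x 1 (fun y : R => c * y) (c * 1 + x * 0).
  exact: (is_deriveM (is_derive_cst c x 1) (is_derive_id x 1)).
have := is_deriveD h1 (is_derive_cst b x 1).
by rewrite mulr1 mulr0 !addr0.
Qed.

Lemma derivablen_comp_affine k (c b : R) f : derivablen k f ->
  derivablen k (fun x => f (c * x + b)).
Proof.
elim: k f => [//|k IH] f [f' ff' kf'].
exists (fun x => c * f' (c * x + b)); last by apply: derivablenZ; exact: IH.
move=> x; rewrite mulrC.
exact: (@is_derive1_comp _ f (fun x => c * x + b) _ _ _ (ff' (c * x + b)) (is_derive_affine c b x)).
Qed.

(** For [m = 0] this is the classical [exp(-1/t)]. The powers [t^(-m)] make the family closed under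
    differentiation up to linear combinations, which yields all orders at once. *)
Definition flat m (t : R) : R := if t <= 0 then 0 else t ^- m * expR (- t^-1).

Lemma flat_ge0 m t : 0 <= flat m t.
Proof.
by rewrite /flat; case: (leP t 0) => // t0; rewrite mulr_ge0 ?expR_ge0// invr_ge0 exprn_ge0// ltW.
Qed.

(** The quadratic bound gives the zero derivative at the origin. With [y = 1/t] it reads
    [y^(m+2) <= (m+2)^(m+2) exp y], the power [m+2] of [x <= exp x] at [x = y/(m+2)]. *)
Lemma flat_le m t : flat m t <= m.+2%:R ^+ m.+2 * t ^+ 2.
Proof.
rewrite /flat; case: (leP t 0) => t0; first by apply: mulr_ge0; [exact: exprn_ge0|exact: sqr_ge0].
set y := t^-1; have y0 : 0 < y by rewrite invr_gt0.
have K : y ^+ m.+2 <= m.+2%:R ^+ m.+2 * expR y.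
  have -> : expR y = expR (y / m.+2%:R) ^+ m.+2.
    by rewrite -expRM_natl; congr expR; rewrite mulrC divfK.
  have h : y <= m.+2%:R * expR (y / m.+2%:R).
    rewrite mulrC -ler_pdivrMr ?ltr0n//; apply: le_trans (expR_ge1Dx _).
    by rewrite lerDr.
  rewrite -exprMn; apply: lerXn2r => //; rewrite nnegrE; first exact: ltW.
  by rewrite mulr_ge0// expR_ge0.
rewrite expRN -exprVn -/y ler_pdivrMr ?expR_gt0//.
have -> : t = y^-1 by rewrite invrK.
have y2 : 0 < y ^+ 2 by exact: exprn_gt0.
rewrite -(ler_pM2r y2) -exprD addn2; apply: le_trans K _.
rewrite exprVn (mulrAC _ _ (y ^+ 2)) divfK//.
by rewrite gt_eqF.
Qed.

Lemma cvg_is_derive (V W : normedModType R) (f : V -> W) x v l :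
  (h^-1 *: ((f \o shift x) (h *: v) - f x) @[h --> 0^']) --> l -> is_derive x v f l.
Proof. by move=> fl; split; [apply/cvg_ex; exists l|exact: cvg_lim fl]. Qed.

Lemma is_derive_pow m (y : R) :
  is_derive y 1 (fun y : R => y ^+ m) (m%:R * y ^+ m.-1).
Proof.
elim: m => [|m IH]; first by rewrite mul0r; exact: is_derive_cst.
have := is_deriveM (is_derive_id y 1) IH; rewrite /GRing.scale /= => h.
have -> : (fun y => y ^+ m.+1) = (fun y : R => y * y ^+ m).
  by apply/funext => z; rewrite exprS.
apply: is_derive_eq h _.
by case: m {IH} => [|m] /=; rewrite ?mul0r ?expr0 ?exprS -?natr1; ring.
Qed.

Lemma is_derive_flat m (x : R) : is_derive x 1 (flat m) (flat m.+2 x - m%:R * flat m.+1 x).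
Proof.
have [x0|x0|->] := ltgtP x 0.
- apply: (near_eq_is_derive (f := cst 0)).
    near=> y; rewrite /flat ifT//; apply/ltW; near: y; exact: lt_nbhsl.
  rewrite /flat !(ltW x0) mulr0 subrr; exact: is_derive_cst.
- apply: (near_eq_is_derive (f := (fun y : R => y ^+ m * expR (- y)) \o GRing.inv)).
    near=> y; have y0 : 0 < y by near: y; exact: lt_nbhsr.
    by rewrite /flat leNgt y0 /= exprVn.
  have d1 : is_derive x 1 (@GRing.inv R) (- x ^- 2 *: 1).
    by apply: (is_deriveV (f := id)); rewrite ?gt_eqF//; exact: is_derive_id.
  have d2 (y : R) : is_derive y 1 (fun y : R => expR (- y)) (- expR (- y)).
    have := is_derive1_comp (is_derive_expR (- y)) (is_deriveN (is_derive_id y 1)).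
    by rewrite mulrN1.
  have d3 (y : R) : is_derive y 1 (fun y : R => y ^+ m) (m%:R * y ^+ m.-1).
    exact: is_derive_pow.
  have d4 : is_derive x^-1 1 (fun y : R => y ^+ m * expR (- y)) _ :=
    is_deriveM (d3 x^-1) (d2 x^-1).
  apply: is_derive_eq (is_derive1_comp d4 d1) _.
  rewrite /flat leNgt x0 /= -!exprVn /GRing.scale /=; set y := x^-1.
  have e2 : y ^+ m.+2 = y ^+ m * y ^+ 2 by rewrite -exprD addn2.
  clear d4 d3; case: m e2 => [|k] e2; rewrite ?mul0r ?expr0 /=.
    by rewrite !mulr0 !addr0 subr0; ring.
  by rewrite !exprS; ring.
have z k : flat k 0 = 0 by rewrite /flat lexx.
rewrite !z mulr0 subrr; apply: cvg_is_derive; apply/cvgr0Pnorm_le => e e0.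
have C0 : 0 < m.+2%:R ^+ m.+2 :> R by rewrite exprn_gt0.
exists (e / m.+2%:R ^+ m.+2) => /=; first by rewrite divr_gt0.
move=> h /=; rewrite sub0r normrN => he h0.
rewrite z subr0 /= addr0 /GRing.scale /= mulr1 normrM normfV.
rewrite (ger0_norm (flat_ge0 _ _)) ler_pdivrMl ?normr_gt0//.
apply: le_trans (flat_le m h) _; rewrite -real_normK ?num_real// expr2 mulrCA.
by rewrite ler_pM2l ?normr_gt0// -ler_pdivlMl// mulrC ltW.
Unshelve. all: by end_near. Qed.

Lemma smooth1_flat m : smooth1 (flat m).
Proof.
move=> k; elim: k m => [//|k IH] m; exists (fun x => flat m.+2 x - m%:R * flat m.+1 x).
  by move=> x; exact: is_derive_flat.
have -> : (fun x => flat m.+2 x - m%:R * flat m.+1 x) =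
    (fun x => flat m.+2 x + (- m%:R) * flat m.+1 x).
  by apply/funext => x; rewrite mulNr.
by apply: derivablenD => //; exact: derivablenZ.
Qed.

(** The factor [k + 1] sharpens the bump without moving its support, so the bumps tend pointwise to
    the indicator of []a, b[]; integrals over boxes are recovered from test functions in this
    way. *)
Definition bump (a b : R) k (t : R) : R :=
  flat 0 (k.+1%:R * (t - a)) * flat 0 (k.+1%:R * (b - t)).

Lemma smooth1_bump a b k : smooth1 (bump a b k).
Proof.
move=> j; rewrite /bump; apply: derivablenM.
  have := derivablen_comp_affine k.+1%:R (- (k.+1%:R * a)) (smooth1_flat 0 j).
  by congr derivablen; apply/funext => x; rewrite mulrBr.
have := derivablen_comp_affine (- k.+1%:R) (k.+1%:R * b) (smooth1_flat 0 j).
by congr derivablen; apply/funext => x; congr flat; ring.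
Qed.

Lemma flat0_bound t : 0 <= flat 0 t <= 1.
Proof.
rewrite flat_ge0 /=/flat; case: (leP t 0) => // t0; rewrite expr0 invr1 mul1r.
by rewrite -expR0 ler_expR oppr_le0 invr_ge0 ltW.
Qed.

Lemma bump_bound a b k t : 0 <= bump a b k t <= 1.
Proof.
have /andP[h1 h2] := flat0_bound (k.+1%:R * (t - a)).
have /andP[h3 h4] := flat0_bound (k.+1%:R * (b - t)).
by rewrite /bump mulr_ge0//= mulr_ile1.
Qed.

Lemma flat_neq0 m t : flat m t != 0 -> 0 < t.
Proof. by rewrite /flat; case: leP => //; rewrite eqxx. Qed.

Lemma bump_supp a b k t : bump a b k t != 0 -> a < t < b.
Proof.
rewrite /bump mulf_eq0 negb_or => /andP[/flat_neq0 + /flat_neq0].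
by rewrite !pmulr_rgt0// !subr_gt0 => -> ->.
Qed.

Lemma bump_gt0 a b k t : a < t < b -> 0 < bump a b k t.
Proof.
move=> /andP[at_ tb]; rewrite /bump /flat !leNgt !mulr_gt0 ?subr_gt0//= ?expr0 ?invr1 ?expR_gt0//.
Qed.

Lemma flat0_cvg (s : R) : 0 < s -> (fun k => flat 0 (k.+1%:R * s)) @ \oo --> (1 : R).
Proof.
move=> s0.
have -> : (fun k => flat 0 (k.+1%:R * s)) = (fun k => expR (- (s^-1 * k.+1%:R^-1))).
  apply/funext => k; rewrite /flat leNgt mulr_gt0//= expr0 invr1 mul1r.
  by rewrite invfM mulrC.
have h : (fun k => - (s^-1 * k.+1%:R^-1)) @ \oo --> - (s^-1 * 0).
  by apply: cvgN; apply: cvgMr; exact: cvg_harmonic.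
have := continuous_cvg _ (@continuous_expR R _) h.
by rewrite mulr0 oppr0 expR0; exact.
Qed.

Lemma bump_cvg a b t : bump a b ^~ t @ \oo --> (\1_(`]a, b[%classic) t : R).
Proof.
have [tab|tab] := boolP (a < t < b).
  rewrite indicE mem_set ?in_itv//= -[1]mulr1.
  by move/andP : tab => [ta tb]; apply: cvgM; apply: flat0_cvg; rewrite subr_gt0.
rewrite indicE memNset ?in_itv/= ?in_itv//; last exact/negP.
apply: cvg_near_cst; apply: nearW => k; apply/eqP; apply: contraNT tab.
exact: bump_supp.
Qed.

End iterated_derivability.

(** * Tensor products of bumps as test functions *)

Section tensor_products.
Variables (R : realType) (n : nat).
Implicit Types (psi : 'I_n -> R -> R) (x : 'rV[R]_n).

Definition tensor psi x : R := \prod_(i < n) psi i (x ord0 i).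

(** Differentiating a tensor product replaces one factor by its derivative, so iterated partial
    derivatives stay tensor products. *)
Definition subst_factor psi (j : 'I_n) (g : R -> R) : 'I_n -> R -> R :=
  fun i => if i == j then g else psi i.

Lemma differentiable_tensor psi x : (forall i, smooth1 (psi i)) ->
  differentiable (tensor psi) x.
Proof.
move=> spsi; rewrite /tensor.
elim: (index_enum _) => [|i s IH].
  have -> : (fun x => \prod_(i <- [::]) psi i (x ord0 i)) = cst 1.
    by apply/funext => y; rewrite big_nil.
  exact: differentiable_cst.
have -> : (fun x => \prod_(j <- i :: s) psi j (x ord0 j)) =
    (psi i \o (fun x => x ord0 i)) * (fun x => \prod_(j <- s) psi j (x ord0 j)).
  by apply/funext => y; rewrite big_cons.
apply: differentiableM => //; apply: differentiable_comp.
  exact: differentiable_coord.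
have [f' ff' _] := spsi i 1%N.
by apply/derivable1_diffP; exact: (@ex_derive _ _ _ _ _ _ _ (ff' _)).
Qed.

Lemma partial_tensor psi (j : 'I_n) (g : R -> R) :
  (forall t : R, is_derive t 1 (psi j) (g t)) ->
  partial j (tensor psi) = tensor (subst_factor psi j g).
Proof.
move=> pg; apply/funext => x; rewrite /partial.
pose C := \prod_(i < n | i != j) psi i (x ord0 i).
have -> : tensor (subst_factor psi j g) x = C * g (x ord0 j).
  rewrite /tensor (bigD1 j)//= /subst_factor eqxx mulrC; congr (_ * _).
  by apply: eq_bigr => i /negPf ->.
have d : is_derive (x ord0 j) 1 (fun y => C * psi j y) (C * g (x ord0 j) + psi j (x ord0 j) * 0).
  exact: (is_deriveM (is_derive_cst C _ _) (pg _)).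
have : 'D_1 (fun y => C * psi j y) (x ord0 j) = C * g (x ord0 j).
  by rewrite (@derive_val _ _ _ _ _ _ _ d) mulr0 addr0.
move=> <-.
suff E : (fun h : R => h^-1 *: ((tensor psi \o shift x) (h *: delta_mx ord0 j) - tensor psi x)) =
    (fun h : R => h^-1 *: (((fun y => C * psi j y) \o shift (x ord0 j)) (h *: 1) -
      C * psi j (x ord0 j))) by rewrite /derive E.
apply/funext => h /=; congr (_ *: _).
rewrite /tensor [X in X - _](bigD1 j)//= [X in _ - X](bigD1 j)//= !mxE !eqxx.
have -> : \prod_(i < n | i != j) psi i ((h *: delta_mx ord0 j + x) ord0 i) = C.
  by apply: eq_bigr => i ij; rewrite !mxE eqxx (negPf ij) mulr0 add0r.
by rewrite -/C /GRing.scale /= !mulr1; ring.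
Qed.

Lemma smooth_tensor psi : (forall i, smooth1 (psi i)) -> smooth (tensor psi).
Proof.
move=> spsi s.
suff [psi' spsi' ->] : exists2 psi', (forall i, smooth1 (psi' i)) &
    foldr (@partial R n) (tensor psi) s = tensor psi'.
  by move=> x; exact: differentiable_tensor.
elim: s => [|j s [psi' spsi' /= ->]]; first by exists psi.
have [g pg _] := spsi' j 1%N.
exists (subst_factor psi' j g); last exact: partial_tensor.
move=> i; rewrite /subst_factor; case: eqP => // _ k.
have [g' pg' kg'] := spsi' j k.+1.
(* The derivative found at order 1 must be the one found at order [k + 1]: derivatives are
   unique. *)
suff -> : g = g' by [].
by apply/funext => t; rewrite -(@derive_val _ _ _ _ _ _ _ (pg t)) (@derive_val _ _ _ _ _ _ _ (pg' t)).
Qed.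

Lemma tensor_neq0 psi (a b : 'rV[R]_n) : (forall i t, psi i t != 0 -> a ord0 i < t < b ord0 i) ->
  forall x, tensor psi x != 0 -> obox a b x.
Proof.
by move=> pab x /prodf_neq0 h i; apply: pab; exact: h.
Qed.

Lemma compact_cbox (a b : 'rV[R]_n) :
  compact [set x : 'rV[R]_n | forall i, a ord0 i <= x ord0 i <= b ord0 i].
Proof.
have := @rV_compact R n (fun i => `[a ord0 i, b ord0 i]%classic)
  (fun i => @segment_compact R _ _).
by congr compact; apply/seteqP; split => x /= h i; have := h i; rewrite /= in_itv.
Qed.

Lemma closed_cbox (a b : 'rV[R]_n) :
  closed [set x : 'rV[R]_n | forall i, a ord0 i <= x ord0 i <= b ord0 i].
Proof. by apply: compact_closed; [exact: norm_hausdorff|exact: compact_cbox]. Qed.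

Lemma compact_closure_box (A : set 'rV[R]_n) a b : A `<=` obox a b ->
  compact (closure A).
Proof.
move=> Aab.
have cA : closed (closure A) by exact: closed_closure.
apply: (@subclosed_compact _ (closure A) _ cA (@compact_cbox a b)).
rewrite [X in _ `<=` X](closure_id _).1; last exact: closed_cbox.
apply: closureS => x /Aab h i; have /andP[h1 h2] := h i.
by rewrite !ltW.
Qed.

Lemma test_function_tensor psi (a b : 'rV[R]_n) : (forall i, smooth1 (psi i)) ->
  (forall i t, psi i t != 0 -> a ord0 i < t < b ord0 i) ->
  test_function (tensor psi).
Proof.
move=> spsi pab; split; first exact: smooth_tensor.
by apply: (@compact_closure_box _ a b) => x; exact: tensor_neq0.
Qed.

Definition box_bump (a b : 'rV[R]_n) k : 'rV[R]_n -> R :=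
  tensor (fun i => bump (a ord0 i) (b ord0 i) k).

Lemma box_bump_test a b k : test_function (box_bump a b k).
Proof.
apply: (@test_function_tensor _ a b) => [i|i t]; first exact: smooth1_bump.
exact: bump_supp.
Qed.

Lemma box_bump_neq0 a b k x : box_bump a b k x != 0 -> obox a b x.
Proof. by apply: tensor_neq0 => i t; exact: bump_supp. Qed.

Lemma box_bump_gt0 a b k x : obox a b x -> 0 < box_bump a b k x.
Proof. by move=> xab; apply: prodr_gt0 => i _; apply: bump_gt0; exact: xab. Qed.

Lemma box_bump_bound a b k x : 0 <= box_bump a b k x <= 1.
Proof.
apply/andP; split.
  by apply: prodr_ge0 => i _; case/andP: (bump_bound (a ord0 i) (b ord0 i) k (x ord0 i)).
rewrite /box_bump /tensor; apply: (@le_trans _ _ (\prod_(i < n) 1)); last by rewrite big1_eq.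
by apply: ler_prod => i _; exact: bump_bound.
Qed.

Lemma box_bump_cvg a b x : box_bump a b ^~ x @ \oo --> (\1_(obox a b) x : R).
Proof.
have -> : \1_(obox a b) x = \prod_(i < n) \1_(`]a ord0 i, b ord0 i[%classic) (x ord0 i) :> R.
  have [xab|xab] := pselect (obox a b x).
    rewrite indicE mem_set// big1// => i _; rewrite indicE mem_set//= in_itv.
    exact: xab.
  rewrite indicE memNset//; apply/esym/eqP.
  apply: contra_notT xab => /prodf_neq0 h i.
  have := h i isT; rewrite indicE pnatr_eq0 eqb0 negbK => /set_mem.
  by rewrite /= in_itv.
rewrite /box_bump /tensor.
elim: (index_enum _) => [|i s IH].
  by rewrite big_nil; under eq_fun do rewrite big_nil; exact: cvg_cst.
by rewrite big_cons; under eq_fun do rewrite big_cons; apply: cvgM => //; exact: bump_cvg.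
Qed.

Lemma test_function_continuous (f : 'rV[R]_n -> R) : test_function f -> continuous f.
Proof. by move=> [sf _] x; apply: differentiable_continuous; exact: (sf [::]). Qed.

Lemma test_function_measurable (f : 'rV[R]_n -> R) : test_function f -> measurable_fun setT f.
Proof. by move=> /test_function_continuous; exact: continuous_measurable_rV. Qed.

End tensor_products.

(** * Weak gradients *)

Section fundamental_lemma.
Variables (R : realType) (n : nat).
Local Notation mu := (lebesgue_rV R n).
Implicit Types (f : 'rV[R]_n -> R) (a b x : 'rV[R]_n) (A U : set 'rV[R]_n).

(** Local integrability in the form produced by limits of [box_bump]: indicators of boxes in place
    of integrals over compact sets. *)
Definition box_integrable f := measurable_fun setT f /\
  forall a b, (\int[mu]_x (`|f x| * \1_(obox a b) x)%:E < +oo)%E.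

Lemma measurable_obox_indic a b : measurable_fun setT (\1_(obox a b) : 'rV[R]_n -> R).
Proof. by apply: measurable_indic; exact: measurable_obox. Qed.

Lemma box_integrable_indic f a b : box_integrable f ->
  mu.-integrable setT (fun x => (f x * \1_(obox a b) x)%:E).
Proof.
move=> [mf fab]; apply/integrableP; split.
  by apply/measurable_EFinP; apply: measurable_funM => //; exact: measurable_obox_indic.
apply: le_lt_trans (fab a b); rewrite le_eqVlt; apply/orP; left; apply/eqP.
by apply: eq_integral => x _; rewrite abse_EFin normrM indicE normr_nat.
Qed.

Lemma integrable_box_bump f a b k : box_integrable f ->
  mu.-integrable setT (fun x => (f x * box_bump a b k x)%:E).
Proof.
move=> fl; apply: le_integrable (box_integrable_indic a b fl) => //.
  apply/measurable_EFinP; apply: measurable_funM; first exact: fl.1.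
  by apply: test_function_measurable; exact: box_bump_test.
move=> x _; rewrite !abse_EFin lee_fin !normrM ler_wpM2l//.
have /andP[h1 h2] := box_bump_bound a b k x.
have [xab|xab] := pselect (obox a b x).
  by rewrite indicE mem_set// normr1 ger0_norm.
rewrite (_ : box_bump a b k x = 0) ?normr0//; apply/eqP.
by apply: contra_notT xab => /box_bump_neq0.
Qed.

Lemma box_integral_eq0 f a b : box_integrable f ->
  (forall k, \int[mu]_x (f x * box_bump a b k x)%:E = 0)%E ->
  (\int[mu]_x (f x * \1_(obox a b) x)%:E = 0)%E.
Proof.
move=> fl H; have [mf _] := fl.
have [] // := @dominated_convergence _ _ _ mu setT measurableT
  (fun k x => (f x * box_bump a b k x)%:E) (fun x => (f x * \1_(obox a b) x)%:E)
  (fun x => (`|f x * \1_(obox a b) x|)%:E).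
- by move=> k; have /integrableP[] := integrable_box_bump a b k fl.
- by have /integrableP[] := box_integrable_indic a b fl.
- apply: aeW => x _; apply: cvg_EFin; first by apply: nearW.
  by apply: cvgMr; exact: box_bump_cvg.
- by have := integrable_abse (box_integrable_indic a b fl); apply: eq_integrable.
- apply: aeW => x k _; rewrite abse_EFin lee_fin !normrM ler_wpM2l//.
  have /andP[h1 h2] := box_bump_bound a b k x.
  have [xab|xab] := pselect (obox a b x).
    by rewrite indicE mem_set// normr1 ger0_norm.
  rewrite (_ : box_bump a b k x = 0) ?normr0//; apply/eqP.
  by apply: contra_notT xab => /box_bump_neq0.
move=> _ _; under eq_fun do rewrite H.
move=> h; have /cvg_lim <- // := h; rewrite lim_cst//.
Qed.

Definition centered_box k : set 'rV[R]_n := obox (const_mx (- k%:R)) (const_mx k%:R).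

Lemma centered_boxP x : exists k, centered_box k x.
Proof.
exists (truncn `|x|).+1 => i; rewrite !mxE -ltr_norml.
by apply: le_lt_trans (truncnS_gt _); exact: coord_le_norm.
Qed.

(** Restricted to a centred box, [f] is integrable, and Dynkin induction extends the vanishing of
    its integral from boxes to all measurable sets. *)
Lemma ae_eq0_of_boxes f : box_integrable f ->
  (forall a b, \int[mu]_x (f x * \1_(obox a b) x)%:E = 0)%E ->
  {ae mu, forall x, f x = 0}.
Proof.
move=> fl H.
suff K k : {ae mu, forall x, centered_box k x -> f x = 0}.
  have := ae_foralln K; apply: filterS => x Kx.
  by have [k] := centered_boxP x; exact: Kx.
pose F (x : 'rV[R]_n) := f x * \1_(centered_box k) x.
have IF : mu.-integrable setT (EFin \o F) by exact: box_integrable_indic.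
have IFD D : measurable D -> mu.-integrable D (EFin \o F).
  by move=> mD; apply: integrableS IF.
suff E A : measurable A -> (\int[mu]_(x in A) (F x)%:E = 0)%E.
  have : ae_eq mu setT (EFin \o F) (cst 0%E).
    apply: integral_ae_eq => // D _ mD; rewrite integral0; exact: E.
  apply: filterS => x /(_ I) [] + xk; rewrite /F indicE mem_set//= mulr1.
  by move=> [].
move=> mA; pose P := [set A | (\int[mu]_(x in A) (F x)%:E = 0)%E].
suff : P A by [].
have : <<s @oboxes R n >> A by rewrite -measurable_rV_oboxes.
apply: (@dynkin_induction _ 'rV[R]_n) => //.
- exact: measurable_rV_oboxes.
- exact: setI_closed_oboxes.
- exact: H.
- move=> C [->|[a [b ->]]]; rewrite /P /=; first by rewrite integral_set0.
  rewrite integral_mkcond; have := H (\row_i maxr (a ord0 i) ((const_mx (- k%:R) : 'rV[R]_n) ord0 i))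
    (\row_i minr (b ord0 i) ((const_mx k%:R : 'rV[R]_n) ord0 i)).
  rewrite -obox_setI => <-; apply: eq_integral => x _.
  rewrite patchE /F !indicE in_setI; case: (x \in obox a b) => //=.
  by rewrite mulr0.
- move=> C mC PC; rewrite /P /=.
  have := H (const_mx (- k%:R)) (const_mx k%:R); rewrite -[setT](setUv C).
  rewrite integral_setU//; last 3 first.
  + exact: measurableC.
  + by rewrite setUv; case/integrableP : IF.
  + by rewrite disj_set2E setICr.
  by rewrite PC add0e.
- move=> G mG tG PG; rewrite /P /= integral_bigcup//; last first.
    by apply: IFD; exact: bigcupT_measurable.
  by rewrite eseries0// => i _ _; exact: PG.
Qed.

(** The condition on [U] turns each box integral of [f * \1_U] into an integral of [f] over a box
    inside [U], where bumps are available. It holds for the whole space and for coordinate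
    half-spaces, the two cases used. *)
Lemma fundamental_lemma U f : box_integrable f -> measurable U ->
  (forall a b, exists a' b', obox a b `&` U = obox a' b') ->
  (forall a b k, obox a b `<=` U -> \int[mu]_x (f x * box_bump a b k x)%:E = 0)%E ->
  {ae mu, forall x, U x -> f x = 0}.
Proof.
move=> fl mU Ubox H; have [mf fab] := fl.
have : {ae mu, forall x, f x * \1_U x = 0}.
  apply: ae_eq0_of_boxes.
    split; first by apply: measurable_funM => //; exact: measurable_indic.
    move=> a b; apply: le_lt_trans (fab a b); apply: ge0_le_integralT.
    - apply: measurable_funM; last exact: measurable_obox_indic.
      by apply: measurableT_comp => //; apply: measurable_funM => //; exact: measurable_indic.
    - by apply: measurable_funM; [exact: measurableT_comp|exact: measurable_obox_indic].
    - move=> x; rewrite mulr_ge0 ?indicE//= ler_wpM2r// normrM normr_nat.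
      by rewrite ler_piMr//; case: (_ \in _).
  move=> a b; have [a' [b' E]] := Ubox a b.
  rewrite -[RHS](@box_integral_eq0 f a' b')//.
    apply: eq_integral => x _; rewrite -E !indicE in_setI -mulrA.
    by rewrite -natrM mulnb andbC.
  by move=> k; apply: H; rewrite -E; exact: subIsetr.
by apply: filterS => x + Ux; rewrite indicE mem_set// mulr1.
Qed.

Lemma loc_integrable_box f : loc_integrable f -> box_integrable f.
Proof.
move=> [mf fK]; split => // a b.
apply: le_lt_trans (fK _ (@compact_cbox R n a b)).
have -> : (\int[mu]_x (`|f x| * \1_(obox a b) x)%:E =
    \int[mu]_(x in obox a b) `|f x|%:E)%E.
  rewrite [RHS]integral_mkcond; apply: eq_integral => x _.
  by rewrite patchE indicE; case: ifPn => _; rewrite ?mulr1 ?mulr0.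
apply: ge0_subset_integral => //.
- exact: measurable_obox.
- by rewrite -[X in measurable X]setCK; apply: measurableC; apply: open_measurable_rV;
    apply: closed_openC; exact: closed_cbox.
- by apply: measurable_funTS; apply/measurable_EFinP; exact: measurableT_comp.
- by move=> x h i; have /andP[h1 h2] := h i; rewrite !ltW.
Qed.

Lemma integrable_box f : mu.-integrable setT (EFin \o f) -> box_integrable f.
Proof.
move=> /integrableP[/measurable_EFinP mf foo]; split => // a b.
apply: le_lt_trans foo; apply: ge0_le_integralT => //.
- by apply: measurable_funM; [exact: measurableT_comp|exact: measurable_obox_indic].
- exact: measurableT_comp.
- by move=> x; rewrite mulr_ge0 ?indicE//= ler_piMr// ; case: (_ \in _).
Qed.

Lemma fundamental_lemmaT f g : box_integrable f -> box_integrable g ->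
  (forall phi, test_function phi ->
    \int[mu]_x (f x * phi x)%:E = \int[mu]_x (g x * phi x)%:E)%E ->
  {ae mu, forall x, f x = g x}.
Proof.
move=> fl gl H.
have : {ae mu, forall x, setT x -> f x - g x = 0}.
  apply: fundamental_lemma => //.
  - split; first by apply: measurable_funB; [exact: fl.1|exact: gl.1].
    move=> a b.
    have := integrableB measurableT (box_integrable_indic a b fl) (box_integrable_indic a b gl).
    move=> /integrableP[_]; apply: le_lt_trans; rewrite le_eqVlt; apply/orP; left; apply/eqP.
    apply: eq_integral => x _; apply/esym.
    rewrite [LHS](_ : _ = `|f x * \1_(obox a b) x - g x * \1_(obox a b) x|%:E)//.
    by rewrite -mulrBl normrM indicE normr_nat.
  - by move=> a b; exists a, b; rewrite setIT.
  - move=> a b k _.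
    under eq_integral do rewrite mulrBl EFinB.
    rewrite (integralB measurableT (integrable_box_bump a b k fl) (integrable_box_bump a b k gl)).
    rewrite H; last exact: box_bump_test.
    rewrite subee//; apply: integrable_fin_num => //.
    exact: integrable_box_bump.
by apply: filterS => x /(_ I)/eqP; rewrite subr_eq0 => /eqP.
Qed.

End fundamental_lemma.

Section weak_gradients.
Variables (R : realType) (n : nat).
Local Notation mu := (lebesgue_rV R n).
Implicit Types (u : 'rV[R]_n -> R) (g : 'rV[R]_n -> 'rV[R]_n).

Lemma ae_forall_ord m (P : 'I_m -> 'rV[R]_n -> Prop) :
  (forall i, {ae mu, forall x, P i x}) -> {ae mu, forall x, forall i, P i x}.
Proof.
move=> H; have : {ae mu, forall x, forall k, forall i : 'I_m, nat_of_ord i = k -> P i x}.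
  apply: ae_foralln => k.
  have [km|km] := ltnP k m; last first.
    by apply: aeW => x i ik; move: (ltn_ord i); rewrite ik ltnNge km.
  by have := H (Ordinal km); apply: filterS => x Px i ik; rewrite (_ : i = Ordinal km)//; exact: val_inj.
by apply: filterS => x Px i; exact: (Px i).
Qed.

Lemma weak_gradient_unique u g g' : is_weak_gradient u g -> is_weak_gradient u g' ->
  {ae mu, forall x, g x = g' x}.
Proof.
move=> ug ug'.
have : {ae mu, forall x, forall i : 'I_n, g x ord0 i = g' x ord0 i}.
  apply: ae_forall_ord => i.
  have [gl hg] := ug i; have [gl' hg'] := ug' i.
  apply: fundamental_lemmaT; [exact: loc_integrable_box|exact: loc_integrable_box|].
  by move=> phi tphi; apply: oppe_inj; rewrite -hg// -hg'.
by apply: filterS => x h; apply/rowP => i; exact: h.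
Qed.

Lemma is_weak_gradientP u : (exists g, is_weak_gradient u g) ->
  is_weak_gradient u (weak_gradient u).
Proof. by move=> [g ug]; rewrite /weak_gradient; apply: xgetPex; exists g. Qed.

Lemma weak_gradient_ae u g : is_weak_gradient u g ->
  {ae mu, forall x, weak_gradient u x = g x}.
Proof.
move=> ug.
exact: (weak_gradient_unique (is_weak_gradientP (ex_intro _ g ug)) ug).
Qed.

Lemma partial_eq0 (phi : 'rV[R]_n -> R) i x :
  (\forall y \near x, phi y = 0) -> partial i phi x = 0.
Proof.
move=> phi0; rewrite /partial.
apply: (@derive_val _ _ _ _ _ _ _ (near_eq_is_derive _ (is_derive_cst 0 x (delta_mx ord0 i)))).
by apply: filterS phi0 => y ->.
Qed.

(** The space [W^{1,1}] with the gradient as explicit data. On bounded domains it contains every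
    [W1p0] function, and L1 is where translations and difference quotients are easiest to
    control. *)
Definition sobolev11 u g := [/\ mu.-integrable setT (EFin \o u),
  forall i, mu.-integrable setT (fun x => (g x ord0 i)%:E) &
  forall i phi, test_function phi ->
    (\int[mu]_x (u x * partial i phi x)%:E = - \int[mu]_x (g x ord0 i * phi x)%:E)%E].

Lemma integrable_loc u : mu.-integrable setT (EFin \o u) -> loc_integrable u.
Proof.
move=> /integrableP[mu_ uoo]; split; first exact/measurable_EFinP.
move=> K cK; apply: le_lt_trans uoo; apply: ge0_subset_integral => //.
- rewrite -[X in measurable X]setCK; apply: measurableC; apply: open_measurable_rV.
  by apply: closed_openC; apply: compact_closed => //; exact: norm_hausdorff.
- by apply/measurable_EFinP; apply: measurableT_comp => //; exact/measurable_EFinP.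
Qed.

Lemma sobolev11_weak_gradient u g : sobolev11 u g -> is_weak_gradient u g.
Proof. move=> [Iu Ig ug] i; split; last by move=> phi; exact: ug.
by apply: integrable_loc; exact: Ig. Qed.

Lemma partial_outside (phi : 'rV[R]_n -> R) i (W : set 'rV[R]_n) x : open W -> W x ->
  (forall y, W y -> phi y = 0) -> partial i phi x = 0.
Proof.
move=> oW Wx phi0; apply: partial_eq0.
by have : nbhs x W by [move: oW; rewrite openE => /(_ _ Wx)]; apply: filterS.
Qed.

Lemma half_box (i : 'I_n) (c : R) a b : exists a' b',
  obox a b `&` [set x : 'rV[R]_n | c < x ord0 i] = obox a' b'.
Proof.
exists (\row_j if j == i then maxr (a ord0 j) c else a ord0 j), b.
apply/seteqP; split => x /=.
  move=> [h cx] j; rewrite mxE; have /andP[h1 h2] := h j; case: eqP => [->|_]; last by rewrite h1.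
  by rewrite gt_max cx; have /andP[-> ->] := h i.
move=> h; split; last by have := h i; rewrite mxE eqxx gt_max => /andP[/andP[]].
move=> j; have := h j; rewrite mxE; case: eqP => // _.
by rewrite gt_max => /andP[/andP[-> _] ->].
Qed.

Lemma half_boxN (i : 'I_n) (c : R) a b : exists a' b',
  obox a b `&` [set x : 'rV[R]_n | x ord0 i < c] = obox a' b'.
Proof.
exists a, (\row_j if j == i then minr (b ord0 j) c else b ord0 j).
apply/seteqP; split => x /=.
  move=> [h cx] j; rewrite mxE; have /andP[h1 h2] := h j; case: eqP => [->|_]; last by rewrite h1.
  by rewrite lt_min cx; have /andP[-> ->] := h i.
move=> h; split; last by have := h i; rewrite mxE eqxx lt_min => /andP[_ /andP[]].
move=> j; have := h j; rewrite mxE; case: eqP => // _.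
by rewrite lt_min => /andP[-> /andP[-> _]].
Qed.

Lemma open_coord_gt (i : 'I_n) (c : R) : open [set x : 'rV[R]_n | c < x ord0 i].
Proof.
have -> : [set x : 'rV[R]_n | c < x ord0 i] = rV_coord i @^-1` `]c, +oo[%classic.
  by apply/seteqP; split => x /=; rewrite in_itv /= andbT.
apply: open_comp; first by move=> z _; exact: continuous_rV_coord.
exact: rray_open.
Qed.

Lemma open_coord_lt (i : 'I_n) (c : R) : open [set x : 'rV[R]_n | x ord0 i < c].
Proof.
have -> : [set x : 'rV[R]_n | x ord0 i < c] = rV_coord i @^-1` `]-oo, c[%classic.
  by apply/seteqP; split => x /=; rewrite in_itv.
apply: open_comp; first by move=> z _; exact: continuous_rV_coord.
exact: lray_open.
Qed.

(** Bumps in boxes inside [U] vanish on the open set [W], hence so do their partial derivatives; off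
    [W] it is [u] that vanishes. Thus [u * partial i phi] is zero almost everywhere. *)
Lemma weak_gradient_vanish u g (U V W : set 'rV[R]_n) :
  measurable_fun setT u -> is_weak_gradient u g ->
  measurable U -> (forall a b, exists a' b', obox a b `&` U = obox a' b') ->
  open W -> W `<=` ~` U -> (forall x, V x \/ W x) ->
  {ae mu, forall x, V x -> u x = 0} ->
  forall i, {ae mu, forall x, U x -> g x ord0 i = 0}.
Proof.
move=> mu_ ug mU Ubox oW WU VW u0 i; have [gl hg] := ug i.
apply: fundamental_lemma => //; first exact: loc_integrable_box.
move=> a b k abU; apply: oppe_inj; rewrite -hg ?oppe0; last exact: box_bump_test.
rewrite (ae_eq_integral (cst 0%E))//; first by rewrite integral0.
  apply/measurable_EFinP; apply: measurable_funM => //.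
  apply: continuous_measurable_rV => x; apply: differentiable_continuous.
  exact: ((box_bump_test a b k).1 [:: i] x).
apply: filterS u0 => x ux _.
have [/ux ->|Wx] := VW x; first by rewrite mul0r.
rewrite (@partial_outside _ i W x)// ?mulr0// => y Wy; apply/eqP.
by apply: contra_notT (WU y Wy) => /box_bump_neq0; exact: abU.
Qed.

(** Boundedness of [Omega] gives both integrabilities: [u] is dominated by [1 + |u|^p] on a box
    containing [Omega], and the locally integrable gradient vanishes outside a slightly larger
    box. *)
Lemma W1p0_sobolev11 p (Omega : set 'rV[R]_n) u : 1 < p -> bounded_set Omega ->
  W1p0 p Omega u -> sobolev11 u (weak_gradient u).
Proof.
move=> p1 bO [up ug gp u0].
have [M Mn Om] : exists2 M : R, 0 < M & forall x, Omega x -> forall i, `|x ord0 i| < M.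
  have [N [_ hN]] := bO; exists (`|N| + 2).
    by rewrite ltr_wpDl.
  move=> x Ox i; apply: le_lt_trans (coord_le_norm _ _) _.
  apply: le_lt_trans (hN (`|N| + 1) _ x Ox) _; last by rewrite ltrD2l ltr1n.
  by rewrite ltr_pwDr// ler_norm.
have muu : measurable_fun setT u.
  by move: up; rewrite inE => /andP[]; rewrite inE.
have wg := is_weak_gradientP ug.
have Ig i : mu.-integrable setT (fun x => (weak_gradient u x ord0 i)%:E).
  have [gl _] := wg i; apply/integrableP; split; first by apply/measurable_EFinP; exact: gl.1.
  pose C := [set x : 'rV[R]_n | forall j, (const_mx (- (M + 1)) : 'rV[R]_n) ord0 j <= x ord0 j
     <= (const_mx (M + 1) : 'rV[R]_n) ord0 j].
  apply: le_lt_trans (gl.2 C (@compact_cbox R n _ _)).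
  rewrite [leRHS]integral_mkcond; apply: ae_ge0_le_integral => //.
  - by apply: measurableT_comp => //; apply/measurable_EFinP; exact: gl.1.
  - by move=> x _; rewrite patchE; case: ifPn.
  - apply/(measurable_restrictT _ _).1 => //.
      rewrite -[X in measurable X]setCK; apply: measurableC; apply: open_measurable_rV.
      by apply: closed_openC; exact: closed_cbox.
    apply: measurable_funTS; apply/measurable_EFinP; apply: measurableT_comp => //; exact: gl.1.
  (* The margin 1 lets two open regions cover the space: [u] vanishes where the coordinate exceeds
     [M], and the rest has coordinate below [M + 1]. *)
  have H (j : 'I_n) : {ae mu, forall x : 'rV[R]_n, M + 1 < x ord0 j -> weak_gradient u x ord0 i = 0}.
    apply: (@weak_gradient_vanish u _ [set x | M + 1 < x ord0 j] [set x | M < x ord0 j]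
       [set x | x ord0 j < M + 1]) => //.
    - by apply: open_measurable_rV; exact: open_coord_gt.
    - by move=> a b; exact: half_box.
    - exact: open_coord_lt.
    - by move=> x /= h1 h2; have := lt_trans h1 h2; rewrite ltxx.
    - move=> x /=; case: (ltP M (x ord0 j)); [by left|move=> h; right].
      by apply: le_lt_trans h _; rewrite ltrDl.
    - apply: filterS u0 => x h Mx; apply: h => /Om /(_ j).
      by rewrite ltNge (le_trans (ltW Mx)) ?ler_norm.
  have H' (j : 'I_n) : {ae mu, forall x : 'rV[R]_n, x ord0 j < - (M + 1) -> weak_gradient u x ord0 i = 0}.
    apply: (@weak_gradient_vanish u _ [set x | x ord0 j < - (M + 1)] [set x | x ord0 j < - M]
       [set x | - (M + 1) < x ord0 j]) => //.
    - by apply: open_measurable_rV; exact: open_coord_lt.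
    - by move=> a b; exact: half_boxN.
    - exact: open_coord_gt.
    - by move=> x /= h1 h2; have := lt_trans h1 h2; rewrite ltxx.
    - move=> x /=; case: (ltP (x ord0 j) (- M)); [by left|move=> h; right].
      by apply: lt_le_trans h; rewrite ltrN2 ltrDl.
    - apply: filterS u0 => x h Mx; apply: h => /Om /(_ j).
      rewrite ltNge -normrN (le_trans _ (ler_norm _))// lerNr ltW//.
  apply: filterS2 (ae_forall_ord H) (ae_forall_ord H') => x h h' _.
  rewrite patchE; case: ifPn => // xC.
  have W0 : weak_gradient u x ord0 i = 0.
    apply: contrapT => gx; move/negP : xC; apply; rewrite inE => j; rewrite !mxE.
    by apply/andP; split; rewrite leNgt; apply/negP => hh; apply: gx; [exact: h' hh|exact: h hh].
  by rewrite W0 abse0.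
split => //; last by move=> i; exact: (wg i).2.
apply/integrableP; split; first exact/measurable_EFinP.
have mup : measurable_fun setT (fun x => `|u x| `^ p).
  apply: (measurableT_comp (f := (@powR R) ^~ p)); first exact: measurable_powR.
  exact: measurableT_comp.
pose a : 'rV[R]_n := const_mx (- M); pose b : 'rV[R]_n := const_mx M.
apply: (@le_lt_trans _ _ (\int[mu]_x ((\1_(obox a b) x)%:E + (`|u x| `^ p)%:E))%E).
  apply: ae_ge0_le_integral => //.
  - by apply: measurableT_comp => //; exact/measurable_EFinP.
  - by move=> x _; rewrite -EFinD lee_fin addr_ge0 ?powR_ge0// indicE.
  - apply: emeasurable_funD; apply/measurable_EFinP => //; exact: measurable_obox_indic.
  - apply: filterS u0 => x ux _; rewrite -EFinD lee_fin.
    have [Ox|/ux ->] := pselect (Omega x); last first.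
      by rewrite normr0 addr_ge0 ?powR_ge0// indicE.
    rewrite indicE mem_set; last by move=> i; rewrite !mxE -ltr_norml; exact: Om.
    have [u1|u1] := leP `|u x| 1; first by rewrite (le_trans u1)// lerDl powR_ge0.
    by rewrite ler_wpDl//; apply: le1r_powR; exact: ltW.
rewrite ge0_integralD//; last 2 first.
- by apply/measurable_EFinP; exact: measurable_obox_indic.
- exact/measurable_EFinP.
apply: lte_add_pinfty.
  by rewrite integral_indic ?setIT ?lebesgue_rV_obox_lty//; exact: measurable_obox.
have p0 : p != 0 by rewrite gt_eqF// (lt_trans ltr01).
have := up; rewrite inE => /andP[_]; rewrite inE /finLfun /= => Np.
have := poweR_lty p Np; rewrite poweR_Lnorm//.
Qed.
End weak_gradients.

(** * Increments as line integrals of weak derivatives *)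

Section bump_antiderivative.
Variable R : realType.
Local Notation leb := (@lebesgue_measure R).

Lemma derivablen_continuous (f : R -> R) : derivablen 1 f -> continuous f.
Proof.
move=> [f' ff' _] x; apply: differentiable_continuous.
by apply/derivable1_diffP; exact: (@ex_derive _ _ _ _ _ _ _ (ff' x)).
Qed.

Lemma bump_continuous (a b : R) k : continuous (bump a b k).
Proof. by apply: derivablen_continuous; exact: smooth1_bump. Qed.

Lemma bump_eq0 (a b : R) k t : ~~ (a < t < b) -> bump a b k t = 0.
Proof. by move=> h; apply/eqP; apply: contraNT h; exact: bump_supp. Qed.

Lemma bump_primitive (a b : R) k :
  exists Psi : R -> R, forall x : R, is_derive x 1 Psi (bump a b k x).
Proof.
(* Starting at [a - 1], where the bump vanishes, makes one formula valid everywhere: [Psi] is 0 to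
   the left of [a], and the fundamental theorem of calculus applies from [a] on. *)
pose Psi (x : R) : R := (\int[leb]_(t in [set` Interval (BLeft (a - 1)) (BRight x)]) (bump a b k t))%R.
exists Psi => x.
have [xa|xa] := ltP x a.
  rewrite bump_eq0; last by apply/negP => /andP[ax _]; lra.
  have dc : is_derive x 1 (cst (0 : R)) (0 : R) := is_derive_cst (0 : R) x 1.
  apply: near_eq_is_derive dc.
  near=> y; have ya : y < a by near: y; exact: lt_nbhsl.
  rewrite /Psi /Rintegral integral0_eq// => t /=; rewrite in_itv /= => /andP[_ ty].
  by rewrite bump_eq0//; apply/negP => /andP[at_ _]; lra.
have [] := @continuous_FTC1 R (bump a b k) (BLeft (a - 1)) x (x + 1).
- by rewrite ltrDl.
- apply: continuous_compact_integrable; first exact: segment_compact.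
  by apply: continuous_subspaceT; exact: bump_continuous.
- by rewrite lte_fin; lra.
- exact: bump_continuous.
move=> d1 d2; split; first exact: d1.
by rewrite -derive1E.
Unshelve. all: by end_near. Qed.

(** [Th y] is the integral of the bump over [[y - t, y]]: a finite difference of the bump becomes
    the exact derivative of a smooth function with compact support. *)
Lemma bump_sliding_average (a b : R) k (t : R) : 0 < t ->
  exists Th : R -> R, [/\ smooth1 Th,
    forall y : R, is_derive y 1 Th (bump a b k y - bump a b k (y - t)),
    forall y, (\int[leb]_r (bump a b k (y - r) * \1_(`[0%R, t]%classic) r)%:E = (Th y)%:E)%E &
    forall y, Th y != 0 -> a < y < b + t].
Proof.
move=> t0; have [Psi dPsi] := bump_primitive a b k.
pose Th y := Psi y + (-1) * Psi (1 * y + (- t)).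
have dTh (y : R) : is_derive y 1 Th (bump a b k y - bump a b k (y - t)).
  have h := @is_derive1_comp _ Psi (fun y => 1 * y + (- t)) y _ _ (dPsi (1 * y + (- t)))
    (is_derive_affine 1 (- t) y).
  have e : is_derive y 1 Th _ := is_deriveD (dPsi y) (is_deriveM (is_derive_cst (-1 : R) y 1) h).
  by apply: is_derive_eq e _; rewrite /GRing.scale /= !mul1r !mulr1 mulr0 addr0 mulN1r.
have sPsi : smooth1 Psi.
  by case=> [//|j]; exists (bump a b k) => //; exact: smooth1_bump.
have ThE y : (\int[leb]_r (bump a b k (y - r) * \1_(`[0%R, t]%classic) r)%:E = (Th y)%:E)%E.
  transitivity (\int[leb]_(r in `[0%R, t]) (bump a b k (y - r))%:E)%E.
    rewrite [RHS]integral_mkcond; apply: eq_integral => r _; rewrite patchE indicE.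
    by case: ifPn => _; rewrite ?mulr1 ?mulr0.
  have dF (r : R) : is_derive r 1 (fun r => (-1) * Psi ((-1) * r + y)) (bump a b k (y - r)).
    have h := @is_derive1_comp _ Psi (fun r => (-1) * r + y) r _ _ (dPsi _)
      (is_derive_affine (-1) y r).
    have e : is_derive r 1 (fun r => (-1) * Psi ((-1) * r + y)) _ :=
      is_deriveM (is_derive_cst (-1 : R) r 1) h.
    apply: is_derive_eq e _; rewrite /GRing.scale /= mulr0 addr0 mulrN1 mulrNN mul1r.
    by rewrite mulN1r addrC.
  rewrite (@continuous_FTC2 R (fun r => bump a b k (y - r)) (fun r => (-1) * Psi ((-1) * r + y)))//.
  - rewrite -EFinB; congr EFin; rewrite /Th mulr0 add0r mul1r mulN1r.
    by rewrite (_ : -1 * t + y = y - t); ring.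
  - apply: continuous_subspaceT => r.
    apply: (@continuous_comp _ _ _ (fun r => y - r) (bump a b k)); last exact: bump_continuous.
    by apply: cvgB; [exact: cvg_cst|exact: cvg_id].
  - have cF : continuous (fun r : R => (-1) * Psi ((-1) * r + y)).
      move=> r; apply: differentiable_continuous; apply/derivable1_diffP.
      exact: (@ex_derive _ _ _ _ _ _ _ (dF r)).
    split; first by move=> r _; exact: (@ex_derive _ _ _ _ _ _ _ (dF r)).
      by apply: cvg_at_right_filter; exact: cF.
    by apply: cvg_at_left_filter; exact: cF.
  - by move=> r _; rewrite derive1E (@derive_val _ _ _ _ _ _ _ (dF r)).
exists Th; split => //.
  by move=> j; apply: derivablenD => //; apply: derivablenZ; exact: derivablen_comp_affine.
move=> y; apply: contraNT => yab; apply/eqP; have := ThE y.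
rewrite integral0_eq => [[]//|r _]; congr EFin.
have [/set_mem|] := boolP (r \in `[0%R, t]%classic); last by rewrite indicE => /negPf ->; rewrite mulr0.
rewrite /= in_itv /= => /andP[r0 rt]; rewrite bump_eq0 ?mul0r//.
apply: contra yab => /andP[h1 h2]; apply/andP; split.
  by apply: lt_le_trans h1 _; rewrite gerBl.
by move: h2; rewrite ltrBlDr => /lt_le_trans; apply; rewrite lerD2l.
Qed.

Variable n : nat.

(** Writes a finite difference of a bump as a partial derivative of a test function, the form to
    which the definition of a weak gradient applies. *)
Lemma box_bump_sliding_average (a b : 'rV[R]_n) k (i : 'I_n) (t : R) : 0 < t ->
  exists Phi : 'rV[R]_n -> R, [/\ test_function Phi,
    forall x, partial i Phi x = box_bump a b k x - box_bump a b k (x - t *: delta_mx ord0 i) &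
    forall x, (\int[leb]_r (box_bump a b k (x - r *: delta_mx ord0 i) *
       \1_(`[0%R, t]%classic) r)%:E = (Phi x)%:E)%E].
Proof.
move=> t0; have [Th [sTh dTh ThE Th0]] := bump_sliding_average (a ord0 i) (b ord0 i) k t0.
pose psi (j : 'I_n) := bump (a ord0 j) (b ord0 j) k.
have bE r (x : 'rV[R]_n) : box_bump a b k (x - r *: delta_mx ord0 i) =
    (\prod_(j < n | j != i) psi j (x ord0 j)) * bump (a ord0 i) (b ord0 i) k (x ord0 i - r).
  rewrite /box_bump /tensor (bigD1 i)//= !mxE !eqxx mulr1 mulrC; congr (_ * _).
  by apply: eq_bigr => j ji; rewrite !mxE eqxx (negPf ji) mulr0 subr0.
exists (tensor (subst_factor psi i Th)); split.
- apply: (@test_function_tensor _ _ _ a (b + t *: const_mx 1)).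
    by move=> j; rewrite /subst_factor; case: eqP => // _; exact: smooth1_bump.
  move=> j y; rewrite /subst_factor !mxE mulr1; case: (eqVneq j i) => [->|_]; first exact: Th0.
  by move=> /bump_supp /andP[-> h] /=; rewrite (lt_le_trans h)// lerDl ltW.
- move=> x.
  have dsub (y : R) : is_derive y 1 (subst_factor psi i Th i)
      ((fun y => bump (a ord0 i) (b ord0 i) k y - bump (a ord0 i) (b ord0 i) k (y - t)) y).
    by rewrite /subst_factor eqxx.
  rewrite (partial_tensor dsub).
  have := bE 0 x; rewrite scale0r !subr0 => ->; rewrite bE -mulrBr.
  rewrite /tensor (bigD1 i)//= {1}/subst_factor eqxx mulrC; congr (_ * _).
  by apply: eq_bigr => j /negPf ji; rewrite /subst_factor ji.
- move=> x; under eq_integral do rewrite bE -mulrA EFinM.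
  rewrite integralZl//; last first.
    apply/integrableP; split.
      apply/measurable_EFinP; apply: measurable_funM; last exact: measurable_indic.
      apply: (measurableT_comp (f := bump (a ord0 i) (b ord0 i) k)).
        by apply: continuous_measurable_fun; exact: bump_continuous.
      exact: measurable_funB.
    have := ThE (x ord0 i); set I1 := (X in X = _ -> _) => I1E.
    apply: (@le_lt_trans _ _ I1); last by rewrite I1E ltry.
    rewrite le_eqVlt; apply/orP; left; apply/eqP; apply: eq_integral => r _.
    rewrite gee0_abs// lee_fin mulr_ge0//.
    by case/andP: (bump_bound (a ord0 i) (b ord0 i) k (x ord0 i - r)).
  rewrite ThE -EFinM; congr EFin.
  rewrite /tensor [RHS](bigD1 i)//= {1}/subst_factor eqxx mulrC; congr (_ * _).
  by apply: eq_bigr => j /negPf ji; rewrite /subst_factor ji.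
Qed.

End bump_antiderivative.

Section increments.
Variables (R : realType) (n : nat).
Local Notation mu := (lebesgue_rV R n).
Local Notation leb := (@lebesgue_measure R).
Implicit Types (u : 'rV[R]_n -> R) (g : 'rV[R]_n -> 'rV[R]_n).
Local Notation e_ i := (delta_mx (ord0 : 'I_1) i : 'rV[R]_n).

Lemma measurable_segment (f : 'rV[R]_n -> R) (v : 'rV[R]_n) : measurable_fun setT f ->
  measurable_fun setT (fun p : 'rV[R]_n * measurableTypeR R => f (p.1 + p.2 *: v)).
Proof.
move=> mf; apply: measurableT_comp => //; apply: measurable_rVD; first exact: measurable_fst.
apply: measurable_rVZ; first exact: measurable_snd.
exact: measurable_cst.
Qed.

Lemma measurable_unit_slab (t : R) : measurable_fun setT
  (fun p : 'rV[R]_n * measurableTypeR R => \1_(`[0%R, t]%classic) p.2 : R).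
Proof.
apply: (measurableT_comp (f := (\1_(`[0%R, t]%classic) : measurableTypeR R -> R))).
  exact: measurable_indic.
exact: measurable_snd.
Qed.

Lemma integral_segment_indic (t : R) : 0 <= t ->
  (\int[leb]_r (\1_(`[0%R, t]%classic) r)%:E = t%:E)%E.
Proof.
move=> t0; rewrite integral_indic// setIT.
transitivity (@lebesgue_measure R `[0, t]%classic) => //.
rewrite lebesgue_measure_itv /= lte_fin.
by case: ltgtP t0 => // [t0 _|<- _]; rewrite ?oppr0 ?adde0// -EFinB subr0.
Qed.

Lemma integrable_segment (f : 'rV[R]_n -> R) (v : 'rV[R]_n) (t : R) : 0 <= t ->
  mu.-integrable setT (EFin \o f) ->
  (mu \x leb)%E.-integrable setT
    (fun p => (f (p.1 + p.2 *: v) * \1_(`[0%R, t]%classic) p.2)%:E).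
Proof.
move=> t0 If.
have mf : measurable_fun setT f by case/integrableP : If => /measurable_EFinP.
apply/integrable21ltyP.
  apply/measurable_EFinP; apply: measurable_funM; first exact: measurable_segment.
  exact: measurable_unit_slab.
rewrite (eq_integral (fun r : measurableTypeR R => (\int[mu]_x `|f x|%:E) * (\1_(`[0%R, t]%classic) r)%:E)%E); last first.
  move=> r _ /=.
  rewrite (eq_integral (fun x : 'rV[R]_n => `|f (x + r *: v)|%:E * (\1_(`[0%R, t]%classic) r)%:E)%E); last first.
    by move=> x _; rewrite -EFinM normrM indicE normr_nat.
  rewrite ge0_integralZr//.
  - by rewrite (integral_translate_norm (r *: v) mf).
  - by apply/measurable_EFinP; apply: measurableT_comp => //; exact: measurable_translate.
rewrite ge0_integralZl//.
- have Nf : (\int[mu]_x `|f x|%:E)%E \is a fin_num.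
    by rewrite ge0_fin_numE ?integral_ge0//; case/integrableP : If.
  by rewrite (integral_segment_indic t0) -(fineK Nf) -EFinM ltry.
- by apply/measurable_EFinP; exact: measurable_indic.
- exact: integral_ge0.
Qed.

(** Tested against a bump, the increment of [u] becomes a finite difference of the bump, that is a
    partial derivative of its sliding average [Phi]. The weak gradient turns this into the integral
    of [f * Phi], and Fubini with a translation gives back the line integral of [f]. *)
Lemma sobolev11_increment u g (i : 'I_n) (t : R) : 0 < t -> sobolev11 u g ->
  {ae mu, forall x, ((u (x + t *: e_ i) - u x)%:E =
    \int[leb]_r (g (x + r *: e_ i) ord0 i * \1_(`[0%R, t]%classic) r)%:E)%E}.
Proof.
move=> t0 [Iu Ig ug].
pose f x := g x ord0 i; have If : mu.-integrable setT (EFin \o f) by exact: Ig.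
have mf : measurable_fun setT f by case/integrableP : If => /measurable_EFinP.
pose K (p : 'rV[R]_n * measurableTypeR R) := (f (p.1 + p.2 *: e_ i) * \1_(`[0%R, t]%classic) p.2)%:E.
have IK : (mu \x leb)%E.-integrable setT K by exact: integrable_segment (ltW t0) If.
pose J x := fubini_F leb K x.
have IJ : mu.-integrable setT J by exact: integrable_fubini_F.
have Jf := integrable_ae measurableT IJ.
have IfJ : mu.-integrable setT (EFin \o (fine \o J)).
  have := IJ; apply: le_integrable => //.
    by apply/measurable_EFinP; apply: measurableT_comp => //; exact: (measurable_int _ IJ).
  by move=> x _ /=; case: (J x) => //= *; rewrite normr0 leey.
have Iut : mu.-integrable setT (EFin \o (fun x => u (x + t *: e_ i))).
  exact: (integrable_preserving (translation_preserving _) Iu).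
pose D x := u (x + t *: e_ i) - u x.
have ID : mu.-integrable setT (EFin \o D) by exact: (integrableB measurableT Iut Iu).
(* [fine] is harmless: the line integral [J x] is finite for almost every [x]. *)
suff : {ae mu, forall x, setT x -> D x - fine (J x) = 0}.
  apply: filterS2 Jf => x /(_ I) Jx /(_ I) /eqP; rewrite subr_eq0 => /eqP E.
  by rewrite -/(D x) E fineK.
apply: fundamental_lemma => //.
- by apply: integrable_box; exact: (integrableB measurableT ID IfJ).
- by move=> a b; exists a, b; rewrite setIT.
move=> a b k _.
have [Phi [tPhi pPhi iPhi]] := box_bump_sliding_average a b k i t0.
set phi := box_bump a b k in pPhi iPhi *.
have tphi : test_function phi by exact: box_bump_test.
have mphi := test_function_measurable tphi.
have bphi x : 0 <= phi x <= 1 by exact: box_bump_bound.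
have nphi x : `|phi x| <= 1 by rewrite ger0_norm; case/andP: (bphi x).
have Iphi (w : 'rV[R]_n -> R) : mu.-integrable setT (EFin \o w) ->
    mu.-integrable setT (fun x => (w x * phi x)%:E).
  by move=> Iw; apply: integrable_box_bump; exact: integrable_box.
have mseg x : measurable_fun setT (fun r : measurableTypeR R => phi (x - r *: e_ i)).
  apply: measurableT_comp => //; apply: measurable_rVB; first exact: measurable_cst.
  by apply: measurable_rVZ; [exact: measurable_id|exact: measurable_cst].
(* Each slice in [r] is translated by [r *: e_ i], which moves the averaging along the segment from
   [f] to [phi]. *)
have EJ : (\int[mu]_x (fine (J x) * phi x)%:E = \int[mu]_x (f x * Phi x)%:E)%E.
  pose K1 (p : 'rV[R]_n * measurableTypeR R) :=
    (f (p.1 + p.2 *: e_ i) * phi p.1 * \1_(`[0%R, t]%classic) p.2)%:E.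
  have IK1 : (mu \x leb)%E.-integrable setT K1.
    have := IK; apply: le_integrable => //.
      apply/measurable_EFinP; apply: measurable_funM; last exact: measurable_unit_slab.
      apply: measurable_funM; first exact: measurable_segment.
      by apply: measurableT_comp => //; exact: measurable_fst.
    move=> p _; rewrite /K1 /K !abse_EFin lee_fin !normrM ler_wpM2r//.
    by rewrite ler_piMr.
  pose K2 (p : 'rV[R]_n * measurableTypeR R) :=
    (f p.1 * phi (p.1 - p.2 *: e_ i) * \1_(`[0%R, t]%classic) p.2)%:E.
  have mK2 : measurable_fun setT (fun p : 'rV[R]_n * measurableTypeR R =>
      phi (p.1 - p.2 *: e_ i)).
    rewrite (_ : (fun p => _) = (fun p : 'rV[R]_n * measurableTypeR R => phi (p.1 + p.2 *: (- e_ i)))).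
      exact: measurable_segment.
    by apply/funext => p; rewrite scalerN.
  have IK2 : (mu \x leb)%E.-integrable setT K2.
    have := integrable_segment 0 (ltW t0) If; apply: le_integrable => //.
      apply/measurable_EFinP; apply: measurable_funM; last exact: measurable_unit_slab.
      apply: measurable_funM => //.
      by apply: measurableT_comp => //; exact: measurable_fst.
    move=> p _; rewrite /K2 !abse_EFin lee_fin !normrM ler_wpM2r//.
    by rewrite scaler0 addr0 ler_piMr.
  transitivity (\int[mu]_x \int[leb]_r K1 (x, r))%E.
    apply: ae_eq_integral => //.
    - by have /integrableP[] := Iphi _ IfJ.
    - exact: (measurable_int _ (integrable_fubini_F IK1)).
    apply: filterS2 Jf (ae_integrable1 IK) => x /(_ I) Jx Kx _.
    rewrite EFinM fineK// muleC -integralZl//.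
    by apply: eq_integral => r _; rewrite /K /K1 /= -EFinM; congr EFin; ring.
  rewrite (Fubini IK1).
  transitivity (\int[leb]_r \int[mu]_x K2 (x, r))%E.
    apply: eq_integral => r _.
    pose W (x : 'rV[R]_n) := f x * phi (x - r *: e_ i) * \1_(`[0%R, t]%classic) r.
    have IW : mu.-integrable setT (EFin \o W).
      have := If; apply: le_integrable => //.
        apply/measurable_EFinP; apply: measurable_funM => //.
        by apply: measurable_funM => //; exact: measurable_translate.
      move=> x _; rewrite !abse_EFin lee_fin /W !normrM.
      rewrite -mulrA ler_piMr// mulr_ile1//.
      by rewrite indicE normr_nat; case: (_ \in _).
    have := integral_preserving (translation_preserving (r *: e_ i)) IW.
    by move=> <-; apply: eq_integral => x _; rewrite /K1 /W /= addrK.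
  rewrite -(Fubini IK2); apply: eq_integral => x _.
  rewrite EFinM -iPhi -integralZl//.
    by apply: eq_integral => r _; rewrite /K2 /= -EFinM mulrA.
  apply/integrableP; split.
    apply/measurable_EFinP; apply: measurable_funM.
      exact: mseg.
    exact: measurable_indic.
  apply: (@le_lt_trans _ _ (\int[leb]_r (\1_(`[0%R, t]%classic) r)%:E)%E).
    apply: ge0_le_integral => //.
    - apply: measurableT_comp => //; apply/measurable_EFinP; apply: measurable_funM; first exact: mseg.
      exact: measurable_indic.
    - by apply/measurable_EFinP; exact: measurable_indic.
    - move=> r _; rewrite abse_EFin lee_fin normrM indicE normr_nat.
      by rewrite ler_piMl.
  by rewrite (integral_segment_indic (ltW t0)) ltry.
have IfPhi : mu.-integrable setT (fun x => (f x * Phi x)%:E).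
  have := integrableZl measurableT t If; apply: le_integrable => //.
    by apply/measurable_EFinP; apply: measurable_funM => //; exact: test_function_measurable.
  move=> x _; rewrite -EFinM !abse_EFin lee_fin !normrM mulrC ler_wpM2r//.
  have P0 : 0 <= Phi x.
    rewrite -lee_fin -iPhi; apply: integral_ge0 => r _; rewrite lee_fin mulr_ge0 ?indicE//.
    by case/andP: (bphi (x - r *: e_ i)).
  rewrite (ger0_norm P0) (ger0_norm (ltW t0)) -lee_fin -iPhi -(integral_segment_indic (ltW t0)).
  apply: ge0_le_integral => //.
  - move=> r _; rewrite lee_fin mulr_ge0 ?indicE//.
    by case/andP: (bphi (x - r *: e_ i)).
  - apply/measurable_EFinP; apply: measurable_funM; first exact: mseg.
    exact: measurable_indic.
  - by apply/measurable_EFinP; exact: measurable_indic.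
  - move=> r _; rewrite lee_fin ler_piMl ?indicE//.
    by case/andP: (bphi (x - r *: e_ i)).
have E1 : (\int[mu]_x (D x * phi x)%:E = \int[mu]_x (f x * Phi x)%:E)%E.
  apply: oppe_inj; rewrite -(ug i Phi tPhi).
  pose W x := u x * phi (x - t *: e_ i).
  have mu_ : measurable_fun setT u by case/integrableP : Iu => /measurable_EFinP.
  have IW : mu.-integrable setT (EFin \o W).
    have := Iu; apply: le_integrable => //.
      by apply/measurable_EFinP; apply: measurable_funM => //; exact: measurable_translate.
    by move=> x _; rewrite !abse_EFin lee_fin /W normrM ler_piMr.
  have EW : (\int[mu]_x (W x)%:E = \int[mu]_x (u (x + t *: e_ i) * phi x)%:E)%E.
    rewrite -(integral_preserving (translation_preserving (t *: e_ i)) IW).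
    by apply: eq_integral => x _; rewrite /W addrK.
  under [RHS]eq_integral do rewrite pPhi mulrBr EFinB.
  rewrite (integralB measurableT (Iphi _ Iu) IW) EW.
  have -> : (\int[mu]_x (D x * phi x)%:E =
      \int[mu]_x (u (x + t *: e_ i) * phi x)%:E - \int[mu]_x (u x * phi x)%:E)%E.
    rewrite -(integralB measurableT (Iphi _ Iut) (Iphi _ Iu)).
    by apply: eq_integral => x _; rewrite -EFinB -mulrBl.
  rewrite fin_num_oppeB 1?addeC//.
  exact: integrable_fin_num (Iphi _ Iu).
under eq_integral do rewrite mulrBl EFinB.
rewrite (integralB measurableT (Iphi _ ID) (Iphi _ IfJ)) E1 EJ subee//.
exact: integrable_fin_num.
Qed.

End increments.

(** * Differentiability in L1 *)

Section L1_differentiability.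
Variables (R : realType) (n : nat).
Local Notation mu := (lebesgue_rV R n).
Local Notation leb := (@lebesgue_measure R).
Implicit Types (u w : 'rV[R]_n -> R) (g : 'rV[R]_n -> 'rV[R]_n) (x z : 'rV[R]_n).
Local Notation e_ i := (delta_mx (ord0 : 'I_1) i : 'rV[R]_n).

(** Frechet differentiability at 0 of the map sending [z] to [u (. + z)] in L1. Being free of
    coordinates it survives reflections, and for integrable pairs it is equivalent to
    [sobolev11]. *)
Definition L1_differentiable u g := forall e : R, 0 < e ->
  exists2 r : R, 0 < r & forall z : 'rV[R]_n, `|z| < r ->
    (\int[mu]_x `|u (x + z) - u x - dotrV (g x) z|%:E <= (e * `|z|)%:E)%E.

Lemma normr_delta_le (i : 'I_n) (t : R) : `|t *: e_ i| <= `|t|.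
Proof.
apply: normr_rV_le => // j; rewrite !mxE eqxx /=.
by case: eqP => _; rewrite ?mulr1// mulr0 normr0.
Qed.

Lemma integrable_measurable (f : 'rV[R]_n -> R) :
  mu.-integrable setT (EFin \o f) -> measurable_fun setT f.
Proof. by case/integrableP => /measurable_EFinP. Qed.

(** The remainder is the integral of [f (x + r e_i) - f x] over [r] in [[0, t]]; by Tonelli and the
    continuity of translations each slice contributes at most [e]. *)
Lemma L1_quotient_pos u g (i : 'I_n) : sobolev11 u g -> forall e : R, 0 < e ->
  exists2 r : R, 0 < r & forall t, 0 < t < r ->
    (\int[mu]_x `|u (x + t *: e_ i) - u x - t * g x ord0 i|%:E <= (e * t)%:E)%E.
Proof.
move=> sug e e0; have [Iu Ig ug] := sug.
pose f x := g x ord0 i; have If : mu.-integrable setT (EFin \o f) by exact: Ig.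
have mf := integrable_measurable If; have muu := integrable_measurable Iu.
have [r r0 fr] := integrable_translation_continuous If e0.
exists r => // t /andP[t0 tr].
pose F (p : 'rV[R]_n * measurableTypeR R) :=
  (`|f (p.1 + p.2 *: e_ i) - f p.1| * \1_(`[0%R, t]%classic) p.2)%:E.
have mF : measurable_fun setT F.
  apply/measurable_EFinP; apply: measurable_funM; last exact: measurable_unit_slab.
  apply: measurableT_comp => //; apply: measurable_funB; first exact: measurable_segment.
  by apply: measurableT_comp => //; exact: measurable_fst.
have F0 p : (0 <= F p)%E by rewrite lee_fin mulr_ge0 ?indicE.
have IK := integrable_segment (e_ i) (ltW t0) If.
have IK0 := integrable_segment 0 (ltW t0) If.
apply: (@le_trans _ _ (\int[mu]_x \int[leb]_r F (x, r))%E).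
  apply: ae_ge0_le_integral => //.
  - apply/measurable_EFinP; apply: measurableT_comp => //; apply: measurable_funB.
      by apply: measurable_funB => //; exact: measurable_translate.
    exact: measurable_funM.
  - by move=> x _; apply: integral_ge0.
  - exact: (measurable_fun_fubini_tonelli_F F).
  have := sobolev11_increment i t0 sug.
  move=> H; apply: filterS2 (filterI (ae_integrable1 IK) (ae_integrable1 IK0)) H => x [Kx K0x] Ex _.
  have E0 : (u (x + t *: e_ i) - u x - t * g x ord0 i)%:E =
     (\int[leb]_r ((f (x + r *: e_ i) * \1_(`[0%R, t]%classic) r)%:E -
        (f (x + r *: 0) * \1_(`[0%R, t]%classic) r)%:E))%E.
    rewrite (integralB _ Kx K0x)// EFinB Ex; congr (_ - _)%E.
    under eq_integral do rewrite /= scaler0 addr0 EFinM.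
    rewrite integralZl//; last first.
      apply/integrableP; split; first by apply/measurable_EFinP; exact: measurable_indic.
      under eq_integral do rewrite gee0_abs ?lee_fin ?indicE//.
      by under eq_integral do rewrite -indicE; rewrite (integral_segment_indic (ltW t0)) ltry.
    by rewrite (integral_segment_indic (ltW t0)) -EFinM mulrC.
  rewrite -abse_EFin E0; apply: le_trans (le_abse_integral _ _ _) _ => //.
    by apply: emeasurable_funB; [exact: (measurable_int _ Kx)|exact: (measurable_int _ K0x)].
  rewrite le_eqVlt; apply/orP; left; apply/eqP; apply: eq_integral => r' _.
  by rewrite scaler0 addr0 -EFinB abse_EFin /F /= -mulrBl normrM indicE normr_nat.
rewrite (fubini_tonelli F mF F0).
apply: (@le_trans _ _ (\int[leb]_r (e%:E * (\1_(`[0%R, t]%classic) r)%:E))%E); last first.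
  rewrite ge0_integralZl//.
  - by rewrite (integral_segment_indic (ltW t0)).
  - by apply/measurable_EFinP; exact: measurable_indic.
  - by rewrite lee_fin ltW.
apply: ge0_le_integral => //.
- by move=> s _; apply: integral_ge0.
- exact: (measurable_fun_fubini_tonelli_G F).
- by apply/measurable_EFinP; apply: measurable_funM => //; exact: measurable_indic.
move=> s _; rewrite /F /=.
rewrite (eq_integral (fun x : 'rV[R]_n => (\1_(`[0%R, t]%classic) s)%:E * `|f (x + s *: e_ i) - f x|%:E)%E); last first.
  by move=> x _; rewrite mulrC EFinM.
rewrite ge0_integralZl//; last first.
  apply/measurable_EFinP; apply: measurableT_comp => //; apply: measurable_funB => //.
  exact: measurable_translate.
rewrite muleC indicE; have [/set_mem|_] := boolP (s \in _); last by rewrite !mule0.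
rewrite /= in_itv /= => /andP[s0 st]; rewrite !mule1; apply: fr.
by apply: le_lt_trans (normr_delta_le _ _) _; rewrite ger0_norm// (le_lt_trans st).
Qed.

(** For [t < 0] the translation by [- t e_i] reduces to the positive step [- t], at the cost [V] of
    comparing [g] at the old and the new base point. *)
Lemma L1_quotient u g (i : 'I_n) : sobolev11 u g -> forall e : R, 0 < e ->
  exists2 r : R, 0 < r & forall t, `|t| < r ->
    (\int[mu]_x `|u (x + t *: e_ i) - u x - t * g x ord0 i|%:E <= (e * `|t|)%:E)%E.
Proof.
move=> sug e e0; have [Iu Ig ug] := sug; have e2 : 0 < e / 2 by lra.
have If := Ig i; have muu := integrable_measurable Iu.
have mf : measurable_fun setT (fun x => g x ord0 i) by exact: integrable_measurable If.
have [r r0 ur] := L1_quotient_pos i sug e2.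
have [s s0 gs] := integrable_translation_continuous If e2.
exists (minr r s); first by rewrite lt_min r0.
move=> t; rewrite lt_min => /andP[tr ts].
have [t0|t0|->] := ltgtP t 0; last first.
- by rewrite integral0_eq ?normr0 ?mulr0// => x _; rewrite scale0r addr0 subrr mul0r subrr normr0.
- rewrite gtr0_norm//; apply: le_trans (ur t _) _; first by rewrite t0 -(gtr0_norm t0).
  by rewrite lee_fin ler_pM2r//; lra.
have t0' : 0 < - t by rewrite oppr_gt0.
have tr' : - t < r by rewrite -(ltr0_norm t0).
pose W x := u (x + (- t) *: e_ i) - u x - (- t) * g x ord0 i.
pose V x := (- t) * (g (x + (- t) *: e_ i) ord0 i - g x ord0 i).
have mW : measurable_fun setT W.
  apply: measurable_funB; last exact: measurable_funM.
  by apply: measurable_funB => //; exact: measurable_translate.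
have mV : measurable_fun setT V.
  apply: measurable_funM => //; apply: measurable_funB => //.
  exact: (measurable_translate (f := fun x => g x ord0 i)).
have mG : measurable_fun setT (fun x => u (x + t *: e_ i) - u x - t * g x ord0 i).
  apply: measurable_funB; last exact: measurable_funM.
  by apply: measurable_funB => //; exact: measurable_translate.
rewrite -(integral_translate_norm ((- t) *: e_ i) mG).
rewrite (eq_integral (fun x : 'rV[R]_n => `|V x + - W x|%:E)); last first.
  move=> x _; congr (`|_|%:E); rewrite /V /W.
  have -> : x + (- t) *: e_ i + t *: e_ i = x by rewrite -addrA -scalerDl addNr scale0r addr0.
  ring.
have mNW : measurable_fun setT (fun x => - W x) by exact: measurableT_comp.
apply: le_trans (integral_normrD _ mV mNW) _.
rewrite ltr0_norm// [e](_ : _ = e / 2 + e / 2); last by lra.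
rewrite mulrDl EFinD; apply: leeD.
  rewrite integral_normrZ; last first.
    apply: measurable_funB => //; exact: (measurable_translate (f := fun x => g x ord0 i)).
  rewrite gtr0_norm// (mulrC (e / 2)) EFinM; apply: lee_wpmul2l; first by rewrite lee_fin ltW.
  apply: gs.
  by apply: le_lt_trans (normr_delta_le _ _) _; rewrite normrN.
under eq_integral do rewrite normrN.
by apply: ur; rewrite t0'.
Qed.

(** The coordinates of [z] are added one at a time, [tr m z] keeping the first [m]. A further
    coordinate costs a one-dimensional remainder at a translated point and the change of one
    component of [g] under a translation, hence the thirds of [e]. *)
Lemma sobolev11_L1_differentiable u g : sobolev11 u g -> L1_differentiable u g.
Proof.
move=> sug; have [Iu Ig ug] := sug; have muu := integrable_measurable Iu.
have mg i : measurable_fun setT (fun x => g x ord0 i) by exact: integrable_measurable (Ig i).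
pose tr m z : 'rV[R]_n := \row_j (if (j < m)%N then z ord0 j else 0).
have ntr m z : `|tr m z| <= `|z|.
  apply: normr_rV_le => // j; rewrite mxE; case: ifP => _; last by rewrite normr0.
  exact: coord_le_norm.
suff H m : (m <= n)%N -> forall e : R, 0 < e -> exists2 r : R, 0 < r &
    forall z : 'rV[R]_n, `|z| < r ->
    (\int[mu]_x `|u (x + tr m z) - u x - dotrV (g x) (tr m z)|%:E <= (e * `|z|)%:E)%E.
  move=> e e0; have [r r0 hr] := H n (leqnn n) e e0; exists r => // z zr.
  have E : z = tr n z by apply/rowP => j; rewrite mxE ltn_ord.
  by have := hr z zr; rewrite -E.
elim: m => [_ e e0|m IH mn e e0].
  exists 1 => // z _; have -> : tr 0%N z = 0 by apply/rowP => j; rewrite !mxE.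
  rewrite integral0_eq; first by rewrite lee_fin mulr_ge0// ltW.
  move=> x _; by rewrite addr0 subrr dotrVC dotrV0l subrr normr0.
have e3 : 0 < e / 3 by lra.
pose k := Ordinal mn.
have [r1 r10 h1] := IH (ltnW mn) _ e3.
have [r2 r20 h2] := L1_quotient k sug e3.
have [r3 r30 h3] := integrable_translation_continuous (Ig k) e3.
exists (minr r1 (minr r2 r3)); first by rewrite !lt_min r10 r20.
move=> z; rewrite !lt_min => /and3P[z1 z2 z3].
set y := tr m z; set c := z ord0 k.
have trS : tr m.+1 z = y + c *: e_ k.
  apply/rowP => j; rewrite !mxE eqxx /= ltnS leq_eqVlt.
  have [jk|jk] := eqVneq (nat_of_ord j) m.
    have -> : j = k by exact: val_inj.
    by rewrite eqxx ltnn add0r mulr1.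
  rewrite (_ : (j == k) = false) ?mulr0 ?addr0//.
  by apply/negbTE; apply: contra jk => /eqP ->.
have cz : `|c| <= `|z| by exact: coord_le_norm.
pose A x := u (x + c *: e_ k) - u x - c * g x ord0 k.
pose B x := c * (g (x + y) ord0 k - g x ord0 k).
pose C x := u (x + y) - u x - dotrV (g x) y.
have mA : measurable_fun setT A.
  apply: measurable_funB; last exact: measurable_funM.
  by apply: measurable_funB => //; exact: measurable_translate.
have mgy : measurable_fun setT (fun x => g (x + y) ord0 k).
  exact: (measurable_translate (f := fun x => g x ord0 k)).
have mB : measurable_fun setT B by apply: measurable_funM => //; exact: measurable_funB.
have mC : measurable_fun setT C.
  apply: measurable_funB; first by apply: measurable_funB => //; exact: measurable_translate.
  apply: measurable_dotrV; last exact: measurable_cst.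
  by apply/measurable_fun_rVP => j; exact: mg.
rewrite trS (eq_integral (fun x : 'rV[R]_n => `|A (x + y) + (B x + C x)|%:E)); last first.
  move=> x _; congr (`|_|%:E); rewrite /A /B /C dotrVDr dotrVZr dotrV_delta addrA; ring.
apply: le_trans (integral_normrD _ _ _) _; [exact: measurable_translate|exact: measurable_funD|].
rewrite [e](_ : _ = e / 3 + (e / 3 + e / 3)); last by lra.
rewrite !mulrDl !EFinD; apply: leeD.
  rewrite (integral_translate_norm y mA); apply: le_trans (h2 c _) _.
    exact: le_lt_trans z2.
  by rewrite lee_fin ler_pM2l.
apply: le_trans (integral_normrD _ mB mC) _; apply: leeD; last exact: h1.
rewrite integral_normrZ; last exact: measurable_funB.
apply: (@le_trans _ _ (`|c|%:E * (e / 3)%:E)%E).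
  rewrite lee_wpmul2l//; apply: h3; exact: le_lt_trans (ntr m z) _.
by rewrite -EFinM lee_fin mulrC ler_pM2l.
Qed.

Lemma test_function_partial (phi : 'rV[R]_n -> R) i : test_function phi ->
  test_function (partial i phi).
Proof.
move=> [sphi cphi]; split.
  by move=> s; have := sphi (rcons s i); rewrite foldr_rcons.
have cl : closed (closure [set x | phi x != 0]) by exact: closed_closure.
apply: (subclosed_compact _ cphi); first exact: closed_closure.
rewrite [X in _ `<=` X](closure_id _).1//; apply: closureS => x /=.
apply: contra_neqP => xcl; rewrite (@partial_outside _ _ phi i (~` closure [set x | phi x != 0]))//.
  by rewrite openC.
move=> y ycl; apply/eqP; apply: contra_notT ycl => py; exact: subset_closure.
Qed.

Lemma test_function_bounded (phi : 'rV[R]_n -> R) : test_function phi ->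
  exists M : R, forall x, `|phi x| <= M.
Proof.
move=> tphi; have [sphi cphi] := tphi; have cont := test_function_continuous tphi.
have : compact [set phi x | x in closure [set x | phi x != 0]].
  by apply: continuous_compact => //; exact: continuous_subspaceT.
move=> /compact_bounded[M [_ hM]]; exists (`|M| + 1) => x.
have [->|px] := eqVneq (phi x) 0; first by rewrite normr0 addr_ge0.
apply: hM; first by rewrite ltr_pwDr// ler_norm.
by exists x => //; exact: subset_closure.
Qed.

Lemma differential_partial (phi : 'rV[R]_n -> R) x v : differentiable phi x ->
  'D_v phi x = \sum_(i < n) v ord0 i * partial i phi x.
Proof.
move=> dphi; rewrite deriveE// {1}(row_sum_delta v) linear_sum; apply: eq_bigr => i _.
by rewrite linearZ /= /partial deriveE.
Qed.

Lemma is_derive_line (phi : 'rV[R]_n -> R) x v (r : R) : differentiable phi (x + r *: v) ->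
  is_derive r 1 (fun r : R => phi (x + r *: v)) ('D_v phi (x + r *: v)).
Proof.
move=> dphi; apply: cvg_is_derive.
have /cvg_ex[l hl] : derivable phi (x + r *: v) v by exact: diff_derivable.
have -> : 'D_v phi (x + r *: v) = l by apply: cvg_lim => //; exact: hl.
have -> // : (fun h : R => h^-1 *: (((fun r : R => phi (x + r *: v)) \o shift r) (h *: 1) -
    phi (x + r *: v))) = (fun h : R => h^-1 *: ((phi \o shift (x + r *: v)) (h *: v) - phi (x + r *: v))).
apply/funext => h /=; congr (_ *: (phi _ - _)).
by rewrite [h *: 1]mulr1 scalerDl addrCA.
Qed.

Lemma test_function_lipschitz (phi : 'rV[R]_n -> R) : test_function phi ->
  exists2 L : R, 0 <= L & forall x y, `|phi x - phi y| <= L * enorm (x - y).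
Proof.
move=> tphi; have [sphi cphi] := tphi.
have /choice[M hM] : forall i : 'I_n, exists M : R, forall x, `|partial i phi x| <= M.
  by move=> i; apply: test_function_bounded; exact: test_function_partial.
have M0 i : 0 <= M i by apply: le_trans (hM i 0).
exists (\sum_i M i); first exact: sumr_ge0.
move=> x y; set v := x - y.
have d (r : R) : is_derive r 1 (fun r : R => phi (y + r *: v)) ('D_v phi (y + r *: v)).
  exact: is_derive_line (sphi [::] _).
have cc : {within `[0, 1], continuous (fun r : R => phi (y + r *: v))}.
  apply: continuous_subspaceT => r; apply: differentiable_continuous.
  by apply/derivable1_diffP; exact: (@ex_derive _ _ _ _ _ _ _ (d r)).
have [c _] := @MVT R (fun r => phi (y + r *: v)) (fun r => 'D_v phi (y + r *: v)) 0 1 ltr01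
  (fun r _ => d r) cc.
rewrite scale1r scale0r addr0 subr0 mulr1 /v addrCA subrr addr0 => ->.
rewrite differential_partial; last exact: (sphi [::]).
apply: le_trans (ler_norm_sum _ _ _) _; rewrite mulr_suml; apply: ler_sum => i _.
rewrite normrM mulrC ler_pM//; exact: coord_le_enorm.
Qed.

Lemma L1_quotient_integrable u (v : 'rV[R]_n) (t : R) : mu.-integrable setT (EFin \o u) ->
  mu.-integrable setT (EFin \o (fun x => (u (x + t *: v) - u x) / t)).
Proof.
move=> Iu.
have Iv := integrable_preserving (translation_preserving (t *: v)) Iu.
have := integrableZl measurableT t^-1 (integrableB measurableT Iv Iu).
by apply: eq_integrable => // x _ /=; rewrite -EFinB -EFinM mulrC.
Qed.

Lemma bounded_mul_integrable u (psi : 'rV[R]_n -> R) (M : R) :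
  mu.-integrable setT (EFin \o u) -> measurable_fun setT psi ->
  (forall x, u x != 0 -> `|psi x| <= M) ->
  mu.-integrable setT (fun x => (u x * psi x)%:E).
Proof.
move=> Iu mpsi psiM; have muu := integrable_measurable Iu.
have := integrableZl measurableT M Iu; apply: le_integrable => //.
  by apply/measurable_EFinP; exact: measurable_funM.
move=> x _; rewrite -EFinM !abse_EFin lee_fin !normrM mulrC.
have [->|ux] := eqVneq (u x) 0; first by rewrite normr0 !mulr0.
by rewrite ler_wpM2r//; apply: le_trans (psiM x ux) (ler_norm _).
Qed.

Lemma L1_cvg_integral (F_ : nat -> 'rV[R]_n -> R) (F : 'rV[R]_n -> R) :
  (forall k, mu.-integrable setT (EFin \o F_ k)) -> mu.-integrable setT (EFin \o F) ->
  (fun k => \int[mu]_x `|F_ k x - F x|%:E)%E @ \oo --> 0%E ->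
  (fun k => \int[mu]_x (F_ k x)%:E)%E @ \oo --> (\int[mu]_x (F x)%:E)%E.
Proof.
move=> IF_ IF FF.
have f1 : (\int[mu]_x (F x)%:E)%E \is a fin_num by exact: integrable_fin_num IF.
have f2 k : (\int[mu]_x (F_ k x)%:E)%E \is a fin_num by exact: integrable_fin_num (IF_ k).
rewrite -(fineK f1); apply/fine_cvgP; split; first by apply: nearW.
apply/cvgrPdist_le => e e0.
have /cvge0P /(_ _ e0)[|N hN] := FF; first by move=> k; exact: integral_ge0.
exists N => // k /= Nk; rewrite -fineB// -lee_fin.
apply: le_trans (hN k Nk).
have IB := integrableB measurableT IF (IF_ k).
rewrite -(integralB measurableT IF (IF_ k)).
have := EFin_normr_Rintegral (f := fun x => F x - F_ k x) measurableT.
rewrite /Rintegral => -> //.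
apply: le_trans (le_abse_integral _ measurableT (measurable_int _ IB)) _.
by rewrite le_eqVlt; apply/orP; left; apply/eqP; apply: eq_integral => x _; rewrite -EFinB abse_EFin distrC.
Qed.

(* The test function psi need only be differentiable where u does not vanish. *)
Lemma L1_quotient_by_parts u w (psi psi' : 'rV[R]_n -> R) (v : 'rV[R]_n) (t_ : nat -> R) (M L : R) :
  mu.-integrable setT (EFin \o u) -> mu.-integrable setT (EFin \o w) ->
  (forall k, t_ k != 0) ->
  (fun k => \int[mu]_x `|(u (x + t_ k *: v) - u x) / t_ k - w x|%:E)%E @ \oo --> 0%E ->
  measurable_fun setT psi -> (forall x, `|psi x| <= M) ->
  (forall x t, `|psi (x + t *: v) - psi x| <= L * `|t|) ->
  measurable_fun setT psi' ->
  (forall x, u x != 0 -> (fun k => (psi (x - t_ k *: v) - psi x) / t_ k) @ \oo --> - psi' x) ->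
  (\int[mu]_x (u x * psi' x)%:E = - \int[mu]_x (w x * psi x)%:E)%E.
Proof.
move=> Iu Iw t0 qw mpsi psiM psiL mpsi' dpsi.
have muu := integrable_measurable Iu; have mw := integrable_measurable Iw.
pose q k x := (u (x + t_ k *: v) - u x) / t_ k.
pose p k x := (psi (x - t_ k *: v) - psi x) / t_ k.
have Iq k : mu.-integrable setT (EFin \o q k) by exact: L1_quotient_integrable.
have Ib f : mu.-integrable setT (EFin \o f) -> mu.-integrable setT (fun x => (f x * psi x)%:E).
  by move=> If; apply: bounded_mul_integrable If mpsi _ => x _; exact: psiM.
have mp k : measurable_fun setT (p k).
  apply: measurable_funM => //; apply: measurable_funB => //.
  have := measurable_translate (- (t_ k *: v)) mpsi; exact.
have pL k x : `|p k x| <= L.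
  rewrite /p normrM normfV ler_pdivrMr ?normr_gt0//.
  by have := psiL x (- t_ k); rewrite normrN scaleNr.
have Ip k : mu.-integrable setT (fun x => (u x * p k x)%:E).
  by apply: bounded_mul_integrable Iu (mp k) _ => x _; exact: pL.
(* Summation by parts for the difference quotient: the shift passes from [u] to [psi]. *)
have E k : (\int[mu]_x (u x * p k x)%:E = \int[mu]_x (q k x * psi x)%:E)%E.
  pose W x := u x * psi (x - t_ k *: v).
  have IW : mu.-integrable setT (EFin \o W).
    apply: bounded_mul_integrable Iu _ (fun x _ => psiM _).
    exact: (measurable_translate (- (t_ k *: v)) mpsi).
  have EW : (\int[mu]_x (W x)%:E = \int[mu]_x (u (x + t_ k *: v) * psi x)%:E)%E.
    rewrite -(integral_preserving (translation_preserving (t_ k *: v)) IW).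
    by apply: eq_integral => x _; rewrite /W addrK.
  have Iut := Ib _ (integrable_preserving (translation_preserving (t_ k *: v)) Iu).
  transitivity ((t_ k)^-1%:E * (\int[mu]_x (W x)%:E - \int[mu]_x (u x * psi x)%:E))%E.
    rewrite -(integralB measurableT IW (Ib _ Iu)) -integralZl//; last exact: (integrableB measurableT IW (Ib _ Iu)).
    by apply: eq_integral => x _; rewrite -EFinB -EFinM /W /p; congr EFin; ring.
  rewrite EW -(integralB measurableT Iut (Ib _ Iu)) -integralZl//; last exact: (integrableB measurableT Iut (Ib _ Iu)).
  by apply: eq_integral => x _; rewrite -EFinB -EFinM /q /=; congr EFin; ring.
have L0 : 0 <= `|L| by [].
have [I1 lim1] : mu.-integrable setT (fun x => (u x * - psi' x)%:E) /\
    (fun k => \int[mu]_x (u x * p k x)%:E)%E @ \oo --> (\int[mu]_x (u x * - psi' x)%:E)%E.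
  have [] // := @dominated_convergence _ _ _ mu setT measurableT
    (fun k x => (u x * p k x)%:E) (fun x => (u x * - psi' x)%:E) (fun x => (`|L| * `|u x|)%:E).
  - by move=> k; exact: (measurable_int _ (Ip k)).
  - by apply/measurable_EFinP; apply: measurable_funM => //; exact: measurableT_comp.
  - apply: aeW => x _; apply: cvg_EFin; first by apply: nearW.
    have [->|ux] := eqVneq (u x) 0.
      by rewrite mul0r; apply: cvg_near_cst; apply: nearW => k /=; rewrite mul0r.
    by apply: cvgMr; exact: dpsi.
  - have := integrableZl measurableT `|L| (integrable_abse Iu).
    by apply: eq_integrable => // x _; rewrite EFinM.
  - apply: aeW => x k _; rewrite abse_EFin lee_fin normrM mulrC ler_wpM2r//.
    by apply: le_trans (pL k x) (ler_norm _).
have lim2 : (fun k => \int[mu]_x (q k x * psi x)%:E)%E @ \oo --> (\int[mu]_x (w x * psi x)%:E)%E.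
  apply: L1_cvg_integral; [by move=> k; exact: Ib|exact: Ib|].
  apply/cvge0P => [k|e e0]; first exact: integral_ge0.
  have M1 : 0 < `|M| + 1 by rewrite ltr_wpDl.
  have /cvge0P /(_ _ (divr_gt0 e0 M1))[|N hN] := qw; first by move=> k; exact: integral_ge0.
  exists N => k Nk.
  apply: (@le_trans _ _ (\int[mu]_x `|(`|M| + 1) * (q k x - w x)|%:E)%E).
    apply: ge0_le_integralT.
    - apply: measurableT_comp => //; apply: measurable_funB; apply: measurable_funM => //.
      exact: integrable_measurable (Iq k).
    - apply: measurableT_comp => //; apply: measurable_funM => //; apply: measurable_funB => //.
      exact: integrable_measurable (Iq k).
    - move=> x; rewrite normr_ge0 /= -mulrBl !normrM mulrC ler_wpM2r//.
      by rewrite (gtr0_norm M1) (le_trans (psiM x))// (le_trans (ler_norm _))// lerDl.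
  rewrite integral_normrZ; last first.
    by apply: measurable_funB => //; exact: integrable_measurable (Iq k).
  rewrite (gtr0_norm M1); apply: le_trans (lee_wpmul2l _ (hN k Nk)) _; first by rewrite lee_fin ltW.
  by rewrite -EFinM mulrC divfK// gt_eqF.
have EE : (\int[mu]_x (u x * - psi' x)%:E = \int[mu]_x (w x * psi x)%:E)%E.
  apply: (cvg_unique _ lim1); first exact: ereal_hausdorff.
  move: lim2; rewrite (_ : (fun k => \int[mu]_x (q k x * psi x)%:E)%E =
    (fun k => \int[mu]_x (u x * p k x)%:E)%E)//.
  by apply/funext => k; rewrite E.
rewrite -EE -[RHS]mulN1e -integralZl//.
by apply: eq_integral => x _; rewrite -EFinM; congr EFin; ring.
Qed.

End L1_differentiability.

(** * Absolute values, reflections and cut-offs of Sobolev functions *)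

Section sobolev11_calculus.
Variables (R : realType) (n : nat).
Local Notation mu := (lebesgue_rV R n).
Implicit Types (u w : 'rV[R]_n -> R) (g h : 'rV[R]_n -> 'rV[R]_n) (x : 'rV[R]_n).
Local Notation e_ i := (delta_mx (ord0 : 'I_1) i : 'rV[R]_n).

Lemma derivative_along_sequence (phi : 'rV[R]_n -> R) x v (t_ : nat -> R) :
  differentiable phi x -> (forall k, t_ k != 0) -> t_ @ \oo --> (0 : R) ->
  (fun k => (phi (x - t_ k *: v) - phi x) / t_ k) @ \oo --> - 'D_v phi x.
Proof.
move=> dphi t0 tc.
have /cvg_ex[l hl] : derivable phi x v by exact: diff_derivable.
have -> : 'D_v phi x = l by apply: cvg_lim => //; exact: hl.
apply/cvgrPdist_lt => e e0.
have /cvgrPdist_lt /(_ e e0) [r /= r0 hr] := hl.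
have /cvgrPdist_lt /(_ r r0) := tc; apply: filterS => k tk.
have := hr (- t_ k); rewrite /= sub0r normrN oppr_eq0.
rewrite /= sub0r in tk; move=> /(_ tk (t0 k)).
rewrite -normrN; congr (`|_| < e).
by rewrite scaleNr [- _ + x]addrC invrN scaleNr /GRing.scale /= mulrC; ring.
Qed.

Lemma L1_quotient_cvg u (w : 'rV[R]_n -> R) (v : 'rV[R]_n) (t_ : nat -> R) (b : nat -> R) :
  measurable_fun setT u -> measurable_fun setT w -> (forall k, t_ k != 0) ->
  (forall k, (\int[mu]_x `|u (x + t_ k *: v) - u x - t_ k * w x|%:E <= (b k * `|t_ k|)%:E)%E) ->
  forall k, (\int[mu]_x `|(u (x + t_ k *: v) - u x) / t_ k - w x|%:E <= (b k)%:E)%E.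
Proof.
move=> mu_ mw t0 H k.
rewrite (eq_integral (fun x : 'rV[R]_n => `|(t_ k)^-1 * (u (x + t_ k *: v) - u x - t_ k * w x)|%:E)%E); last first.
  by move=> x _; congr (`|_|%:E); rewrite [RHS]mulrBr mulKf// mulrC.
rewrite integral_normrZ; last first.
  apply: measurable_funB; last exact: measurable_funM.
  by apply: measurable_funB => //; exact: measurable_translate.
apply: le_trans (lee_wpmul2l _ (H k)) _; first by rewrite lee_fin.
by rewrite -EFinM lee_fin normfV mulrC mulfK// normr_eq0.
Qed.

Lemma L1_differentiable_quotient u g (v : 'rV[R]_n) (t_ : nat -> R) :
  measurable_fun setT u -> measurable_fun setT g -> L1_differentiable u g ->
  (forall k, t_ k != 0) -> t_ @ \oo --> (0 : R) ->
  (fun k => \int[mu]_x `|(u (x + t_ k *: v) - u x) / t_ k - dotrV (g x) v|%:E)%E @ \oo --> 0%E.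
Proof.
move=> mu_ mg ug t0 tc.
apply/cvge0P => [k|e e0]; first exact: integral_ge0.
have v1 : 0 < `|v| + 1 by rewrite ltr_wpDl.
have [r r0 hr] := ug _ (divr_gt0 e0 v1).
have /cvgrPdist_lt /(_ _ (divr_gt0 r0 v1)) [N _ hN] := tc.
exists N => k Nk; have := hN k Nk; rewrite sub0r normrN => tk.
have mdot : measurable_fun setT (fun x => dotrV (g x) v).
  by apply: measurable_dotrV => //; exact: measurable_cst.
have tvr : `|t_ k *: v| < r.
  rewrite normrZ; apply: (@le_lt_trans _ _ (`|t_ k| * (`|v| + 1))).
    by rewrite ler_wpM2l// lerDl.
  by rewrite -ltr_pdivlMr.
apply: (@L1_quotient_cvg u _ v (fun=> t_ k) (fun=> e)) => // _.
under eq_integral do rewrite -dotrVZr.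
apply: le_trans (hr _ tvr) _; rewrite lee_fin normrZ mulrCA mulrC ler_wpM2r//.
by rewrite mulrAC ler_pdivrMr// ler_pM2l// lerDl.
Qed.

Lemma test_by_parts u w (v : 'rV[R]_n) (t_ : nat -> R) (phi : 'rV[R]_n -> R) :
  mu.-integrable setT (EFin \o u) -> mu.-integrable setT (EFin \o w) ->
  (forall k, t_ k != 0) -> t_ @ \oo --> (0 : R) ->
  (fun k => \int[mu]_x `|(u (x + t_ k *: v) - u x) / t_ k - w x|%:E)%E @ \oo --> 0%E ->
  test_function phi ->
  (\int[mu]_x (u x * 'D_v phi x)%:E = - \int[mu]_x (w x * phi x)%:E)%E.
Proof.
move=> Iu Iw t0 tc qw tphi; have [sphi _] := tphi.
have [M hM] := test_function_bounded tphi.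
have [L L0 hL] := test_function_lipschitz tphi.
apply: (@L1_quotient_by_parts _ _ u w phi _ v t_ M (L * enorm v)) => //.
- exact: test_function_measurable.
- move=> x t; apply: le_trans (hL _ _) _.
  by rewrite addrC addKr enormZ mulrCA mulrC.
- rewrite (_ : (fun x => _) = fun x => \sum_(i < n) v ord0 i * partial i phi x).
    apply: measurable_sum => i; apply: measurable_funM => //.
    by apply: test_function_measurable; exact: test_function_partial.
  by apply/funext => x; rewrite differential_partial//; exact: (sphi [::]).
- by move=> x _; apply: derivative_along_sequence => //; exact: (sphi [::]).
Qed.

Lemma harmonic_neq0 (k : nat) : (k.+1%:R : R)^-1 != 0.
Proof. by rewrite invr_eq0. Qed.

Lemma sobolev11_measurable u g : sobolev11 u g ->
  measurable_fun setT u /\ measurable_fun setT g.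
Proof.
move=> [Iu Ig _]; split; first exact: integrable_measurable Iu.
by apply/measurable_fun_rVP => i; exact: integrable_measurable (Ig i).
Qed.

Lemma L1_differentiable_sobolev11 u g : mu.-integrable setT (EFin \o u) ->
  (forall i, mu.-integrable setT (fun x => (g x ord0 i)%:E)) ->
  L1_differentiable u g -> sobolev11 u g.
Proof.
move=> Iu Ig ug; split => // i phi tphi.
have mg : measurable_fun setT g.
  by apply/measurable_fun_rVP => j; exact: integrable_measurable (Ig j).
apply: (@test_by_parts u (fun x => g x ord0 i) (e_ i) (fun k => k.+1%:R^-1)) => //.
- exact: Ig.
- exact: cvg_harmonic.
- under eq_fun do under eq_integral do rewrite -dotrV_delta.
  apply: L1_differentiable_quotient => //.
  + exact: integrable_measurable Iu.
  + exact: cvg_harmonic.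
Qed.

(** Dominated convergence with varying dominating functions that converge in L1: the truncation of
    [|b_k - w|] at [2 |f|] tends to 0 in the usual way, and the excess is at most [|q_k - f|]. *)
Lemma L1_cvg_pratt (b_ q_ : nat -> 'rV[R]_n -> R) w (f : 'rV[R]_n -> R) :
  (forall k, measurable_fun setT (b_ k)) -> (forall k, measurable_fun setT (q_ k)) ->
  measurable_fun setT w -> mu.-integrable setT (EFin \o f) ->
  (forall k x, `|b_ k x| <= `|q_ k x|) -> (forall x, `|w x| <= `|f x|) ->
  {ae mu, forall x, b_ ^~ x @ \oo --> w x} ->
  (fun k => \int[mu]_x `|q_ k x - f x|%:E)%E @ \oo --> 0%E ->
  (fun k => \int[mu]_x `|b_ k x - w x|%:E)%E @ \oo --> 0%E.
Proof.
move=> mb mq mw If bq wf bw qf.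
have mf := integrable_measurable If.
pose m k x := minr `|b_ k x - w x| (2 * `|f x|).
have m0 k x : 0 <= m k x by rewrite le_min normr_ge0 mulr_ge0.
have mm k : measurable_fun setT (m k).
  apply: measurable_minr; first by apply: measurableT_comp => //; exact: measurable_funB.
  by apply: measurable_funM => //; exact: measurableT_comp.
have lim1 : (fun k => \int[mu]_x (m k x)%:E)%E @ \oo --> 0%E.
  have [] // := @dominated_convergence _ _ _ mu setT measurableT
    (fun k x => (m k x)%:E) (cst 0%E) (fun x => (2 * `|f x|)%:E).
  - by move=> k; apply/measurable_EFinP.
  - apply: filterS bw => x bwx _; apply: cvg_EFin; first by apply: nearW.
    apply: (@squeeze_cvgr _ _ _ _ (cst 0) (fun k => `|b_ k x - w x|)).
    + by apply: nearW => k /=; rewrite m0 /m ge_min lexx.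
    + exact: cvg_cst.
    + rewrite -(normr0 R); apply: cvg_norm; rewrite -(subrr (w x)).
      by apply: cvgB => //; exact: cvg_cst.
  - have := integrableZl measurableT 2 (integrable_abse If).
    by apply: eq_integrable => // x _; rewrite EFinM.
  - by apply: aeW => x k _; rewrite abse_EFin lee_fin ger0_norm ?m0// /m ge_min lexx orbT.
  by rewrite integral0.
apply/cvge0P => [k|e e0]; first exact: integral_ge0.
have e2 : 0 < e / 2 by lra.
have /cvge0P /(_ _ e2)[|N1 h1] := lim1; first by move=> k; apply: integral_ge0 => x _; rewrite lee_fin.
have /cvge0P /(_ _ e2)[|N2 h2] := qf; first by move=> k; exact: integral_ge0.
exists (maxn N1 N2) => k; rewrite geq_max => /andP[k1 k2].
have mqf : measurable_fun setT (fun x => `|q_ k x - f x|).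
  by apply: measurableT_comp => //; exact: measurable_funB.
apply: (@le_trans _ _ (\int[mu]_x ((m k x)%:E + `|q_ k x - f x|%:E))%E).
  apply: ge0_le_integral => //.
  - by apply/measurable_EFinP; apply: measurableT_comp => //; exact: measurable_funB.
  - by apply: emeasurable_funD; exact/measurable_EFinP.
  - move=> x _; rewrite -EFinD lee_fin /m.
    have [h|h] := leP `|b_ k x - w x| (2 * `|f x|); first by rewrite lerDl.
    apply: le_trans (ler_normB _ _) _.
    apply: le_trans (lerD (bq k x) (wf x)) _.
    have := ler_normD (q_ k x - f x) (f x); rewrite subrK => ?.
    by rewrite mulr_natl; lra.
rewrite ge0_integralD//; last 3 first.
- by move=> x _; rewrite lee_fin.
- exact/measurable_EFinP.
- exact/measurable_EFinP.
by rewrite [e](_ : _ = e / 2 + e / 2) ?EFinD; [apply: leeD; [exact: h1|exact: h2]|lra].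
Qed.

End sobolev11_calculus.

(** [tau] is the common sign of the increments [t_ k]. It matters only at a zero of [a], where the
    quotient of absolute values is [tau] times the absolute value of the quotient. *)
Lemma abs_quotient_cvg (R : realType) (a_ t_ : nat -> R) (a f tau : R) :
  `|tau| = 1 -> (forall k, t_ k = tau * `|t_ k|) -> (forall k, t_ k != 0) -> t_ @ \oo --> (0 : R) ->
  (fun k => (a_ k - a) / t_ k) @ \oo --> f ->
  (fun k => (`|a_ k| - `|a|) / t_ k) @ \oo --> (if a == 0 then tau * `|f| else sgr a * f).
Proof.
move=> tau1 ttau t0 tc qc.
have aE k : a_ k = a + t_ k * ((a_ k - a) / t_ k) by rewrite mulrCA mulfV// mulr1 addrC subrK.
have ac : a_ @ \oo --> a.
  rewrite (funext aE) -[X in _ --> X]addr0 -(mul0r f); apply: cvgD; first exact: cvg_cst.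
  exact: cvgM.
have [a0|a0] := eqVneq a 0.
  have tt : tau * tau = 1 by rewrite -expr2 -real_normK ?num_real// tau1 expr1n.
  have -> : (fun k => (`|a_ k| - `|a|) / t_ k) = (fun k => tau * `|(a_ k - a) / t_ k|).
    apply/funext => k; rewrite a0 normr0 !subr0 normrM normfV mulrCA; congr (_ * _).
    rewrite {1}ttau invfM -[RHS]mul1r -tt mulrA; congr (_ * _).
    have tau0 : tau != 0 by rewrite -normr_eq0 tau1 oner_neq0.
    by apply: (mulfI tau0); rewrite mulfV// tt mul1r tt.
  by apply: cvgM; [exact: cvg_cst|exact: cvg_norm].
have sa : forall y, `|y - a| < `|a| -> `|y| = sgr a * y.
  move=> y; rewrite ltr_norml => /andP[h1 h2].
  have [a1|a1] := ltP 0 a.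
    by rewrite gtr0_sg// mul1r gtr0_norm// ; move: h1; rewrite (gtr0_norm a1); lra.
  have a2 : a < 0 by rewrite lt_neqAle a0.
  by rewrite ltr0_sg// mulN1r ltr0_norm//; move: h2; rewrite (ltr0_norm a2); lra.
have : (fun k => sgr a * ((a_ k - a) / t_ k)) @ \oo --> sgr a * f.
  by apply: cvgM => //; exact: cvg_cst.
apply: cvg_trans; apply: near_eq_cvg.
have an : 0 < `|a| by rewrite normr_gt0.
have /cvgrPdist_lt /(_ _ an) := ac; apply: filterS => k ak.
by rewrite (sa (a_ k)) 1?distrC// (sa a) ?subrr ?normr0// -mulrBr mulrA.
Qed.

Lemma measurable_sgr (R : realType) : measurable_fun setT (@Num.sg R).
Proof.
rewrite (_ : @Num.sg R = fun x => if x == 0 then 0 else if x < 0 then -1 else 1).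
  apply: measurable_fun_ifT; [exact: measurable_fun_eqr|exact: measurable_cst|].
  apply: measurable_fun_ifT; [exact: measurable_fun_ltr|exact: measurable_cst|exact: measurable_cst].
apply/funext => x; case: sgrP => h.
- by [].
- by [].
- by [].
Qed.

Section sobolev11_abs.
Variables (R : realType) (n : nat).
Local Notation mu := (lebesgue_rV R n).
Implicit Types (u w : 'rV[R]_n -> R) (g : 'rV[R]_n -> 'rV[R]_n) (x : 'rV[R]_n).
Local Notation e_ i := (delta_mx (ord0 : 'I_1) i : 'rV[R]_n).

(** The summable rate yields almost everywhere convergence of the quotients in addition to L1
    convergence, along steps that serve for both signs [tau]. *)
Lemma fast_quotient_sequence u g (i : 'I_n) : sobolev11 u g ->
  exists2 t_ : nat -> R, (forall k, 0 < t_ k) /\ t_ @ \oo --> (0 : R) &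
    forall tau : R, `|tau| = 1 -> forall k,
      (\int[mu]_x `|(u (x + (tau * t_ k) *: e_ i) - u x) / (tau * t_ k) - g x ord0 i|%:E <=
       (1 / (2 ^ k.+1)%:R)%:E)%E.
Proof.
move=> sug; have [mu_ mg] := sobolev11_measurable sug.
have H k : exists t : R, (0 < t <= k.+1%:R^-1) /\ forall tau : R, `|tau| = 1 ->
    (\int[mu]_x `|u (x + (tau * t) *: e_ i) - u x - (tau * t) * g x ord0 i|%:E <=
     (1 / (2 ^ k.+1)%:R * `|tau * t|)%:E)%E.
  have e0 : 0 < 1 / (2 ^ k.+1)%:R :> R by rewrite divr_gt0// ltr0n expn_gt0.
  have [r r0 hr] := L1_quotient i sug e0.
  have r1 : 0 < minr (r / 2) k.+1%:R^-1 by rewrite lt_min divr_gt0//= invr_gt0.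
  exists (minr (r / 2) k.+1%:R^-1); split; first by rewrite r1 ge_min lexx orbT.
  move=> tau tau1; apply: hr; rewrite normrM tau1 mul1r gtr0_norm//.
  by rewrite gt_min; apply/orP; left; lra.
have [t_ ht] := choice H; exists t_; first split.
- by move=> k; have [/andP[]] := ht k.
- apply: (@squeeze_cvgr _ _ _ _ (cst 0) (fun k => k.+1%:R^-1)).
  + by apply: nearW => k /=; have [/andP[/ltW -> ->]] := ht k.
  + exact: cvg_cst.
  + exact: cvg_harmonic.
move=> tau tau1; apply: (@L1_quotient_cvg _ _ u _ (e_ i) (fun k => tau * t_ k) (fun k => 1 / (2 ^ k.+1)%:R)) => //.
- exact: measurableT_comp (measurable_rV_coord i) mg.
- by move=> k; have [/andP[tk _] _] := ht k; rewrite -normr_eq0 normrM tau1 mul1r normr_eq0 gt_eqF.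
- by move=> k; have [_] := ht k; apply.
Qed.

(** The quotients of [|u|] are dominated by those of [u], which converge in L1, so their pointwise
    limit is also a limit in L1. On the zeros of [u] this limit depends on [tau]. *)
Lemma abs_by_parts u g (i : 'I_n) (t_ : nat -> R) (tau : R) (phi : 'rV[R]_n -> R) :
  sobolev11 u g -> `|tau| = 1 -> (forall k, 0 < t_ k) -> t_ @ \oo --> (0 : R) ->
  (forall k,
      (\int[mu]_x `|(u (x + (tau * t_ k) *: e_ i) - u x) / (tau * t_ k) - g x ord0 i|%:E <=
       (1 / (2 ^ k.+1)%:R)%:E)%E) -> test_function phi ->
  (\int[mu]_x (`|u x| * partial i phi x)%:E =
   - \int[mu]_x ((if u x == 0 then tau * `|g x ord0 i| else sgr (u x) * g x ord0 i) * phi x)%:E)%E.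
Proof.
move=> sug tau1 t0 tc qt tphi; have [mu_ mg] := sobolev11_measurable sug; have [Iu Ig _] := sug.
have mgi : measurable_fun setT (fun x => g x ord0 i).
  exact: measurableT_comp (measurable_rV_coord i) mg.
set w := fun x : 'rV[R]_n => if u x == 0 then tau * `|g x ord0 i| else sgr (u x) * g x ord0 i.
have wg x : `|w x| <= `|g x ord0 i|.
  by rewrite /w; case: eqVneq => ux; rewrite normrM ?tau1 ?normr_id ?mul1r// normr_sg ux mul1r.
have mw : measurable_fun setT w.
  apply: measurable_fun_ifT.
  - by apply: measurable_fun_eqr => //; exact: measurable_cst.
  - by apply: measurable_funM => //; exact: measurableT_comp.
  - by apply: measurable_funM => //; exact: measurableT_comp (@measurable_sgr R) _.
have t1 k : tau * t_ k != 0 by rewrite -normr_eq0 normrM tau1 mul1r normr_eq0 gt_eqF.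
have t1c : (fun k => tau * t_ k) @ \oo --> (0 : R).
  by rewrite -(mulr0 tau); apply: cvgM => //; exact: cvg_cst.
have mq (f : 'rV[R]_n -> R) k : measurable_fun setT f -> measurable_fun setT
    (fun x : 'rV[R]_n => (f (x + (tau * t_ k) *: e_ i) - f x) / (tau * t_ k)).
  move=> mf; apply: measurable_funM => //.
  by apply: measurable_funB => //; exact: measurable_translate.
apply: (@test_by_parts _ _ (fun x => `|u x|) w (e_ i) (fun k => tau * t_ k)) => //.
- by have := integrable_abse Iu; apply: eq_integrable.
- have := Ig i; apply: le_integrable => //; first exact/measurable_EFinP.
  by move=> x _ /=; rewrite lee_fin.
apply: (@L1_cvg_pratt _ _ _ (fun k x => (u (x + (tau * t_ k) *: e_ i) - u x) / (tau * t_ k)) _ (fun x => g x ord0 i)) => //.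
- by move=> k; apply: (mq (fun x => `|u x|)); exact: measurableT_comp.
- by move=> k; exact: mq.
- exact: Ig.
- move=> k x; rewrite !normrM ler_wpM2r//.
  by apply: le_trans (ler_dist_dist _ _) _.
- have : {ae mu, forall x, (fun k => `|(u (x + (tau * t_ k) *: e_ i) - u x) / (tau * t_ k) - g x ord0 i|) @ \oo --> (0 : R)}.
    apply: (summable_integral_ae_cvg0 _ _ qt) => // k.
    by apply: measurableT_comp => //; apply: measurable_funB => //; exact: mq.
  apply: filterS => x hx; apply: abs_quotient_cvg => //.
    by move=> k; rewrite normrM tau1 mul1r gtr0_norm.
  by apply/subr_cvg0; apply/norm_cvg0P.
apply/cvge0P => [k|e e0]; first exact: integral_ge0.
have /cvgrPdist_le /(_ _ e0)[N _ hN] := @cvg_harmonic R.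
exists N => k Nk; apply: le_trans (qt k) _; rewrite lee_fin.
have := hN k Nk; rewrite /= sub0r normrN ger0_norm ?invr_ge0//; apply: le_trans.
rewrite div1r lef_pV2 ?posrE ?ltr0n ?expn_gt0// ler_nat.
by apply: ltnW; exact: ltn_expl.
Qed.

(** The two signs [tau] give two weak derivatives of [|u|]. By uniqueness they agree, so
    [|g_i| = - |g_i|] almost everywhere on the zero set of [u], and the gradient vanishes there. *)
Lemma sobolev11_abs u g : sobolev11 u g ->
  sobolev11 (fun x => `|u x|) (fun x => sgr (u x) *: g x) /\
  {ae mu, forall x, u x = 0 -> g x = 0}.
Proof.
move=> sug; have [mu_ mg] := sobolev11_measurable sug; have [Iu Ig _] := sug.
have mgi i : measurable_fun setT (fun x => g x ord0 i).
  exact: measurableT_comp (measurable_rV_coord i) mg.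
pose w (tau : R) i := fun x : 'rV[R]_n => if u x == 0 then tau * `|g x ord0 i| else sgr (u x) * g x ord0 i.
have Iw tau i : `|tau| = 1 -> mu.-integrable setT (EFin \o w tau i).
  move=> tau1; have := Ig i; apply: le_integrable => //.
    apply/measurable_EFinP; apply: measurable_fun_ifT.
    - by apply: measurable_fun_eqr => //; exact: measurable_cst.
    - by apply: measurable_funM => //; exact: measurableT_comp.
    - by apply: measurable_funM => //; exact: measurableT_comp (@measurable_sgr R) _.
  move=> x _ /=; rewrite lee_fin /w.
  by case: eqVneq => ux; rewrite normrM ?tau1 ?normr_id ?mul1r// normr_sg ux mul1r.
have n1 : `|1| = 1 :> R by rewrite normr1.
have nN1 : `|-1| = 1 :> R by rewrite normrN normr1.
have ibp tau i phi : `|tau| = 1 -> test_function phi ->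
    (\int[mu]_x (`|u x| * partial i phi x)%:E = - \int[mu]_x (w tau i x * phi x)%:E)%E.
  move=> tau1 tphi; have [t_ [t0 tc] qt] := fast_quotient_sequence i sug.
  by apply: (abs_by_parts sug tau1 t0 tc (qt _ tau1) tphi).
have g0 : {ae mu, forall x, u x = 0 -> g x = 0}.
  have : {ae mu, forall x, forall i, w 1 i x = w (-1) i x}.
    apply: ae_forall_ord => i; apply: fundamental_lemmaT.
    - by apply: integrable_box; exact: Iw.
    - by apply: integrable_box; exact: Iw.
    - by move=> phi tphi; apply: oppe_inj; rewrite -!ibp.
  apply: filterS => x H ux; apply/rowP => i; rewrite mxE; have := H i.
  rewrite /w ux eqxx mul1r mulN1r => /eqP; rewrite -subr_eq0 opprK -mulr2n mulrn_eq0 /= normr_eq0.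
  by move/eqP.
split => //; split.
- by have := integrable_abse Iu; apply: eq_integrable.
- move=> i; have := Ig i; apply: le_integrable => //.
    apply/measurable_EFinP; rewrite (_ : (fun x => _) = fun x => sgr (u x) * g x ord0 i); last first.
      by apply/funext => x; rewrite mxE.
    by apply: measurable_funM => //; exact: measurableT_comp (@measurable_sgr R) _.
  move=> x _; rewrite mxE !abse_EFin lee_fin normrM normr_sg.
  by case: eqVneq => _; rewrite ?mul1r// mul0r.
move=> i phi tphi; rewrite (ibp 1)//; congr (- _)%E; apply: ae_eq_integral => //.
- apply/measurable_EFinP; apply: measurable_funM; last exact: test_function_measurable.
  exact: integrable_measurable (Iw 1 i n1).
- apply/measurable_EFinP; apply: measurable_funM; last exact: test_function_measurable.
  rewrite (_ : (fun x => _) = fun x => sgr (u x) * g x ord0 i).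
    by apply: measurable_funM => //; exact: measurableT_comp (@measurable_sgr R) _.
  by apply/funext => x; rewrite mxE.
apply: filterS g0 => x g0 _; rewrite /w mxE; case: eqVneq => // ux.
by rewrite g0// mxE normr0 !mulr0.
Qed.
End sobolev11_abs.

(** * Reflections and cut-offs by a half-space *)

Section sobolev11_cut.
Variables (R : realType) (n : nat).
Local Notation mu := (lebesgue_rV R n).
Implicit Types (u w : 'rV[R]_n -> R) (g h : 'rV[R]_n -> 'rV[R]_n) (x z : 'rV[R]_n).
Local Notation e_ i := (delta_mx (ord0 : 'I_1) i : 'rV[R]_n).

Lemma integrable_mul_test u phi : mu.-integrable setT (EFin \o u) -> test_function phi ->
  mu.-integrable setT (fun x => (u x * phi x)%:E).
Proof.
move=> Iu tphi; have [M hM] := test_function_bounded tphi.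
by apply: (@bounded_mul_integrable _ _ _ _ M) => //; exact: test_function_measurable.
Qed.

Lemma sobolev11D u g u' g' : sobolev11 u g -> sobolev11 u' g' ->
  sobolev11 (fun x => u x + u' x) (fun x => g x + g' x).
Proof.
move=> [Iu Ig ug] [Iu' Ig' ug']; split.
- have := integrableD measurableT Iu Iu'; exact: eq_integrable.
- move=> i; have := integrableD measurableT (Ig i) (Ig' i).
  by apply: eq_integrable => // x _; rewrite mxE.
move=> i phi tphi; have tp := test_function_partial i tphi.
rewrite (eq_integral (fun x : 'rV[R]_n => (u x * partial i phi x)%:E + (u' x * partial i phi x)%:E)%E); last first.
  by move=> x _; rewrite -EFinD mulrDl.
rewrite integralD//; [|exact: integrable_mul_test|exact: integrable_mul_test].
rewrite ug// ug'//.
rewrite [in RHS](eq_integral (fun x : 'rV[R]_n => (g x ord0 i * phi x)%:E + (g' x ord0 i * phi x)%:E)%E); last first.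
  by move=> x _; rewrite -EFinD mxE mulrDl.
have I1 := integrable_mul_test (Ig i) tphi; have I2 := integrable_mul_test (Ig' i) tphi.
rewrite integralD// fin_num_oppeD//.
by apply: integrable_fin_num I2.
Qed.

Lemma sobolev11Z (c : R) u g : sobolev11 u g -> sobolev11 (fun x => c * u x) (fun x => c *: g x).
Proof.
move=> [Iu Ig ug]; split.
- have := integrableZl measurableT c Iu; exact: eq_integrable.
- move=> i; have := integrableZl measurableT c (Ig i).
  by apply: eq_integrable => // x _; rewrite mxE.
move=> i phi tphi; have tp := test_function_partial i tphi.
rewrite (eq_integral (fun x : 'rV[R]_n => c%:E * (u x * partial i phi x)%:E)%E); last first.
  by move=> x _; rewrite -EFinM mulrA.
rewrite integralZl//; last exact: integrable_mul_test.
rewrite ug// [in RHS](eq_integral (fun x : 'rV[R]_n => c%:E * (g x ord0 i * phi x)%:E)%E); last first.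
  by move=> x _; rewrite -EFinM mxE mulrA.
by rewrite integralZl// ?muleN//; exact: (integrable_mul_test (Ig i)).
Qed.

Lemma sobolev11_unique u g g' : sobolev11 u g -> sobolev11 u g' -> {ae mu, forall x, g x = g' x}.
Proof.
move=> /sobolev11_weak_gradient ug /sobolev11_weak_gradient; exact: weak_gradient_unique ug.
Qed.

Variable H : polarizer R n.
Local Notation sigma := (reflection H).
Local Notation S := (lin_reflection H).
Local Notation nu := (pol_normal H).

Lemma integrable_coords g : (forall v, mu.-integrable setT (fun x => (dotrV (g x) v)%:E)) ->
  forall i, mu.-integrable setT (fun x => (g x ord0 i)%:E).
Proof.
by move=> Ig i; have := Ig (e_ i); apply: eq_integrable => // x _; rewrite dotrV_delta.
Qed.

Lemma integrable_dotrV g v : (forall i, mu.-integrable setT (fun x => (g x ord0 i)%:E)) ->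
  mu.-integrable setT (EFin \o (fun x => dotrV (g x) v)).
Proof.
move=> Ig; rewrite (_ : _ \o _ = fun x => (\sum_(i < n) (v ord0 i)%:E * (g x ord0 i)%:E)%E).
  by apply: integrable_sum => // i _; exact: integrableZl.
by apply/funext => x /=; rewrite /dotrV -sumEFin; apply: eq_bigr => i _; rewrite -EFinM mulrC.
Qed.

(** The L1 expansion is carried over by the measure-preserving change of variables, [S] being
    self-adjoint. The factor [n + 1] compares the sup norms of [S z] and [z] through the Euclidean
    norm. *)
Lemma sobolev11_reflection u g : sobolev11 u g ->
  sobolev11 (u \o sigma) (fun x => S (g (sigma x))).
Proof.
move=> sug; have [mu_ mg] := sobolev11_measurable sug; have [Iu Ig _] := sug.
have ps := reflection_preserving H.
apply: L1_differentiable_sobolev11.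
- exact: integrable_preserving.
- apply: integrable_coords => v.
  have := integrable_preserving ps (integrable_dotrV (S v) Ig).
  by apply: eq_integrable => // x _ /=; rewrite dotrV_lin_reflectionC.
have n1 : 0 < n%:R + 1 :> R by rewrite ltr_wpDl.
move=> e e0; have [r r0 hr] := sobolev11_L1_differentiable sug (divr_gt0 e0 n1).
exists (r / (n%:R + 1)); first exact: divr_gt0.
move=> z zr.
have Sz : `|S z| <= (n%:R + 1) * `|z|.
  apply: le_trans (norm_le_enorm _) _; rewrite enorm_lin_reflection.
  by apply: le_trans (enorm_le_norm _) _; rewrite ler_wpM2r// lerDl.
have Szr : `|S z| < r by apply: le_lt_trans Sz _; rewrite mulrC -ltr_pdivlMr.
pose F (y : 'rV[R]_n) := `|u (y + S z) - u y - dotrV (g y) (S z)|%:E.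
rewrite (eq_integral (fun x : 'rV[R]_n => F (sigma x))); last first.
  by move=> x _; rewrite /F /= reflectionD dotrV_lin_reflectionC.
rewrite (ge0_integral_preserving (f := F) ps) ?/F //=.
- apply: le_trans (hr _ Szr) _; rewrite lee_fin.
  by rewrite mulrAC ler_pdivrMr// -mulrA ler_pM2l// mulrC.
- apply/measurable_EFinP; apply: measurableT_comp => //; apply: measurable_funB; last first.
    by apply: measurable_dotrV => //; exact: measurable_cst.
  by apply: measurable_funB => //; exact: measurable_translate.
Qed.

(** Folds an integral over the whole space onto the half-space: in the applications [A] carries the
    factor [chi], and [F] is its symmetrization. *)
Lemma integral_reflection_double (F A : 'rV[R]_n -> R) :
  mu.-integrable setT (EFin \o A) -> measurable_fun setT F ->
  {ae mu, forall x, A x + A (sigma x) = F x} ->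
  (\int[mu]_x (F x)%:E = \int[mu]_x (A x)%:E + \int[mu]_x (A x)%:E)%E.
Proof.
move=> IA mF AF; have ps := reflection_preserving H.
rewrite -{2}(integral_preserving ps IA) -integralD//; last exact: integrable_preserving.
apply: ae_eq_integral => //; first exact/measurable_EFinP.
  apply: emeasurable_funD; apply/measurable_EFinP; first exact: integrable_measurable IA.
  by apply: measurableT_comp; [exact: integrable_measurable IA|exact: ps.1].
by apply: filterS AF => x <- _; rewrite EFinD.
Qed.

Lemma reflection_normal x (t : R) : sigma (x + t *: nu) = sigma x - t *: nu.
Proof.
rewrite reflectionD lin_reflectionZ (_ : S nu = - nu) ?scalerN//.
by rewrite /lin_reflection dotrV_normal mulr1 scaler_nat mulr2n opprD addNKr.
Qed.

Lemma reflection_fixed x : dotrV x nu = pol_offset H -> sigma x = x.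
Proof. by rewrite /reflection => ->; rewrite subrr mulr0 scale0r subr0. Qed.

Lemma derive_lin (phi : 'rV[R]_n -> R) x (c : R) v v' : test_function phi ->
  'D_(c *: v + v') phi x = c * 'D_v phi x + 'D_v' phi x.
Proof.
move=> [sphi _]; have dphi : differentiable phi x by exact: (sphi [::]).
rewrite !differential_partial// mulr_sumr -big_split; apply: eq_bigr => i _.
by rewrite !mxE mulrDl mulrA.
Qed.

Lemma test_function_derive_measurable (phi : 'rV[R]_n -> R) v : test_function phi ->
  measurable_fun setT ('D_v phi).
Proof.
move=> tphi; have [sphi _] := tphi.
rewrite (_ : 'D_v phi = fun x => \sum_(i < n) v ord0 i * partial i phi x).
  apply: measurable_sum => i; apply: measurable_funM => //.
  by apply: test_function_measurable; exact: test_function_partial.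
by apply/funext => x; rewrite differential_partial//; exact: (sphi [::]).
Qed.

Lemma integrable_mul_derive u phi v : mu.-integrable setT (EFin \o u) -> test_function phi ->
  mu.-integrable setT (EFin \o (fun x => u x * 'D_v phi x)).
Proof.
move=> Iu tphi; have [sphi _] := tphi.
rewrite (_ : _ \o _ = fun x => (\sum_(i < n) (v ord0 i)%:E * (u x * partial i phi x)%:E)%E).
  apply: integrable_sum => // i _; apply: integrableZl => //.
  by apply: integrable_mul_test => //; exact: test_function_partial.
apply/funext => x /=; rewrite differential_partial; last exact: (sphi [::]).
by rewrite mulr_sumr -sumEFin; apply: eq_bigr => i _; rewrite -EFinM mulrCA.
Qed.

Local Notation chi := (\1_(half_space H) : 'rV[R]_n -> R).

Lemma half_space_indic x : chi x = ((dotrV x nu < pol_offset H)%R : bool)%:R.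
Proof. by rewrite indicE /half_space; congr (nat_of_bool _)%:R; apply/idP/idP; rewrite inE. Qed.

Lemma chi_norm_le1 x : `|chi x| <= 1.
Proof. by rewrite indicE; case: (x \in _); rewrite ?normr0// normr1. Qed.

Lemma integrable_cut u : mu.-integrable setT (EFin \o u) ->
  mu.-integrable setT (EFin \o (fun x => chi x * u x)).
Proof.
move=> Iu; have mu_ := integrable_measurable Iu; move: Iu; apply: le_integrable => //.
  apply/measurable_EFinP; apply: measurable_funM => //.
  exact: measurable_indic (measurable_half_space H).
move=> x _ /=; rewrite lee_fin normrM -[leRHS]mul1r ler_wpM2r//; exact: chi_norm_le1.
Qed.

(** A translation parallel to the hyperplane leaves [chi] unchanged, so the quotients of [chi * w]
    are [chi] times those of [w]. *)
Lemma cut_by_parts_orth w g v phi : sobolev11 w g -> dotrV v nu = 0 -> test_function phi ->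
  (\int[mu]_x (chi x * w x * 'D_v phi x)%:E = - \int[mu]_x (chi x * dotrV (g x) v * phi x)%:E)%E.
Proof.
move=> swg vnu tphi; have [mw mg] := sobolev11_measurable swg; have [Iw Ig _] := swg.
have Igv := integrable_dotrV v Ig.
have mchi : measurable_fun setT chi by exact: measurable_indic (measurable_half_space H).
have mgv := integrable_measurable Igv.
apply: (@test_by_parts _ _ (fun x => chi x * w x) (fun x => chi x * dotrV (g x) v) v (fun k => k.+1%:R^-1)) => //.
- exact: integrable_cut.
- exact: integrable_cut.
- exact: cvg_harmonic.
have q := L1_differentiable_quotient v mw mg (sobolev11_L1_differentiable swg) (@harmonic_neq0 R) (@cvg_harmonic R).
apply: (@squeeze_cvge _ _ _ _ (cst 0%E) _ _ _ _ (cvg_cst _) q).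
apply: nearW => k /=; rewrite integral_ge0//=.
have mq (f : 'rV[R]_n -> R) : measurable_fun setT f -> measurable_fun setT
    (fun x : 'rV[R]_n => (f (x + k.+1%:R^-1 *: v) - f x) / k.+1%:R^-1).
  move=> mf; apply: measurable_funM => //.
  by apply: measurable_funB => //; exact: measurable_translate.
apply: ge0_le_integralT => //.
- apply: measurableT_comp => //.
  apply: measurable_funB; last exact: measurable_funM.
  by apply: (mq (fun x => chi x * w x)); exact: measurable_funM.
- by apply: measurableT_comp => //; apply: measurable_funB => //; exact: mq.
move=> x; rewrite normr_ge0 /= !half_space_indic dotrVDl dotrVZl vnu mulr0 addr0.
by case: (_ < _); rewrite ?mul1r// !mul0r subrr mul0r subr0 normr0.
Qed.

(** The extension stays Lipschitz across the hyperplane, unlike a test function multiplied by [chi].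
    It may fail to be differentiable only on the hyperplane, where an odd [w] vanishes. *)
Definition even_extension (phi : 'rV[R]_n -> R) x : R :=
  if dotrV x nu < pol_offset H then phi x else phi (sigma x).

Lemma even_extension_lipschitz phi (L : R) x (t : R) :
  (forall x y, `|phi x - phi y| <= L * enorm (x - y)) ->
  `|even_extension phi (x + t *: nu) - even_extension phi x| <= L * `|t|.
Proof.
move=> hL; have n1 : enorm nu = 1 by case: H.
have T1 := ler_norm t; have T2 := ler_norm (- t); rewrite normrN in T2.
have L0 : 0 <= L by have := hL nu 0; rewrite subr0 n1 mulr1; exact: le_trans.
have lin y z (s : R) : y - z = s *: nu -> `|s| <= `|t| -> `|phi y - phi z| <= L * `|t|.
  move=> yz st; apply: le_trans (hL _ _) _; rewrite yz enormZ n1 mulr1.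
  by rewrite ler_wpM2l.
rewrite /even_extension dotrVDl dotrVZl dotrV_normal mulr1 reflection_normal.
case: ltP => h1; case: ltP => h2.
- by apply: (lin _ _ t) => //; rewrite addrC addKr.
- apply: (lin _ _ (t + 2 * (dotrV x nu - pol_offset H))).
    by rewrite /reflection; apply/rowP => i; rewrite !mxE; ring.
  by rewrite ler_norml; apply/andP; split; lra.
- apply: (lin _ _ (- t - 2 * (dotrV x nu - pol_offset H))).
    by rewrite /reflection; apply/rowP => i; rewrite !mxE; ring.
  by rewrite ler_norml; apply/andP; split; lra.
- by apply: (lin _ _ (- t)); rewrite ?normrN// addrAC subrr add0r scaleNr.
Qed.

Lemma even_extension_derivative phi x (t_ : nat -> R) : test_function phi ->
  (forall k, t_ k != 0) -> t_ @ \oo --> (0 : R) -> dotrV x nu != pol_offset H ->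
  (fun k => (even_extension phi (x - t_ k *: nu) - even_extension phi x) / t_ k) @ \oo -->
  - (if dotrV x nu < pol_offset H then 'D_nu phi x else - 'D_nu phi (sigma x)).
Proof.
move=> [sphi _] t0 tc xa; have dphi y : differentiable phi y by exact: (sphi [::]).
have dx : 0 < `|dotrV x nu - pol_offset H| by rewrite normr_gt0 subr_eq0.
have side : \forall k \near \oo, (dotrV (x - t_ k *: nu) nu < pol_offset H) = (dotrV x nu < pol_offset H).
  have /cvgrPdist_lt /(_ _ dx) := tc; apply: filterS => k.
  rewrite sub0r normrN dotrVBl dotrVZl dotrV_normal mulr1 ltr_norml => /andP[].
  case: (ltP (dotrV x nu) (pol_offset H)) => h.
    by rewrite ler0_norm; [move=> h1 h2; apply/idP; lra|lra].
  by rewrite ger0_norm; [move=> h1 h2; apply/negP; lra|lra].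
case: ifPn => hx.
  have := derivative_along_sequence (v := nu) (dphi x) t0 tc.
  apply: cvg_trans; apply: near_eq_cvg; apply: filterS side => k.
  by rewrite /even_extension hx => ->.
have := derivative_along_sequence (v := - nu) (dphi (sigma x)) t0 tc.
have -> : 'D_(- nu) phi (sigma x) = - 'D_nu phi (sigma x).
  by rewrite !deriveE// linearN.
apply: cvg_trans; apply: near_eq_cvg; apply: filterS side => k.
rewrite /even_extension (negPf hx) => ->.
have -> : x - t_ k *: nu = x + (- t_ k) *: nu by rewrite scaleNr.
by rewrite reflection_normal scalerN scaleNr.
Qed.

(** Integration by parts over the whole space of the odd [w] against the even extension of [phi]:
    both integrands are invariant under [sigma], so each side is twice its part over the
    half-space. *)
Lemma cut_by_parts_normal w g phi : sobolev11 w g -> (forall x, w (sigma x) = - w x) ->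
  test_function phi ->
  (\int[mu]_x (chi x * w x * 'D_nu phi x)%:E = - \int[mu]_x (chi x * dotrV (g x) nu * phi x)%:E)%E.
Proof.
move=> swg wodd tphi; have [mw mg] := sobolev11_measurable swg; have [Iw Ig _] := swg.
have Ign := integrable_dotrV nu Ig; have mgn := integrable_measurable Ign.
have mphi := test_function_measurable tphi.
have mchi : measurable_fun setT chi by exact: measurable_indic (measurable_half_space H).
have ps := reflection_preserving H.
have hyper x : dotrV x nu = pol_offset H -> w x = 0.
  by move=> /reflection_fixed xs; have := wodd x; rewrite xs => /eqP; rewrite -subr_eq0 opprK -mulr2n mulrn_eq0 => /eqP.
have [M hM] := test_function_bounded tphi.
have [L L0 hL] := test_function_lipschitz tphi.
have mhs : measurable_fun setT (fun x : 'rV[R]_n => dotrV x nu < pol_offset H).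
  apply: measurable_fun_ltr; last exact: measurable_cst.
  by apply: measurable_dotrV; [exact: measurable_id|exact: measurable_cst].
have ee x : even_extension phi (sigma x) = even_extension phi x.
  rewrite /even_extension dotrV_reflection reflectionK.
  case: ltP => h1; case: ltP => h2 //; first lra.
  by rewrite reflection_fixed//; lra.
pose psi' x := if dotrV x nu < pol_offset H then 'D_nu phi x else - 'D_nu phi (sigma x).
have mD := test_function_derive_measurable nu tphi.
have mpsi' : measurable_fun setT psi'.
  apply: measurable_fun_ifT => //; apply: measurableT_comp => //.
  by apply: (measurableT_comp mD); exact: ps.1.
have mpsi : measurable_fun setT (even_extension phi).
  by apply: measurable_fun_ifT => //; apply: measurableT_comp => //; exact: ps.1.
have key : (\int[mu]_x (w x * psi' x)%:E = - \int[mu]_x (dotrV (g x) nu * even_extension phi x)%:E)%E.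
  apply: (@L1_quotient_by_parts _ _ w _ _ _ nu (fun k => k.+1%:R^-1) M L Iw Ign (@harmonic_neq0 R)) => //.
  - exact: L1_differentiable_quotient (sobolev11_L1_differentiable swg) (@harmonic_neq0 R) (@cvg_harmonic R).
  - by move=> x; rewrite /even_extension; case: ifP.
  - by move=> x t; exact: even_extension_lipschitz.
  - move=> x wx; apply: even_extension_derivative => //; first exact: cvg_harmonic.
    by apply: contra_neq wx; exact: hyper.
have I1 : mu.-integrable setT (EFin \o (fun x => chi x * w x * 'D_nu phi x)).
  by apply: integrable_mul_derive => //; exact: integrable_cut.
have I2 : mu.-integrable setT (EFin \o (fun x => chi x * dotrV (g x) nu * phi x)).
  by apply: integrable_mul_test => //; exact: integrable_cut.
(* Uniqueness of the weak gradient of [w \o sigma = - w] makes the normal component of [g] even. *)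
have gsym : {ae mu, forall x, dotrV (g (sigma x)) nu = dotrV (g x) nu}.
  have s1 := sobolev11_reflection swg; have s2 := sobolev11Z (-1) swg.
  rewrite (_ : (fun x => -1 * w x) = w \o sigma) in s2; last by apply/funext => x /=; rewrite wodd mulN1r.
  apply: filterS (sobolev11_unique s1 s2) => x /(congr1 (fun v => dotrV v nu)).
  by rewrite dotrV_lin_reflectionh scaleN1r dotrVNl => /oppr_inj.
(* On the hyperplane [chi] vanishes at both [x] and [sigma x]; there [w] is 0, and so is [g] for
   almost every such point. *)
have [_ g0] := sobolev11_abs swg.
move: key; rewrite (integral_reflection_double I1 (F := fun x => w x * psi' x)).
- rewrite (integral_reflection_double I2 (F := fun x => dotrV (g x) nu * even_extension phi x)).
  + have f1 := integrable_fin_num measurableT I1; have f2 := integrable_fin_num measurableT I2.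
    rewrite -[(\int[mu]_x (chi x * w x * 'D_nu phi x)%:E)%E](fineK f1).
    rewrite -[(\int[mu]_x (chi x * dotrV (g x) nu * phi x)%:E)%E](fineK f2).
    by rewrite -!EFinD -!EFinN => -[?]; congr (_%:E); lra.
  + exact: measurable_funM.
  + apply: filterS2 gsym g0 => x gsx g0x; rewrite !half_space_indic gsx dotrV_reflection /even_extension.
    case: ltgtP => h.
    * by rewrite (_ : _ < _ = false) ?mul0r ?mul1r ?addr0 ?mul0r//; apply/negbTE; rewrite -leNgt; lra.
    * by rewrite (_ : _ < _ = true) ?mul0r ?mul1r ?add0r//; lra.
    * by rewrite g0x ?hyper// dotrV0l !(mulr0, mul0r) addr0.
- exact: measurable_funM.
- apply: aeW => x; rewrite !half_space_indic dotrV_reflection /psi' wodd.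
  case: ltgtP => h.
  + by rewrite (_ : _ < _ = false) ?mul0r ?mul1r ?addr0 ?mul0r//; apply/negbTE; rewrite -leNgt; lra.
  + by rewrite (_ : _ < _ = true) ?mul0r ?mul1r ?add0r ?mulNr ?mulrN//; lra.
  + by rewrite hyper// oppr0 !(mulr0, mul0r) addr0.
Qed.

(** Each basis vector splits into a normal component and a vector [k] parallel to the hyperplane, to
    which the two integrations by parts apply. *)
Lemma sobolev11_cut w g : sobolev11 w g -> (forall x, w (sigma x) = - w x) ->
  sobolev11 (fun x => chi x * w x) (fun x => chi x *: g x).
Proof.
move=> swg wodd; have [Iw Ig _] := swg; split; first exact: integrable_cut.
  by move=> i; have := integrable_cut (Ig i); apply: eq_integrable => // x _ /=; rewrite mxE.
move=> i phi tphi.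
pose c := nu ord0 i; pose k := e_ i - c *: nu.
have ei : e_ i = c *: nu + k by rewrite /k addrC subrK.
have knu : dotrV k nu = 0.
  by rewrite /k dotrVBl dotrVZl dotrV_normal mulr1 dotrVC dotrV_delta subrr.
have Iv v := integrable_mul_derive v (integrable_cut Iw) tphi.
have Ivg v := integrable_mul_test (integrable_cut (integrable_dotrV v Ig)) tphi.
rewrite (eq_integral (fun x : 'rV[R]_n => c%:E * (chi x * w x * 'D_nu phi x)%:E + (chi x * w x * 'D_k phi x)%:E)%E); last first.
  by move=> x _; rewrite -EFinM -EFinD /partial ei derive_lin//; congr (_%:E); ring.
rewrite [in RHS](eq_integral (fun x : 'rV[R]_n => c%:E * (chi x * dotrV (g x) nu * phi x)%:E +
    (chi x * dotrV (g x) k * phi x)%:E)%E); last first.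
  move=> x _; rewrite -EFinM -EFinD mxE -(dotrV_delta (g x)) ei dotrVDr dotrVZr; congr (_%:E); ring.
have Iv' := integrableZl measurableT c (Iv nu); have Ivg' := integrableZl measurableT c (Ivg nu).
rewrite (integralD measurableT Iv' (Iv k)) (integralD measurableT Ivg' (Ivg k)).
rewrite (integralZl measurableT (Iv nu)) (integralZl measurableT (Ivg nu)).
rewrite /= (cut_by_parts_normal swg wodd tphi) (cut_by_parts_orth swg knu tphi) muleN.
have fk := integrable_fin_num measurableT (Ivg k).
by rewrite (fin_num_oppeD _ fk).
Qed.

End sobolev11_cut.

(** * Polarization of functions *)

Section polarize.
Variables (R : realType) (n : nat).
Local Notation mu := (lebesgue_rV R n).
Implicit Types (u w : 'rV[R]_n -> R) (g h : 'rV[R]_n -> 'rV[R]_n) (x : 'rV[R]_n).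

Lemma sobolev11_ae u u' g g' : sobolev11 u g -> u =1 u' -> measurable_fun setT g' ->
  {ae mu, forall x, g x = g' x} -> sobolev11 u' g'.
Proof.
move=> [Iu Ig ug] /funext <- mg' gg'.
have mgi i : measurable_fun setT (fun x => g' x ord0 i).
  exact: measurableT_comp (measurable_rV_coord i) mg'.
have mi i : measurable_fun setT (fun x => g x ord0 i) by exact: integrable_measurable (Ig i).
split => // [i|i phi tphi].
  have /integrableP[_ goo] := Ig i; apply/integrableP; split; first exact/measurable_EFinP.
  rewrite (@ae_eq_integral _ _ _ _ _ (fun x => `|(g x ord0 i)%:E|%E))//.
  - by apply: measurableT_comp => //; exact/measurable_EFinP.
  - by apply: measurableT_comp => //; exact/measurable_EFinP.
  - by apply: filterS gg' => x gx _; rewrite gx.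
rewrite ug//; congr (- _)%E; have mphi := test_function_measurable tphi.
apply: ae_eq_integral => //; [apply/measurable_EFinP; exact: measurable_funM..|].
by apply: filterS gg' => x gx _; rewrite gx.
Qed.

Variable H : polarizer R n.
Local Notation sigma := (reflection H).
Local Notation S := (lin_reflection H).
Local Notation nu := (pol_normal H).
Local Notation inH x := (dotrV x nu < pol_offset H).

(** Polarization puts the larger of [u x] and [u (sigma x)] on the side of [H]. The inequalities are
    strict on both sides, so ties are not swapped and [swapped] is invariant under [sigma]. *)
Definition swapped u x : bool :=
  if inH x then u x < u (sigma x) else u (sigma x) < u x.

Definition polarize u x : R := if swapped u x then u (sigma x) else u x.

Definition polarize_gradient u g x := if swapped u x then S (g (sigma x)) else g x.

Lemma swapped_reflection u x : swapped u (sigma x) = swapped u x.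
Proof.
rewrite /swapped reflectionK dotrV_reflection; case: (ltP (dotrV x nu)) => h1; case: ltP => h2 //.
  lra.
by rewrite reflection_fixed//; lra.
Qed.

Lemma polarize_reflection u x : polarize u (sigma x) = if swapped u x then u x else u (sigma x).
Proof. by rewrite /polarize swapped_reflection reflectionK. Qed.

Lemma measurable_inH : measurable_fun setT (fun x : 'rV[R]_n => inH x).
Proof.
apply: measurable_fun_ltr; last exact: measurable_cst.
by apply: measurable_dotrV; [exact: measurable_id|exact: measurable_cst].
Qed.

Lemma measurable_reflection_comp d (T : measurableType d) (f : 'rV[R]_n -> T) : measurable_fun setT f ->
  measurable_fun setT (f \o sigma).
Proof. by move=> mf; apply: measurableT_comp => //; exact: (reflection_preserving H).1. Qed.

Lemma measurable_swapped u : measurable_fun setT u -> measurable_fun setT (swapped u).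
Proof.
move=> mu_; have mus := measurable_reflection_comp mu_.
by apply: measurable_fun_ifT; [exact: measurable_inH|exact: measurable_fun_ltr|exact: measurable_fun_ltr].
Qed.

Lemma measurable_polarize u : measurable_fun setT u -> measurable_fun setT (polarize u).
Proof.
move=> mu_; apply: measurable_fun_ifT => //; first exact: measurable_swapped.
exact: measurable_reflection_comp.
Qed.

Lemma measurable_polarize_gradient u g : measurable_fun setT u -> measurable_fun setT g ->
  measurable_fun setT (polarize_gradient u g).
Proof.
move=> mu_ mg; apply: measurable_fun_ifT => //; first exact: measurable_swapped.
apply: measurableT_comp; first exact: measurable_lin_reflection.
exact: measurable_reflection_comp.
Qed.

(* [polarize u = u + q - q o sigma], where [q] is the negative part of
   [1_H (u - u o sigma)]. *)
Lemma sobolev11_polarize u g : sobolev11 u g ->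
  sobolev11 (polarize u) (polarize_gradient u g).
Proof.
move=> sug; have [mu_ mg] := sobolev11_measurable sug.
have sw := sobolev11D sug (sobolev11Z (-1) (sobolev11_reflection H sug)).
set w := (fun x => u x + _) in sw; set gw := (fun x => g x + _) in sw.
have wE x : w x = u x - u (sigma x) by rewrite /w /= mulN1r.
have gwE x : gw x = g x - S (g (sigma x)) by rewrite /gw scaleN1r.
have wodd x : w (sigma x) = - w x by rewrite !wE reflectionK opprB.
have sc := sobolev11_cut sw wodd.
have [sa _] := sobolev11_abs sc; have [_ gw0] := sobolev11_abs sw.
have sq := sobolev11Z 2^-1 (sobolev11D sa (sobolev11Z (-1) sc)).
have sv := sobolev11D sug (sobolev11D sq (sobolev11Z (-1) (sobolev11_reflection H sq))).
have gw0s := ae_preserving (reflection_preserving H) gw0.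
apply: (sobolev11_ae sv).
- move=> x /=; rewrite !half_space_indic dotrV_reflection /polarize /swapped !wE reflectionK.
  case: ltgtP => h.
  + rewrite (_ : _ < _ = false); last by apply/negbTE; rewrite -leNgt; lra.
    rewrite !mul0r !mul1r normr0; case: ltP => uu; [rewrite ltr0_norm|rewrite ger0_norm]; lra.
  + rewrite (_ : _ < _ = true); last by lra.
    rewrite !mul0r !mul1r normr0; case: ltP => uu; [rewrite ltr0_norm|rewrite ger0_norm]; lra.
  + by rewrite reflection_fixed// !subrr !(mulr0, normr0, addr0) ltxx.
- exact: measurable_polarize_gradient.
(* Where [u] and [u \o sigma] agree, the sign is 0 and what remains of the correction is a multiple
   of [gw], which vanishes there almost everywhere. *)
apply: filterS2 gw0 gw0s => x; rewrite wE gwE => g0; rewrite wE gwE reflectionK => g0s /=.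
rewrite !half_space_indic dotrV_reflection /polarize_gradient /swapped.
have S0 : S 0 = 0 by rewrite /lin_reflection dotrV0l mulr0 scale0r subr0.
have half (v : 'rV[R]_n) : 2^-1 *: (- v + - v) = - v.
  by apply/rowP => i; rewrite !mxE; field.
case: ltgtP => h.
- rewrite (_ : _ < _ = false); last by apply/negbTE; rewrite -leNgt; lra.
  rewrite !(mul0r, mul1r, scale0r, scale1r, scaler0, addr0, S0, scaleN1r, oppr0).
  case: (ltgtP (u x)) => uu.
  + by rewrite ltr0_sg ?subr_lt0// scaleN1r half opprB addrC subrK.
  + by rewrite gtr0_sg ?subr_gt0// scale1r subrr scaler0 addr0.
  + by rewrite g0 ?uu ?subrr// scaler0 oppr0 addr0 scaler0 addr0.
- rewrite (_ : _ < _ = true); last by lra.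
  rewrite !(mul0r, mul1r, scale0r, scale1r, scaler0, add0r, S0, scaleN1r, oppr0).
  case: (ltgtP (u x)) => uu.
  + by rewrite gtr0_sg ?subr_gt0// scale1r subrr scaler0 S0 oppr0 addr0.
  + rewrite ltr0_sg ?subr_lt0// scaleN1r half (opprB (g (sigma x))).
    rewrite lin_reflectionD lin_reflectionN lin_reflectionK.
    by rewrite (opprB (g x)) addrC subrK.
  + by rewrite g0s ?uu ?subrr// scaler0 oppr0 addr0 scaler0 S0 oppr0 addr0.
- rewrite (_ : _ < _ = false); last by apply/negbTE; rewrite -leNgt; lra.
  rewrite reflection_fixed// ltxx.
  by rewrite !(scale0r, S0, scaler0, addr0, scaleN1r, oppr0).
Qed.

(** Each integral is half the integral of the sum over the pair [x], [sigma x], and polarization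
    only exchanges values within such pairs. *)
Lemma ge0_integral_reflection_eq (F G : 'rV[R]_n -> \bar R) :
  measurable_fun setT F -> measurable_fun setT G -> (forall x, 0 <= F x)%E -> (forall x, 0 <= G x)%E ->
  (forall x, F x + F (sigma x) = G x + G (sigma x))%E ->
  (\int[mu]_x F x = \int[mu]_x G x)%E.
Proof.
move=> mF mG F0 G0 FG; have ps := reflection_preserving H.
have dbl (f : 'rV[R]_n -> \bar R) : measurable_fun setT f -> (forall x, 0 <= f x)%E ->
    (\int[mu]_x (f x + f (sigma x)) = 2%:E * \int[mu]_x f x)%E.
  move=> mf f0; rewrite ge0_integralD//; last exact: measurable_reflection_comp.
  rewrite (ge0_integral_preserving (f := f) ps)// (_ : 2 = 1 + 1) // EFinD.
  by rewrite ge0_muleDl ?mul1e// lee_fin.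
apply: (@mule_fin_inj _ 2%:E) => //.
by rewrite -!dbl//; apply: eq_integral.
Qed.

Lemma integral_polarize u (f : R -> \bar R) : measurable_fun setT u -> measurable_fun setT f ->
  (forall t, 0 <= f t)%E -> (\int[mu]_x f (polarize u x) = \int[mu]_x f (u x))%E.
Proof.
move=> mu_ mf f0; apply: ge0_integral_reflection_eq => //.
- by apply: measurableT_comp => //; exact: measurable_polarize.
- exact: measurableT_comp.
by move=> x; rewrite polarize_reflection /polarize; case: ifP => // _; rewrite addeC.
Qed.

Lemma integral_polarize_gradient u g (f : R -> \bar R) : measurable_fun setT u ->
  measurable_fun setT g -> measurable_fun setT f -> (forall t, 0 <= f t)%E ->
  (\int[mu]_x f (enorm (polarize_gradient u g x)) = \int[mu]_x f (enorm (g x)))%E.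
Proof.
move=> mu_ mg mf f0; apply: ge0_integral_reflection_eq => //.
- apply: measurableT_comp => //; apply: measurable_enorm.
  exact: measurable_polarize_gradient.
- by apply: measurableT_comp => //; apply: measurable_enorm.
move=> x; rewrite /polarize_gradient swapped_reflection reflectionK.
by case: ifP => // _; rewrite !enorm_lin_reflection addeC.
Qed.

(** Off [H] the polarized function is the smaller of two nonnegative values, and outside the
    polarized set at least one of them is 0; this is where the sign of [u] enters. *)
Lemma polarize_vanish u (Omega : set 'rV[R]_n) : (forall x, 0 <= u x) ->
  {ae mu, forall x, ~ Omega x -> u x = 0} ->
  {ae mu, forall x, ~ polarization H Omega x -> polarize u x = 0}.
Proof.
move=> u0 uO; have := ae_preserving (reflection_preserving H) uO.
apply: filterS2 uO => x ux usx; rewrite /polarization /setU /setI /= => nP.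
have im : (reflection H @` Omega) x <-> Omega (sigma x).
  by split=> [[y Oy <-]|Ox]; [rewrite reflectionK|exists (sigma x) => //; rewrite reflectionK].
rewrite /polarize /swapped; have [hx|hx] := boolP (inH x).
  have nx : ~ Omega x by move=> Ox; apply: nP; left; split => //; left.
  have nsx : ~ Omega (sigma x) by move=> Ox; apply: nP; left; split => //; right; apply/im.
  by rewrite ux// usx// ltxx.
have [Ox|nOx] := pselect (Omega x).
  have nsx : ~ Omega (sigma x) by move=> Osx; apply: nP; right; split => //; apply/im.
  rewrite usx//; case: ltP => // h; by apply/eqP; rewrite eq_le h u0.
rewrite (ux nOx); case: ltP => // h; by apply/eqP; rewrite eq_le (ltW h) u0.
Qed.

Lemma measurable_polarization (Omega : set 'rV[R]_n) : measurable Omega ->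
  measurable (polarization H Omega).
Proof.
move=> mO; have im : reflection H @` Omega = sigma @^-1` Omega.
  apply/seteqP; split=> [x [y Oy <-]|x Ox]; first by rewrite /= reflectionK.
  by exists (sigma x) => //; rewrite reflectionK.
have mR : measurable (reflection H @` Omega).
  by rewrite im -[X in measurable X]setTI; exact: (reflection_preserving H).1.
apply: measurableU; apply: measurableI => //; first exact: measurableU.
exact: measurable_half_space.
Qed.

End polarize.

(** * The eigenvalue as an infimum over admissible pairs *)

Section energy.
Variables (R : realType) (n : nat).
Local Notation mu := (lebesgue_rV R n).
Implicit Types (u : 'rV[R]_n -> R) (g h : 'rV[R]_n -> 'rV[R]_n) (x : 'rV[R]_n).
Implicit Types (p s : R) (Omega : set 'rV[R]_n).

(* Locked, as are the following integrals and kernels, to keep unification from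
   unfolding [powR]. *)
Fact integral_powR_key : unit. Proof. exact: tt. Qed.
Definition integral_powR p := locked_with integral_powR_key
  (fun u => \int[mu]_x (`|u x| `^ p)%:E)%E.

Fact double_integral_key : unit. Proof. exact: tt. Qed.
Definition double_integral := locked_with double_integral_key
  (fun F : 'rV[R]_n -> 'rV[R]_n -> R => \int[mu]_x \int[mu]_y (F x y)%:E)%E.

Fact gagliardo_density_key : unit. Proof. exact: tt. Qed.
Definition gagliardo_density s p u := locked_with gagliardo_density_key
  (fun x y : 'rV[R]_n => `|u x - u y| `^ p / enorm (x - y) `^ (n%:R + s * p)).

Lemma integral_powR_def p u : integral_powR p u = (\int[mu]_x (`|u x| `^ p)%:E)%E.
Proof. by rewrite /integral_powR unlock. Qed.

Lemma double_integral_def F : double_integral F = (\int[mu]_x \int[mu]_y (F x y)%:E)%E.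
Proof. by rewrite /double_integral unlock. Qed.

Lemma gagliardo_density_def s p u x y : gagliardo_density s p u x y =
  `|u x - u y| `^ p / enorm (x - y) `^ (n%:R + s * p).
Proof. by rewrite /gagliardo_density unlock. Qed.

Definition energy s p u g : \bar R :=
  (integral_powR p (fun x => enorm (g x)) + double_integral (gagliardo_density s p u))%E.

Definition admissible p Omega u g := [/\ sobolev11 u g, (integral_powR p u < +oo)%E,
  (integral_powR p (fun x => enorm (g x)) < +oo)%E & {ae mu, forall x, ~ Omega x -> u x = 0}].

Lemma integral_powR_ge0 p u : (0 <= integral_powR p u)%E.
Proof. by rewrite integral_powR_def; apply: integral_ge0 => x _; rewrite lee_fin powR_ge0. Qed.

Lemma gagliardo_density_ge0 s p u x y : 0 <= gagliardo_density s p u x y.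
Proof. by rewrite gagliardo_density_def divr_ge0// powR_ge0. Qed.

Lemma double_integral_ge0 F : (forall x y, 0 <= F x y) -> (0 <= double_integral F)%E.
Proof.
move=> F0; rewrite double_integral_def; apply: integral_ge0 => x _; apply: integral_ge0 => y _.
by rewrite lee_fin.
Qed.

Lemma energy_ge0 s p u g : (0 <= energy s p u g)%E.
Proof. by rewrite adde_ge0 ?integral_powR_ge0 ?double_integral_ge0//; exact: gagliardo_density_ge0. Qed.

Lemma Lnorm_powR p u : p != 0 -> ('N[mu]_p%:E[EFin \o u] `^ p = integral_powR p u)%E.
Proof.
by move=> p0; rewrite poweR_Lnorm// integral_powR_def; apply: eq_integral => x _; rewrite poweR_EFin. Qed.

Lemma Lnorm_lty p u : 0 < p -> (('N[mu]_p%:E[EFin \o u] < +oo) = (integral_powR p u < +oo))%E.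
Proof.
move=> p0; have p1 : p != 0 by rewrite gt_eqF.
apply/idP/idP => [?|]; first by rewrite -Lnorm_powR// poweR_lty.
rewrite -Lnorm_powR//; apply: contraLR; rewrite -!leNgt !leye_eq => /eqP ->.
by rewrite poweRyr.
Qed.

Lemma Lnorm_eq1 p u : 0 < p -> (('N[mu]_p%:E[EFin \o u] = 1) <-> (integral_powR p u = 1))%E.
Proof.
move=> p0; have p1 : p != 0 by rewrite gt_eqF.
split=> [h|]; first by rewrite -Lnorm_powR// h poweR1r.
rewrite -Lnorm_powR// => h; rewrite -[LHS]poweRe1 ?Lnorm_ge0//.
by rewrite -[1%R in LHS](mulfV p1) poweRrM h poweR1r.
Qed.

Lemma admissible_weak_gradient p Omega u : 1 < p -> bounded_set Omega -> W1p0 p Omega u ->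
  admissible p Omega u (weak_gradient u).
Proof.
move=> p1 bO uW; have sug := W1p0_sobolev11 p1 bO uW; have p0 : 0 < p by lra.
have [up _ gp u0] := uW; split => //; last by rewrite -Lnorm_lty.
by move: up; rewrite inE => /andP[_]; rewrite inE /= /finite_norm Lnorm_lty.
Qed.

Lemma integral_powR_ae p u u' : measurable_fun setT u -> measurable_fun setT u' ->
  {ae mu, forall x, u x = u' x} -> integral_powR p u = integral_powR p u'.
Proof.
move=> mu_ mu' uu'.
have mp (f : 'rV[R]_n -> R) : measurable_fun setT f -> measurable_fun setT (fun x => (`|f x| `^ p)%:E).
  move=> mf; apply/measurable_EFinP; apply: (measurableT_comp (measurable_powR _)) => //.
  exact: measurableT_comp.
rewrite !integral_powR_def; apply: ae_eq_integral => //; [exact: mp|exact: mp|].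
by apply: filterS uu' => x -> _.
Qed.

Lemma sobolev11_weak_gradientT u g : sobolev11 u g -> sobolev11 u (weak_gradient u).
Proof.
move=> sug; have wug := sobolev11_weak_gradient sug.
apply: (sobolev11_ae sug) => //.
  apply/measurable_fun_rVP => i.
  by have [[m _] _] := is_weak_gradientP (ex_intro _ g wug) i.
by apply: filterS (weak_gradient_ae wug).
Qed.

Lemma admissible_W1p0 p Omega u g : 1 < p -> admissible p Omega u g -> W1p0 p Omega u.
Proof.
move=> p1 [sug up gp u0]; have [mu_ mg] := sobolev11_measurable sug; have p0 : 0 < p by lra.
have wug := sobolev11_weak_gradient sug.
split; [|by exists g| |by []]; last first.
- have [_ mwg] := sobolev11_measurable (sobolev11_weak_gradientT sug).
  change (Lnorm mu p%:E (EFin \o (fun x => enorm (weak_gradient u x))) < +oo)%E.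
  rewrite (Lnorm_lty _ p0); apply: le_lt_trans gp; rewrite le_eqVlt; apply/orP; left; apply/eqP.
  apply: integral_powR_ae.
  + exact: measurable_enorm.
  + exact: measurable_enorm.
  + by apply: filterS (weak_gradient_ae wug) => x ->.
by rewrite inE; apply/andP; split; rewrite inE//= /finite_norm Lnorm_lty.
Qed.

Lemma measurable_mem Omega : measurable Omega ->
  measurable_fun setT (fun x : 'rV[R]_n => x \in Omega).
Proof.
move=> mO; apply: (measurable_fun_bool true); rewrite setTI (_ : _ @^-1` _ = Omega)//.
by apply/seteqP; split=> x /=; [exact: set_mem|exact: mem_set].
Qed.

(** Restricting the gradient to [Omega] loses nothing: [u] vanishes almost everywhere outside, and a
    weak gradient vanishes almost everywhere on the zero set of its function. *)
Lemma dirichlet_energyE s p Omega u g : 1 < p -> measurable Omega -> admissible p Omega u g ->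
  dirichlet_energy s p Omega u = energy s p u g.
Proof.
move=> p1 mO [sug up gp u0]; have p0 : 0 < p by lra.
have pn0 : p != 0 by rewrite gt_eqF.
have [_ mwg] := sobolev11_measurable (sobolev11_weak_gradientT sug).
have [mu_ mg] := sobolev11_measurable sug.
have mO' : measurable_fun setT (fun x : 'rV[R]_n => x \in Omega).
  exact: measurable_mem.
rewrite /dirichlet_energy /energy; congr (_ + _)%E; last first.
  rewrite /gagliardo -poweRrM mulVf// poweRe1; last first.
    by apply: integral_ge0 => x _; apply: integral_ge0 => y _; rewrite lee_fin divr_ge0 ?powR_ge0.
  rewrite double_integral_def; apply: eq_integral => x _; apply: eq_integral => y _.
  by rewrite gagliardo_density_def.
rewrite (@eq_Lnorm _ _ _ _ _ _ (EFin \o (fun x => if x \in Omega then enorm (weak_gradient u x) else 0))); last first.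
  by move=> x; rewrite patchE /=; case: ifP.
rewrite (Lnorm_powR _ pn0); apply: integral_powR_ae.
- by apply: measurable_fun_ifT => //; exact: measurable_enorm.
- exact: measurable_enorm.
have [_ g0] := sobolev11_abs sug.
apply: filterS3 (weak_gradient_ae (sobolev11_weak_gradient sug)) g0 u0 => x -> gx ux.
by case: ifPn => //; rewrite notin_setE => /ux/gx ->; rewrite enorm0.
Qed.

Lemma Lnorm_restrict p Omega u : 0 < p -> measurable Omega -> measurable_fun setT u ->
  {ae mu, forall x, ~ Omega x -> u x = 0} ->
  (Lnorm mu p%:E ((EFin \o u) \_ Omega) = 1%E) <-> (integral_powR p u = 1)%E.
Proof.
move=> p0 mO mu_ u0.
have mO' : measurable_fun setT (fun x : 'rV[R]_n => x \in Omega).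
  exact: measurable_mem.
rewrite (@eq_Lnorm _ _ _ _ _ _ (EFin \o (fun x => if x \in Omega then u x else 0))); last first.
  by move=> x; rewrite patchE /=; case: ifP.
rewrite Lnorm_eq1// (@integral_powR_ae _ _ u)//; first exact: measurable_fun_ifT.
by apply: filterS u0 => x ux; case: ifPn => //; rewrite notin_setE => /ux ->.
Qed.

(** Frees the infimum from the selected [weak_gradient] and from the restrictions to [Omega]. A
    function of norm 1 is automatically not null. *)
Lemma least_eigenvalueE s p Omega : 1 < p -> measurable Omega -> bounded_set Omega ->
  least_eigenvalue s p Omega = ereal_inf [set energy s p ug.1 ug.2 | ug in
    [set ug | admissible p Omega ug.1 ug.2 /\ integral_powR p ug.1 = 1%E]].
Proof.
move=> p1 mO bO; have p0 : 0 < p by lra.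
congr (ereal_inf _); apply/seteqP; split=> e /=.
  move=> [u [uW _ N1] <-]; have adm := admissible_weak_gradient p1 bO uW.
  exists (u, weak_gradient u) => /=; last by rewrite (dirichlet_energyE _ _ _ adm).
  split => //; have [sug _ _ u0] := adm; have [mu_ _] := sobolev11_measurable sug.
  exact/(Lnorm_restrict p0 mO mu_ u0).
move=> [[u g] /= [adm N1] <-]; have [sug _ _ u0] := adm; have [mu_ _] := sobolev11_measurable sug.
exists u; last by rewrite (dirichlet_energyE _ _ _ adm).
split; first exact: admissible_W1p0 adm.
  move=> u00; have : integral_powR p u = 0%E; last by rewrite N1 => /eqP; rewrite onee_eq0.
  rewrite (@integral_powR_ae _ _ (cst 0))//.
    by rewrite integral_powR_def (eq_integral (cst 0%E)) ?integral0// => x _; rewrite /= normr0 powR0// gt_eqF.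
  by apply: filterS u00 => x; apply.
exact/(Lnorm_restrict p0 mO mu_ u0).
Qed.

End energy.

(** * Gain of the Gagliardo energy under polarization *)

Lemma powR_norm_convex (R : realType) (p t a b : R) : 1 <= p -> 0 <= t <= 1 ->
  `|t * a + (1 - t) * b| `^ p <= t * `|a| `^ p + (1 - t) * `|b| `^ p.
Proof.
move=> p1 /andP[t0 t1].
have t1' : 0 <= 1 - t by rewrite subr_ge0.
apply: (@le_trans _ _ ((t * `|a| + (1 - t) * `|b|) `^ p)).
  apply: ge0_ler_powR; rewrite ?nnegrE ?addr_ge0 ?mulr_ge0//; first lra.
  by apply: le_trans (ler_normD _ _) _; rewrite !normrM (ger0_norm t0) (ger0_norm t1').
have := @convex_powR R p p1 (Itv01 t0 t1) `|a| `|b|; rewrite !convRE /=.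
by apply; rewrite inE/= in_itv/= normr_ge0.
Qed.

(* The four differences satisfy [a - b <= a - b', a' - b <= a' - b'] and have
   equal sums, so this is convexity of [|t|^p]. *)
Lemma powR_norm_rearrangement (R : realType) (p a a' b b' : R) : 1 <= p -> a <= a' -> b' <= b ->
  `|a - b'| `^ p + `|a' - b| `^ p <= `|a - b| `^ p + `|a' - b'| `^ p.
Proof.
move=> p1 aa bb.
have [e|ne] := eqVneq (a' - a + (b - b')) 0.
  have -> : a' = a by lra.
  have -> : b' = b by lra.
  by [].
have d0 : 0 < a' - a + (b - b') by rewrite lt_neqAle eq_sym ne; lra.
(* [a - b'] and [a' - b] are convex combinations of [a - b] and [a' - b'] with the complementary
   weights [t] and [1 - t]. *)
pose t := (a' - a) / (a' - a + (b - b')).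
have t0 : 0 <= t <= 1.
  by rewrite divr_ge0 ?(ltW d0) ?subr_ge0//= ler_pdivrMr// mul1r lerDl subr_ge0.
have e1 : a - b' = t * (a - b) + (1 - t) * (a' - b') by rewrite /t; field.
have e2 : a' - b = (1 - t) * (a - b) + (1 - (1 - t)) * (a' - b') by rewrite /t; field.
have t0' : 0 <= 1 - t <= 1 by move: t0; lra.
have h1 := powR_norm_convex (a - b) (a' - b') p1 t0.
have h2 := powR_norm_convex (a - b) (a' - b') p1 t0'.
rewrite {1}e1 {1}e2; move: h1 h2; lra.
Qed.

Section double_integral.
Variables (R : realType) (n : nat).
Local Notation mu := (lebesgue_rV R n).
Implicit Types F G : 'rV[R]_n -> 'rV[R]_n -> R.

Definition measurable2 F := measurable_fun setT (fun xy : 'rV[R]_n * 'rV[R]_n => F xy.1 xy.2).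

Lemma measurable2_section F x : measurable2 F -> measurable_fun setT (F x).
Proof. by move=> mF; exact: (measurableT_comp mF (pair1_measurable x)). Qed.

Lemma measurable2_inner F : measurable2 F -> (forall x y, 0 <= F x y) ->
  measurable_fun setT (fun x => \int[mu]_y (F x y)%:E)%E.
Proof.
move=> mF F0; apply: (@measurable_fun_fubini_tonelli_F _ _ _ _ _ mu (fun xy => (F xy.1 xy.2)%:E)).
  exact/measurable_EFinP.
by move=> x; rewrite lee_fin.
Qed.

Lemma inner_integral_ge0 F x : (forall x y, 0 <= F x y) -> (0 <= \int[mu]_y (F x y)%:E)%E.
Proof. by move=> F0; apply: integral_ge0 => y _; rewrite lee_fin. Qed.

Lemma double_integralD F G : measurable2 F -> measurable2 G -> (forall x y, 0 <= F x y) ->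
  (forall x y, 0 <= G x y) ->
  (double_integral (fun x y => F x y + G x y)%R = double_integral F + double_integral G)%E.
Proof.
move=> mF mG F0 G0; rewrite !double_integral_def.
rewrite -ge0_integralD//; [|by move=> x _; exact: inner_integral_ge0|exact: measurable2_inner
  |by move=> x _; exact: inner_integral_ge0|exact: measurable2_inner].
apply: eq_integral => x _; rewrite -ge0_integralD//.
- by move=> y _; rewrite lee_fin.
- by apply/measurable_EFinP; exact: measurable2_section.
- by move=> y _; rewrite lee_fin.
- by apply/measurable_EFinP; exact: measurable2_section.
Qed.

Lemma double_integralZ F (c : R) : measurable2 F -> (forall x y, 0 <= F x y) -> 0 <= c ->
  (double_integral (fun x y => c * F x y)%R = c%:E * double_integral F)%E.
Proof.
move=> mF F0 c0; rewrite !double_integral_def -ge0_integralZl//; last 2 first.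
- exact: measurable2_inner.
- by move=> x _; exact: inner_integral_ge0.
apply: eq_integral => x _; rewrite -ge0_integralZl//.
- by apply/measurable_EFinP; exact: measurable2_section.
- by move=> y _; rewrite lee_fin.
Qed.

Lemma le_double_integral F G : measurable2 F -> measurable2 G -> (forall x y, 0 <= F x y) ->
  (forall x y, F x y <= G x y) -> (double_integral F <= double_integral G)%E.
Proof.
move=> mF mG F0 FG; have G0 x y : 0 <= G x y by exact: le_trans (FG x y).
rewrite !double_integral_def; apply: ge0_le_integral => //.
- by move=> x _; exact: inner_integral_ge0.
- exact: measurable2_inner.
- exact: measurable2_inner.
move=> x _; apply: ge0_le_integral => //.
- by move=> y _; rewrite lee_fin.
- by apply/measurable_EFinP; exact: measurable2_section.
- by apply/measurable_EFinP; exact: measurable2_section.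
- by move=> y _; rewrite lee_fin.
Qed.

Variable H : polarizer R n.
Local Notation sigma := (reflection H).

Lemma double_integral_reflectionl F : measurable2 F -> (forall x y, 0 <= F x y) ->
  double_integral (fun x y => F (sigma x) y) = double_integral F.
Proof.
move=> mF F0; rewrite !double_integral_def.
apply: (ge0_integral_preserving (f := fun x => \int[mu]_y (F x y)%:E)%E (reflection_preserving H)).
  exact: measurable2_inner.
by move=> x; exact: inner_integral_ge0.
Qed.

Lemma double_integral_reflectionr F : measurable2 F -> (forall x y, 0 <= F x y) ->
  double_integral (fun x y => F x (sigma y)) = double_integral F.
Proof.
move=> mF F0; rewrite !double_integral_def; apply: eq_integral => x _.
apply: (ge0_integral_preserving (f := fun y => (F x y)%:E) (reflection_preserving H)).
  by apply/measurable_EFinP; exact: measurable2_section.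
by move=> y; rewrite lee_fin.
Qed.

Lemma measurable2_reflectionl F : measurable2 F -> measurable2 (fun x y => F (sigma x) y).
Proof.
move=> mF; apply: (measurableT_comp mF (g := fun xy : 'rV[R]_n * 'rV[R]_n => (sigma xy.1, xy.2))).
apply/measurable_fun_pair => /=; last exact: measurable_snd.
by apply: measurableT_comp; [exact: (reflection_preserving H).1|exact: measurable_fst].
Qed.

Lemma measurable2_reflectionr F : measurable2 F -> measurable2 (fun x y => F x (sigma y)).
Proof.
move=> mF; apply: (measurableT_comp mF (g := fun xy : 'rV[R]_n * 'rV[R]_n => (xy.1, sigma xy.2))).
apply/measurable_fun_pair => /=; first exact: measurable_fst.
by apply: measurableT_comp; [exact: (reflection_preserving H).1|exact: measurable_snd].
Qed.

Lemma measurable2D F G : measurable2 F -> measurable2 G -> measurable2 (fun x y => F x y + G x y).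
Proof. by move=> mF mG; exact: measurable_funD. Qed.

(** Reflecting [x], [y] or both preserves the double integral, which is therefore a quarter of the
    integral of the sum over the four pairs: the origin of the factor [4^-1] in the energy
    identities. *)
Lemma double_integral_reflection_eq F G : measurable2 F -> measurable2 G ->
  (forall x y, 0 <= F x y) -> (forall x y, 0 <= G x y) ->
  (forall x y, F x y + F (sigma x) y + (F x (sigma y) + F (sigma x) (sigma y)) =
     G x y + G (sigma x) y + (G x (sigma y) + G (sigma x) (sigma y))) ->
  double_integral F = double_integral G.
Proof.
move=> mF mG F0 G0 FG.
have quad K : measurable2 K -> (forall x y, 0 <= K x y) ->
    (double_integral (fun x y => K x y + K (sigma x) y + (K x (sigma y) + K (sigma x) (sigma y)))%R =
     4%:E * double_integral K)%E.
  move=> mK K0; have mr := measurable2_reflectionr mK; have ml := measurable2_reflectionl mK.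
  have mlr := measurable2_reflectionl mr.
  rewrite (double_integralD (measurable2D mK ml) (measurable2D mr mlr)); last 2 first.
  - by move=> x y; rewrite addr_ge0.
  - by move=> x y; rewrite addr_ge0.
  rewrite !double_integralD// (double_integral_reflectionl mr)// (double_integral_reflectionl mK)//.
  rewrite (double_integral_reflectionr mK)// (_ : 4 = 1 + 1 + (1 + 1)); last by ring.
  by rewrite !EFinD !ge0_muleDl ?mul1e// lee_fin.
apply: (@mule_fin_inj _ 4%:E) => //.
rewrite -!quad//; congr double_integral; apply/funext => x; apply/funext => y; exact: FG.
Qed.

End double_integral.

Section gagliardo_polarization.
Variables (R : realType) (n : nat) (H : polarizer R n) (s p : R).
Hypotheses (p1 : 1 < p) (s01 : 0 < s < 1).
Implicit Types (u : 'rV[R]_n -> R) (g h : 'rV[R]_n -> 'rV[R]_n) (x z : 'rV[R]_n).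
Local Notation sigma := (reflection H).
Local Notation nu := (pol_normal H).
Local Notation off x := (dotrV x nu - pol_offset H).
Local Notation density := (gagliardo_density s p).

Fact frac_kernel_key : unit. Proof. exact: tt. Qed.
Definition frac_kernel :=
  locked_with frac_kernel_key (fun x y : 'rV[R]_n => (enorm (x - y) `^ (n%:R + s * p))^-1).

Lemma frac_kernelE x y : frac_kernel x y = (enorm (x - y) `^ (n%:R + s * p))^-1.
Proof. by rewrite /frac_kernel unlock. Qed.

(** The sign of [off x * off y] decides which of [y] and [sigma y] is nearer to [x]. *)
Lemma enorm_reflection_sqr x y :
  enorm (x - sigma y) ^+ 2 = enorm (x - y) ^+ 2 + 4 * (off x * off y).
Proof.
have -> : x - sigma y = (x - y) + (2 * off y) *: nu by rewrite /reflection opprB addrA addrAC.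
have gen (z : 'rV[R]_n) (c : R) : enorm (z + c *: nu) ^+ 2 = enorm z ^+ 2 + 2 * c * dotrV z nu + c ^+ 2.
  rewrite !enorm_sqr dotrVDl !dotrVDr !dotrVZl !dotrVZr dotrV_normal (dotrVC nu).
  by ring.
by rewrite gen dotrVBl; ring.
Qed.

Lemma gagliardo_densityE u x y : density u x y = `|u x - u y| `^ p * frac_kernel x y.
Proof. by rewrite gagliardo_density_def frac_kernelE. Qed.

Lemma frac_kernel_reflectionC x y : frac_kernel (sigma x) y = frac_kernel x (sigma y).
Proof. by rewrite !frac_kernelE enorm_reflectionC. Qed.

Lemma frac_exponent_gt0 : 0 < n%:R + s * p.
Proof. by apply: ltr_wpDl => //; apply: mulr_gt0; [case/andP : s01|exact: lt_trans p1]. Qed.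

(** With the convention [0^-1 = 0] the kernel is 0 on the diagonal, hence the assumption
    [x != y]. *)
Lemma frac_kernel_anti x y x' y' : x != y -> enorm (x - y) ^+ 2 <= enorm (x' - y') ^+ 2 ->
  frac_kernel x' y' <= frac_kernel x y.
Proof.
move=> xy le; have e0 : 0 < enorm (x - y).
  rewrite lt_neqAle enorm_ge0 eq_sym andbT; apply: contra_neq xy => /enorm_eq0 /eqP.
  by rewrite subr_eq0 => /eqP.
have le' : enorm (x - y) <= enorm (x' - y').
  by move: le; rewrite ler_sqr ?nnegrE ?enorm_ge0.
have q0 := frac_exponent_gt0.
have e0' := lt_le_trans e0 le'.
rewrite !frac_kernelE lef_pV2; [|rewrite posrE; exact: powR_gt0..].
by apply: ge0_ler_powR => //; [exact: ltW|rewrite nnegrE enorm_ge0|rewrite nnegrE enorm_ge0].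
Qed.

Fact powR_defect_key : unit. Proof. exact: tt. Qed.
(** Straight pairs minus crossed pairs: exchanging the values of [u] at one of the two points
    changes its sign. *)
Definition powR_defect u := locked_with powR_defect_key (fun x y : 'rV[R]_n =>
  `|u x - u y| `^ p + `|u (sigma x) - u (sigma y)| `^ p -
  (`|u (sigma x) - u y| `^ p + `|u x - u (sigma y)| `^ p)).

Lemma powR_defectE u x y : powR_defect u x y =
  `|u x - u y| `^ p + `|u (sigma x) - u (sigma y)| `^ p -
  (`|u (sigma x) - u y| `^ p + `|u x - u (sigma y)| `^ p).
Proof. by rewrite /powR_defect unlock. Qed.

Lemma powR_defect_ge0 u x y : (u (sigma x) - u x) * (u (sigma y) - u y) <= 0 ->
  0 <= powR_defect u x y.
Proof.
have p1' := ltW p1; rewrite powR_defectE subr_ge0.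
rewrite [X in _ -> X <= _]addrC; case: (leP (u x) (u (sigma x))) => hx.
  case: (leP (u (sigma y)) (u y)) => hy h; first exact: powR_norm_rearrangement.
  rewrite pmulr_lle0 ?subr_gt0// in h; have -> : u (sigma x) = u x by lra.
  by rewrite addrC.
rewrite nmulr_rle0 ?subr_lt0// subr_ge0 => hy.
by rewrite addrC [leRHS]addrC; apply: powR_norm_rearrangement => //; exact: ltW.
Qed.

Lemma powR_defect_reflection u x y : powR_defect u x (sigma y) = - powR_defect u x y.
Proof. by rewrite !powR_defectE reflectionK; ring. Qed.

Lemma frac_kernel_reflection x y : frac_kernel (sigma x) (sigma y) = frac_kernel x y.
Proof. by rewrite frac_kernel_reflectionC reflectionK. Qed.

Lemma measurable2_frac_kernel : measurable2 frac_kernel.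
Proof.
rewrite /measurable2; under eq_fun do rewrite frac_kernelE -powRN.
apply: (measurableT_comp (measurable_powR _)); apply: measurable_enorm.
by apply: measurable_rVB; [exact: measurable_fst|exact: measurable_snd].
Qed.

Lemma measurable2_powR_norm (f g : 'rV[R]_n -> R) : measurable_fun setT f -> measurable_fun setT g ->
  measurable2 (fun x y => `|f x - g y| `^ p).
Proof.
move=> mf mg; apply: (measurableT_comp (measurable_powR _)); apply: measurableT_comp => //.
apply: measurable_funB; first exact: measurableT_comp mf measurable_fst.
exact: measurableT_comp mg measurable_snd.
Qed.

Lemma measurable2_gagliardo_density u : measurable_fun setT u -> measurable2 (density u).
Proof.
move=> mu_; rewrite /measurable2; under eq_fun do rewrite gagliardo_densityE.
apply: measurable_funM; first exact: measurable2_powR_norm.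
exact: measurable2_frac_kernel.
Qed.

Lemma powR_defect_reflectionl u x y : powR_defect u (sigma x) y = - powR_defect u x y.
Proof. by rewrite !powR_defectE reflectionK; ring. Qed.

Lemma measurable2_powR_defect u : measurable_fun setT u -> measurable2 (powR_defect u).
Proof.
move=> mu_; have mus := measurable_reflection_comp H mu_.
rewrite /measurable2; under eq_fun do rewrite powR_defectE.
apply: measurable_funB; apply: measurable_funD.
- exact: (measurable2_powR_norm mu_ mu_).
- exact: (measurable2_powR_norm mus mus).
- exact: (measurable2_powR_norm mus mu_).
- exact: (measurable2_powR_norm mu_ mus).
Qed.

(* The amount by which polarization decreases the sum of the Gagliardo densities
   over the four pairs [(x or sigma x, y or sigma y)]. *)
Definition polarization_gain u x y : R :=
  if swapped H u x == swapped H u y then 0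
  else `|frac_kernel x y - frac_kernel x (sigma y)| * `|powR_defect u x y|.

(** If both points or neither are swapped, the four differences are permuted compatibly with the
    kernel. If exactly one is, straight and crossed differences trade places and the sum drops by
    [(K1 - K2) * D]; rearrangement and the monotonicity of the kernel give the two factors the same
    sign. *)
Lemma gagliardo_polarize_pointwise u x y :
  density u x y + density u (sigma x) y + (density u x (sigma y) + density u (sigma x) (sigma y)) =
  density (polarize H u) x y + density (polarize H u) (sigma x) y +
    (density (polarize H u) x (sigma y) + density (polarize H u) (sigma x) (sigma y)) +
  polarization_gain u x y.
Proof.
rewrite !gagliardo_densityE !polarize_reflection /polarize /polarization_gain.
rewrite !frac_kernel_reflectionC !reflectionK.
set K1 := frac_kernel x y; set K2 := frac_kernel x (sigma y).
set sx := swapped H u x; set sy := swapped H u y.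
have [e|ne] := eqVneq sx sy; first by rewrite -e; case: sx {e}; ring.
(* Equal points, and points that are reflections of each other, are swapped together; so both
   kernels are taken off the diagonal. *)
have xy : x != y by apply: contra_neq ne => e; rewrite /sx e.
have xsy : x != sigma y by apply: contra_neq ne => e; rewrite /sx e swapped_reflection.
set D := powR_defect u x y.
suff : (K1 - K2) * D = `|K1 - K2| * `|D|.
  by move=> <-; rewrite /D powR_defectE; move: ne; case: sx; case: sy => // _; ring.
(* [off z * (u (sigma z) - u z)] is at most 0 at a swapped point and at least 0 at any other, and
   exactly one of [x], [y] is swapped. *)
have dsgn : (off x * off y) * ((u (sigma x) - u x) * (u (sigma y) - u y)) <= 0.
  rewrite mulrACA; move: ne; rewrite /sx /sy.
  have aux (z : 'rV[R]_n) : swapped H u z -> off z * (u (sigma z) - u z) <= 0.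
    rewrite /swapped; case: ltP => h uz; first by rewrite nmulr_rle0; lra.
    by rewrite mulr_ge0_le0//; lra.
  have aux' (z : 'rV[R]_n) : ~~ swapped H u z -> 0 <= off z * (u (sigma z) - u z).
    rewrite /swapped; case: ltP => h; rewrite -leNgt => uz; first by rewrite nmulr_rge0; lra.
    by rewrite mulr_ge0//; lra.
  case: (boolP (swapped H u x)) => hx; case: (boolP (swapped H u y)) => hy //.
    by move=> _; rewrite mulr_le0_ge0 ?aux ?aux'.
  by move=> _; rewrite mulr_ge0_le0 ?aux ?aux'.
have [xy0|xy0|xy0] := ltgtP 0 (off x * off y).
- have K12 : 0 <= K1 - K2.
    rewrite subr_ge0; apply: frac_kernel_anti => //; rewrite enorm_reflection_sqr; lra.
  rewrite (ger0_norm K12) ger0_norm//; apply: powR_defect_ge0.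
  by rewrite pmulr_rle0 in dsgn.
- have K12 : K1 - K2 <= 0.
    rewrite subr_le0; apply: frac_kernel_anti => //; rewrite enorm_reflection_sqr; lra.
  rewrite (ler0_norm K12) ler0_norm ?mulrNN// -oppr_ge0 -powR_defect_reflection.
  apply: powR_defect_ge0; rewrite nmulr_rle0// in dsgn.
  by rewrite reflectionK -oppr_ge0 -mulrN opprB.
have -> : K1 = K2; last by rewrite subrr normr0 !mul0r.
by rewrite /K1 /K2 !frac_kernelE; congr (_ `^ _)^-1; apply/eqP; rewrite -(@eqrXn2 _ 2) ?enorm_ge0// enorm_reflection_sqr -xy0 mulr0 addr0.
Qed.

Lemma polarization_gain_ge0 u x y : 0 <= polarization_gain u x y.
Proof. by rewrite /polarization_gain; case: ifP => // _; rewrite mulr_ge0. Qed.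

Lemma polarization_gain_reflectionl u x y : polarization_gain u (sigma x) y = polarization_gain u x y.
Proof.
rewrite /polarization_gain swapped_reflection powR_defect_reflectionl normrN.
by rewrite frac_kernel_reflectionC frac_kernel_reflection (distrC (frac_kernel x (sigma y))).
Qed.

Lemma polarization_gain_reflectionr u x y : polarization_gain u x (sigma y) = polarization_gain u x y.
Proof.
rewrite /polarization_gain swapped_reflection powR_defect_reflection normrN reflectionK.
by rewrite (distrC (frac_kernel x (sigma y))).
Qed.

Lemma measurable2_polarization_gain u : measurable_fun setT u -> measurable2 (polarization_gain u).
Proof.
move=> mu_; have mus := measurable_reflection_comp H mu_.
have msw := measurable_swapped H mu_; have mK := measurable2_frac_kernel.
apply: measurable_fun_ifT; last apply: measurable_funM.
- rewrite (_ : (fun _ => _) = fun xy : 'rV[R]_n * 'rV[R]_n =>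
      if swapped H u xy.1 then swapped H u xy.2 else ~~ swapped H u xy.2); last first.
    by apply/funext => xy; case: (swapped H u xy.1); case: (swapped H u xy.2).
  have m1 := measurableT_comp msw (@measurable_fst _ _ 'rV[R]_n 'rV[R]_n).
  have m2 := measurableT_comp msw (@measurable_snd _ _ 'rV[R]_n 'rV[R]_n).
  by apply: measurable_fun_ifT => //; exact: measurable_neg.
- exact: measurable_cst.
- apply: measurableT_comp => //; apply: measurable_funB => //.
  exact: measurable2_reflectionr.
- by apply: measurableT_comp => //; exact: measurable2_powR_defect.
Qed.

Lemma gagliardo_polarize u : measurable_fun setT u ->
  (double_integral (density u) = double_integral (density (polarize H u)) +
   4^-1%:E * double_integral (polarization_gain u))%E.
Proof.
move=> mu_; have mv := measurable_polarize H mu_; have mg := measurable2_polarization_gain mu_.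
have m1 := measurable2_gagliardo_density mu_; have m2 := measurable2_gagliardo_density mv.
have i4 : 0 <= 4^-1 :> R by rewrite invr_ge0.
have mg4 : measurable2 (fun x y => 4^-1 * polarization_gain u x y) by exact: measurable_funM.
rewrite -double_integralZ//; last exact: polarization_gain_ge0.
rewrite -double_integralD//; last 2 first.
- by move=> x y; exact: gagliardo_density_ge0.
- by move=> x y; rewrite mulr_ge0// polarization_gain_ge0.
apply: (double_integral_reflection_eq (H := H)) => //.
- exact: measurable2D.
- by move=> x y; exact: gagliardo_density_ge0.
- by move=> x y; rewrite addr_ge0// ?gagliardo_density_ge0// mulr_ge0// polarization_gain_ge0.
move=> x y; rewrite gagliardo_polarize_pointwise !polarization_gain_reflectionl !polarization_gain_reflectionr.
set G := polarization_gain u x y; set a := density _ _ _; set b := density _ _ _.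
by set c := density _ _ _; set e := density _ _ _; move: G a b c e => G a b c e; field.
Qed.

Lemma energyE u g : (energy s p u g =
  integral_powR p (fun x => enorm (g x)) + double_integral (density u))%E.
Proof. by []. Qed.

Lemma energy_polarize u g : sobolev11 u g ->
  (energy s p u g = energy s p (polarize H u) (polarize_gradient H u g) +
   4^-1%:E * double_integral (polarization_gain u))%E.
Proof.
move=> sug; have [mu_ mg] := sobolev11_measurable sug.
have E : integral_powR p (fun x => enorm (polarize_gradient H u g x)) =
    integral_powR p (fun x => enorm (g x)).
  rewrite !integral_powR_def.
  apply: (integral_polarize_gradient H (f := fun t => (`|t| `^ p)%:E) mu_ mg).
  - apply/measurable_EFinP; apply: (measurableT_comp (measurable_powR _)).
    exact: normr_measurable.
  - by move=> t; rewrite lee_fin powR_ge0.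
by rewrite !energyE E (gagliardo_polarize mu_) addeA.
Qed.

Lemma admissible_polarize Omega u g : (forall x, 0 <= u x) -> admissible p Omega u g ->
  admissible p (polarization H Omega) (polarize H u) (polarize_gradient H u g).
Proof.
move=> u0 [sug up gp uO]; have [mu_ mg] := sobolev11_measurable sug.
have mpow : measurable_fun setT (fun t : R => (`|t| `^ p)%:E).
  apply/measurable_EFinP; apply: (measurableT_comp (measurable_powR _)).
  exact: normr_measurable.
have pow0 (t : R) : (0 <= (`|t| `^ p)%:E)%E by rewrite lee_fin powR_ge0.
split.
- exact: sobolev11_polarize.
- by rewrite integral_powR_def (integral_polarize H (f := fun t => (`|t| `^ p)%:E))// -integral_powR_def.
- by rewrite integral_powR_def (integral_polarize_gradient H (f := fun t => (`|t| `^ p)%:E))// -(integral_powR_def _ (fun x => enorm (g x))).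
- exact: polarize_vanish.
Qed.

End gagliardo_polarization.

(** * The weak inequality *)

Section weak_inequality.
Variables (R : realType) (n : nat) (s p : R).
Hypotheses (p1 : 1 < p) (s01 : 0 < s < 1).
Implicit Types (u w : 'rV[R]_n -> R) (g : 'rV[R]_n -> 'rV[R]_n) (x : 'rV[R]_n).

Lemma le_integral_powR u w : measurable_fun setT u -> measurable_fun setT w ->
  (forall x, `|u x| <= `|w x|) -> (integral_powR p u <= integral_powR p w)%E.
Proof.
move=> mu_ mw uw.
have mp (f : 'rV[R]_n -> R) : measurable_fun setT f -> measurable_fun setT (fun x => (`|f x| `^ p)%:E).
  move=> mf; apply/measurable_EFinP; apply: (measurableT_comp (measurable_powR _)) => //.
  exact: measurableT_comp.
have p0 : 0 <= p by have := p1; lra.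
have mpu := mp u mu_; have mpw := mp w mw.
rewrite !integral_powR_def; apply: ge0_le_integral => //.
by move=> x _; rewrite lee_fin; apply: ge0_ler_powR; rewrite ?nnegrE.
Qed.

Lemma energy_abs u g : sobolev11 u g ->
  (energy s p (fun x => `|u x|)%R (fun x => sgr (u x) *: g x)%R <= energy s p u g)%E.
Proof.
move=> sug; have [mu_ mg] := sobolev11_measurable sug.
have [sa _] := sobolev11_abs sug; have [ma mga] := sobolev11_measurable sa.
have p0 : 0 <= p by have := p1; lra.
rewrite !energyE; apply: leeD.
  apply: le_integral_powR; [exact: measurable_enorm|exact: measurable_enorm|].
  move=> x; rewrite !ger0_norm ?enorm_ge0// enormZ normr_sg.
  by case: eqVneq => _; rewrite ?mul1r// mul0r enorm_ge0.
apply: le_double_integral.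
- exact: measurable2_gagliardo_density.
- exact: measurable2_gagliardo_density.
- by move=> x y; exact: gagliardo_density_ge0.
move=> x y; rewrite !gagliardo_densityE ler_wpM2r//.
  by rewrite frac_kernelE invr_ge0 powR_ge0.
by apply: ge0_ler_powR; rewrite ?nnegrE//; exact: ler_dist_dist.
Qed.

Lemma admissible_abs Omega u g : admissible p Omega u g ->
  admissible p Omega (fun x => `|u x|) (fun x => sgr (u x) *: g x).
Proof.
move=> [sug up gp uO]; have [mu_ mg] := sobolev11_measurable sug.
have [sa _] := sobolev11_abs sug; have [ma mga] := sobolev11_measurable sa.
split => //.
- by apply: le_lt_trans up; apply: le_integral_powR => // x; rewrite normr_id.
- apply: le_lt_trans gp; apply: le_integral_powR; [exact: measurable_enorm|exact: measurable_enorm|].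
  move=> x; rewrite !ger0_norm ?enorm_ge0// enormZ normr_sg.
  by case: eqVneq => _; rewrite ?mul1r// mul0r enorm_ge0.
by apply: filterS uO => x ux /ux ->; rewrite normr0.
Qed.

Lemma integral_powR_abs u : integral_powR p (fun x => `|u x|) = integral_powR p u.
Proof. by rewrite !integral_powR_def; apply: eq_integral => x _; rewrite normr_id. Qed.

Variable H : polarizer R n.

Lemma bounded_polarization (Omega : set 'rV[R]_n) : bounded_set Omega ->
  bounded_set (polarization H Omega).
Proof.
move=> [M [_ hM]].
have bO x : Omega x -> `|x| <= `|M| + 1.
  by apply: hM; rewrite ltr_pwDr// ler_norm.
exists (n%:R * (`|M| + 1) + `|(2 * pol_offset H) *: pol_normal H| + (`|M| + 1)); split; first exact: num_real.
move=> K hK x; rewrite /polarization.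
have bs y : Omega y -> `|reflection H y| <= K.
  move=> Oy; apply: le_trans (ltW hK); rewrite reflectionE.
  apply: le_trans (ler_normD _ _) _; rewrite -[leLHS]addr0; apply: lerD; last by rewrite addr_ge0.
  rewrite lerD2r; apply: le_trans (norm_le_enorm _) _; rewrite enorm_lin_reflection.
  apply: le_trans (enorm_le_norm _) _; rewrite ler_wpM2l//; exact: bO.
have b1 y : Omega y -> `|y| <= K.
  move=> Oy; apply: le_trans (ltW hK); apply: le_trans (bO _ Oy) _.
  by rewrite lerDr addr_ge0// mulr_ge0// addr_ge0.
by move=> [[[Ox|[y Oy <-]] _]|[Ox _]]; [exact: b1|exact: bs|exact: b1].
Qed.

Variable Omega : set 'rV[R]_n.
Hypotheses (oO : open Omega) (bO : bounded_set Omega).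

(** Keeping the gain serves both inequalities: it is dropped for the weak one, and bounded along a
    minimizing sequence for the strict one. *)
Lemma least_eigenvalue_gain u g : admissible p Omega u g -> integral_powR p u = 1%E ->
  (least_eigenvalue s p (polarization H Omega) +
   4^-1%:E * double_integral (polarization_gain H s p (fun x => `|u x|)%R) <= energy s p u g)%E.
Proof.
move=> adm N1; have mO := open_measurable_rV oO.
have admA := admissible_abs adm; have [sug _ _ _] := adm; have [sa _ _ _] := admA.
have [mu_ _] := sobolev11_measurable sa.
apply: le_trans (energy_abs sug); rewrite (energy_polarize H p1 s01 sa); apply: leeD => //.
rewrite least_eigenvalueE//; [|exact: measurable_polarization|exact: bounded_polarization].
apply: ereal_inf_lbound; exists (polarize H (fun x => `|u x|),
  polarize_gradient H (fun x => `|u x|) (fun x => sgr (u x) *: g x)) => //=; split.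
  by apply: admissible_polarize => //.
rewrite integral_powR_def (integral_polarize H (f := fun t => (`|t| `^ p)%:E))//.
- by rewrite -(integral_powR_def p (fun x => `|u x|)) integral_powR_abs.
- apply/measurable_EFinP; apply: (measurableT_comp (measurable_powR _)).
  exact: normr_measurable.
Qed.

Lemma least_eigenvalue_polarization :
  (least_eigenvalue s p (polarization H Omega) <= least_eigenvalue s p Omega)%E.
Proof.
have mO := open_measurable_rV oO.
rewrite [leRHS]least_eigenvalueE//; apply: le_ereal_inf_tmp => _ [[u g] /= [adm N1] <-].
apply: le_trans (least_eigenvalue_gain adm N1); rewrite leeDl// mule_ge0//.
by apply: double_integral_ge0 => x y; exact: polarization_gain_ge0.
Qed.

End weak_inequality.

(** * Energy of test functions *)

Section dyadic.
Variable R : realType.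

Lemma dyadic_bracket (t : R) : 1 <= t -> exists j : nat, 2 ^+ j <= t < 2 ^+ j.+1.
Proof.
move=> t1; have ex : exists j : nat, t < 2 ^+ j.+1.
  exists (Num.truncn t).+1; apply: lt_le_trans (truncnS_gt t) _.
  by rewrite -natrX ler_nat; apply: leq_trans (ltnW (ltn_expl _ (ltnSn 1))) _; rewrite leq_exp2l.
have := ex_minnP ex => -[j tj jmin]; exists j; rewrite tj andbT.
case: j jmin tj => [|j] jmin tj; first by rewrite expr0.
by rewrite leNgt; apply/negP => /jmin; rewrite ltnn.
Qed.

Lemma powR_expn (a x : R) (j : nat) : 0 <= a -> (a ^+ j) `^ x = (a `^ x) ^+ j.
Proof.
move=> a0; rewrite -[a ^+ j]powR_mulrn// -powRrM mulrC powRrM powR_mulrn//.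
exact: powR_ge0.
Qed.

End dyadic.

Section kernel_integral.
Variables (R : realType) (n : nat).
Local Notation mu := (lebesgue_rV R n).
Implicit Types (x y z : 'rV[R]_n).

Definition cube (r : R) : set 'rV[R]_n := obox (const_mx (- r)) (const_mx r).

Lemma cubeP r x : 0 < r -> cube r x <-> `|x| < r.
Proof.
move=> r0; split=> [h|h i]; last first.
  by rewrite !mxE -ltr_norml; apply: le_lt_trans h; exact: coord_le_norm.
by apply: normr_rV_lt => // i; have := h i; rewrite !mxE ltr_norml.
Qed.

Lemma measurable_cube r : measurable (cube r).
Proof. exact: measurable_obox. Qed.

Lemma lebesgue_cube r : 0 < r -> mu (cube r) = ((2 * r) ^+ n)%:E.
Proof.
move=> r0; rewrite lebesgue_rV_obox (eq_bigr (fun=> (2 * r)%:E)); last first.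
  move=> i _; rewrite !mxE lebesgue_measure_itv /= lte_fin (_ : - r < r); last by lra.
  by rewrite -EFinB; congr (_%:E); ring.
by rewrite prodEFin prodr_const card_ord.
Qed.

Lemma double_integralC (F : 'rV[R]_n -> 'rV[R]_n -> R) : measurable2 F -> (forall x y, 0 <= F x y) ->
  double_integral F = double_integral (fun x y => F y x).
Proof.
move=> mF F0; rewrite !double_integral_def.
apply: (fubini_tonelli (m1 := mu) (m2 := mu) (fun xy => (F xy.1 xy.2)%:E)).
  exact/measurable_EFinP.
by move=> xy; rewrite lee_fin.
Qed.

(** Comparison with a geometric series, playing the role of polar coordinates. The sets [A j] may
    overlap; the sum of the [a j * \1_(A j)] still dominates [f]. *)
Lemma dyadic_integral_lty (f : 'rV[R]_n -> R) (A : nat -> set 'rV[R]_n) (a : nat -> R) (C rho : R) :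
  measurable_fun setT f -> (forall z, 0 <= f z) -> (forall j, measurable (A j)) ->
  (forall j, 0 <= a j) -> 0 <= C -> 0 < rho < 1 ->
  (forall j, (a j)%:E * mu (A j) <= (C * rho ^+ j)%:E)%E ->
  (forall z, f z != 0 -> exists2 j, A j z & f z <= a j) ->
  (\int[mu]_z (f z)%:E < +oo)%E.
Proof.
move=> mf f0 mA a0 C0 /andP[rho0 rho1] aA fA.
pose g j z := (a j * \1_(A j) z)%:E.
have g0 j z : (0 <= g j z)%E by rewrite lee_fin mulr_ge0.
have mg j : measurable_fun setT (g j).
  by apply/measurable_EFinP; apply: measurable_funM => //; exact: measurable_indic.
apply: (@le_lt_trans _ _ (\int[mu]_z \sum_(0 <= j <oo) g j z)%E).
  apply: ge0_le_integral => //.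
  - by move=> z _; rewrite lee_fin.
  - exact/measurable_EFinP.
  - by apply: ge0_emeasurable_sum => // k z _ _; exact: g0.
  move=> z _; have [->|fz] := eqVneq (f z) 0; first by apply: nneseries_ge0 => j _ _; exact: g0.
  have [j Aj fj] := fA z fz.
  apply: le_trans (nneseries_lim_ge j.+1 _) => //.
  rewrite big_nat_recr//=; apply: (@le_trans _ _ (g j z)); last first.
    by rewrite leeDr//; apply: sume_ge0 => i _; exact: g0.
  by rewrite /g indicE mem_set// mulr1 lee_fin.
rewrite integral_nneseries//.
apply: (@le_lt_trans _ _ (C / (1 - rho))%:E); last exact: ltry.
have ig j : (\int[mu]_z g j z = (a j)%:E * mu (A j))%E.
  rewrite (eq_integral (fun z => (a j)%:E * (\1_(A j) z)%:E)%E); last by move=> z _; rewrite -EFinM.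
  rewrite ge0_integralZl//; first last.
  - by rewrite lee_fin.
  - by apply/measurable_EFinP; exact: measurable_indic.
  by rewrite integral_indic// setIT.
apply: lime_le; first by apply: is_cvg_nneseries => j _ _; exact: integral_ge0.
apply: nearW => N; apply: (@le_trans _ _ (\sum_(0 <= j < N) (C * rho ^+ j)%:E)%E).
  by apply: lee_sum => j _; rewrite ig.
rewrite sumEFin lee_fin.
by apply: (geometric_le_lim N C0 rho0); rewrite ger0_norm// ltW.
Qed.

Variables (s p L M : R).
Hypotheses (p1 : 1 < p) (s01 : 0 < s < 1) (L0 : 0 <= L) (M0 : 0 <= M) (n0 : (0 < n)%N).
Local Notation q := (n%:R + s * p).

Fact truncated_kernel_key : unit. Proof. exact: tt. Qed.
(** Dominates the Gagliardo density of an [L]-Lipschitz function whose differences have [p]-th power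
    at most [M]. It depends on [x - y] alone, so its integral in [y] does not depend on [x]. *)
Definition truncated_kernel := locked_with truncated_kernel_key
  (fun z : 'rV[R]_n => minr ((L * enorm z) `^ p) M / enorm z `^ q).

Lemma truncated_kernelE z : truncated_kernel z = minr ((L * enorm z) `^ p) M / enorm z `^ q.
Proof. by rewrite /truncated_kernel unlock. Qed.

Lemma truncated_kernel_ge0 z : 0 <= truncated_kernel z.
Proof. by rewrite truncated_kernelE divr_ge0 ?powR_ge0// le_min powR_ge0. Qed.

Lemma measurable_truncated_kernel : measurable_fun setT truncated_kernel.
Proof.
have me : measurable_fun setT (fun z : 'rV[R]_n => enorm z) by apply: measurable_enorm; exact: measurable_id.
rewrite (funext truncated_kernelE); under eq_fun do rewrite -powRN.
apply: measurable_funM; last exact: (measurableT_comp (measurable_powR _) me).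
apply: measurable_minr => //; apply: (measurableT_comp (measurable_powR _)).
exact: measurable_funM.
Qed.

Lemma powR_exponent_small (r : R) : 0 < r -> r `^ p / r `^ q * r ^+ n = r `^ (p * (1 - s)).
Proof.
move=> r0; have rn : r != 0 by rewrite gt_eqF.
have D (x y : R) : r `^ (x + y) = r `^ x * r `^ y by rewrite powRD// rn implybT.
apply: (mulIf (_ : r `^ q != 0)); first by rewrite gt_eqF// powR_gt0.
rewrite mulrAC divfK ?gt_eqF ?powR_gt0// -powR_mulrn ?(ltW r0)// -!D.
by congr (_ `^ _); ring.
Qed.

Lemma powR_exponent_large (r : R) : 0 < r -> r ^+ n / r `^ q = r `^ (- (s * p)).
Proof.
move=> r0; have rn : r != 0 by rewrite gt_eqF.
have D (x y : R) : r `^ (x + y) = r `^ x * r `^ y by rewrite powRD// rn implybT.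
apply: (mulIf (_ : r `^ q != 0)); first by rewrite gt_eqF// powR_gt0.
rewrite divfK ?gt_eqF ?powR_gt0// -powR_mulrn ?(ltW r0)// -!D.
by congr (_ `^ _); ring.
Qed.

(** Near the origin the dyadic ratio is [2^(-p(1-s))] and at infinity it is [2^(-sp)]; the bounds
    [s < 1] and [0 < s] make the two series converge. *)
Lemma truncated_kernel_lty : (\int[mu]_z (truncated_kernel z)%:E < +oo)%E.
Proof.
have [s0 s1] := andP s01; have p0 : 0 < p by exact: lt_trans p1.
have q0 : 0 < q by apply: ltr_wpDl => //; exact: mulr_gt0.
have mk := measurable_truncated_kernel; have k0 := truncated_kernel_ge0.
pose f1 z := if `|z| < 1 then truncated_kernel z else 0.
pose f2 z := if `|z| < 1 then 0 else truncated_kernel z.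
have mlt : measurable_fun setT (fun z : 'rV[R]_n => `|z| < 1).
  rewrite (_ : (fun _ => _) = fun z => z \in cube 1); last first.
    by apply/funext => z; apply/idP/idP => [/(cubeP _ ltr01)/mem_set//|/set_mem/(cubeP _ ltr01)].
  by apply: measurable_mem; exact: measurable_cube.
have mf1 : measurable_fun setT f1 by exact: measurable_fun_ifT.
have mf2 : measurable_fun setT f2 by exact: measurable_fun_ifT.
have f10 z : 0 <= f1 z by rewrite /f1; case: ifP.
have f20 z : 0 <= f2 z by rewrite /f2; case: ifP.
rewrite (eq_integral (fun z => (f1 z)%:E + (f2 z)%:E)%E); last first.
  by move=> z _; rewrite -EFinD /f1 /f2; case: ifP; rewrite ?addr0 ?add0r.
rewrite ge0_integralD//; [|by move=> z _; rewrite lee_fin|exact/measurable_EFinP|by move=> z _; rewrite lee_fin|exact/measurable_EFinP].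
have h2 : 0 < 2^-1 :> R by rewrite invr_gt0.
have h2' : 2^-1 < 1 :> R by rewrite invf_lt1// ltr1n.
apply: lte_add_pinfty.
(* The point [z] is placed in a shell [r j / 2 < |z| <= r j]; the radius [2 r j] is taken because
   cubes are open. *)
- pose r j : R := 2^-1 ^+ j.
  have r0 j : 0 < r j by exact: exprn_gt0.
  apply: (@dyadic_integral_lty f1 (fun j => cube (2 * r j))
    (fun j => (L * (n%:R * r j)) `^ p / (r j * 2^-1) `^ q)
    ((L * n%:R) `^ p / (2^-1) `^ q * 4 ^+ n) (2^-1 `^ (p * (1 - s)))) => //.
  + by move=> j; exact: measurable_cube.
  + by move=> j; rewrite divr_ge0 ?powR_ge0.
  + by rewrite mulr_ge0// divr_ge0 ?powR_ge0.
  + rewrite powR_gt0//=.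
    have := @gt0_ltr_powR R (p * (1 - s)) _ 2^-1 1; rewrite powR1; apply => //.
    * by rewrite mulr_gt0// subr_gt0.
    * by rewrite nnegrE.
    * by rewrite nnegrE.
  + move=> j; rewrite lebesgue_cube ?mulr_gt0// -EFinM lee_fin.
    rewrite -powR_expn// -/(r j) le_eqVlt; apply/orP; left; apply/eqP.
    have -> : 2 * (2 * r j) = 4 * r j by ring.
    rewrite [L * (n%:R * r j)]mulrA exprMn (powRM _ _ (ltW (r0 j))) ?mulr_ge0//.
    rewrite (powRM _ (ltW (r0 j)) (ltW h2)) -(powR_exponent_small (r0 j)) invfM.
    set c1 := (r j `^ q)^-1; set c2 := (2^-1 `^ q)^-1; set c3 := 4 ^+ n; set c4 := r j ^+ n.
    by set c5 := r j `^ p; set c6 := (L * n%:R) `^ p; move: c1 c2 c3 c4 c5 c6 => *; ring.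
  + move=> z; rewrite /f1; case: ifPn => [z1|]; last by rewrite eqxx.
    move=> kz; have z0 : 0 < `|z|.
      rewrite normr_gt0; apply: contra_neq kz => ->; rewrite truncated_kernelE enorm0 mulr0.
      have pn : p != 0 by rewrite gt_eqF.
      by rewrite (powR0 pn) (min_l M0) mul0r.
    have [|j /andP[j1 j2]] := dyadic_bracket (t := `|z|^-1).
      by rewrite invf_ge1// ltW.
    have zr : `|z| <= r j by rewrite /r exprVn -[leLHS]invrK lef_pV2 ?posrE ?invr_gt0// exprn_gt0.
    have rz : r j * 2^-1 < `|z|.
      by rewrite /r -exprSr -[ltRHS]invrK exprVn ltf_pV2 ?posrE ?invr_gt0// exprn_gt0.
    exists j.
      by apply/cubeP; [exact: mulr_gt0|apply: le_lt_trans zr _; rewrite ltr_pMl// ltr1n].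
    rewrite truncated_kernelE ler_pM//.
    * by rewrite le_min powR_ge0.
    * by rewrite invr_ge0 powR_ge0.
    * rewrite ge_min; apply/orP; left; apply: ge0_ler_powR.
      - exact: ltW.
      - by rewrite nnegrE mulr_ge0// enorm_ge0.
      - by rewrite nnegrE !mulr_ge0// ltW.
      by rewrite ler_wpM2l//; apply: le_trans (enorm_le_norm z) _; rewrite ler_wpM2l.
    * have e0 := norm_le_enorm z.
      rewrite lef_pV2 ?posrE ?powR_gt0 ?mulr_gt0 ?(lt_le_trans z0 e0)//.
      apply: ge0_ler_powR; rewrite ?nnegrE ?enorm_ge0 ?mulr_ge0//; [exact: ltW|exact: ltW|].
      exact: le_trans (ltW rz) e0.
- apply: (@dyadic_integral_lty f2 (fun j => cube (2 ^+ j.+1))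
    (fun j => M / (2 ^+ j) `^ q) (M * 4 ^+ n) (2 `^ (- (s * p)))) => //.
  + by move=> j; exact: measurable_cube.
  + by move=> j; rewrite divr_ge0 ?powR_ge0.
  + by rewrite mulr_ge0.
  + rewrite powR_gt0//= powRN invf_lt1 ?powR_gt0//.
    have := @gt0_ltr_powR R (s * p) _ 1 2; rewrite powR1; apply.
    * exact: mulr_gt0.
    * by rewrite nnegrE.
    * by rewrite nnegrE.
    * by rewrite ltr1n.
  + move=> j; rewrite lebesgue_cube ?exprn_gt0// -EFinM lee_fin.
    rewrite -powR_expn// le_eqVlt; apply/orP; left; apply/eqP.
    have -> : 2 * 2 ^+ j.+1 = 4 * 2 ^+ j :> R by rewrite exprS; ring.
    have t0 : 0 < 2 ^+ j :> R by exact: exprn_gt0.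
    by rewrite exprMn -(powR_exponent_large t0); ring.
  + move=> z; rewrite /f2; case: ifPn => [|]; first by rewrite eqxx.
    rewrite -leNgt => z1 _; have [j /andP[j1 j2]] := dyadic_bracket z1.
    exists j; first by apply/cubeP => //; exact: exprn_gt0.
    rewrite truncated_kernelE ler_pM//.
    * by rewrite le_min powR_ge0.
    * by rewrite invr_ge0 powR_ge0.
    * by rewrite ge_min lexx orbT.
    * have e0 := norm_le_enorm z; have z0 := lt_le_trans ltr01 z1.
      rewrite lef_pV2 ?posrE ?powR_gt0 ?(lt_le_trans z0 e0) ?exprn_gt0//.
      apply: ge0_ler_powR; rewrite ?nnegrE ?enorm_ge0 ?exprn_ge0//; first exact: ltW.
      exact: le_trans j1 e0.
Qed.

Lemma truncated_kernelN z : truncated_kernel (- z) = truncated_kernel z.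
Proof. by rewrite !truncated_kernelE enormN. Qed.

Lemma measurable2_truncated_kernel : measurable2 (fun x y => truncated_kernel (x - y)).
Proof.
apply: measurableT_comp; first exact: measurable_truncated_kernel.
by apply: measurable_rVB; [exact: measurable_fst|exact: measurable_snd].
Qed.

Lemma truncated_kernel_translate x :
  (\int[mu]_y (truncated_kernel (x - y))%:E = \int[mu]_z (truncated_kernel z)%:E)%E.
Proof.
rewrite (eq_integral (fun y : 'rV[R]_n => (truncated_kernel (y - x))%:E)); last first.
  by move=> y _; rewrite -truncated_kernelN opprB.
apply: (ge0_integral_preserving (f := fun z => (truncated_kernel z)%:E) (translation_preserving (- x))).
  by apply/measurable_EFinP; exact: measurable_truncated_kernel.
by move=> z; rewrite lee_fin truncated_kernel_ge0.
Qed.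

(* The density is at most [1_B(x) k(x - y) + 1_B(y) k(x - y)] for a cube [B]
   containing the support of [u]. *)
Lemma gagliardo_lty (u : 'rV[R]_n -> R) (r : R) : 0 < r -> measurable_fun setT u ->
  (forall x, u x != 0 -> `|x| < r) -> (forall x y, `|u x - u y| <= L * enorm (x - y)) ->
  (forall x y, `|u x - u y| `^ p <= M) ->
  (double_integral (gagliardo_density s p u) < +oo)%E.
Proof.
move=> r0 mu_ ur uL uM; have p0 : 0 < p by exact: lt_trans p1.
have pn : p != 0 by rewrite gt_eqF.
have mB := measurable_cube r; have mk := measurable2_truncated_kernel.
have k0 x y : 0 <= truncated_kernel (x - y) by exact: truncated_kernel_ge0.
have mi1 : measurable2 (fun x y : 'rV[R]_n => \1_(cube r) x : R).
  by apply: measurableT_comp measurable_fst; exact: measurable_indic.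
have mi2 : measurable2 (fun x y : 'rV[R]_n => \1_(cube r) y : R).
  by apply: measurableT_comp measurable_snd; exact: measurable_indic.
pose F1 x y := \1_(cube r) x * truncated_kernel (x - y).
pose F2 x y := \1_(cube r) y * truncated_kernel (x - y).
have mF1 : measurable2 F1 by exact: measurable_funM.
have mF2 : measurable2 F2 by exact: measurable_funM.
have F10 x y : 0 <= F1 x y by rewrite mulr_ge0.
have F20 x y : 0 <= F2 x y by rewrite mulr_ge0.
have F1oo : (double_integral F1 < +oo)%E.
  rewrite double_integral_def; set K := (\int[mu]_z (truncated_kernel z)%:E)%E.
  rewrite (eq_integral (fun x => K * (\1_(cube r) x)%:E)%E); last first.
    move=> x _; rewrite /F1 /K -(truncated_kernel_translate x) muleC -ge0_integralZl//.
    - by apply/measurable_EFinP; exact: (measurable2_section _ mk).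
    - by move=> y _; rewrite lee_fin.
  have K0 : (0 <= K)%E by apply: integral_ge0 => z _; rewrite lee_fin truncated_kernel_ge0.
  rewrite ge0_integralZl//; last first.
  - by apply/measurable_EFinP; exact: measurable_indic.
  rewrite integral_indic// setIT; apply: lte_mul_pinfty => //.
  - by rewrite ge0_fin_numE// truncated_kernel_lty.
  - exact: lebesgue_rV_obox_lty.
have F2E : double_integral F2 = double_integral F1.
  rewrite (double_integralC mF2 F20); congr double_integral; apply/funext => x; apply/funext => y.
  by rewrite /F1 /F2 -truncated_kernelN opprB.
apply: (@le_lt_trans _ _ (double_integral (fun x y => F1 x y + F2 x y)%R)).
  apply: le_double_integral.
  - exact: measurable2_gagliardo_density.
  - exact: measurable2D.
  - by move=> x y; exact: gagliardo_density_ge0.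
  move=> x y; rewrite gagliardo_density_def.
  have le : `|u x - u y| `^ p / enorm (x - y) `^ q <= truncated_kernel (x - y).
    rewrite truncated_kernelE ler_wpM2r ?invr_ge0 ?powR_ge0// le_min uM andbT.
    by apply: ge0_ler_powR; rewrite ?nnegrE ?(ltW p0) ?mulr_ge0 ?enorm_ge0.
  have [cx|cx] := pselect (cube r x).
    by apply: le_trans le _; rewrite /F1 indicE mem_set// mul1r lerDl.
  have [cy|cy] := pselect (cube r y).
    by apply: le_trans le _; rewrite /F2 indicE mem_set// mul1r lerDr.
  have u0 z : ~ cube r z -> u z = 0.
    by move=> cz; apply/eqP; apply: contrapT => /negP /ur /(cubeP _ r0).
  by rewrite !u0// subrr normr0 powR0// mul0r addr_ge0.
by rewrite double_integralD// F2E lte_add_pinfty.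
Qed.

End kernel_integral.

Section test_function_energy.
Variables (R : realType) (n : nat) (s p : R).
Hypotheses (p1 : 1 < p) (s01 : 0 < s < 1).
Local Notation mu := (lebesgue_rV R n).
Implicit Types (x y : 'rV[R]_n) (phi : 'rV[R]_n -> R).
Local Notation e_ i := (delta_mx (ord0 : 'I_1) i : 'rV[R]_n).

Lemma test_function_support phi : test_function phi ->
  exists2 r : R, 0 < r & forall x, phi x != 0 -> `|x| < r.
Proof.
move=> [_ /compact_bounded[M [_ hM]]]; exists (`|M| + 2); first by rewrite ltr_wpDl.
move=> x px; apply: le_lt_trans (hM (`|M| + 1) _ x _) _.
- by rewrite ltr_pwDr// ler_norm.
- exact: subset_closure.
- by rewrite ltrD2l ltr1n.
Qed.

Lemma open_normr_gt (r : R) : open [set y : 'rV[R]_n | r < `|y|].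
Proof.
apply: (@open_comp _ _ (fun y : 'rV[R]_n => `|y|) [set t | r < t]); last exact: open_gt.
by move=> y _; exact: norm_continuous.
Qed.

Lemma integrable_cube (r C : R) : mu.-integrable setT (fun x => (C * \1_(cube r) x)%:E).
Proof.
have : mu.-integrable setT (EFin \o (\1_(cube r) : 'rV[R]_n -> R)).
  apply/integrableP; split.
    by apply/measurable_EFinP; apply: measurable_indic; exact: measurable_cube.
  rewrite (eq_integral (fun x => (\1_(cube r) x)%:E)); last by move=> x _; rewrite /= ger0_norm.
  by rewrite integral_indic ?setIT//; [exact: lebesgue_rV_obox_lty|exact: measurable_cube].
by move=> /(integrableZl measurableT C); apply: eq_integrable => // x _; rewrite /= EFinM.
Qed.

Lemma test_function_integrable phi : test_function phi -> mu.-integrable setT (EFin \o phi).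
Proof.
move=> tphi; have [r r0 hr] := test_function_support tphi.
have [M hM] := test_function_bounded tphi.
apply: le_integrable (integrable_cube r M) => //.
  by apply/measurable_EFinP; exact: test_function_measurable.
move=> x _ /=; rewrite lee_fin; have [->|px] := eqVneq (phi x) 0; first by rewrite normr0.
by rewrite indicE mem_set ?mulr1; [apply: le_trans (hM x) _; exact: ler_norm|apply/cubeP => //; exact: hr].
Qed.

(** The difference quotients converge pointwise and are dominated by a constant on a cube, hence
    converge in L1. The radius is [r + 1] because the steps [t_ k] are at most 1. *)
Lemma test_function_sobolev11 phi : test_function phi -> sobolev11 phi (gradient phi).
Proof.
move=> tphi; have [sphi _] := tphi; have Iphi := test_function_integrable tphi.
have Ip i := test_function_integrable (test_function_partial i tphi).
split => // [i|i psi tpsi].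
  by have := Ip i; apply: eq_integrable => // x _; rewrite mxE.
rewrite [in RHS](eq_integral (fun x => (partial i phi x * psi x)%:E)); last by move=> x _; rewrite mxE.
have [r r0 hr] := test_function_support tphi.
have [L L0 hL] := test_function_lipschitz tphi.
have [M hM] := test_function_bounded (test_function_partial i tphi).
have mphi := test_function_measurable tphi.
have mpart := integrable_measurable (Ip i).
pose t_ k : R := k.+1%:R^-1; have t0 k : t_ k != 0 by exact: harmonic_neq0.
have tk1 k : 0 < t_ k <= 1 by rewrite invr_gt0 ltr0n /= invf_le1 ?ler1n.
apply: (@test_by_parts _ _ phi (partial i phi) (e_ i) t_) => //; first exact: cvg_harmonic.
have mq k : measurable_fun setT (fun x => (phi (x + t_ k *: e_ i) - phi x) / t_ k).
  by apply: measurable_funM => //; apply: measurable_funB => //; exact: measurable_translate.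
have [] // := @dominated_convergence _ _ _ mu setT measurableT
  (fun k x => `|(phi (x + t_ k *: e_ i) - phi x) / t_ k - partial i phi x|%:E) (cst 0%E)
  (fun x => ((L + M) * \1_(cube (r + 1)) x)%:E); last by move=> _ _; rewrite integral0.
- by move=> k; apply/measurable_EFinP; apply: measurableT_comp => //; exact: measurable_funB.
- apply: aeW => x _; apply: cvg_EFin; first exact: nearW.
  rewrite -(normr0 R); apply: cvg_norm; rewrite -(subrr (partial i phi x)).
  apply: cvgB; last exact: cvg_cst.
  have dphi : differentiable phi x by exact: (sphi [::]).
  have := derivative_along_sequence (v := - e_ i) dphi t0 (@cvg_harmonic R).
  have -> : 'D_(- e_ i) phi x = - partial i phi x by rewrite /partial !deriveE// linearN.
  rewrite opprK; apply: cvg_trans; apply: near_eq_cvg; apply: nearW => k.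
  by rewrite scalerN opprK.
- exact: integrable_cube.
apply: aeW => x k _; rewrite abse_EFin normr_id lee_fin.
have [t1 t2] := andP (tk1 k).
have [cx|cx] := pselect (cube (r + 1) x).
  rewrite indicE mem_set// mulr1; apply: le_trans (ler_normB _ _) _; apply: lerD => //.
  rewrite normrM normfV (gtr0_norm t1) ler_pdivrMr//; apply: le_trans (hL _ _) _.
  rewrite addrC addKr enormZ (gtr0_norm t1) (_ : enorm _ = 1) ?mulr1//.
  by rewrite /enorm dotrV_delta mxE !eqxx sqrtr1.
have r1 : 0 < r + 1 by rewrite addr_gt0.
have xr : r + 1 <= `|x| by rewrite leNgt; apply/negP => /(cubeP _ r1).
have p0 y : r <= `|y| -> phi y = 0.
  by move=> ry; apply/eqP; apply: contraT => /hr; rewrite ltNge ry.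
have xr' : r < `|x| by apply: lt_le_trans xr; rewrite ltrDl.
rewrite !p0 ?(ltW xr')//; last first.
  have := ler_normB (x + t_ k *: e_ i) (t_ k *: e_ i); rewrite addrK.
  have := normr_delta_le i (t_ k); rewrite (gtr0_norm t1).
  by move: xr t2; move: (`|x|) (`|t_ k *: _|) => a b; lra.
rewrite (@partial_outside _ _ phi i [set y | r < `|y|])//.
- by rewrite subrr mul0r subrr normr0 mulr_ge0// addr_ge0// (le_trans (normr_ge0 _) (hM 0)).
- exact: open_normr_gt.
- by move=> y /= ry; exact/p0/ltW.
Qed.

Lemma bounded_support_integral_powR (f : 'rV[R]_n -> R) (r M : R) : 0 < r -> measurable_fun setT f ->
  (forall x, f x != 0 -> `|x| < r) -> (forall x, `|f x| <= M) -> (integral_powR p f < +oo)%E.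
Proof.
move=> r0 mf fr fM; have p0 : 0 < p by exact: lt_trans p1.
have M0 : 0 <= M := le_trans (normr_ge0 _) (fM 0).
rewrite integral_powR_def; have /integrableP[_] := integrable_cube r (M `^ p).
apply: le_lt_trans; apply: ge0_le_integral => //.
- apply/measurable_EFinP; apply: (measurableT_comp (measurable_powR _)) => //.
  exact: measurableT_comp.
- apply: measurableT_comp => //; apply/measurable_EFinP; apply: measurable_funM => //.
  by apply: measurable_indic; exact: measurable_cube.
move=> x _; rewrite abse_EFin lee_fin ger0_norm ?mulr_ge0 ?powR_ge0//.
have [->|fx] := eqVneq (f x) 0; first by rewrite normr0 powR0 ?gt_eqF// mulr_ge0 ?powR_ge0.
rewrite indicE mem_set ?mulr1; last by apply/cubeP => //; exact: fr.
by apply: ge0_ler_powR; rewrite ?nnegrE// ltW.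
Qed.

Lemma test_function_admissible Omega phi : test_function phi ->
  (forall x, ~ Omega x -> phi x = 0) ->
  admissible p Omega phi (gradient phi) /\ (energy s p phi (gradient phi) < +oo)%E.
Proof.
move=> tphi pO; have sphi := test_function_sobolev11 tphi.
have [mphi mg] := sobolev11_measurable sphi.
have [r r0 hr] := test_function_support tphi.
have [M hM] := test_function_bounded tphi.
have M0 : 0 <= M := le_trans (normr_ge0 _) (hM 0).
have [L L0 hL] := test_function_lipschitz tphi.
have p0 : 0 < p by exact: lt_trans p1.
have /choice[N hN] : forall i : 'I_n, exists N : R, forall x, `|partial i phi x| <= N.
  by move=> i; apply: test_function_bounded; exact: test_function_partial.
have N0 i : 0 <= N i := le_trans (normr_ge0 _) (hN i 0).
have gp : (integral_powR p (fun x => enorm (gradient phi x)) < +oo)%E.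
  apply: (@bounded_support_integral_powR _ (r + 1) (n%:R * \sum_i N i)).
  - by rewrite addr_gt0.
  - exact: measurable_enorm.
  - move=> x; apply: contra_neqT; rewrite -leNgt => rx.
    have rx' : r < `|x| by apply: lt_le_trans rx; rewrite ltrDl.
    rewrite (_ : gradient phi x = 0) ?enorm0//; apply/rowP => i; rewrite !mxE.
    apply: (@partial_outside _ _ phi i [set y | r < `|y|]) => //; first exact: open_normr_gt.
    by move=> y /= ry; apply/eqP; apply: contraT => /hr; rewrite ltNge (ltW ry).
  - move=> x; rewrite ger0_norm ?enorm_ge0//; apply: le_trans (enorm_le_norm _) _.
    rewrite ler_wpM2l//; apply: normr_rV_le => [|i]; first exact: sumr_ge0.
    by rewrite mxE; apply: le_trans (hN i x) _; rewrite (bigD1 i)//= lerDl sumr_ge0.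
split.
  split => //; first exact: (bounded_support_integral_powR r0 mphi hr hM).
  exact: aeW.
rewrite energyE lte_add_pinfty//.
apply: (gagliardo_lty (L := L) (M := (2 * M) `^ p) _ _ _ _ r0) => //; first exact: powR_ge0.
move=> x y; apply: ge0_ler_powR; rewrite ?nnegrE ?(ltW p0) ?mulr_ge0//.
by apply: le_trans (ler_normB _ _) _; rewrite mulr_natl mulr2n lerD.
Qed.

End test_function_energy.

(** * Maxima and Fatou's lemma *)

Section energy_calculus.
Variables (R : realType) (n : nat) (s p : R).
Hypothesis (p1 : 1 < p).
Local Notation mu := (lebesgue_rV R n).
Implicit Types (u w : 'rV[R]_n -> R) (g h : 'rV[R]_n -> 'rV[R]_n) (x y z : 'rV[R]_n).
Implicit Type Omega : set 'rV[R]_n.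

Let p_gt0 : 0 < p. Proof. exact: lt_trans p1. Qed.

Lemma measurable_norm_powR u : measurable_fun setT u ->
  measurable_fun setT (fun x => (`|u x| `^ p)%:E).
Proof.
move=> mu_; apply/measurable_EFinP; apply: (measurableT_comp (measurable_powR _)) => //.
exact: measurableT_comp.
Qed.

Lemma integral_powRZ (c : R) u : measurable_fun setT u ->
  (integral_powR p (fun x => c * u x)%R = (`|c| `^ p)%:E * integral_powR p u)%E.
Proof.
move=> mu_; rewrite !integral_powR_def.
rewrite (eq_integral (fun x => (`|c| `^ p)%:E * (`|u x| `^ p)%:E)%E); last first.
  by move=> x _; rewrite normrM powRM// EFinM.
by rewrite ge0_integralZl ?lee_fin ?powR_ge0//; exact: measurable_norm_powR.
Qed.

Lemma energyZ (c : R) u g : measurable_fun setT u -> measurable_fun setT g ->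
  (energy s p (fun x => c * u x)%R (fun x => c *: g x)%R = (`|c| `^ p)%:E * energy s p u g)%E.
Proof.
move=> mu_ mg; have c0 : 0 <= `|c| `^ p by exact: powR_ge0.
have mK := measurable2_gagliardo_density s p mu_.
have G0 := gagliardo_density_ge0 s p u.
rewrite !energyE ge0_muleDr ?integral_powR_ge0 ?double_integral_ge0//; congr (_ + _)%E.
  have -> : (fun x => enorm (c *: g x)) = (fun x => `|c| * enorm (g x)).
    by apply/funext => x; rewrite enormZ.
  by rewrite integral_powRZ ?normr_id//; exact: measurable_enorm.
rewrite -double_integralZ//; congr double_integral; apply/funext => x; apply/funext => y.
by rewrite !gagliardo_densityE -mulrBr normrM powRM// mulrA.
Qed.

Lemma admissibleZ (c : R) Omega u g : admissible p Omega u g ->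
  admissible p Omega (fun x => c * u x) (fun x => c *: g x).
Proof.
move=> [sug up gp uO]; have [mu_ mg] := sobolev11_measurable sug.
split; first exact: sobolev11Z.
- by rewrite integral_powRZ// lte_mul_pinfty// ?lee_fin ?powR_ge0.
- have -> : (fun x => enorm (c *: g x)) = (fun x => `|c| * enorm (g x)).
    by apply/funext => x; rewrite enormZ.
  rewrite integral_powRZ; last exact: measurable_enorm.
  by rewrite lte_mul_pinfty// ?lee_fin ?powR_ge0.
- by apply: filterS uO => x ux /ux ->; rewrite mulr0.
Qed.

(** Normalizing divides the energy by the [p]-th power of the norm, which is at least 1. This admits
    competitors that merely dominate a normalized function, such as a maximum. *)
Lemma least_eigenvalue_le Omega u g : open Omega -> bounded_set Omega ->
  admissible p Omega u g -> (1 <= integral_powR p u)%E ->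
  (least_eigenvalue s p Omega <= energy s p u g)%E.
Proof.
move=> oO bO adm N1; have [sug up _ _] := adm; have [mu_ mg] := sobolev11_measurable sug.
have mO := open_measurable_rV oO.
have Nf : integral_powR p u \is a fin_num by rewrite ge0_fin_numE// integral_powR_ge0.
set N := fine (integral_powR p u).
have NE : integral_powR p u = N%:E by rewrite fineK.
have N1' : 1 <= N by rewrite -lee_fin -NE.
have N0 : 0 < N by exact: lt_le_trans N1'.
pose c := N `^ (- p^-1); have c0 : 0 <= c by exact: powR_ge0.
have cp : `|c| `^ p = N^-1.
  rewrite ger0_norm// -powRrM mulNr mulVf ?gt_eqF// powRN powRr1//; exact: ltW.
apply: (@le_trans _ _ (energy s p (fun x => c * u x) (fun x => c *: g x))).
  rewrite least_eigenvalueE//; apply: ereal_inf_lbound.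
  exists ((fun x => c * u x), (fun x => c *: g x)) => //=; split; first exact: admissibleZ.
  by rewrite integral_powRZ// cp NE -EFinM mulVf ?gt_eqF.
rewrite energyZ// cp -[leRHS]mul1e lee_wpmul2r ?energy_ge0//.
by rewrite lee_fin invf_le1.
Qed.

(** The maximum is [(u + w + |u - w|) / 2]. Where [u] and [w] coincide their gradients agree almost
    everywhere, so either choice is correct there. *)
Lemma sobolev11_max u w g h : sobolev11 u g -> sobolev11 w h ->
  sobolev11 (fun x => maxr (u x) (w x)) (fun x => if u x < w x then h x else g x).
Proof.
move=> sug swh; have [mu_ mg] := sobolev11_measurable sug; have [mw mh] := sobolev11_measurable swh.
have sd := sobolev11D sug (sobolev11Z (-1) swh).
have [sa d0] := sobolev11_abs sd.
have sm := sobolev11Z 2^-1 (sobolev11D (sobolev11D sug swh) sa).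
apply: (sobolev11_ae sm).
- move=> x /=; rewrite mulN1r; case: (leP (u x) (w x)) => uw.
    by rewrite ler0_norm; lra.
  by rewrite gtr0_norm; lra.
- by apply: measurable_fun_ifT => //; exact: measurable_fun_ltr.
apply: filterS d0 => x; rewrite mulN1r scaleN1r => d0 /=.
case: (ltgtP (u x) (w x)) => uw.
- by rewrite ltr0_sg ?subr_lt0// scaleN1r; apply/rowP => i; rewrite !mxE; field.
- by rewrite gtr0_sg ?subr_gt0// scale1r; apply/rowP => i; rewrite !mxE; field.
- rewrite uw subrr in d0; rewrite d0// scaler0 addr0.
  have /eqP := d0 erefl; rewrite subr_eq0 => /eqP ->.
  by apply/rowP => i; rewrite !mxE; field.
Qed.

(** At a pair with [u x = 0], [w y = 0] and [u y > 0] this is of first order in a small [w x],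
    whereas the energy of [w] is of order [p]. *)
Definition max_gain u w x y : R := frac_kernel s p x y *
  (`|u x - u y| `^ p + `|w x - w y| `^ p - `|maxr (u x) (w x) - maxr (u y) (w y)| `^ p).

Lemma dist_max_le (a b a' b' : R) : `|maxr a b - maxr a' b'| <= maxr `|a - a'| `|b - b'|.
Proof.
rewrite le_max.
have [h1|h1] := leP a b; have [h2|h2] := leP a' b'.
- by rewrite lexx orbT.
- case: (leP b a') => h3.
    by apply/orP; left; rewrite !ler0_norm; lra.
  by apply/orP; right; rewrite !ger0_norm; lra.
- case: (leP a b') => h3.
    by apply/orP; right; rewrite !ler0_norm; lra.
  by apply/orP; left; rewrite !ger0_norm; lra.
- by rewrite lexx.
Qed.

Lemma max_gain_ge0 u w x y : 0 <= max_gain u w x y.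
Proof.
rewrite /max_gain mulr_ge0//; first by rewrite frac_kernelE invr_ge0 powR_ge0.
rewrite subr_ge0; have := dist_max_le (u x) (w x) (u y) (w y); rewrite le_max => /orP[h|h].
  by rewrite (@le_trans _ _ (`|u x - u y| `^ p))// ?lerDl ?powR_ge0//;
    apply: ge0_ler_powR; rewrite ?nnegrE// ltW.
by rewrite (@le_trans _ _ (`|w x - w y| `^ p))// ?lerDr ?powR_ge0//;
    apply: ge0_ler_powR; rewrite ?nnegrE// ltW.
Qed.

Lemma measurable2_max_gain u w : measurable_fun setT u -> measurable_fun setT w ->
  measurable2 (max_gain u w).
Proof.
move=> mu_ mw; apply: measurable_funM; first exact: measurable2_frac_kernel.
apply: measurable_funB; first by apply: measurable_funD; exact: measurable2_powR_norm.
have mm : measurable_fun setT (fun x => maxr (u x) (w x)) by exact: measurable_maxr.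
exact: (measurable2_powR_norm p mm mm).
Qed.

(** At each point the gradient of the maximum is one of the two gradients, which bounds the local
    part; the nonlocal part is an identity. *)
Lemma energy_max u w g h : sobolev11 u g -> sobolev11 w h ->
  (energy s p (fun x => maxr (u x) (w x))%R (fun x => if (u x < w x)%R then h x else g x) +
   double_integral (max_gain u w) <= energy s p u g + energy s p w h)%E.
Proof.
move=> sug swh; have [mu_ mg] := sobolev11_measurable sug; have [mw mh] := sobolev11_measurable swh.
have [mm mgm] := sobolev11_measurable (sobolev11_max sug swh).
have mgain := measurable2_max_gain mu_ mw.
have gain0 := max_gain_ge0 u w.
have [d1 d2 d3] := And3 (measurable2_gagliardo_density s p mu_)
  (measurable2_gagliardo_density s p mw) (measurable2_gagliardo_density s p mm).
rewrite !energyE -addeA -double_integralD//; last by move=> x y; exact: gagliardo_density_ge0.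
rewrite addeACA; apply: leeD.
  rewrite !integral_powR_def -ge0_integralD//.
  - apply: ge0_le_integral => //.
    + by apply: measurable_norm_powR; exact: measurable_enorm.
    + by apply: emeasurable_funD; apply: measurable_norm_powR; exact: measurable_enorm.
    + move=> x _; rewrite -EFinD lee_fin.
      by case: ifP => _; rewrite ?lerDl ?lerDr powR_ge0.
  - by apply: measurable_norm_powR; exact: measurable_enorm.
  - by apply: measurable_norm_powR; exact: measurable_enorm.
rewrite -double_integralD//; [|by move=> x y; exact: gagliardo_density_ge0..].
apply: le_double_integral.
- exact: measurable2D.
- exact: measurable2D.
- by move=> x y; rewrite addr_ge0// gagliardo_density_ge0.
move=> x y; rewrite /max_gain !gagliardo_densityE le_eqVlt; apply/orP; left; apply/eqP; ring.
Qed.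

Lemma admissible_max Omega u w g h : admissible p Omega u g -> admissible p Omega w h ->
  admissible p Omega (fun x => maxr (u x) (w x)) (fun x => if u x < w x then h x else g x).
Proof.
move=> [sug up gp uO] [swh wp hp wO].
have [mu_ mg] := sobolev11_measurable sug; have [mw mh] := sobolev11_measurable swh.
have [mm mgm] := sobolev11_measurable (sobolev11_max sug swh).
have dom (f f1 f2 : 'rV[R]_n -> R) : measurable_fun setT f -> measurable_fun setT f1 ->
    measurable_fun setT f2 -> (forall x, f x = f1 x \/ f x = f2 x) ->
    (integral_powR p f1 < +oo)%E -> (integral_powR p f2 < +oo)%E -> (integral_powR p f < +oo)%E.
  move=> mf mf1 mf2 ff h1 h2; apply: le_lt_trans (lte_add_pinfty h1 h2).
  rewrite !integral_powR_def -ge0_integralD//.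
  - apply: ge0_le_integral => //.
    + exact: measurable_norm_powR.
    + by apply: emeasurable_funD; exact: measurable_norm_powR.
    + move=> x _; rewrite -EFinD lee_fin.
      by case: (ff x) => ->; rewrite ?lerDl ?lerDr powR_ge0.
  - exact: measurable_norm_powR.
  - exact: measurable_norm_powR.
split; first exact: sobolev11_max.
- by apply: (dom _ u w) => // x; case: (leP (u x) (w x)); [right|left].
- apply: (dom _ (fun x => enorm (g x)) (fun x => enorm (h x))) => //; [exact: measurable_enorm..|].
  by move=> x; case: ifP; [right|left].
- by apply: filterS2 uO wO => x ux wx nx; rewrite ux// wx// maxxx.
Qed.

Lemma double_integral_ae F F' : measurable2 F -> measurable2 F' -> (forall x y, 0 <= F x y) ->
  (forall x y, 0 <= F' x y) ->
  {ae mu, forall x, {ae mu, forall y, F x y = F' x y}} -> double_integral F = double_integral F'.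
Proof.
move=> mF mF' F0 F0' FF; rewrite !double_integral_def; apply: ae_eq_integral => //.
- exact: measurable2_inner.
- exact: measurable2_inner.
apply: filterS FF => x Fx _; apply: ae_eq_integral => //.
- by apply/measurable_EFinP; exact: measurable2_section.
- by apply/measurable_EFinP; exact: measurable2_section.
- by apply: filterS Fx => y -> _.
Qed.

Lemma energy_ae u u' g : measurable_fun setT u -> measurable_fun setT u' ->
  {ae mu, forall x, u x = u' x} -> energy s p u g = energy s p u' g.
Proof.
move=> mu_ mu' uu; rewrite !energyE; congr (_ + _)%E; apply: double_integral_ae.
- exact: measurable2_gagliardo_density.
- exact: measurable2_gagliardo_density.
- exact: gagliardo_density_ge0.
- exact: gagliardo_density_ge0.
apply: filterS (uu) => x ux; apply: filterS uu => y uy.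
by rewrite !gagliardo_densityE ux uy.
Qed.

Lemma sobolev11_ae_fun u u' g : measurable_fun setT u' -> {ae mu, forall x, u x = u' x} ->
  sobolev11 u g -> sobolev11 u' g.
Proof.
move=> mu' uu [Iu Ig ug]; have mu_ := integrable_measurable Iu; split => //.
  have /integrableP[_ uoo] := Iu; apply/integrableP; split; first exact/measurable_EFinP.
  rewrite (@ae_eq_integral _ _ _ _ _ (fun x => `|(u x)%:E|%E))//.
  - by apply: measurableT_comp => //; exact/measurable_EFinP.
  - by apply: measurableT_comp => //; exact/measurable_EFinP.
  - by apply: filterS uu => x ux _; rewrite /= ux.
move=> i phi tphi; rewrite -ug//; have tp := test_function_measurable (test_function_partial i tphi).
apply: ae_eq_integral => //; [apply/measurable_EFinP; exact: measurable_funM..|].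
by apply: filterS uu => x ux _; rewrite ux.
Qed.

(** Passing to [|u|] and to the value 0 outside [Omega] turns almost everywhere properties into
    everywhere ones without raising the energy. *)
Lemma admissible_normalize Omega u g : measurable Omega -> admissible p Omega u g ->
  exists u' g', [/\ admissible p Omega u' g', (forall x, 0 <= u' x),
    (forall x, ~ Omega x -> u' x = 0), integral_powR p u' = integral_powR p u &
    (energy s p u' g' <= energy s p u g)%E].
Proof.
move=> mO adm; have [sa ap ga aO] := admissible_abs p1 adm; have [sug _ _ _] := adm.
have [ma mga] := sobolev11_measurable sa.
pose u' x := if x \in Omega then `|u x| else 0.
have mu' : measurable_fun setT u' by apply: measurable_fun_ifT => //; exact: measurable_mem.
have uu : {ae mu, forall x, `|u x| = u' x}.
  by apply: filterS aO => x ux; rewrite /u'; case: ifPn => //; rewrite notin_setE.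
have N : integral_powR p u' = integral_powR p u.
  by rewrite -(integral_powR_ae p ma mu' uu) integral_powR_abs.
exists u', (fun x => sgr (u x) *: g x); split => //.
- split => //; first exact: sobolev11_ae_fun sa.
    by rewrite N -integral_powR_abs.
  by apply: aeW => x nx; rewrite /u' memNset.
- by move=> x; rewrite /u'; case: ifP.
- by move=> x nx; rewrite /u' memNset.
- by rewrite -(energy_ae _ ma mu' uu); exact: energy_abs.
Qed.

(** Convergence is known at pairs of points of a set [G] of full measure. The cut-off [c x * c y]
    discards the other pairs, and Tonelli turns the double integral into one over the product, where
    Fatou's lemma applies once. *)
Lemma double_integral_fatou (F_ : nat -> 'rV[R]_n -> 'rV[R]_n -> R) F (C : R) (G : set 'rV[R]_n) :
  (forall k, measurable2 (F_ k)) -> (forall k x y, 0 <= F_ k x y) ->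
  measurable2 F -> (forall x y, 0 <= F x y) -> {ae mu, forall x, G x} ->
  (forall x y, G x -> G y -> (fun k => F_ k x y) @ \oo --> F x y) ->
  (forall e : R, 0 < e -> exists N, forall k, (N <= k)%N -> (double_integral (F_ k) <= (C + e)%:E)%E) ->
  (double_integral F <= C%:E)%E.
Proof.
move=> mF_ F_0 mF F0 [A [mA A0 GA]] FG FC.
pose c x : R := \1_(~` A) x.
have c01 x : c x = 1 \/ c x = 0 by rewrite /c indicE; case: (x \in _); [left|right].
have mc : measurable_fun setT c by apply: measurable_indic; exact: measurableC.
have mcc : measurable2 (fun x y => c x * c y).
  by apply: measurable_funM; [exact: measurableT_comp measurable_fst|exact: measurableT_comp measurable_snd].
have cc0 x y : 0 <= c x * c y by rewrite mulr_ge0.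
have ac : {ae mu, forall x, c x = 1}.
  exists A; split => // x /= cx; apply: contrapT => nA; apply: cx.
  by rewrite /c indicE mem_set.
pose F' x y := c x * c y * F x y; pose F'_ k x y := c x * c y * F_ k x y.
have mF' : measurable2 F' by exact: measurable_funM.
have mF'_ k : measurable2 (F'_ k) by apply: measurable_funM => //; exact: mF_.
have F'0 x y : 0 <= F' x y by rewrite mulr_ge0.
have F'_0 k x y : 0 <= F'_ k x y by rewrite mulr_ge0.
have FF' : double_integral F = double_integral F'.
  apply: double_integral_ae => //; apply: filterS (ac) => x cx; apply: filterS ac => y cy.
  by rewrite /F' cx cy !mul1r.
have cv x y : (fun k => F'_ k x y) @ \oo --> F' x y.
  have off0 : c x * c y = 0 -> (fun k => F'_ k x y) @ \oo --> F' x y.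
    move=> c0; rewrite /F' c0 mul0r (_ : (fun k => _) = cst 0); first exact: cvg_cst.
    by apply/funext => k; rewrite /F'_ c0 mul0r.
  case: (c01 x) => cx; last by apply: off0; rewrite cx mul0r.
  case: (c01 y) => cy; last by apply: off0; rewrite cy mulr0.
  have inG z : c z = 1 -> G z.
    rewrite /c indicE; case: (boolP (z \in _)) => [/set_mem nA _|_ /eqP]; last by rewrite eq_sym oner_eq0.
    by apply: contrapT => /GA.
  rewrite /F' cx cy !mul1r (_ : (fun k => _) = fun k => F_ k x y); last first.
    by apply/funext => k; rewrite /F'_ cx cy !mul1r.
  by apply: FG; exact: inG.
have prod K : measurable2 K -> (forall x y, 0 <= K x y) ->
    (double_integral K = \int[mu \x mu]_xy (K xy.1 xy.2)%:E)%E.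
  move=> mK K0; rewrite double_integral_def; apply/esym.
  apply: (fubini_tonelli1 (m1 := mu) (m2 := mu) (fun xy => (K xy.1 xy.2)%:E)).
    exact/measurable_EFinP.
  by move=> xy; rewrite lee_fin.
rewrite FF' prod//.
have := @fatou _ _ R (mu \x mu)%E setT measurableT (fun k xy => (F'_ k xy.1 xy.2)%:E).
rewrite (eq_integral (fun xy : 'rV[R]_n * 'rV[R]_n => (F' xy.1 xy.2)%:E)); last first.
  by move=> xy _; apply: (cvg_limn_einf_sup _).1; apply: cvg_EFin; [exact: nearW|exact: cv].
move=> fat; apply: le_trans (fat _ _) _.
- by move=> k; apply/measurable_EFinP; exact: mF'_.
- by move=> k xy _; rewrite lee_fin.
apply/lee_addgt0Pr => e e0; have [N hN] := FC e e0.
rewrite limn_einf_lim; apply: lime_le; first exact: is_cvg_einfs.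
apply: nearW => k; apply: ereal_inf_le; exists (\int[mu \x mu]_xy (F'_ (maxn k N) xy.1 xy.2)%:E)%E.
  by exists (maxn k N) => //=; rewrite leq_maxl.
rewrite -prod// -EFinD; apply: le_trans (hN (maxn k N) (leq_maxr _ _)).
apply: le_double_integral => // x y; rewrite /F'_ -[leRHS]mul1r ler_wpM2r//.
by case: (c01 x) => ->; case: (c01 y) => ->; rewrite ?mul1r ?mul0r.
Qed.

End energy_calculus.

(** * Compactness of minimizing sequences *)

Definition infinitely_many (A : set nat) := forall N, exists2 k, (N <= k)%N & A k.

Lemma infinitely_many_color (T : finType) (c : nat -> T) (A : set nat) :
  infinitely_many A -> exists t, infinitely_many (A `&` [set k | c k = t]).
Proof.
move=> iA; apply: contrapT => /forallNP H.
have /choice[b hb] : forall t, exists N, forall k, (N <= k)%N -> A k -> c k <> t.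
  move=> t; apply: contrapT => /forallNP Ht; apply: (H t) => N.
  have /existsNP[k /not_implyP[Nk /not_implyP[Ak /contrapT ck]]] := Ht N.
  by exists k.
have [k bk Ak] := iA (\max_t b t).
by apply: (hb (c k) k) => //; apply: leq_trans bk; exact: leq_bigmax.
Qed.

(* Diagonal extraction: each [Q k] holds on a monochromatic infinite set, and
   these sets can be chosen nested. *)
Lemma subsequence_of_colorings (Q : nat -> nat -> nat -> Prop) :
  (forall k, exists (T : finType) (c : nat -> T), forall i j, c i = c j -> Q k i j) ->
  exists2 f : nat -> nat, (forall k, (k <= f k)%N) & forall k m, (k <= m)%N -> Q k (f k) (f m).
Proof.
move=> HQ.
have step (kA : nat * {A : set nat | infinitely_many A}) : exists B : {A : set nat | infinitely_many A},
    sval B `<=` sval kA.2 /\ forall i j, sval B i -> sval B j -> Q kA.1 i j.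
  have [T [c hc]] := HQ kA.1; have [t it] := infinitely_many_color c (svalP kA.2).
  by exists (exist _ _ it); split=> [x []|i j [_ /= <-] [_ /= e]] //; exact: hc.
have [F hF] := choice step.
have iT : infinitely_many setT by move=> N; exists N.
pose I := fix I k := if k is k'.+1 then F (k', I k') else exist infinitely_many setT iT.
have sub k m : (k <= m)%N -> sval (I m) `<=` sval (I k).
  elim: m => [|m IH]; first by rewrite leqn0 => /eqP ->.
  rewrite leq_eqVlt => /predU1P[->//|]; rewrite ltnS => km.
  by apply: subset_trans (IH km); have [] := hF (m, I m).
have /choice[f hf] : forall k, exists j, (k <= j)%N /\ sval (I k.+1) j.
  by move=> k; have [j kj Ij] := svalP (I k.+1) k; exists j.
exists f => [k|k m km]; first by have [] := hf k.
have [_ Ik] := hf k; have [_ Im] := hf m.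
by have [_] := hF (k, I k); apply => //; apply: (sub k.+1 m.+1).
Qed.

Lemma geometric_cauchy_cvg (R : realType) (a_ : nat -> R) :
  (\forall k \near \oo, `|a_ k.+1 - a_ k| <= 2^-1 ^+ k) -> cvgn a_.
Proof.
move=> [N _ hN].
have h2 : `|2^-1| < 1 :> R by rewrite ger0_norm ?invr_ge0// invf_lt1// ltr1n.
pose d k := a_ (N + k).+1 - a_ (N + k).
have dc : cvgn (series d).
  apply: normed_cvg; apply: (@series_le_cvg R _ (geometric 1 2^-1)).
  - by move=> k; exact: normr_ge0.
  - by move=> k; rewrite /geometric /= mul1r exprn_ge0// invr_ge0.
  - move=> k /=; rewrite mul1r; apply: le_trans (hN (N + k)%N _) _; first exact: leq_addr.
    by rewrite exprD ler_piMl ?exprn_ge0 ?invr_ge0// exprn_ile1// ?invr_ge0// invf_le1// ler1n.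
  exact: is_cvg_geometric_series.
have aE k : a_ (k + N)%N = a_ N + series d k.
  elim: k => [|k IH]; first by rewrite add0n /series /= big_geq// addr0.
  by rewrite seriesSr addrA -IH /d addnC [(k + N)%N]addnC addnS [RHS]addrC subrK.
apply/cvg_ex; exists (a_ N + limn (series d)); rewrite -(cvg_shiftn N).
by under eq_fun do rewrite aE; apply: cvgD => //; exact: cvg_cst.
Qed.

Lemma cvg_norm_powR (R : realType) (p : R) (a_ : nat -> R) (a : R) : 0 < p ->
  a_ @ \oo --> a -> (fun k => `|a_ k| `^ p) @ \oo --> `|a| `^ p.
Proof.
move=> p0 ac; have nc : (fun k => `|a_ k|) @ \oo --> `|a| by exact: cvg_norm.
have [a0|a0] := eqVneq a 0.
  rewrite a0 in ac *; rewrite normr0 powR0 ?gt_eqF//; apply/cvgrPdist_lt => e e0.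
  have e1 : 0 < e `^ p^-1 by exact: powR_gt0.
  have /cvgrPdist_lt /(_ _ e1) := ac; apply: filterS => k.
  rewrite distrC subr0 sub0r normrN => ak.
  have ep : (e `^ p^-1) `^ p = e by rewrite -powRrM mulVf ?gt_eqF// powRr1// ltW.
  rewrite ger0_norm ?powR_ge0// -[ltRHS]ep.
  by apply: gt0_ltr_powR; rewrite ?nnegrE// ltW.
have an : 0 < `|a| by rewrite normr_gt0.
have pE t : 0 < t -> t `^ p = expR (p * ln t) by move=> t0; rewrite /powR gt_eqF.
rewrite (pE _ an).
have : (fun k => expR (p * ln `|a_ k|)) @ \oo --> expR (p * ln `|a|).
  apply: continuous_cvg; first exact: continuous_expR.
  apply: cvgM; first exact: cvg_cst.
  by apply: continuous_cvg => //; exact: continuous_ln.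
apply: cvg_trans; apply: near_eq_cvg.
have /cvgrPdist_lt /(_ _ an) := nc; apply: filterS => k ak; rewrite pE//.
by move: ak; rewrite ltr_norml => /andP[]; lra.
Qed.

Section compactness.
Variables (R : realType) (n : nat).
Local Notation mu := (lebesgue_rV R n).
Implicit Types (u : 'rV[R]_n -> R) (x : 'rV[R]_n).

Lemma integral_fatou (f_ : nat -> 'rV[R]_n -> R) (f : 'rV[R]_n -> R) (C : R) :
  (forall k, measurable_fun setT (f_ k)) -> (forall k x, 0 <= f_ k x) ->
  measurable_fun setT f -> (forall x, 0 <= f x) ->
  {ae mu, forall x, f_ ^~ x @ \oo --> f x} ->
  (\forall k \near \oo, (\int[mu]_x (f_ k x)%:E <= C%:E)%E) -> (\int[mu]_x (f x)%:E <= C%:E)%E.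
Proof.
move=> mf_ f_0 mf f0 [A [mA A0 GA]] [N _ hN].
pose c x : R := \1_(~` A) x.
have mc : measurable_fun setT c by apply: measurable_indic; exact: measurableC.
have c0 x : 0 <= c x by rewrite /c.
have c1 x : c x <= 1 by rewrite /c indicE lern1 leq_b1.
have ac : {ae mu, forall x, c x = 1}.
  exists A; split => // x /= cx; apply: contrapT => nA; apply: cx.
  by rewrite /c indicE mem_set.
have -> : (\int[mu]_x (f x)%:E = \int[mu]_x limn_einf (fun k => (c x * f_ k x)%:E))%E.
  transitivity (\int[mu]_x (c x * f x)%:E)%E.
    apply: ae_eq_integral => //; [exact/measurable_EFinP|apply/measurable_EFinP; exact: measurable_funM|].
    by apply: filterS ac => x -> _; rewrite mul1r.
  apply: eq_integral => x _; apply/esym; apply: (cvg_limn_einf_sup _).1.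
  apply: cvg_EFin; first exact: nearW.
  rewrite /c indicE; case: (boolP (x \in _)) => [/set_mem nA|_].
    rewrite mul1r; under eq_fun do rewrite mul1r.
    by apply: contrapT => /GA.
  by rewrite mul0r; under eq_fun do rewrite mul0r; exact: cvg_cst.
apply: le_trans (@fatou _ _ R mu setT measurableT (fun k x => (c x * f_ k x)%:E) _ _) _.
- by move=> k; apply/measurable_EFinP; exact: measurable_funM.
- by move=> k x _; rewrite lee_fin mulr_ge0.
rewrite limn_einf_lim; apply: lime_le; first exact: is_cvg_einfs.
apply: nearW => k; apply: ereal_inf_le; exists (\int[mu]_x (c x * f_ (maxn k N) x)%:E)%E.
  by exists (maxn k N) => //=; rewrite leq_maxl.
apply: le_trans (hN (maxn k N) (leq_maxr _ _)); apply: ge0_le_integral => //.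
- by move=> x _; rewrite lee_fin mulr_ge0.
- by apply/measurable_EFinP; exact: measurable_funM.
- exact/measurable_EFinP.
- by move=> x _; rewrite lee_fin ler_piMl.
Qed.

(** The upper limit is measurable even where the sequence diverges, and [fine] of it is the limit
    where the sequence converges. *)
Lemma ae_limit_measurable (f_ : nat -> 'rV[R]_n -> R) : (forall k, measurable_fun setT (f_ k)) ->
  {ae mu, forall x, cvgn (f_ ^~ x)} ->
  exists2 f : 'rV[R]_n -> R, measurable_fun setT f & {ae mu, forall x, f_ ^~ x @ \oo --> f x}.
Proof.
move=> mf_ cf; exists (fun x => fine (limn_esup (fun k => (f_ k x)%:E))).
  apply: measurableT_comp => //; apply: measurable_fun_limn_esup => k.
  by apply/measurable_EFinP.
apply: filterS cf => x /cvg_ex[l hl].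
have hE : (fun k => (f_ k x)%:E) @ \oo --> l%:E by apply: cvg_EFin; [exact: nearW|].
by rewrite (cvg_limn_einf_sup hE).2.
Qed.

Variable p : R.
Hypothesis p1 : 1 < p.

Let p_gt0 : 0 < p. Proof. exact: lt_trans p1. Qed.

(** Finite colourings at every scale express total boundedness in Lp; a diagonal subsequence
    converges fast enough to converge almost everywhere. *)
Lemma compactness_of_colorings (u_ : nat -> 'rV[R]_n -> R) :
  (forall i, measurable_fun setT (u_ i)) -> (forall i, integral_powR p (u_ i) = 1%E) ->
  (forall e : R, 0 < e -> exists (T : finType) (c : nat -> T), forall i j, c i = c j ->
     (integral_powR p (fun x => u_ i x - u_ j x)%R <= e%:E)%E) ->
  exists (f : nat -> nat) u, [/\ forall k, (k <= f k)%N, measurable_fun setT u,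
    {ae mu, forall x, (fun k => u_ (f k) x) @ \oo --> u x} &
    ~ {ae mu, forall x, u x = 0}].
Proof.
move=> mu_ N1 col.
(* This rate bounds the integral of [(2^k |u_ (f k.+1) - u_ (f k)|)^p] by [2^-(k+1)], so that almost
   everywhere consecutive differences are eventually at most [2^-k]. *)
pose e k : R := (2^-1 ^+ k) `^ p / (2 ^ k.+1)%:R.
have e0 k : 0 < e k by rewrite divr_gt0 ?powR_gt0 ?exprn_gt0 ?invr_gt0// ltr0n expn_gt0.
have [f fk Qf] := @subsequence_of_colorings
  (fun k i j => (integral_powR p (fun x => u_ i x - u_ j x)%R <= (e k)%:E)%E) (fun k => col _ (e0 k)).
have mdiff i j : measurable_fun setT (fun x => u_ i x - u_ j x) by exact: measurable_funB.
pose a k x := (2 ^+ k * `|u_ (f k.+1) x - u_ (f k) x|) `^ p.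
have ma k : measurable_fun setT (a k).
  apply: (measurableT_comp (measurable_powR _)); apply: measurable_funM => //.
  exact: measurableT_comp.
have a0 : {ae mu, forall x, a ^~ x @ \oo --> 0}.
  apply: summable_integral_ae_cvg0 => // [k x|k]; first exact: powR_ge0.
  rewrite (eq_integral (fun x => ((2 ^+ k) `^ p)%:E * (`|u_ (f k) x - u_ (f k.+1) x| `^ p)%:E)%E); last first.
    by move=> x _; rewrite /a powRM// distrC EFinM.
  rewrite ge0_integralZl ?lee_fin ?powR_ge0//; last exact: measurable_norm_powR.
  rewrite -integral_powR_def; apply: le_trans (lee_wpmul2l _ (Qf k k.+1 (leqnSn k))) _.
    by rewrite lee_fin powR_ge0.
  rewrite -EFinM lee_fin /e mulrA -powRM ?exprn_ge0 ?invr_ge0//.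
  by rewrite -exprMn mulfV// expr1n powR1.
have cvu : {ae mu, forall x, cvgn (fun k => u_ (f k) x)}.
  apply: filterS a0 => x ax; apply: geometric_cauchy_cvg.
  have /cvgrPdist_le /(_ _ ltr01) := ax; apply: filterS => k.
  rewrite sub0r normrN ger0_norm ?powR_ge0// /a => le1.
  have : 2 ^+ k * `|u_ (f k.+1) x - u_ (f k) x| <= 1.
    rewrite leNgt; apply/negP => lt1; move: le1; rewrite leNgt => /negP; apply.
    by have := @gt0_ltr_powR R p p_gt0 1 _ _ _ lt1; rewrite powR1; apply; rewrite nnegrE ?mulr_ge0.
  by rewrite exprVn -ler_pdivlMl ?exprn_gt0// mulr1.
have [u muu uc] := ae_limit_measurable (fun k => mu_ (f k)) cvu.
exists f, u; split => // u0.
(* Every [u_ (f k)] is within [e 0 = 1/2] of [u_ (f 0)]; with a null limit, Fatou's lemma would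
   bound an integral equal to 1 by 1/2. *)
have : (\int[mu]_x (`|u_ (f 0%N) x| `^ p)%:E <= (2^-1)%:E)%E.
  apply: (@integral_fatou (fun k x => `|u_ (f 0%N) x - u_ (f k) x| `^ p)).
  - by move=> k; apply/measurable_EFinP; exact: measurable_norm_powR.
  - by move=> k x; exact: powR_ge0.
  - by apply/measurable_EFinP; exact: measurable_norm_powR.
  - by move=> x; exact: powR_ge0.
  - apply: filterS2 u0 uc => x ux ukx; rewrite ux in ukx.
    apply: cvg_norm_powR => //; rewrite -[X in _ --> X]subr0.
    by apply: cvgB => //; exact: cvg_cst.
  - apply: nearW => k; rewrite -integral_powR_def; apply: le_trans (Qf 0%N k (leq0n k)) _.
    by rewrite lee_fin /e expr0 powR1 div1r.
by rewrite -integral_powR_def N1 lee_fin; apply/negP; rewrite -ltNge invf_lt1// ltr1n.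
Qed.
End compactness.

(** * Approximation by step functions on cells *)

Section average.
Variables (R : realType) (n : nat).
Local Notation mu := (lebesgue_rV R n).
Implicit Types (x y : 'rV[R]_n).

(** Otherwise [h] would exceed the bound on all of [Q] and its integral would be at least [j + e];
    the slack [e] makes the contradiction strict. *)
Lemma average_point (Q : set 'rV[R]_n) (h : 'rV[R]_n -> \bar R) (v j e : R) :
  measurable Q -> mu Q = v%:E -> 0 < v -> measurable_fun setT h -> (forall x, 0 <= h x)%E ->
  0 <= j -> 0 < e -> (\int[mu]_(x in Q) h x <= j%:E)%E -> exists2 x, Q x & (h x <= ((j + e) / v)%:E)%E.
Proof.
move=> mQ Qv v0 mh h0 j0 e0 hj; apply: contrapT => /forall2NP H.
have : ((j + e)%:E <= \int[mu]_(x in Q) h x)%E.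
  have -> : ((j + e)%:E = \int[mu]_(x in Q) (cst ((j + e) / v)%:E) x)%E.
    transitivity (((j + e) / v)%:E * mu Q)%E; last by rewrite integral_cst.
    by rewrite Qv -EFinM divfK// gt_eqF.
  apply: ge0_le_integral => //.
  - by move=> x _ /=; rewrite lee_fin divr_ge0 ?addr_ge0// ltW.
  - by apply: measurable_funTS.
  move=> x Qx /=; have [//|/negP] := H x; rewrite -ltNge; exact: ltW.
by move=> /le_trans /(_ hj); rewrite lee_fin; lra.
Qed.

Lemma double_integral_sum (I : finType) (F : I -> 'rV[R]_n -> 'rV[R]_n -> R) :
  (forall i, measurable2 (F i)) -> (forall i x y, 0 <= F i x y) ->
  (double_integral (fun x y => \sum_i F i x y)%R = \sum_i double_integral (F i))%E.
Proof.
move=> mF F0; rewrite double_integral_def; under [RHS]eq_bigr do rewrite double_integral_def.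
rewrite -ge0_integral_sum//; last 2 first.
- by move=> i; exact: measurable2_inner.
- by move=> i x _; exact: inner_integral_ge0.
apply: eq_integral => x _; rewrite -ge0_integral_sum//.
- by apply: eq_integral => y _; rewrite sumEFin.
- by move=> i; apply/measurable_EFinP; exact: measurable2_section.
- by move=> i y _; rewrite lee_fin.
Qed.

End average.

Section cells.
Variables (R : realType) (n : nat) (r : R) (m : nat).
Hypothesis r0 : 0 < r.
Local Notation mu := (lebesgue_rV R n).
Implicit Types (x y : 'rV[R]_n) (k : {ffun 'I_n -> 'I_m.+1}).

Definition cell_size : R := 2 * r / m.+1%:R.
Local Notation delta := cell_size.

Lemma cell_size_gt0 : 0 < delta. Proof. by rewrite divr_gt0// mulr_gt0. Qed.

(** Half-open, so that the cells are pairwise disjoint and cover the cube; each side is cut into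
    [m + 1] pieces, never into 0. *)
Definition cell k : set 'rV[R]_n :=
  [set x | forall i, (k i)%:R * delta <= x ord0 i + r < (k i).+1%:R * delta].

Lemma cell_itv k : cell k = [set x | forall i, 
  `[(k i)%:R * delta - r, (k i).+1%:R * delta - r[%classic (x ord0 i)].
Proof.
by apply/seteqP; split=> x H i; have := H i; rewrite /= in_itv /= lerBlDr ltrBrDr.
Qed.

Lemma measurable_cell k : measurable (cell k).
Proof.
have -> : cell k = \big[setI/setT]_(i < n) (@rV_coord R n i @^-1`
    `[(k i)%:R * delta - r, (k i).+1%:R * delta - r[%classic).
  rewrite cell_itv -bigcap_seq; apply/seteqP; split=> x /= Hx i.
    by move=> _; exact: Hx.
  by apply: Hx; rewrite /= mem_index_enum.
apply: bigsetI_measurable => i _; rewrite -[X in measurable X]setTI.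
exact: measurable_rV_coord.
Qed.

Lemma lebesgue_cell k : mu (cell k) = (delta ^+ n)%:E.
Proof.
rewrite cell_itv (lebesgue_rV_box (A := fun i =>
  `[(k i)%:R * delta - r, (k i).+1%:R * delta - r[%classic))// (eq_bigr (fun=> delta%:E)).
  by rewrite prodEFin prodr_const card_ord.
move=> i _; rewrite lebesgue_measure_itv /= lte_fin.
have d0 := cell_size_gt0.
rewrite ifT; first by rewrite -EFinB; congr (_%:E); rewrite -natr1; ring.
by rewrite ltrD2r ltr_pM2r// ltr_nat.
Qed.

Lemma cell_inj k k' x : cell k x -> cell k' x -> k = k'.
Proof.
move=> h h'; apply/ffunP => i; apply: val_inj; have d0 := cell_size_gt0.
have tr (l : 'I_m.+1) : l%:R * delta <= x ord0 i + r < l.+1%:R * delta ->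
    truncn ((x ord0 i + r) / delta) = l :> nat.
  by move=> /andP[h1 h2]; apply: truncn_def; rewrite ler_pdivlMr// h1 ltr_pdivrMr.
by rewrite /= -(tr _ (h i)) (tr _ (h' i)).
Qed.

Lemma cell_cover x : cube r x -> exists k, cell k x.
Proof.
move=> cx; have d0 := cell_size_gt0.
have b i : 0 <= (x ord0 i + r) / delta < m.+1%:R.
  have := cx i; rewrite !mxE => /andP[h1 h2]; rewrite divr_ge0 ?(ltW d0)//=; last by lra.
  by rewrite ltr_pdivrMr// /delta mulrC divfK//; lra.
have tb i : (truncn ((x ord0 i + r) / delta) < m.+1)%N.
  by have /andP[b1 b2] := b i; rewrite truncn_lt_nat.
exists [ffun i => Ordinal (tb i)] => i; rewrite ffunE /=; have /andP[b1 _] := b i.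
by have /andP[] := truncn_itv b1; rewrite ler_pdivlMr// ltr_pdivrMr// => -> ->.
Qed.

Lemma cell_diam k x y : cell k x -> cell k y -> enorm (x - y) <= n%:R * delta.
Proof.
move=> hx hy; apply: le_trans (enorm_le_norm _) _; rewrite ler_wpM2l//.
apply: normr_rV_le => [|i]; first exact/ltW/cell_size_gt0.
rewrite !mxE; have := hx i; have := hy i; rewrite -!natr1 mulrDl mul1r => /andP[h1 h2] /andP[h3 h4].
by rewrite ler_norml; apply/andP; split; lra.
Qed.

Lemma sum_cell (f : {ffun 'I_n -> 'I_m.+1} -> R) k x : cell k x ->
  \sum_l \1_(cell l) x * f l = f k.
Proof.
move=> kx; rewrite (bigD1 k)//= big1 ?addr0; first by rewrite indicE mem_set// mul1r.
move=> l lk; rewrite indicE memNset ?mul0r// => lx.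
by move/eqP: lk; apply; exact: cell_inj lx kx.
Qed.

Variables (s p : R).
Hypotheses (p1 : 1 < p) (s01 : 0 < s < 1).
Local Notation q := (n%:R + s * p).

Let q_ge0 : 0 <= q. Proof. exact/ltW/frac_exponent_gt0. Qed.

Definition cell_oscillation (u : 'rV[R]_n -> R) k x y : R :=
  \1_(cell k) x * (\1_(cell k) y * `|u y - u x| `^ p).

Lemma measurable2_cell_oscillation u k : measurable_fun setT u -> measurable2 (cell_oscillation u k).
Proof.
move=> mu_; have mc : measurable_fun setT (\1_(cell k) : 'rV[R]_n -> R).
  by apply: measurable_indic; exact: measurable_cell.
apply: measurable_funM; first exact: measurableT_comp mc measurable_fst.
apply: measurable_funM; first exact: measurableT_comp mc measurable_snd.
apply: (measurableT_comp (measurable_powR _)); apply: measurableT_comp => //.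
by apply: measurable_funB; [exact: measurableT_comp mu_ measurable_snd|exact: measurableT_comp mu_ measurable_fst].
Qed.

Lemma cell_oscillation_ge0 u k x y : 0 <= cell_oscillation u k x y.
Proof. by rewrite !mulr_ge0// powR_ge0. Qed.

(** Two points of a cell are at distance at most [n * delta], which bounds the kernel from below,
    and [x] lies in at most one cell. *)
Lemma sum_cell_oscillation u x y :
  \sum_k cell_oscillation u k x y <= (n%:R * delta) `^ q * gagliardo_density s p u x y.
Proof.
have d0 := cell_size_gt0; have p0 : 0 < p by exact: lt_trans p1.
have g0 : 0 <= (n%:R * delta) `^ q * gagliardo_density s p u x y.
  by rewrite mulr_ge0 ?powR_ge0 ?gagliardo_density_ge0.
have [[k kx]|nx] := pselect (exists k, cell k x); last first.
  rewrite big1// => k _; rewrite /cell_oscillation indicE memNset ?mul0r// => kx.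
  by apply: nx; exists k.
rewrite (sum_cell _ kx) indicE; case: (boolP (y \in _)) => [/set_mem ky|_]; last by rewrite mul0r.
rewrite mul1r gagliardo_density_def distrC.
have [->|xy] := eqVneq x y; first by rewrite !subrr normr0 powR0 ?gt_eqF// mul0r mulr0.
have e0 : 0 < enorm (x - y).
  rewrite lt_neqAle enorm_ge0 eq_sym andbT; apply: contra_neq xy => /enorm_eq0 /eqP.
  by rewrite subr_eq0 => /eqP.
rewrite mulrCA -[leLHS]mulr1 ler_wpM2l ?powR_ge0// ler_pdivlMr ?powR_gt0// mul1r.
apply: ge0_ler_powR; [exact: q_ge0|by rewrite nnegrE enorm_ge0| |exact: cell_diam kx ky].
by rewrite nnegrE mulr_ge0// ltW.
Qed.

(** A fractional Poincare inequality. Averaging the oscillation over a cell yields a point whose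
    value [c k] is close to [u] in the mean there, whence the division by the measure [delta ^+ n];
    as a value of [u] it inherits its sign. *)
Lemma cell_approximation u (C e : R) : measurable_fun setT u -> 0 <= C -> 0 < e ->
  (double_integral (gagliardo_density s p u) <= C%:E)%E ->
  exists c : {ffun 'I_n -> 'I_m.+1} -> R, (forall k, exists x, c k = u x) /\
   (\sum_k \int[mu]_x (\1_(cell k) x * `|u x - c k| `^ p)%:E <=
    ((n%:R * delta) `^ q / delta ^+ n * C + e)%:E)%E.
Proof.
move=> mu_ C0 e0 uC; have d0 := cell_size_gt0; have dn : 0 < delta ^+ n by exact: exprn_gt0.
pose J k := double_integral (cell_oscillation u k).
have J0 k : (0 <= J k)%E by apply: double_integral_ge0; exact: cell_oscillation_ge0.
have mo k := measurable2_cell_oscillation k mu_.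
have sumJ : (\sum_k J k <= ((n%:R * delta) `^ q * C)%:E)%E.
  rewrite -double_integral_sum//; last by move=> *; exact: cell_oscillation_ge0.
  apply: (@le_trans _ _ (double_integral (fun x y => (n%:R * delta) `^ q * gagliardo_density s p u x y)%R)).
    apply: le_double_integral.
    - by apply: measurable_sum => k; exact: mo.
    - by apply: measurable_funM => //; exact: measurable2_gagliardo_density.
    - by move=> x y; apply: sumr_ge0 => k _; exact: cell_oscillation_ge0.
    - exact: sum_cell_oscillation.
  rewrite double_integralZ ?powR_ge0//; last 2 first.
  - exact: measurable2_gagliardo_density.
  - exact: gagliardo_density_ge0.
  by rewrite EFinM lee_wpmul2l ?lee_fin ?powR_ge0.
have Jf k : J k \is a fin_num.
  rewrite ge0_fin_numE//; apply: le_lt_trans (ltry ((n%:R * delta) `^ q * C)); apply: le_trans sumJ.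
  by rewrite (bigD1 k)//= leeDl// sume_ge0.
have cn : 0 < #|{: {ffun 'I_n -> 'I_m.+1}}|%:R :> R.
  by rewrite ltr0n; apply/card_gt0P; exists [ffun=> ord0].
(* The slack is shared among the cells: after division by the measure of a cell the total is [e]. *)
pose e' := e * delta ^+ n / #|{: {ffun 'I_n -> 'I_m.+1}}|%:R.
have e'0 : 0 < e' by rewrite divr_gt0// mulr_gt0.
have /choice[c hc] : forall k, exists c : R, (exists x, c = u x) /\
    (\int[mu]_x (\1_(cell k) x * `|u x - c| `^ p)%:E <= ((fine (J k) + e') / delta ^+ n)%:E)%E.
  move=> k; pose h x := (\int[mu]_y (\1_(cell k) y * `|u y - u x| `^ p)%:E)%E.
  have [] := @average_point R n (cell k) h (delta ^+ n) (fine (J k)) e' => //.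
  - exact: measurable_cell.
  - exact: lebesgue_cell.
  - apply: (@measurable2_inner _ _ (fun x y => \1_(cell k) y * `|u y - u x| `^ p)).
      apply: measurable_funM; first exact: measurableT_comp (measurable_indic (measurable_cell k)) measurable_snd.
      apply: (measurableT_comp (measurable_powR _)); apply: measurableT_comp => //.
      apply: measurable_funB; first exact: measurableT_comp mu_ measurable_snd.
      exact: measurableT_comp mu_ measurable_fst.
    by move=> x y; rewrite mulr_ge0// powR_ge0.
  - by move=> x; apply: integral_ge0 => y _; rewrite lee_fin mulr_ge0// powR_ge0.
  - exact: fine_ge0.
  - rewrite fineK// /J double_integral_def integral_mkcond le_eqVlt; apply/orP; left; apply/eqP.
    apply: eq_integral => x _; rewrite patchE /cell_oscillation indicE.
    case: ifPn => xk; first by rewrite /h; apply: eq_integral => y _; rewrite mul1r.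
    by under eq_integral do rewrite mul0r; rewrite integral0.
  by move=> x _ hx; exists (u x); split => //; exists x.
exists c; split; first by move=> k; have [] := hc k.
apply: (@le_trans _ _ (\sum_k ((fine (J k) + e') / delta ^+ n)%:E)%E).
  by apply: lee_sum => k _; have [] := hc k.
rewrite sumEFin lee_fin -mulr_suml big_split /= sumr_const -(mulr_natr e').
rewrite [leLHS]mulrDl lerD//.
  rewrite [leRHS]mulrAC ler_pM2r ?invr_gt0// -lee_fin -sumEFin; apply: le_trans sumJ.
  by apply: lee_sum => k _; rewrite fineK.
by rewrite /e' divfK ?gt_eqF// mulfK// gt_eqF.
Qed.

End cells.

Lemma powR_add3_le (R : realType) (p t a b c : R) : 0 < p -> 0 <= t -> 0 <= a -> 0 <= b -> 0 <= c ->
  t <= a + b + c -> t `^ p <= 3 `^ p * (a `^ p + b `^ p + c `^ p).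
Proof.
move=> p0 t0 a0 b0 c0 tabc.
have key (M : R) : 0 <= M -> a <= M -> b <= M -> c <= M -> M `^ p <= a `^ p + b `^ p + c `^ p ->
    t `^ p <= 3 `^ p * (a `^ p + b `^ p + c `^ p).
  move=> M0 aM bM cM MM; apply: (@le_trans _ _ ((3 * M) `^ p)).
    by apply: ge0_ler_powR; rewrite ?nnegrE ?(ltW p0) ?mulr_ge0//; lra.
  by rewrite powRM// ler_wpM2l// powR_ge0.
have [a1 b1 c1] := And3 (powR_ge0 a p) (powR_ge0 b p) (powR_ge0 c p).
case: (leP a b) => ab; case: (leP b c) => bc.
- by apply: (key c) => //; lra.
- by apply: (key b) => //; lra.
- case: (leP a c) => ac; first by apply: (key c) => //; lra.
  by apply: (key a) => //; lra.
- by apply: (key a) => //; lra.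
Qed.

Section coloring.
Variables (R : realType) (n : nat) (s p r C : R).
Hypotheses (p1 : 1 < p) (s01 : 0 < s < 1) (r0 : 0 < r) (C0 : 0 <= C).
Local Notation mu := (lebesgue_rV R n).
Implicit Types (x : 'rV[R]_n).
Variable u_ : nat -> 'rV[R]_n -> R.
Hypotheses (mu_ : forall i, measurable_fun setT (u_ i)) (u0 : forall i x, 0 <= u_ i x)
  (ur : forall i x, ~ cube r x -> u_ i x = 0) (N1 : forall i, integral_powR p (u_ i) = 1%E)
  (uC : forall i, (double_integral (gagliardo_density s p (u_ i)) <= C%:E)%E).
Local Notation q := (n%:R + s * p).

Let p_gt0 : 0 < p. Proof. exact: lt_trans p1. Qed.

(** The quantity equals [n^q C delta^(sp)], which tends to 0 with the size [delta] because
    [sp > 0]. *)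
Lemma small_cells (e : R) : 0 < e ->
  exists m, (n%:R * cell_size r m) `^ q / cell_size r m ^+ n * C <= e.
Proof.
move=> e0; have sp : 0 < s * p by rewrite mulr_gt0//; case/andP: s01.
pose B := n%:R `^ q * C + 1; have B0 : 0 < B by rewrite ltr_wpDl// mulr_ge0// powR_ge0.
pose d := (e / B) `^ (s * p)^-1; have d0 : 0 < d by rewrite powR_gt0// divr_gt0.
exists (truncn (2 * r / d)); set delta := cell_size _ _.
have dl0 : 0 < delta by exact: cell_size_gt0.
have dld : delta <= d.
  rewrite /delta /cell_size ler_pdivrMr// [leRHS]mulrC -ler_pdivrMr//.
  by apply: ltW; exact: truncnS_gt.
rewrite powRM ?(ltW dl0)//.
have -> : n%:R `^ q * delta `^ q / delta ^+ n * C = n%:R `^ q * C * delta `^ (s * p).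
  have D : delta `^ q = delta ^+ n * delta `^ (s * p).
    by rewrite -powR_mulrn ?(ltW dl0)// -powRD// (gt_eqF dl0) implybT.
  rewrite D; field; rewrite ?expf_neq0 ?gt_eqF//.
have : delta `^ (s * p) <= e / B.
  apply: (@le_trans _ _ (d `^ (s * p))).
    by apply: ge0_ler_powR; rewrite ?nnegrE ?(ltW sp) ?(ltW dl0) ?(ltW d0).
  by rewrite /d -powRrM mulVf ?gt_eqF// powRr1// ltW// divr_gt0.
move=> h; apply: (@le_trans _ _ (B * (e / B))); last by rewrite mulrC divfK// gt_eqF.
apply: ler_pM => //; [by rewrite mulr_ge0// powR_ge0|exact: powR_ge0|].
by rewrite /B lerDl.
Qed.

(** The colour of [u_ i] is the table of integer parts of the [c i k / eta]. These take finitely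
    many values because the [c i k] lie in [[0, B]], and equal colours put the two step functions
    within [eta] of each other on every cell. *)
Lemma approximation_coloring (e : R) : 0 < e -> exists (T : finType) (c : nat -> T),
  forall i j, c i = c j -> (integral_powR p (fun x => u_ i x - u_ j x)%R <= e%:E)%E.
Proof.
move=> e0; have p3 : 0 < 3 `^ p :> R by exact: powR_gt0.
(* The difference [u_ i - u_ j] splits into two approximation errors and a difference of constants,
   each allowed [e1]; the factor [3^p] comes from [powR_add3_le]. *)
pose e1 := e / (3 `^ p * 3); have e10 : 0 < e1 by rewrite divr_gt0// mulr_gt0.
have e2 : 0 < e1 / 2 by rewrite divr_gt0.
have [m hm] := small_cells e2; set delta := cell_size r m in hm.
have d0 : 0 < delta by exact: cell_size_gt0.
have dn : 0 < delta ^+ n by exact: exprn_gt0.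
pose K := {ffun 'I_n -> 'I_m.+1}.
have /choice[c hc] : forall i, exists c : K -> R, (forall k, 0 <= c k) /\
    (\sum_k \int[mu]_x (\1_(cell r k) x * `|u_ i x - c k| `^ p)%:E <= e1%:E)%E.
  move=> i; have [c [cu hc]] := cell_approximation m r0 p1 s01 (mu_ i) C0 e2 (uC i).
  exists c; split; first by move=> k; have [x ->] := cu k; exact: u0.
  by apply: le_trans hc _; rewrite lee_fin; move: hm; rewrite -/delta; lra.
have mind (k : K) (f : 'rV[R]_n -> R) : measurable_fun setT f ->
    measurable_fun setT (fun x => (\1_(cell r k) x * `|f x| `^ p)%:E).
  move=> mf; apply/measurable_EFinP; apply: measurable_funM.
    by apply: measurable_indic; exact: measurable_cell.
  by apply: (measurableT_comp (measurable_powR _)); exact: measurableT_comp.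
have ind0 (k : K) (t : 'rV[R]_n -> R) x : 0 <= \1_(cell r k) x * `|t x| `^ p by rewrite mulr_ge0// powR_ge0.
have hck i k : (\int[mu]_x (\1_(cell r k) x * `|u_ i x - c i k| `^ p)%:E <= e1%:E)%E.
  have [_] := hc i; apply: le_trans; rewrite (bigD1 k)//= leeDl// sume_ge0// => l _.
  by apply: integral_ge0 => x _; rewrite lee_fin mulr_ge0// powR_ge0.
have cst_int (k : K) (t : R) : 0 <= t -> (\int[mu]_x (\1_(cell r k) x * t)%:E = (delta ^+ n * t)%:E)%E.
  move=> t0; rewrite (eq_integral (fun x => t%:E * (\1_(cell r k) x)%:E)%E); last first.
    by move=> x _; rewrite -EFinM mulrC.
  rewrite ge0_integralZl//; last first.
  - by apply/measurable_EFinP; apply: measurable_indic; exact: measurable_cell.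
  rewrite integral_indic ?setIT//; last exact: measurable_cell.
  transitivity (t%:E * (delta ^+ n)%:E)%E; last by rewrite -EFinM mulrC.
  by congr (_ * _)%E; exact: lebesgue_cell.
(* On a cell [c^p] is at most [3^p] times the sum of [|u_ i|^p] and the approximation error, whose
   integrals are at most 1 and [e1]. The leading 1 covers the values [c <= 1], for which [c <= c^p]
   may fail. *)
pose B := 1 + 3 `^ p * (1 + e1) / delta ^+ n.
have cB i k : c i k <= B.
  have [c0 _] := hc i; have ck0 := c0 k.
  have : ((delta ^+ n * c i k `^ p)%:E <= (3 `^ p * (1 + e1))%:E)%E.
    rewrite -(cst_int k) ?powR_ge0//.
    pose f x := 3 `^ p * (`|u_ i x| `^ p + \1_(cell r k) x * `|u_ i x - c i k| `^ p).
    have mA : measurable_fun setT (fun x => (`|u_ i x| `^ p)%:E) by exact: measurable_norm_powR.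
    have mB := mind k _ (measurable_funB (mu_ i) (measurable_cst (c i k))).
    apply: (@le_trans _ _ (\int[mu]_x (f x)%:E)%E).
      apply: ge0_le_integral => //.
      - by move=> x _; rewrite lee_fin mulr_ge0// powR_ge0.
      - apply/measurable_EFinP; apply: measurable_funM => //.
        by apply: measurable_indic; exact: measurable_cell.
      - by apply/measurable_EFinP; apply: measurable_funM => //; apply: measurable_funD; exact/measurable_EFinP.
      move=> x _; rewrite lee_fin /f indicE; case: (x \in _); last first.
        by rewrite !mul0r addr0 mulr_ge0// powR_ge0.
      rewrite !mul1r; apply: (le_trans (powR_add3_le (a := `|u_ i x|) (b := `|u_ i x - c i k|) (c := 0) _ _ _ _ _ _)) => //.
        have := ler_normB (u_ i x) (u_ i x - c i k); rewrite subKr addr0.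
        exact: le_trans (ler_norm _).
      by rewrite powR0 ?gt_eqF// addr0.
    rewrite (eq_integral (fun x => (3 `^ p)%:E * ((`|u_ i x| `^ p)%:E + (\1_(cell r k) x * `|u_ i x - c i k| `^ p)%:E))%E); last first.
      by move=> x _; rewrite -EFinD -EFinM.
    rewrite ge0_integralZl ?lee_fin ?powR_ge0//; last 2 first.
    - exact: emeasurable_funD.
    - by move=> x _; rewrite -EFinD lee_fin addr_ge0// ?powR_ge0// ind0.
    rewrite ge0_integralD//.
    rewrite -integral_powR_def N1 EFinM lee_wpmul2l ?lee_fin ?powR_ge0//.
    by rewrite EFinD leeD.
  rewrite lee_fin mulrC -ler_pdivlMr// => h.
  have [c1|c1] := leP (c i k) 1; first by apply: le_trans c1 _; rewrite lerDl divr_ge0 ?(ltW dn)// mulr_ge0 ?addr_ge0 ?powR_ge0// ltW.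
  apply: (@le_trans _ _ (c i k `^ p)); last by apply: le_trans h _; rewrite lerDr.
  by rewrite -[leLHS]powRr1// ler_powR// ltW.
have B0 : 0 <= B by apply: le_trans (cB 0%N [ffun=> ord0]); have [c0 _] := hc 0%N.
pose V : R := #|K|%:R * delta ^+ n.
have K0 : 0 < #|K|%:R :> R by rewrite ltr0n; apply/card_gt0P; exists [ffun=> ord0].
have V0 : 0 < V by rewrite mulr_gt0.
(* As [eta <= 1], also [eta^p <= eta], so the differences of constants contribute at most
   [V * eta <= e1], with [V] the total measure of the cells. *)
pose eta := minr 1 (e1 / V); have eta0 : 0 < eta by rewrite lt_min ltr01 divr_gt0.
have etaV : V * eta `^ p <= e1.
  rewrite mulrC -ler_pdivlMr//; apply: (@le_trans _ _ eta); last by rewrite ge_min lexx orbT.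
  rewrite -[leRHS]powRr1 ?(ltW eta0)//; apply: ger_powR; last exact: ltW.
  by rewrite eta0 ge_min lexx.
pose L := truncn (B / eta).
have tL i k : (truncn (c i k / eta) < L.+1)%N.
  by rewrite ltnS le_truncn// ler_pM2r ?invr_gt0.
exists {ffun K -> 'I_L.+1}, (fun i => [ffun k => Ordinal (tL i k)]) => i j cij.
have cd k : `|c i k - c j k| <= eta.
  have := congr1 (fun f : {ffun K -> 'I_L.+1} => f k) cij; rewrite !ffunE => /(congr1 val) /= E.
  have [ci _] := hc i; have [cj _] := hc j.
  have := truncn_itv (divr_ge0 (ci k) (ltW eta0)); have := truncn_itv (divr_ge0 (cj k) (ltW eta0)).
  rewrite -E; set t := truncn _; rewrite -natr1 !ler_pdivlMr// !ltr_pdivrMr// mulrDl mul1r.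
  move=> /andP[h1 h2] /andP[h3 h4].
  by rewrite ler_norml; apply/andP; split; lra.
pose F i' (k : K) x := \1_(cell r k) x * `|u_ i' x - c i' k| `^ p.
have mF i' k : measurable_fun setT (fun x => (F i' k x)%:E).
  by apply: mind; exact: (measurable_funB (mu_ i') (measurable_cst (c i' k))).
have F0 i' k x : 0 <= F i' k x by rewrite mulr_ge0// powR_ge0.
pose E (k : K) x := \1_(cell r k) x * eta `^ p.
have mE k : measurable_fun setT (fun x => (E k x)%:E).
  by apply/measurable_EFinP; apply: measurable_funM => //; apply: measurable_indic; exact: measurable_cell.
have E0 k x : 0 <= E k x by rewrite mulr_ge0// powR_ge0.
pose G (k : K) x := 3 `^ p * (F i k x + E k x + F j k x).
have G0 k x : 0 <= G k x by rewrite mulr_ge0 ?powR_ge0// !addr_ge0.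
have mG k : measurable_fun setT (fun x => (G k x)%:E).
  have mFi := (measurable_EFinP _ _).1 (mF i k); have mFj := (measurable_EFinP _ _).1 (mF j k).
  have mEk := (measurable_EFinP _ _).1 (mE k).
  apply/measurable_EFinP; apply: measurable_funM => //.
  by apply: (measurable_funD (f := fun x => F i k x + E k x)) => //; exact: measurable_funD.
rewrite integral_powR_def; apply: (@le_trans _ _ (\int[mu]_x \sum_k (G k x)%:E)%E).
  apply: ge0_le_integral => //.
  - by apply: measurable_norm_powR; exact: measurable_funB.
  - exact: emeasurable_sum.
  move=> x _; rewrite sumEFin lee_fin.
  have [cx|cx] := pselect (cube r x); last first.
    by rewrite !ur// subrr normr0 powR0 ?gt_eqF// sumr_ge0.
  have [k kx] := cell_cover m r0 cx.
  rewrite (bigD1 k)//=; apply: (@le_trans _ _ (G k x)); last by rewrite lerDl sumr_ge0.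
  rewrite /G /F /E indicE mem_set// !mul1r; apply: powR_add3_le => //; first exact: ltW.
  have -> : u_ i x - u_ j x = (u_ i x - c i k) + (c i k - c j k) - (u_ j x - c j k) by ring.
  apply: le_trans (ler_normB _ _) _; rewrite lerD2r.
  by apply: le_trans (ler_normD _ _) _; rewrite lerD2l.
rewrite ge0_integral_sum//; last by move=> k x _; rewrite lee_fin.
have GE k : (\int[mu]_x (G k x)%:E = (3 `^ p)%:E * (\int[mu]_x (F i k x)%:E + (delta ^+ n * eta `^ p)%:E + \int[mu]_x (F j k x)%:E))%E.
  rewrite (eq_integral (fun x => (3 `^ p)%:E * ((F i k x)%:E + (E k x)%:E + (F j k x)%:E))%E); last first.
    by move=> x _; rewrite -!EFinD -EFinM.
  rewrite ge0_integralZl ?lee_fin ?powR_ge0//; last 2 first.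
  - by apply: emeasurable_funD => //; exact: emeasurable_funD.
  - by move=> x _; rewrite -!EFinD lee_fin !addr_ge0.
  rewrite ge0_integralD//; last 3 first.
  - by move=> x _; rewrite -EFinD lee_fin addr_ge0.
  - exact: emeasurable_funD.
  - by move=> x _; rewrite lee_fin.
  rewrite ge0_integralD//; last 2 first.
  - by move=> x _; rewrite lee_fin.
  - by move=> x _; rewrite lee_fin.
  by rewrite cst_int// powR_ge0.
under eq_bigr do rewrite GE.
rewrite -ge0_sume_distrr; last first.
  move=> k _; apply: adde_ge0; first apply: adde_ge0.
  - by apply: integral_ge0 => x _; rewrite lee_fin.
  - by rewrite lee_fin mulr_ge0 ?powR_ge0// ltW.
  - by apply: integral_ge0 => x _; rewrite lee_fin.
rewrite 2!big_split /=.
have -> : e = 3 `^ p * (e1 + e1 + e1) by rewrite /e1; field; rewrite gt_eqF.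
rewrite [leRHS]EFinM; apply: lee_wpmul2l; first by rewrite lee_fin powR_ge0.
rewrite (EFinD (e1 + e1)); apply: leeD; last by have [_] := hc j.
rewrite (EFinD e1); apply: leeD; first by have [_] := hc i.
rewrite sumEFin lee_fin sumr_const -mulr_natl; apply: le_trans etaV.
by rewrite /V -mulrA.
Qed.

End coloring.

(** * Boxes whose reflections avoid the domain *)

Section geometry.
Variables (R : realType) (n : nat).
Implicit Types (x y z e : 'rV[R]_n) (Omega U : set 'rV[R]_n).

Lemma nbhs_obox x U : nbhs x U -> exists a b : 'rV[R]_n,
  [/\ forall i, a ord0 i < b ord0 i, obox a b x & obox a b `<=` U].
Proof.
move=> /nbhs_rVP[e e0 xU]; exists (x - const_mx e), (x + const_mx e); split.
- by move=> i; rewrite !mxE; lra.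
- by move=> i; rewrite !mxE; apply/andP; split; lra.
- by move=> y hy; apply: xU => i; have := hy i; rewrite !mxE ltr_distl.
Qed.

Lemma lipschitz_near (L : R) x (d : R) : 0 < d -> 0 <= L ->
  nbhs x [set y : 'rV[R]_n | L * enorm (x - y) < d].
Proof.
move=> d0 L0; have c0 : 0 < L * n%:R + 1 by rewrite ltr_wpDl// mulr_ge0.
apply/nbhs_rVP; exists (d / (L * n%:R + 1)); first exact: divr_gt0.
move=> y hy /=; have xy : `|x - y| < d / (L * n%:R + 1).
  by apply: normr_rV_lt => [|i]; [exact: divr_gt0|rewrite !mxE distrC; exact: hy].
apply: (@le_lt_trans _ _ (L * n%:R * `|x - y|)).
  by rewrite -mulrA ler_wpM2l//; exact: enorm_le_norm.
rewrite -[ltRHS](divfK (lt0r_neq0 c0)) mulrC.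
apply: (@le_lt_trans _ _ (`|x - y| * (L * n%:R + 1))); first by rewrite ler_wpM2l// lerDl.
by rewrite ltr_pM2r.
Qed.

Lemma lipschitz_continuous (f : 'rV[R]_n -> R) (L : R) : 0 <= L ->
  (forall x y, `|f x - f y| <= L * enorm (x - y)) -> continuous f.
Proof.
move=> L0 fL x A /nbhs_ballP[d /= d0 fA].
by apply: filterS (lipschitz_near x d0 L0) => y hy; apply: fA; exact: le_lt_trans hy.
Qed.

Lemma lipschitz_continuous_rV (f : 'rV[R]_n -> 'rV[R]_n) (L : R) : 0 <= L ->
  (forall x y, `|f x - f y| <= L * enorm (x - y)) -> continuous f.
Proof.
move=> L0 fL x A /nbhs_rVP[d d0 fA].
apply: filterS (lipschitz_near x d0 L0) => y hy; apply: fA => i.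
apply: le_lt_trans hy; apply: le_trans (fL x y); rewrite distrC.
by have := coord_le_norm (f x - f y) i; rewrite !mxE.
Qed.

Lemma normr_dotrV_le x e : `|dotrV x e| <= n%:R * `|e| * enorm x.
Proof.
apply: le_trans (ler_norm_sum _ _ _) _; apply: (@le_trans _ _ (\sum_(i < n) `|e| * enorm x)).
  apply: ler_sum => i _; rewrite normrM mulrC ler_pM//; [exact: coord_le_norm|exact: coord_le_enorm].
by rewrite sumr_const card_ord -[X in X <= _]mulr_natl -mulrA.
Qed.

Lemma continuous_dotrV e : continuous (fun x => dotrV x e).
Proof.
apply: (@lipschitz_continuous _ (n%:R * `|e|)); first by rewrite mulr_ge0.
by move=> x y; rewrite -dotrVBl; exact: normr_dotrV_le.
Qed.

Lemma continuous_projection e : continuous (fun x => x - dotrV x e *: e).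
Proof.
apply: (@lipschitz_continuous_rV _ (1 + n%:R * `|e| * `|e|)); first by rewrite addr_ge0// !mulr_ge0.
move=> x y; have -> : x - dotrV x e *: e - (y - dotrV y e *: e) = (x - y) - dotrV (x - y) e *: e.
  by rewrite dotrVBl scalerBl; apply/rowP => i; rewrite !mxE; ring.
apply: le_trans (ler_normB _ _) _; rewrite mulrDl mul1r normrZ; apply: lerD; first exact: norm_le_enorm.
by rewrite mulrAC ler_wpM2r//; exact: normr_dotrV_le.
Qed.

Lemma continuous_reflection (H : polarizer R n) : continuous (reflection H).
Proof.
apply: (@lipschitz_continuous_rV _ 1) => // x y; rewrite mul1r -(enorm_reflection H).
exact: norm_le_enorm.
Qed.

(* Moving from a boundary point [z] by [- t e] leaves the epigraph, and only the
   continuity of the boundary function is used. *)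
Lemma exterior_point (beta : R) Omega z U : open Omega -> C1holder_set beta Omega -> ~ Omega z ->
  nbhs z U -> exists2 y, U y & nbhs y (~` Omega).
Proof.
move=> oO C1 nz Uz.
have [cz|cz] := pselect (closure Omega z); last first.
  exists z; first exact: nbhs_singleton.
  have : nbhs z (~` closure Omega) by apply: open_nbhs_nbhs; split => //; apply: closed_openC; exact: closed_closure.
  by apply: filterS => y ny Oy; apply: ny; exact: subset_closure.
have [|r [e [f [r0 e1 [df _] Of]]]] := C1 z.
  by split => //; move=> /interior_subset.
have [d d0 zU] := (nbhs_rVP _ _).1 Uz.
have n1 : 0 < n%:R + 1 :> R by rewrite ltr_wpDl.
pose r' := r / (n%:R + 1); have r'0 : 0 < r' by exact: divr_gt0.
(* [2 t <= r'] keeps the sup-norm ball of radius [t] around [y] inside the chart, the factor [n + 1]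
   in [r'] converting to the Euclidean norm; [t < d] keeps [y] in [U]. *)
pose t := minr d r' / 2; have dr : 0 < minr d r' by rewrite lt_min d0.
have t0 : 0 < t by rewrite divr_gt0.
have td : t < d.
  by have : minr d r' <= d; [rewrite ge_min lexx|rewrite /t; lra].
have tr : 2 * t <= r'.
  by have : minr d r' <= r'; [rewrite ge_min lexx orbT|rewrite /t; lra].
have close x : `|x - z| < 2 * t -> enorm (x - z) < r.
  move=> xt; apply: le_lt_trans (enorm_le_norm _) _.
  apply: (@le_lt_trans _ _ (n%:R * r')).
    by rewrite ler_wpM2l// (le_trans (ltW xt)).
  by rewrite /r' mulrCA gtr_pMr// ltr_pdivrMr// mul1r ltrDl.
pose y := z - t *: e; exists y.
  apply: zU => i; rewrite !mxE addrAC subrr add0r normrN normrM (gtr0_norm t0).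
  apply: le_lt_trans td; rewrite -[leRHS]mulr1 ler_wpM2l ?(ltW t0)// -e1.
  exact: coord_le_enorm.
have ee : dotrV e e = 1 by rewrite -enorm_sqr e1 expr1n.
have ye : dotrV y e = dotrV z e - t by rewrite /y dotrVBl dotrVZl ee mulr1.
have yP : y - dotrV y e *: e = z - dotrV z e *: e.
  by rewrite ye /y; apply/rowP => i; rewrite !mxE; ring.
have zf : dotrV z e <= f (z - dotrV z e *: e).
  rewrite leNgt; apply/negP => h; apply: nz; apply/Of => //.
  by rewrite subrr enorm0.
have near1 : \forall x \near y, enorm (x - z) < r.
  apply/nbhs_rVP; exists t => // x hx; apply: close; apply: normr_rV_lt => [|i].
    by rewrite mulr_gt0.
  have := hx i; have := coord_le_enorm e i; rewrite e1 !mxE => ei.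
  have : `|t * e ord0 i| <= t by rewrite normrM (gtr0_norm t0) -[leRHS]mulr1 ler_wpM2l// ltW.
  rewrite !ler_norml !ltr_norml => /andP[h1 h2] /andP[h3 h4]; apply/andP; split; lra.
(* Half the depth of [y] below the graph, one half for the variation of [f] and one for that of the
   height. *)
pose c := (f (y - dotrV y e *: e) - dotrV y e) / 2.
have c0 : 0 < c by rewrite /c yP ye; lra.
have near2 : \forall x \near y, `|f (y - dotrV y e *: e) - f (x - dotrV x e *: e)| < c.
  have h : nbhs (f (y - dotrV y e *: e)) [set w : R | `|f (y - dotrV y e *: e) - w| < c].
    by apply/nbhs_ballP; exists c.
  exact: (continuous_projection (differentiable_continuous (df (y - dotrV y e *: e)) h)).
have near3 : \forall x \near y, `|dotrV y e - dotrV x e| < c.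
  have h : nbhs (dotrV y e) [set w : R | `|dotrV y e - w| < c] by apply/nbhs_ballP; exists c.
  exact: (continuous_dotrV h).
apply: filterS3 near1 near2 near3 => x xr xf xe Ox; move: ((Of x xr).1 Ox) xf xe.
rewrite !ltr_norml => fx /andP[h1 h2] /andP[h3 h4].
have : 2 * c = f (y - dotrV y e *: e) - dotrV y e by rewrite /c mulrC divfK.
lra.
Qed.

(** The point [sigma x] may lie on the boundary of [Omega]. Regularity of the boundary provides an
    exterior point nearby, and the reflection carries a neighbourhood of it back into [U]. *)
Lemma fat_box (beta : R) (H : polarizer R n) Omega U x : open Omega -> C1holder_set beta Omega ->
  open U -> U x -> ~ Omega (reflection H x) ->
  exists a b : 'rV[R]_n, [/\ forall i, a ord0 i < b ord0 i, obox a b `<=` U &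
    forall y, obox a b y -> ~ Omega (reflection H y)].
Proof.
move=> oO C1 oU Ux nx.
have [|z Uz nz] := exterior_point (U := reflection H @^-1` U) oO C1 nx.
  by apply: continuous_reflection; rewrite reflectionK; exact: open_nbhs_nbhs.
have : nbhs (reflection H z) (U `&` (reflection H @^-1` (~` Omega))).
  apply: filterI; first exact: open_nbhs_nbhs.
  by apply: continuous_reflection; rewrite reflectionK.
move=> /nbhs_obox[a [b [ab _ h]]]; exists a, b; split => //.
- by move=> y /h[].
- by move=> y /h[].
Qed.

Variable H : polarizer R n.
Local Notation sigma := (reflection H).
Local Notation off x := (dotrV x (pol_normal H) - pol_offset H).

Lemma image_reflection Omega x : (sigma @` Omega) x <-> Omega (sigma x).
Proof.
by split=> [[y Oy <-]|Ox]; [rewrite reflectionK|exists (sigma x) => //; rewrite reflectionK].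
Qed.

(** Without such a point the part of [Omega] off [H] reflects into [Omega], and polarization changes
    nothing; a point of the hyperplane is its own reflection. *)
Lemma polarization_neq Omega : polarization H Omega <> Omega ->
  exists x, [/\ Omega x, 0 < off x & ~ Omega (sigma x)].
Proof.
move=> PO; apply: contrapT => /forallNP N; apply: PO.
have S x : Omega x -> ~ half_space H x -> Omega (sigma x).
  move=> Ox; rewrite /half_space /= => /negP; rewrite -leNgt le_eqVlt => /predU1P[e|lt].
    by rewrite reflection_fixed.
  by apply: contrapT => nO; apply: (N x); split => //; rewrite subr_gt0.
have hs x : half_space H x -> ~ half_space H (sigma x).
  by rewrite /half_space /= dotrV_reflection => h; apply/negP; rewrite -leNgt; lra.
apply/seteqP; split=> [x [[[Ox|/image_reflection Osx] hx]|[Ox _]]|x Ox] //.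
  by have := S _ Osx (hs _ hx); rewrite reflectionK.
have [hx|nhx] := pselect (half_space H x); first by left; split => //; left.
by right; split => //; apply/image_reflection; exact: S.
Qed.

(** Without such a point the part of [Omega] in [H] reflects into [Omega], and polarization amounts
    to the reflection. *)
Lemma polarization_neq_reflection Omega : polarization H Omega <> sigma @` Omega ->
  exists x, [/\ Omega x, off x < 0 & ~ Omega (sigma x)].
Proof.
move=> PO; apply: contrapT => /forallNP N; apply: PO.
have S x : Omega x -> half_space H x -> Omega (sigma x).
  move=> Ox hx; apply: contrapT => nO; apply: (N x); split => //.
  by rewrite subr_lt0.
apply/seteqP; split=> [x [[[Ox|//] hx]|[_ //]]|x /image_reflection Osx].
  by apply/image_reflection; exact: S.
have [hx|nhx] := pselect (half_space H x); first by left; split => //; right; apply/image_reflection.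
right; split; last exact/image_reflection.
have [hs|nhs] := pselect (half_space H (sigma x)).
  by have := S _ Osx hs; rewrite reflectionK.
rewrite -(reflection_fixed (H := H) (x := x))//.
move: nhx nhs; rewrite /half_space /= dotrV_reflection => /negP + /negP; rewrite -!leNgt => h1 h2; lra.
Qed.

Lemma open_half_space : open (half_space H).
Proof. by apply: (open_comp _ (@open_lt R (pol_offset H))) => x _; exact: continuous_dotrV. Qed.

Lemma open_half_spaceC : open [set x | 0 < off x].
Proof.
rewrite (_ : [set x | _] = (fun x => dotrV x (pol_normal H)) @^-1` [set t | pol_offset H < t]).
  by apply: (open_comp _ (@open_gt R (pol_offset H))) => x _; exact: continuous_dotrV.
by apply/seteqP; split => x /=; rewrite subr_gt0.
Qed.

End geometry.

(** * Vanishing of limits of minimizing sequences *)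

Section vanishing.
Variables (R : realType) (n : nat) (s p : R).
Hypotheses (p1 : 1 < p) (s01 : 0 < s < 1).
Local Notation mu := (lebesgue_rV R n).
Implicit Types (u w : 'rV[R]_n -> R) (h : 'rV[R]_n -> 'rV[R]_n) (x y : 'rV[R]_n).
Implicit Type Omega : set 'rV[R]_n.

Let p_gt0 : 0 < p. Proof. exact: lt_trans p1. Qed.

Lemma double_integral_eq0 F : measurable2 F -> (forall x y, 0 <= F x y) ->
  (double_integral F <= 0%:E)%E -> {ae mu, forall x, {ae mu, forall y, F x y = 0}}.
Proof.
move=> mF F0; rewrite double_integral_def => I0.
have mi := measurable2_inner mF F0.
have i0 x := inner_integral_ge0 x F0.
have : ae_eq mu setT (fun x => \int[mu]_y (F x y)%:E)%E (cst 0%E).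
  apply/(ae_eq_integral_abs _ measurableT mi); apply/eqP; rewrite eq_le integral_ge0// andbT.
  by apply: le_trans I0; rewrite le_eqVlt; apply/orP; left; apply/eqP; apply: eq_integral => x _; rewrite gee0_abs.
apply: filterS => x /(_ Logic.I) Fx0.
have mFx : measurable_fun setT (fun y => (F x y)%:E).
  by apply/measurable_EFinP; exact: measurable2_section.
have : ae_eq mu setT (fun y => (F x y)%:E) (cst 0%E).
  apply/(ae_eq_integral_abs _ measurableT mFx); rewrite -[RHS]Fx0.
  by apply: eq_integral => y _; rewrite gee0_abs// lee_fin.
by apply: filterS => y /(_ Logic.I) [].
Qed.

Lemma ae_exists (P Q : 'rV[R]_n -> Prop) : {ae mu, forall x, Q x} -> ~ {ae mu, forall x, P x} ->
  exists x, Q x /\ ~ P x.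
Proof.
move=> aQ nP; apply: contrapT => /forallNP H; apply: nP; apply: filterS aQ => x Qx.
by apply: contrapT => nPx; exact: (H x).
Qed.

Lemma obox_not_null (a b : 'rV[R]_n) : (forall i, a ord0 i < b ord0 i) ->
  ~ {ae mu, forall x, ~ obox a b x}.
Proof.
move=> ab [A [mA A0 hA]]; have := lebesgue_rV_obox_gt0 ab; apply/negP; rewrite -leNgt -A0.
apply: le_measure; rewrite ?inE//; first exact: measurable_obox.
by move=> x xab; apply: hA => /=; exact.
Qed.

(** For [theta = (b - al) / b] in [[0, 1]] this is [theta^p <= theta]. The bound is linear in [al],
    which makes the saving of order [t]. *)
Lemma powR_sub_ge (al b : R) : 0 <= al -> 0 < b -> al <= b -> al * (b `^ p / b) <= b `^ p - (b - al) `^ p.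
Proof.
move=> al0 b0 alb; have b1 : b != 0 by rewrite gt_eqF.
have -> : b - al = b * ((b - al) / b) by rewrite mulrCA mulfV// mulr1.
set th := (b - al) / b; have th0 : 0 <= th by rewrite divr_ge0 ?(ltW b0)// subr_ge0.
have th1 : th <= 1 by rewrite ler_pdivrMr// mul1r gerBl.
have thp : th `^ p <= th.
  have [->|t0] := eqVneq th 0; first by rewrite powR0// gt_eqF.
  rewrite -[leRHS]powRr1//; apply: ger_powR; last exact: ltW.
  by rewrite lt_neqAle eq_sym t0 th0.
rewrite powRM ?(ltW b0)// lerBrDr -lerBrDl.
apply: (@le_trans _ _ (b `^ p * th)); first by rewrite ler_wpM2l// powR_ge0.
by rewrite /th le_eqVlt; apply/orP; left; apply/eqP; field.
Qed.

Lemma cvg_maxr (a_ : nat -> R) (a b : R) : a_ @ \oo --> a ->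
  (fun k => maxr (a_ k) b) @ \oo --> maxr a b.
Proof.
move=> /cvgrPdist_lt ac; apply/cvgrPdist_lt => e e0; apply: filterS (ac e e0) => k.
apply: le_lt_trans; apply: le_trans (dist_max_le _ _ _ _) _.
by rewrite subrr normr0 ge_max lexx normr_ge0.
Qed.

Variable Omega : set 'rV[R]_n.
Hypotheses (oO : open Omega) (bO : bounded_set Omega).
Variables (lam : R) (u_ : nat -> 'rV[R]_n -> R) (g_ : nat -> 'rV[R]_n -> 'rV[R]_n).
Variable u : 'rV[R]_n -> R.
Hypotheses (lamE : least_eigenvalue s p Omega = lam%:E)
  (adm : forall k, admissible p Omega (u_ k) (g_ k)) (u_0 : forall k x, 0 <= u_ k x)
  (N1 : forall k, integral_powR p (u_ k) = 1%E)
  (Elam : forall k, (energy s p (u_ k) (g_ k) <= (lam + k.+1%:R^-1)%:E)%E)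
  (muu : measurable_fun setT u) (u0 : forall x, 0 <= u x)
  (uc : {ae mu, forall x, u_ ^~ x @ \oo --> u x}).

Let mu_ k : measurable_fun setT (u_ k).
Proof. by have [sug _ _ _] := adm k; have [] := sobolev11_measurable sug. Qed.

(** The maximum of [u_ k] and [t * w] has norm at least 1, so its energy is at least [lam], while
    the two separate energies add up to at most [lam + 1/(k+1) + t^p E]. *)
Lemma max_gain_bound w h (t E : R) k : 0 <= t -> admissible p Omega w h ->
  (energy s p w h <= E%:E)%E ->
  (double_integral (max_gain s p (u_ k) (fun x => t * w x)%R) <= (t `^ p * E + k.+1%:R^-1)%:E)%E.
Proof.
move=> t0 adw Ew; have [swh _ _ _] := adw; have [mw mh] := sobolev11_measurable swh.
have adtw := admissibleZ t adw; have [stw _ _ _] := adtw.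
have [suk _ _ _] := adm k; have admax := admissible_max (adm k) adtw.
have [smax _ _ _] := admax; have [mmax _] := sobolev11_measurable smax.
have Emax := least_eigenvalue_le s p1 oO bO admax.
have N : (1 <= integral_powR p (fun x => maxr (u_ k x) (t * w x))%R)%E.
  rewrite -(N1 k); apply: le_integral_powR => // x.
  rewrite (ger0_norm (u_0 k x)); apply: le_trans (ler_norm _).
  by rewrite le_max lexx.
have := energy_max s p1 suk stw.
rewrite energyZ// => Emg.
have : (lam%:E + double_integral (max_gain s p (u_ k) (fun x => t * w x)%R) <=
    (lam + k.+1%:R^-1)%:E + (t `^ p * E)%:E)%E.
  rewrite EFinM; apply: (@le_trans _ _ (energy s p (u_ k) (g_ k) + (`|t| `^ p)%:E * energy s p w h)%E).
    by apply: le_trans Emg; apply: leeD => //; rewrite -lamE; exact: Emax.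
  by apply: leeD => //; rewrite (ger0_norm t0); apply: lee_wpmul2l => //; rewrite lee_fin powR_ge0.
by rewrite -EFinD -addrA EFinD leeD2lE// addrC.
Qed.

Lemma limit_vanishing (a b : 'rV[R]_n) : (0 < n)%N -> (forall i, a ord0 i < b ord0 i) ->
  obox a b `<=` Omega -> {ae mu, forall x, obox a b x -> u x = 0} -> {ae mu, forall x, u x = 0}.
Proof.
move=> n0 ab abO uab.
pose phi := box_bump a b 0; have tphi : test_function phi by exact: box_bump_test.
have phi01 x : 0 <= phi x <= 1 by exact: box_bump_bound.
have phi_out x : ~ obox a b x -> phi x = 0.
  by move=> nx; apply/eqP; apply: contrapT => /negP /box_bump_neq0.
have [admphi Ephi] := test_function_admissible p1 s01 tphi
  (fun x nx => phi_out x (fun xab => nx (abO x xab))).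
have mphi := test_function_measurable tphi.
have Ef : energy s p phi (gradient phi) \is a fin_num by rewrite ge0_fin_numE ?energy_ge0.
set E := fine (energy s p phi (gradient phi)).
have EE : (energy s p phi (gradient phi) <= E%:E)%E by rewrite fineK.
have E0 : 0 <= E by rewrite fine_ge0// energy_ge0.
(* A representative of [u] that is exactly 0 on the box, so that the lower bound of the gain holds
   at every pair of points. *)
pose v x := if x \in obox a b then 0 else u x.
have mv : measurable_fun setT v.
  by apply: measurable_fun_ifT => //; apply: measurable_mem; exact: measurable_obox.
have v0 x : 0 <= v x by rewrite /v; case: ifP.
have vc : {ae mu, forall x, u_ ^~ x @ \oo --> v x}.
  apply: filterS2 uc uab => x ux uabx; rewrite /v; case: ifPn => // /set_mem /uabx <-.
  exact: ux.
have gain_t (t : R) : 0 < t ->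
    (double_integral (max_gain s p v (fun x => t * phi x)%R) <= (t `^ p * E)%:E)%E.
  move=> t0; have mt : measurable_fun setT (fun x => t * phi x) by exact: measurable_funM.
  apply: (double_integral_fatou (F_ := fun k => max_gain s p (u_ k) (fun x => t * phi x)) (G := [set x | u_ ^~ x @ \oo --> v x])) => //.
  - by move=> k; exact: measurable2_max_gain.
  - by move=> k x y; exact: max_gain_ge0.
  - exact: measurable2_max_gain.
  - by move=> x y; exact: max_gain_ge0.
  - move=> x y /= ux uy; apply: cvgM; first exact: cvg_cst.
    apply: cvgB; first apply: cvgD; last 2 first.
    + exact: cvg_cst.
    + apply: cvg_norm_powR => //; apply: cvgB; exact: cvg_maxr.
    by apply: cvg_norm_powR => //; exact: cvgB.
  move=> e e0; have /cvgrPdist_le /(_ _ e0)[N _ hN] := @cvg_harmonic R.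
  exists N => k Nk; apply: le_trans (max_gain_bound k (ltW t0) admphi EE) _.
  rewrite lee_fin lerD2l; have := hN k Nk; rewrite /= sub0r normrN ger0_norm//.
(* The coefficient of [t] in the lower bound from [powR_sub_ge], where [v y^p / v y] is [v y^(p-1)].
   The cut-off [d <= v y] guarantees [t * phi x <= v y] whenever [t <= d]. *)
pose A (d : R) x y := frac_kernel s p x y * (phi x * (if d <= v y then v y `^ p / v y else 0)).
have A0 d x y : 0 <= A d x y.
  have [ph0 _] := andP (phi01 x).
  rewrite mulr_ge0//; first by rewrite frac_kernelE invr_ge0 powR_ge0.
  by rewrite mulr_ge0//; case: ifP => // _; rewrite divr_ge0// powR_ge0.
have mA d : measurable2 (A d).
  apply: measurable_funM; first exact: measurable2_frac_kernel.
  apply: measurable_funM; first exact: measurableT_comp mphi measurable_fst.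
  apply: (measurableT_comp (f := fun y => if d <= v y then v y `^ p / v y else 0)); last exact: measurable_snd.
  apply: measurable_fun_ifT => //; first by apply: measurable_fun_ler.
  apply: measurable_funM; first exact: (measurableT_comp (measurable_powR _)).
  under eq_fun => y do rewrite -(powR_inv1 (v0 y)).
  exact: (measurableT_comp (measurable_powR _)).
have gainA (d t : R) x y : 0 < t -> t <= d -> t * A d x y <= max_gain s p v (fun x => t * phi x) x y.
  move=> t0 td; have g0 := max_gain_ge0 s p1 v (fun x => t * phi x) x y.
  rewrite /A; case: ifPn => dv; last by rewrite !mulr0.
  have vy : 0 < v y by apply: lt_le_trans dv; exact: lt_le_trans td.
  have [xab|xab] := pselect (obox a b x); last by rewrite phi_out// mul0r !mulr0.
  have yab : ~ obox a b y by move=> yab; move: vy; rewrite /v mem_set// ltxx.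
  have vx : v x = 0 by rewrite /v mem_set.
  have [ph0 ph1] := andP (phi01 x).
  rewrite /max_gain mulrCA ler_wpM2l//; first by rewrite frac_kernelE invr_ge0 powR_ge0.
  rewrite vx (phi_out y yab) mulr0 !sub0r subr0 normrN (ger0_norm (v0 y)).
  have tp0 : 0 <= t * phi x by rewrite mulr_ge0// ltW.
  have tpv : t * phi x <= v y.
    apply: le_trans dv; apply: le_trans td; rewrite -[leRHS]mulr1 ler_wpM2l//; exact: ltW.
  rewrite (max_r tp0) (max_l (v0 y)) (mulrA t) (ger0_norm tp0) distrC ger0_norm ?subr_ge0//.
  apply: le_trans (powR_sub_ge tp0 vy tpv) _.
  by rewrite lerD2r lerDl powR_ge0.
have A_null (d : R) : 0 < d -> (double_integral (A d) <= 0%:E)%E.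
  move=> d0; apply/lee_addgt0Pr => e e0; rewrite add0e.
  have p10 : 0 < p - 1 by rewrite subr_gt0.
  (* Chosen so that [t^(p-1) E <= e], the bound left after dividing the gain by [t]; [E + 1] keeps
     the denominator positive. *)
  pose t := minr d ((e / (E + 1)) `^ (p - 1)^-1).
  have E1 : 0 < E + 1 by rewrite ltr_wpDl.
  have t0 : 0 < t by rewrite lt_min d0 powR_gt0// divr_gt0.
  have td : t <= d by rewrite ge_min lexx.
  have tE : t `^ (p - 1) * E <= e.
    apply: (@le_trans _ _ (e / (E + 1) * (E + 1))); last by rewrite divfK// gt_eqF.
    apply: ler_pM => //; first exact: powR_ge0; last by rewrite lerDl.
    apply: (@le_trans _ _ (((e / (E + 1)) `^ (p - 1)^-1) `^ (p - 1))).
      apply: ge0_ler_powR; rewrite ?nnegrE ?powR_ge0 ?(ltW t0) ?(ltW p10)//.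
      by rewrite ge_min lexx orbT.
    by rewrite -powRrM mulVf ?gt_eqF// powRr1// ltW// divr_gt0.
  have : (t%:E * double_integral (A d) <= (t `^ p * E)%:E)%E.
    apply: le_trans (gain_t t t0); rewrite -double_integralZ//; last exact: ltW.
    apply: le_double_integral.
    - by apply: measurable_funM => //; exact: mA.
    - by apply: measurable2_max_gain => //; exact: measurable_funM.
    - by move=> x y; rewrite mulr_ge0// ltW.
    - by move=> x y; exact: gainA.
  have -> : t `^ p * E = t * (t `^ (p - 1) * E).
    rewrite mulrA; congr (_ * _); rewrite -{2}(powRr1 (ltW t0)) -powRD; last by rewrite (gt_eqF t0) implybT.
    by congr (_ `^ _); ring.
  rewrite EFinM lee_pmul2l// => h; apply: le_trans h _; by rewrite lee_fin.
(* The thresholds [1/(j+1)] exhaust the points where [v] is positive. *)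
have good : {ae mu, forall x, forall j : nat, {ae mu, forall y, A j.+1%:R^-1 x y = 0}}.
  apply: ae_foralln => j; apply: double_integral_eq0 => //.
  by apply: A_null; rewrite invr_gt0.
have [x [gx /contrapT xab]] := ae_exists good (obox_not_null ab).
have phx : 0 < phi x by exact: box_bump_gt0.
have gx' : {ae mu, forall y, forall j : nat, A j.+1%:R^-1 x y = 0} by exact: ae_foralln.
apply: filterS2 gx' uab => y Ay uy.
have [yab|yab] := pselect (obox a b y); first exact: uy.
have vy : v y = u y by rewrite /v memNset.
apply/eqP; apply: contrapT => /negP uy0.
have vpos : 0 < v y by rewrite vy lt_neqAle eq_sym uy0 u0.
have [j hj] : exists j : nat, j.+1%:R^-1 <= v y.
  have /cvgrPdist_lt /(_ _ vpos)[N _ hN] := @cvg_harmonic R.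
  exists N; have := hN N (leqnn N); rewrite /= sub0r normrN ger0_norm//; exact: ltW.
have := Ay j; rewrite /A hj => /eqP; rewrite !mulf_eq0 (gt_eqF phx) orFb.
rewrite invr_eq0 !(gt_eqF vpos) (gt_eqF (powR_gt0 _ vpos)) !orbF => /eqP.
rewrite frac_kernelE => /eqP; rewrite invr_eq0 => /eqP.
have : 0 < enorm (x - y).
  rewrite lt_neqAle enorm_ge0 andbT eq_sym; apply/eqP => /enorm_eq0 /eqP.
  by rewrite subr_eq0 => /eqP xy; apply: yab; rewrite -xy.
by move=> e0 e1; have := powR_gt0 (n%:R + s * p) e0; rewrite e1 ltxx.
Qed.

End vanishing.

(** * Strict inequality *)
Section minimizers.
Variables (R : realType) (n : nat) (s p : R).
Hypotheses (p1 : 1 < p) (s01 : 0 < s < 1).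
Local Notation mu := (lebesgue_rV R n).
Variable Omega : set 'rV[R]_n.
Hypotheses (oO : open Omega) (bO : bounded_set Omega).

Let p_gt0 : 0 < p. Proof. exact: lt_trans p1. Qed.

Lemma integral_powR_eq0 (u : 'rV[R]_n -> R) : measurable_fun setT u ->
  integral_powR p u = 0%E -> {ae mu, forall x, u x = 0}.
Proof.
move=> mu_ ; rewrite integral_powR_def => I0.
have mf : measurable_fun setT (fun x => (`|u x| `^ p)%:E).
  exact: measurable_norm_powR.
have : ae_eq mu setT (fun x => (`|u x| `^ p)%:E) (cst 0%E).
  apply/(ae_eq_integral_abs _ measurableT mf); rewrite -[RHS]I0.
  by apply: eq_integral => y _; rewrite gee0_abs// lee_fin powR_ge0.
apply: filterS => y /(_ Logic.I) [] /eqP.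
by rewrite powR_eq0 (gt_eqF p_gt0) andbT normr_eq0 => /eqP.
Qed.

Lemma least_eigenvalue_fin_num : Omega !=set0 -> least_eigenvalue s p Omega \is a fin_num.
Proof.
move=> [x0 Ox0]; have mO : measurable Omega by exact: open_measurable_rV.
have L0 : (0 <= least_eigenvalue s p Omega)%E.
  by rewrite least_eigenvalueE//; apply: le_ereal_inf_tmp => _ [[u g] _ <-]; exact: energy_ge0.
rewrite ge0_fin_numE//.
have [a [b [ab _ abO]]] := nbhs_obox (open_nbhs_nbhs (conj oO Ox0)).
pose phi := box_bump a b 0.
have tphi : test_function phi by exact: box_bump_test.
have phi_out x : ~ Omega x -> phi x = 0.
  by move=> nx; apply/eqP; apply: contrapT => /negP /box_bump_neq0 xab; exact/nx/abO.
have [admphi Ephi] := test_function_admissible p1 s01 tphi phi_out.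
have [sphi Nphi _ _] := admphi; have [mphi mgphi] := sobolev11_measurable sphi.
have [N0|N0] := eqVneq (integral_powR p phi) 0%E.
  exfalso; apply: (obox_not_null ab); apply: filterS (integral_powR_eq0 mphi N0) => x px xab.
  by have := box_bump_gt0 0 xab; rewrite -/phi px ltxx.
have Nf : integral_powR p phi \is a fin_num by rewrite ge0_fin_numE ?integral_powR_ge0.
set N := fine (integral_powR p phi); have NE : integral_powR p phi = N%:E by rewrite fineK.
have Np : 0 < N by rewrite fine_gt0// lt_neqAle eq_sym N0 integral_powR_ge0.
set c := N `^ (- p^-1).
have c0 : 0 <= c by exact: powR_ge0.
have cN : integral_powR p (fun x => c * phi x) = 1%E.
  rewrite integral_powRZ// NE -EFinM ger0_norm// -powRrM mulNr mulVf ?gt_eqF//.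
  by rewrite powR_inv1 ?(ltW Np)// mulVf// gt_eqF.
have := least_eigenvalue_le s p1 oO bO (admissibleZ c admphi); rewrite cN => /(_ (lexx _)) h.
apply: le_lt_trans h _; rewrite energyZ//.
have Ef : energy s p phi (gradient phi) \is a fin_num by rewrite ge0_fin_numE ?energy_ge0.
by rewrite -(fineK Ef) -EFinM ltry.
Qed.

Lemma minimizing_sequence (lam : R) : least_eigenvalue s p Omega = lam%:E ->
  exists (u_ : nat -> 'rV[R]_n -> R) (g_ : nat -> 'rV[R]_n -> 'rV[R]_n),
  forall k, [/\ admissible p Omega (u_ k) (g_ k), forall x, 0 <= u_ k x,
    forall x, ~ Omega x -> u_ k x = 0, integral_powR p (u_ k) = 1%E &
    (energy s p (u_ k) (g_ k) <= (lam + k.+1%:R^-1)%:E)%E].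
Proof.
move=> lamE; have mO : measurable Omega by exact: open_measurable_rV.
have step (k : nat) : exists ug : ('rV[R]_n -> R) * ('rV[R]_n -> 'rV[R]_n),
    [/\ admissible p Omega ug.1 ug.2, forall x, 0 <= ug.1 x,
    forall x, ~ Omega x -> ug.1 x = 0, integral_powR p ug.1 = 1%E &
    (energy s p ug.1 ug.2 <= (lam + k.+1%:R^-1)%:E)%E].
  have k0 : 0 < k.+1%:R^-1 :> R by rewrite invr_gt0.
  have := lamE; rewrite (least_eigenvalueE s p1 mO bO) => iE.
  have [|_ [[u g] /= [adm N] <-]] := lb_ereal_inf_adherent k0 (S := [set energy s p ug.1 ug.2
     | ug in [set ug | admissible p Omega ug.1 ug.2 /\ integral_powR p ug.1 = 1%E]]).
    by rewrite iE.
  rewrite iE => /ltW Eu; have [u' [g' [adm' u0 uO N' E']]] := admissible_normalize s p1 mO adm.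
  by exists (u', g'); split => //=; [rewrite N'|exact: le_trans E' Eu].
have [F hF] := choice step.
by exists (fun k => (F k).1), (fun k => (F k).2) => k; exact: hF.
Qed.

Lemma minimizing_limit (lam : R) : least_eigenvalue s p Omega = lam%:E ->
  exists (u_ : nat -> 'rV[R]_n -> R) (g_ : nat -> 'rV[R]_n -> 'rV[R]_n) (u : 'rV[R]_n -> R),
  [/\ forall k, [/\ admissible p Omega (u_ k) (g_ k), forall x, 0 <= u_ k x,
    forall x, ~ Omega x -> u_ k x = 0, integral_powR p (u_ k) = 1%E &
    (energy s p (u_ k) (g_ k) <= (lam + k.+1%:R^-1)%:E)%E],
    measurable_fun setT u, forall x, 0 <= u x, {ae mu, forall x, u_ ^~ x @ \oo --> u x} &
    ~ {ae mu, forall x, u x = 0}].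
Proof.
move=> lamE; have [u_ [g_ ug]] := minimizing_sequence lamE.
have mu_ k : measurable_fun setT (u_ k).
  by have [[sug _ _ _] _ _ _ _] := ug k; have [] := sobolev11_measurable sug.
have N1 k : integral_powR p (u_ k) = 1%E by have [] := ug k.
have u0 k x : 0 <= u_ k x by have [] := ug k.
have lam0 : 0 <= lam.
  rewrite -lee_fin -lamE (least_eigenvalueE s p1 (open_measurable_rV oO) bO).
  by apply: le_ereal_inf_tmp => _ [[u g] _ <-]; exact: energy_ge0.
have [M [_ hM]] := bO; pose r := `|M| + 2.
have r0 : 0 < r by rewrite ltr_wpDl.
have Or x : Omega x -> cube r x.
  move=> Ox; apply/cubeP => //; apply: (@le_lt_trans _ _ (`|M| + 1)); last by rewrite /r; lra.
  by apply: hM => //; have := ler_norm M; lra.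
have ur k x : ~ cube r x -> u_ k x = 0.
  by move=> nx; have [_ _ uO _ _] := ug k; apply: uO => /Or.
have uC k : (double_integral (gagliardo_density s p (u_ k)) <= (lam + 1)%:E)%E.
  have [_ _ _ _ Eu] := ug k; apply: (@le_trans _ _ (energy s p (u_ k) (g_ k))).
    by rewrite energyE; apply: leeDr; exact: integral_powR_ge0.
  by apply: le_trans Eu _; rewrite lee_fin lerD2l invf_le1// ler1n.
have C0 : 0 <= lam + 1 by rewrite addr_ge0.
have [f [u [fk muu uc nu]]] := compactness_of_colorings p1 mu_ N1
  (approximation_coloring p1 s01 r0 C0 mu_ u0 ur N1 uC).
(* The limit [u] is nonnegative only almost everywhere, [|u|] everywhere; the energy bounds survive
   extraction because [k <= f k]. *)
exists (u_ \o f), (g_ \o f), (fun x => `|u x|); split => //.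
- move=> k; have [h1 h2 h3 h4 h5] := ug (f k); split => //.
  apply: le_trans h5 _; rewrite lee_fin lerD2l lef_pV2 ?posrE// ler_nat ltnS; exact: fk.
- exact: measurableT_comp.
- apply: filterS uc => x ux; rewrite (_ : (_ ^~ x) = (fun k => `|u_ (f k) x|)); first exact: cvg_norm.
  by apply/funext => k /=; rewrite ger0_norm.
- by move=> h; apply: nu; apply: filterS h => x /eqP; rewrite normr_eq0 => /eqP.
Qed.

End minimizers.

(** * Gains on separated boxes *)

Section polarization_gap.
Variables (R : realType) (n : nat) (s p : R) (H : polarizer R n).
Hypotheses (p1 : 1 < p) (s01 : 0 < s < 1).
Local Notation off x := (dotrV x (pol_normal H) - pol_offset H).
Local Notation sigma := (reflection H).
Implicit Types u : 'rV[R]_n -> R.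
Implicit Types x y : 'rV[R]_n.

Let p_gt0 : 0 < p. Proof. exact: lt_trans p1. Qed.

Lemma powR_dist_lt (a b : R) : 0 < a -> 0 < b -> `|a - b| `^ p < a `^ p + b `^ p.
Proof.
move=> a0 b0; have [ab|ba] := leP b a.
- rewrite ger0_norm ?subr_ge0//; apply: (@lt_le_trans _ _ (a `^ p)).
    by apply: gt0_ltr_powR; rewrite ?nnegrE ?subr_ge0// ?(ltW a0)// gtrBl.
  by rewrite lerDl powR_ge0.
- rewrite ltr0_norm ?subr_lt0// opprB; apply: (@lt_le_trans _ _ (b `^ p)).
    by apply: gt0_ltr_powR; rewrite ?nnegrE ?subr_ge0// ?(ltW b0)// ?(ltW ba)// gtrBl.
  by rewrite lerDr powR_ge0.
Qed.

Lemma frac_kernel_reflection_neq x y : off x < 0 -> 0 < off y ->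
  frac_kernel s p x y != frac_kernel s p x (sigma y).
Proof.
move=> ox oy; apply/eqP; rewrite !frac_kernelE => /invr_inj.
have e : enorm (x - sigma y) < enorm (x - y).
  have h := enorm_reflection_sqr H x y.
  have o : off x * off y < 0 by rewrite pmulr_llt0.
  rewrite ltNge; apply/negP => h2.
  have : enorm (x - y) ^+ 2 <= enorm (x - sigma y) ^+ 2 by rewrite ler_sqr ?nnegrE ?enorm_ge0.
  by rewrite h lerDl pmulr_rge0// leNgt o.
have := gt0_ltr_powR (frac_exponent_gt0 n p1 s01) _ _ e; rewrite !nnegrE !enorm_ge0 => /(_ isT isT).
by move=> h h2; rewrite h2 ltxx in h.
Qed.

(** What [polarization_gain] becomes when [u] vanishes at both reflected points. It depends
    continuously on the values [u x] and [v y], unlike the test on [swapped], so it passes to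
    pointwise limits. *)
Definition separated_gain (u v : 'rV[R]_n -> R) x y :=
  `|frac_kernel s p x y - frac_kernel s p x (sigma y)| *
  `| `|u x| `^ p + `|v y| `^ p - `|u x - v y| `^ p|.

Lemma separated_gain_ge0 u v x y : 0 <= separated_gain u v x y.
Proof. by rewrite mulr_ge0. Qed.

Lemma measurable2_separated_gain u v : measurable_fun setT u -> measurable_fun setT v ->
  measurable2 (separated_gain u v).
Proof.
move=> mu_ mv; apply: measurable_funM.
  apply: measurableT_comp => //; apply: measurable_funB; first exact: measurable2_frac_kernel.
  by apply: measurable2_reflectionr; exact: measurable2_frac_kernel.
apply: measurableT_comp => //; apply: measurable_funB; last exact: measurable2_powR_norm.
apply: measurable_funD.
- by move/measurable_EFinP: (measurable_norm_powR p mu_) => m; exact: (measurableT_comp m measurable_fst).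
- by move/measurable_EFinP: (measurable_norm_powR p mv) => m; exact: (measurableT_comp m measurable_snd).
Qed.

(** As [u] vanishes at the reflections of [B1] and [B2], a point of [B1] is never swapped and a
    point of [B2] is swapped as soon as [u y > 0]; the defect then reduces to its three terms in
    [u x] and [u y]. *)
Lemma separated_gain_le (Omega B1 B2 : set 'rV[R]_n) u x y : (forall z, 0 <= u z) ->
  (forall z, ~ Omega z -> u z = 0) ->
  (forall z, B1 z -> off z < 0 /\ ~ Omega (sigma z)) ->
  (forall z, B2 z -> 0 < off z /\ ~ Omega (sigma z)) ->
  separated_gain (fun z => if z \in B1 then u z else 0) (fun z => if z \in B2 then u z else 0) x y
  <= polarization_gain H s p u x y.
Proof.
move=> u0 uO hB1 hB2; have g0 := polarization_gain_ge0 H s p u x y.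
rewrite /separated_gain; case: ifPn => [/set_mem B1x|_]; last first.
  by rewrite normr0 powR0 ?gt_eqF// add0r sub0r normrN subrr normr0 mulr0.
case: ifPn => [/set_mem B2y|_]; last first.
  by rewrite normr0 powR0 ?gt_eqF// addr0 subr0 subrr normr0 mulr0.
have [ox /uO ux] := hB1 x B1x; have [oy /uO uy] := hB2 y B2y.
have [uy0|uy0] := eqVneq (u y) 0.
  by rewrite uy0 normr0 powR0 ?gt_eqF// addr0 subr0 subrr normr0 mulr0.
rewrite /polarization_gain /swapped.
have -> : dotrV x (pol_normal H) < pol_offset H by rewrite -subr_lt0.
have -> : (dotrV y (pol_normal H) < pol_offset H) = false by apply/negbTE; rewrite -leNgt -subr_ge0 ltW.
have -> : (u x < u (sigma x)) = false by rewrite ux ltNge u0.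
have -> : (u (sigma y) < u y) by rewrite uy lt_neqAle eq_sym uy0 u0.
rewrite /= ler_wpM2l//.
rewrite powR_defectE ux uy subrr normr0 powR0 ?gt_eqF// addr0 sub0r subr0 normrN.
by rewrite distrC [`|u y| `^ p + _]addrC.
Qed.

End polarization_gap.

Section gap.
Variables (R : realType) (n : nat) (s p : R) (H : polarizer R n).
Hypotheses (p1 : 1 < p) (s01 : 0 < s < 1).
Local Notation mu := (lebesgue_rV R n).
Local Notation off x := (dotrV x (pol_normal H) - pol_offset H).
Local Notation sigma := (reflection H).
Variables (Omega B1 B2 : set 'rV[R]_n).
Hypotheses (oO : open Omega) (bO : bounded_set Omega) (mB1 : measurable B1) (mB2 : measurable B2)
  (hB1 : forall z, B1 z -> off z < 0 /\ ~ Omega (sigma z))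
  (hB2 : forall z, B2 z -> 0 < off z /\ ~ Omega (sigma z)).
Variables (lam : R) (u_ : nat -> 'rV[R]_n -> R) (g_ : nat -> 'rV[R]_n -> 'rV[R]_n).
Variable u : 'rV[R]_n -> R.
Hypotheses (lam_le : (lam%:E <= least_eigenvalue s p (polarization H Omega))%E)
  (ug : forall k, [/\ admissible p Omega (u_ k) (g_ k), forall x, 0 <= u_ k x,
    forall x, ~ Omega x -> u_ k x = 0, integral_powR p (u_ k) = 1%E &
    (energy s p (u_ k) (g_ k) <= (lam + k.+1%:R^-1)%:E)%E])
  (muu : measurable_fun setT u) (u0 : forall x, 0 <= u x)
  (uc : {ae mu, forall x, u_ ^~ x @ \oo --> u x}).

Let p_gt0 : 0 < p. Proof. exact: lt_trans p1. Qed.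

Let mu_ k : measurable_fun setT (u_ k).
Proof. by have [[sug _ _ _] _ _ _ _] := ug k; have [] := sobolev11_measurable sug. Qed.

Local Notation cutoff B f := (fun z => if z \in B then f z else 0).

Let mcut B (f : 'rV[R]_n -> R) : measurable B -> measurable_fun setT f -> measurable_fun setT (cutoff B f).
Proof. by move=> mB mf; apply: measurable_fun_ifT => //; exact: measurable_mem. Qed.

Lemma polarization_gain_bound k :
  (double_integral (polarization_gain H s p (u_ k)) <= (4 * k.+1%:R^-1)%:E)%E.
Proof.
have [adm uk0 uO N E] := ug k.
have := least_eigenvalue_gain p1 s01 H oO bO adm N.
rewrite (_ : (fun x => `|u_ k x|) = u_ k); last by apply/funext => x; rewrite ger0_norm.
move=> /le_trans /(_ E); set D := double_integral _ => h.
have : (lam%:E + 4^-1%:E * D <= lam%:E + (k.+1%:R^-1)%:E)%E.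
  by rewrite -EFinD; apply: le_trans h; exact: leeD.
rewrite leeD2lE// => h4.
have : (4%:E * (4^-1%:E * D) <= 4%:E * (k.+1%:R^-1)%:E)%E by apply: lee_wpmul2l h4; rewrite lee_fin.
by rewrite muleA -!EFinM mulfV// mul1e.
Qed.

Lemma limit_separated_gain :
  {ae mu, forall x, {ae mu, forall y, separated_gain s p H (cutoff B1 u) (cutoff B2 u) x y = 0}}.
Proof.
apply: double_integral_eq0.
- exact: (measurable2_separated_gain s p H (mcut mB1 muu) (mcut mB2 muu)).
- by move=> x y; exact: separated_gain_ge0.
apply: (double_integral_fatou (F_ := fun k => separated_gain s p H (cutoff B1 (u_ k)) (cutoff B2 (u_ k)))
  (G := [set x | u_ ^~ x @ \oo --> u x])) => //.
- by move=> k; exact: (measurable2_separated_gain s p H (mcut mB1 (mu_ k)) (mcut mB2 (mu_ k))).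
- by move=> k x y; exact: separated_gain_ge0.
- exact: (measurable2_separated_gain s p H (mcut mB1 muu) (mcut mB2 muu)).
- by move=> x y; exact: separated_gain_ge0.
- move=> x y /= ux uy.
  have c B z : (u_ ^~ z) @ \oo --> u z -> (fun k => cutoff B (u_ k) z) @ \oo --> cutoff B u z.
    by move=> uz; case: ifP => // _; exact: cvg_cst.
  apply: cvgM; first exact: cvg_cst.
  apply: cvg_norm; apply: cvgB; last by apply: cvg_norm_powR => //; apply: cvgB; exact: c.
  by apply: cvgD; apply: cvg_norm_powR => //; exact: c.
move=> e e0; have e4 : 0 < e / 4 by rewrite divr_gt0.
have /cvgrPdist_le /(_ _ e4)[N _ hN] := @cvg_harmonic R.
exists N => k Nk; apply: le_trans (_ : _ <= (4 * k.+1%:R^-1)%:E)%E _.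
  apply: le_trans (polarization_gain_bound k); apply: le_double_integral.
  - exact: (measurable2_separated_gain s p H (mcut mB1 (mu_ k)) (mcut mB2 (mu_ k))).
  - exact: measurable2_polarization_gain.
  - by move=> x y; exact: separated_gain_ge0.
  - by move=> x y; have [_ ? ? _ _] := ug k; apply: separated_gain_le hB1 hB2.
by rewrite lee_fin add0r mulrC -ler_pdivlMr//; have := hN k Nk; rewrite /= sub0r normrN ger0_norm.
Qed.

(** Fix a good [x] in [B1] with [u x > 0]: for almost every [y] in [B2] the gain is 0 although the
    two kernels differ, and the strict inequality [|a - b|^p < a^p + b^p] for positive [a], [b]
    excludes [u y > 0]. *)
Lemma limit_vanishes_on_a_box :
  {ae mu, forall x, B1 x -> u x = 0} \/ {ae mu, forall x, B2 x -> u x = 0}.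
Proof.
have [|nB1] := pselect {ae mu, forall x, B1 x -> u x = 0}; first by left.
right; have [x [gx /not_implyP[B1x ux]]] := ae_exists limit_separated_gain nB1.
apply: filterS gx => y gxy B2y; apply: contrapT => uy; move: gxy.
rewrite /separated_gain !mem_set// => /eqP; rewrite mulf_eq0 !normr_eq0 subr_eq0.
have [ox _] := hB1 B1x; have [oy _] := hB2 B2y.
rewrite (negbTE (frac_kernel_reflection_neq p1 s01 ox oy)) /= subr_eq0.
have pos z : u z <> 0 -> 0 < u z by move=> /eqP uz; rewrite lt_neqAle eq_sym uz u0.
rewrite !(ger0_norm (u0 _)) => /eqP e.
by have := powR_dist_lt p1 (pos _ ux) (pos _ uy); rewrite e ltxx.
Qed.

End gap.

Theorem theorem1p2 (R : realType) (d : nat) (p s : R) (H : polarizer R d)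
    (Omega : set 'rV[R]_d) :
  (2 <= d)%N -> 1 < p -> 0 < s < 1 ->
  domain Omega -> bounded_set Omega ->
  (least_eigenvalue s p (polarization H Omega) <= least_eigenvalue s p Omega)%E
  /\
  ((exists beta : R, 0 < beta < 1 /\ C1holder_set beta Omega) ->
   polarization H Omega <> Omega ->
   polarization H Omega <> reflection H @` Omega ->
   (least_eigenvalue s p (polarization H Omega) < least_eigenvalue s p Omega)%E).
Proof.
move=> d2 p1 s01 [ne0 _ oO] bO; split; first exact: least_eigenvalue_polarization.
move=> [beta [_ C1]] PO PsO; rewrite ltNge; apply/negP => le_eigen.
have fin := least_eigenvalue_fin_num p1 s01 oO bO ne0.
have lamE := esym (fineK fin); set lam := fine _ in lamE.
have [u_ [g_ [u [ug muu u0 uc nu]]]] := minimizing_limit p1 s01 oO bO lamE.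
have [x1 [Ox1 ox1 sx1]] := polarization_neq_reflection PsO.
have [x2 [Ox2 ox2 sx2]] := polarization_neq PO.
have oU1 : open (Omega `&` half_space H) by apply: openI => //; exact: open_half_space.
have oU2 : open (Omega `&` [set x | 0 < dotrV x (pol_normal H) - pol_offset H]).
  by apply: openI => //; exact: open_half_spaceC.
have U1x1 : (Omega `&` half_space H) x1 by split => //; rewrite /half_space /= -subr_lt0.
have [a1 [b1 [ab1 abU1 sab1]]] := fat_box oO C1 oU1 U1x1 sx1.
have [a2 [b2 [ab2 abU2 sab2]]] := fat_box oO C1 oU2 (conj Ox2 ox2) sx2.
have hB1 z : obox a1 b1 z -> dotrV z (pol_normal H) - pol_offset H < 0 /\ ~ Omega (reflection H z).
  by move=> zab; split; [rewrite subr_lt0; have [] := abU1 z zab|exact: sab1].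
have hB2 z : obox a2 b2 z -> 0 < dotrV z (pol_normal H) - pol_offset H /\ ~ Omega (reflection H z).
  by move=> zab; split; [have [] := abU2 z zab|exact: sab2].
(* This is all that is kept from the negated conclusion; it bounds the gain of [u_ k] by
   [4 / (k + 1)]. *)
have lam_le : (lam%:E <= least_eigenvalue s p (polarization H Omega))%E by rewrite -lamE.
have adm k : admissible p Omega (u_ k) (g_ k) by have [] := ug k.
have u_0 k x : 0 <= u_ k x by have [] := ug k.
have N1 k : integral_powR p (u_ k) = 1%E by have [] := ug k.
have Elam k : (energy s p (u_ k) (g_ k) <= (lam + k.+1%:R^-1)%:E)%E by have [] := ug k.
have d0 : (0 < d)%N by exact: ltn_trans d2.
apply: nu; have [|] := limit_vanishes_on_a_box p1 s01 oO bO (measurable_obox a1 b1)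
  (measurable_obox a2 b2) hB1 hB2 lam_le ug muu u0 uc.
- by apply: (limit_vanishing p1 s01 oO bO lamE adm u_0 N1 Elam muu u0 uc d0 ab1) => x /abU1[].
- by apply: (limit_vanishing p1 s01 oO bO lamE adm u_0 N1 Elam muu u0 uc d0 ab2) => x /abU2[].
Qed.
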